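(* For every $\varepsilon>0$ there is a constant $C_\varepsilon$ such that the following holds. If $u$ solves the wave equation $\Box u=0$ on $\mathbb{R}^2_x\times\mathbb{R}_t$ with initial data $u|_{t=0}=f$, $\partial_tu|_{t=0}=0$, then $$\|u\|_{L^6(\mathbb{R}^2\times[1,2])}\le C_\varepsilon\,\|f\|_{W^{2,\frac12+\varepsilon}(\mathbb{R}^2)} .$$
   Context: $\Box=\partial_t^2-\Delta_x$ is the wave operator, and $W^{2,s}(\mathbb{R}^2)$ denotes the $L^2$-based (inhomogeneous) Sobolev space with $s$ derivatives. *)

(* Defs.v *)
From HB Require Import structures.
From mathcomp Require Import all_boot all_order all_algebra.
From mathcomp Require Import all_classical all_reals all_analysis.
From mathcomp Require Import complex.
Import Order.TTheory GRing.Theory Num.Theory.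
Import numFieldTopology.Exports numFieldNormedType.Exports.

Set Implicit Arguments.
Unset Strict Implicit.
Unset Printing Implicit Defensive.

Local Open Scope classical_set_scope.
Local Open Scope ring_scope.

(* MathComp-Analysis integrates real-valued functions only: measurability,
   integrability and integrals of complex-valued functions are taken on real
   and imaginary parts. *)
Section ComplexValued.
Context {d : measure_display} {T : measurableType d} {R : realType}.
Variable mu : {measure set T -> \bar R}.

Definition cmeasurable (f : T -> R[i]) : Prop :=
  measurable_fun [set: T] (fun x => complex.Re (f x)) /\
  measurable_fun [set: T] (fun x => complex.Im (f x)).

Definition cintegrable (D : set T) (f : T -> R[i]) : Prop :=
  mu.-integrable D (fun x => (complex.Re (f x))%:E) /\
  mu.-integrable D (fun x => (complex.Im (f x))%:E).

Definition cintegral (D : set T) (f : T -> R[i]) : R[i] :=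
  Complex (\int[mu]_(x in D) complex.Re (f x))%R
          (\int[mu]_(x in D) complex.Im (f x))%R.

(* The L^p norm of f over D; Normc.normc is the R-valued modulus. *)
Definition cLnorm (p : \bar R) (D : set T) (f : T -> R[i]) : \bar R :=
  ('N[mu]_p[EFin \o ((fun x => Normc.normc (f x)) \_ D)])%E.

Definition in_Lp (p : \bar R) (f : T -> R[i]) : Prop :=
  cmeasurable f /\ (cLnorm p [set: T] f < +oo)%E.

End ComplexValued.

Section Smooth.
Variables (R : realType) (V : normedModType R).

(* On a finite-dimensional V this is C^n: all iterated directional
   derivatives up to order n exist everywhere and are continuous. *)
Fixpoint is_Ck (n : nat) (phi : V -> R) : Prop :=
  continuous phi /\
  (if n is m.+1 then
     forall v : V, (forall x : V, derivable phi x v) /\ is_Ck m ('D_v phi)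
   else True).

Definition test_function (phi : V -> R) : Prop :=
  (forall n, is_Ck n phi) /\ compact (closure [set x | phi x != 0]).

End Smooth.

Section Sobolev.
Variable R : realType.

(* The library's Lebesgue measure lives on [measurableTypeR R], which is R
   itself with its Borel sigma-algebra. *)
Definition leb2 :
    {measure set (measurableTypeR R * measurableTypeR R)%type
      -> \bar R} :=
  (@lebesgue_measure R \x @lebesgue_measure R)%E.

(* The Fourier integral \int e^{- i x . xi} h(x) dx of h in L^1(R^2). *)
Definition fourier_integral (h : R * R -> R[i]) (xi : R * R) : R[i] :=
  cintegral leb2 [set: R * R] (fun x =>
    let a := x.1 * xi.1 + x.2 * xi.2 in
    Complex (cos a) (- sin a) * h x).

(* g is the L^2 Fourier transform of f: the extension by continuity to L^2
   of the Fourier integral on the intersection of L^1 and L^2. *)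
Definition is_fourier (f g : R * R -> R[i]) : Prop :=
  [/\ in_Lp leb2 2%:E f, in_Lp leb2 2%:E g &
    exists h : nat -> R * R -> R[i],
      [/\ forall n, in_Lp leb2 1%:E (h n) /\ in_Lp leb2 2%:E (h n),
          cLnorm leb2 2%:E [set: R * R] (fun x => h n x - f x)
            @[n --> \oo] --> 0%E &
          cLnorm leb2 2%:E [set: R * R]
            (fun xi => fourier_integral (h n) xi - g xi)
            @[n --> \oo] --> 0%E]].

(* || (1 + |xi|^2)^(s/2) \hat f ||_{L^2}. The infimum is over the (a.e.
   unique) L^2 Fourier transforms of f, so the value is +oo if f is not in
   L^2. For s >= 0 a tempered distribution with finite norm is an L^2
   function, so this covers the whole Sobolev space; for s < 0 it would not. *)
Definition sobolev_norm (s : R) (f : R * R -> R[i]) : \bar R :=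
  ereal_inf [set cLnorm leb2 2%:E [set: R * R]
      (fun xi => ((1 + xi.1 ^+ 2 + xi.2 ^+ 2) `^ (s / 2))%:C%C * g xi)
    | g in [set g | is_fourier f g]].

Definition in_sobolev (s : R) (f : R * R -> R[i]) : Prop :=
  (sobolev_norm s f < +oo)%E.

End Sobolev.

Section Wave.
Variable R : realType.

(* A space-time point is (x, t) with x : R * R. *)
Definition leb3 :
    {measure
      set (measurableTypeR R * measurableTypeR R * measurableTypeR R)%type
      -> \bar R} :=
  (leb2 R \x @lebesgue_measure R)%E.

Definition dir_x1 : R * R * R := ((1, 0), 0).
Definition dir_x2 : R * R * R := ((0, 1), 0).
Definition dir_t : R * R * R := ((0, 0), 1).

Definition box (phi : R * R * R -> R) (z : R * R * R) : R :=
  'D_dir_t ('D_dir_t phi) z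
  - ('D_dir_x1 ('D_dir_x1 phi) z + 'D_dir_x2 ('D_dir_x2 phi) z).

(* Measurability of u is part of integrability on each compact K. *)
Definition loc_integrable (u : R * R * R -> R[i]) : Prop :=
  forall K : set (R * R * R), compact K -> cintegrable leb3 K u.

(* Box u = 0 in the sense of distributions on R^2 x R. *)
Definition solves_wave (u : R * R * R -> R[i]) : Prop :=
  forall phi : R * R * R -> R, test_function phi ->
    cintegral leb3 [set: R * R * R] (fun z => u z * (box phi z)%:C%C) = 0.

(* u(., 0) = f and d_t u(., 0) = 0, in the weak sense appropriate to rough f.
   For a C^2 solution u, integrating by parts twice over t > 0 gives
     \int_{t > 0} u (Box phi)
       = - \int u(x, 0) d_t phi(x, 0) dx + \int d_t u(x, 0) phi(x, 0) dx,
   and phi(., 0), d_t phi(., 0) are arbitrary test functions on R^2. *)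
Definition has_cauchy_data (u : R * R * R -> R[i]) (f : R * R -> R[i]) : Prop :=
  forall phi : R * R * R -> R, test_function phi ->
    cintegral leb3 [set z | 0 < z.2] (fun z => u z * (box phi z)%:C%C) =
    - cintegral (leb2 R) [set: R * R]
        (fun x => f x * ('D_dir_t phi (x, 0) : R)%:C%C).

Definition wave_solution (u : R * R * R -> R[i]) (f : R * R -> R[i]) : Prop :=
  [/\ loc_integrable u, solves_wave u & has_cauchy_data u f].

End Wave.

(* Main.v *)
Require Import Defs.
From HB Require Import structures.
From mathcomp Require Import all_boot all_order all_algebra.
From mathcomp Require Import all_classical all_reals all_analysis.
From mathcomp Require Import complex measurable_realfun.
From mathcomp Require Import ring lra.
Import Order.TTheory GRing.Theory Num.Theory.
Import numFieldTopology.Exports numFieldNormedType.Exports.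
Set Implicit Arguments.
Unset Strict Implicit.
Unset Printing Implicit Defensive.
Local Open Scope classical_set_scope.
Local Open Scope ring_scope.

(** Half waves are superpositions of the plane waves [exp (i (x . xi +- t |xi|))].
    The sixth power integral of a half wave is the squared L^2 norm of its
    cube, which is a plane wave superposition over three copies of the
    frequency plane.  Abel regularisation followed by Schur's test for T T^*
    bounds it by the cube of the energy [\int p^2 |xi|] times the largest mass
    of the triple convolution of the measure [dxi / |xi|] on the light cone.
    In the light coordinates [u = |xi| + xi_1], [v = |xi| - xi_1], [y = xi_2]
    the cone is [u v = y^2], and this mass is computed to be bounded by an
    absolute constant, first in [y] and then in [u].

    The transform [g] of the data need not be integrable, so the wave it
    generates is obtained as an almost everywhere limit: the part of [g] in the
    k-th dyadic shell has energy [O(r^(2k))] with [r < 1] depending on [eps],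
    and the pieces are dominated by [r^k + r^(-5k) |piece|^6], which is summable
    in L^1_loc.  The limit has the same pairings as [u] with the test functions
    over [t > 0].  The difference, extended by zero to the past, is thus a weak
    solution on the whole space-time; its mollifications have zero energy flux
    through the spacelike level sets of [t + (1 + |x|^2)^(1/2)], hence vanish.
    Fatou's lemma carries the L^6 bound to the limit. *)

(** The exponent 6 is the one for which [dxi / |xi|] fits. This measure on the cone has homogeneity
    one, so its triple convolution in the three-dimensional frequency space has a density of degree
    zero, which can be bounded by a constant at all scales. The density itself is never formed:
    Poisson kernels of width [d] stand for the delta functions, and since they are positive with
    mass [2 pi] for every [d], the bound is uniform in [d] and Fatou's lemma removes the damping.
    The resulting [L^6] bound is global in time and costs only the weight [|xi|]. The surplus [eps]
    is spent on the almost everywhere convergence of the dyadic sums, not on the size of the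
    constant. The obstacle in the second half is that [u] is only locally integrable and is known
    only through its pairings over [t > 0]. All tests are therefore products of one-dimensional
    bumps: their pairings with plane waves reduce to integrations by parts on the line, and a
    monotone class argument shows that such products determine a function almost everywhere. Complex
    functions are handled through real and imaginary parts, with a pair [p], [q] of real amplitudes
    for each part. *)

Lemma measurable_invr (R : realType) : measurable_fun [set: R] (fun x : R => x^-1).
Proof.
rewrite (_ : [set: R] = `]-oo, 0[ `|` ([set 0] `|` `]0, +oo[)); last first.
  apply/seteqP; split=> x //= _; rewrite !in_itv/= andbT.
  by case: (ltgtP x 0) => [||->]; [left|right; right|right; left].
apply/measurable_funU => //; first exact: measurableU.
split; last (apply/measurable_funU => //; split).
- apply: open_continuous_measurable_fun => // x.
  rewrite inE/= in_itv/= => x0; apply: (@inv_continuous R).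
  by rewrite lt_eqF.
- exact: measurable_fun_set1.
- apply: open_continuous_measurable_fun => // x.
  rewrite inE/= in_itv/= andbT => x0; apply: (@inv_continuous R).
  by rewrite gt_eqF.
Qed.

Lemma measurable_sqrtr (R : realType) : measurable_fun [set: R] (@Num.sqrt R).
Proof. by apply: continuous_measurable_fun; exact: sqrt_continuous. Qed.

Lemma measurable_cos (R : realType) : measurable_fun [set: R] (@cos R).
Proof. by apply: continuous_measurable_fun; exact: continuous_cos. Qed.

Lemma measurable_sin (R : realType) : measurable_fun [set: R] (@sin R).
Proof. by apply: continuous_measurable_fun; exact: continuous_sin. Qed.

(** * Syntax-directed proofs of measurability and of nonnegativity *)

Ltac meas_step :=
  match goal with
  | H : measurable_fun setT ?f |- measurable_fun setT ?f => exact: H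
  | |- measurable_fun _ (fun _ => ?c) => exact: measurable_cst
  | |- measurable_fun _ (fun x => x) => exact: measurable_id
  | |- measurable_fun _ (fun x => (@?f x)%:E) => apply/measurable_EFinP; cbv beta
  | |- measurable_fun _ (fun x => (@?f x - @?g x)%R) => apply: measurable_funB
  | |- measurable_fun _ (fun x => (@?f x + @?g x)%R) => apply: measurable_funD
  | |- measurable_fun _ (fun x => (@?f x * @?g x)%R) => apply: measurable_funM
  | |- measurable_fun _ (fun x => (@?f x ^+ _)%R) => apply: measurable_funX
  | |- measurable_fun _ (fun x => (- @?f x)%R) => apply: measurable_funN
  | |- measurable_fun _ (fun x => ((@?f x)^-1)%R) =>
       apply: (measurableT_comp (@measurable_invr _))
  | |- measurable_fun _ (fun x => expR (@?f x)) => apply: (measurableT_comp (@measurable_expR _))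
  | |- measurable_fun _ (fun x => powR (@?f x) ?p) => apply: (measurableT_comp (@measurable_powR _ p))
  | |- measurable_fun _ (fun x => cos (@?f x)) => apply: (measurableT_comp (@measurable_cos _))
  | |- measurable_fun _ (fun x => sin (@?f x)) => apply: (measurableT_comp (@measurable_sin _))
  | |- measurable_fun _ (fun x => Num.sqrt (@?f x)) => apply: (measurableT_comp (@measurable_sqrtr _))
  | |- measurable_fun _ (fun x => `|@?f x|%R) => apply: (measurableT_comp (@normr_measurable _ setT))
  | |- measurable_fun _ (fun x => `|@?f x|%E) => apply: (measurableT_comp (@abse_measurable _ setT))
  | |- measurable_fun _ (fun x => (@?f x * @?g x)%E) => apply: emeasurable_funM
  | |- measurable_fun _ (fun x => (@?f x + @?g x)%E) => apply: emeasurable_funD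
  | |- measurable_fun _ (fun x => fst x) => exact: measurable_fst
  | |- measurable_fun _ (fun x => snd x) => exact: measurable_snd
  | |- measurable_fun _ fst => exact: measurable_fst
  | |- measurable_fun _ (fun x => (@?f x).1) => apply: (measurableT_comp measurable_fst)
  | |- measurable_fun _ (fun x => (@?f x).2) => apply: (measurableT_comp measurable_snd)
  | |- measurable_fun _ (fun x => (@?f x, @?g x)) => apply: measurable_fun_pair
  | H : measurable_fun setT ?f |- measurable_fun _ (fun x => ?f (@?g x)) =>
       apply: (measurableT_comp H)
  | |- measurable_fun ?D ?f => first [exact: measurable_sqrtr | exact: measurable_cos
      | exact: measurable_sin | exact: measurable_expR | exact: normr_measurable]
  | |- measurable_fun ?D ?f =>
      lazymatch f with (fun _ => _) => fail | _ => change (measurable_fun D (fun x => f x)) end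
  end.
Ltac meas := rewrite /=; repeat (meas_step; rewrite /=).

Ltac pos := repeat first [done | assumption | exact: sqr_ge0 | exact: expR_ge0
  | exact: sqrtr_ge0 | exact: pi_ge0 | exact: normr_ge0 | apply: mulr_ge0 | apply: addr_ge0
  | apply: exprn_ge0 | rewrite invr_ge0 | match goal with H : is_true (0 < ?x) |- is_true (0 <= ?x) => exact: ltW H end
  | match goal with H : _ |- is_true (0 <= _) => solve [apply: H] end].

(** * Derivatives and continuity of explicit functions *)

Section Calc.
Variable R : realType.
Implicit Types (f g : R -> R) (x a b : R).

(* A copy of [is_derive] hidden from type class resolution, which otherwise
   fills in the derivative in an unusable form. *)
Definition der1 x f a : Prop := is_derive x 1 f a.

Lemma der1_eq f x a b : der1 x f a -> a = b -> is_derive x 1 f b.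
Proof. by move=> + <-. Qed.

Lemma der_cst c x : der1 x (fun=> c : R) 0.
Proof. exact: is_derive_cst. Qed.

Lemma der_id x : der1 x (fun y : R => y) 1.
Proof. exact: is_derive_id. Qed.

Lemma der_add f g x a b : der1 x f a -> der1 x g b ->
  der1 x (fun y => f y + g y) (a + b).
Proof. by move=> df dg; exact: is_deriveD. Qed.

Lemma der_sub f g x a b : der1 x f a -> der1 x g b ->
  der1 x (fun y => f y - g y) (a - b).
Proof. by move=> df dg; exact: is_deriveB. Qed.

Lemma der_opp f x a : der1 x f a -> der1 x (fun y => - f y) (- a).
Proof. by move=> df; exact: is_deriveN. Qed.

Lemma der_mul f g x a b : der1 x f a -> der1 x g b ->
  der1 x (fun y => f y * g y) (a * g x + f x * b).
Proof.
move=> df dg; have H := @is_deriveM _ _ f g x 1 a b df dg.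
by rewrite mulrC addrC; exact: H.
Qed.

Lemma der_exp f x a n : der1 x f a ->
  der1 x (fun y => f y ^+ n) (n%:R * f x ^+ n.-1 * a).
Proof.
move=> df; rewrite (_ : (fun y => _) = f ^+ n); first exact: is_deriveX.
by apply/funext => y; elim: n => // n IH; rewrite exprS IH [in RHS]exprS.
Qed.

Lemma der_comp h f x a b : der1 (f x) h a -> der1 x f b ->
  der1 x (fun y => h (f y)) (a * b).
Proof. by move=> dh df; exact: is_derive1_comp. Qed.

Lemma der_inv f x a : f x != 0 -> der1 x f a ->
  der1 x (fun y => (f y)^-1) (- a / f x ^+ 2).
Proof.
move=> fx0 df; have H := @is_deriveV _ f x a 1 fx0 df.
by rewrite mulNr mulrC -mulNr; exact: H.
Qed.

Lemma der_sqrt f x a : 0 < f x -> der1 x f a ->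
  der1 x (fun y => Num.sqrt (f y)) ((2 * Num.sqrt (f x))^-1 * a).
Proof. by move=> fx0 df; apply: der_comp => //; exact: is_derive1_sqrt. Qed.

Lemma der_expR f x a : der1 x f a ->
  der1 x (fun y => expR (f y)) (expR (f x) * a).
Proof. by move=> df; apply: der_comp => //; exact: is_derive_expR. Qed.

Lemma der_cos f x a : der1 x f a ->
  der1 x (fun y => cos (f y)) (- sin (f x) * a).
Proof. by move=> df; apply: der_comp => //; exact: is_derive_cos. Qed.

Lemma der_sin f x a : der1 x f a ->
  der1 x (fun y => sin (f y)) (cos (f x) * a).
Proof. by move=> df; apply: der_comp => //; exact: is_derive_sin. Qed.

Lemma der_continuous f x a : is_derive x 1 f a -> {for x, continuous f}.
Proof. by move=> [df _]; apply: differentiable_continuous; exact/derivable1_diffP. Qed.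

Variable T : topologicalType.
Implicit Types (u v : T -> R) (t : T).

Lemma cont_add u v t : {for t, continuous u} -> {for t, continuous v} ->
  {for t, continuous (fun y => u y + v y)}.
Proof. by move=> cu cv; exact: continuousD. Qed.

Lemma cont_sub u v t : {for t, continuous u} -> {for t, continuous v} ->
  {for t, continuous (fun y => u y - v y)}.
Proof. by move=> cu cv; exact: continuousB. Qed.

Lemma cont_opp u t : {for t, continuous u} -> {for t, continuous (fun y => - u y)}.
Proof. by move=> cu; exact: continuousN. Qed.

Lemma cont_mul u v t : {for t, continuous u} -> {for t, continuous v} ->
  {for t, continuous (fun y => u y * v y)}.
Proof. by move=> cu cv; exact: continuousM. Qed.

Lemma cont_comp (h : R -> R) u t : {for u t, continuous h} -> {for t, continuous u} ->
  {for t, continuous (fun y => h (u y))}.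
Proof. by move=> ch cu; exact: continuous_comp. Qed.

Lemma cont_exp u t n : {for t, continuous u} -> {for t, continuous (fun y => u y ^+ n)}.
Proof. by move=> cu; apply: (@cont_comp (fun z => z ^+ n)) => //; exact: exprn_continuous. Qed.

Lemma cont_inv u t : u t != 0 -> {for t, continuous u} -> {for t, continuous (fun y => (u y)^-1)}.
Proof. by move=> ut0 cu; exact: continuousV. Qed.

Lemma cont_sqrt u t : {for t, continuous u} -> {for t, continuous (fun y => Num.sqrt (u y))}.
Proof. by move=> cu; apply: cont_comp => //; exact: sqrt_continuous. Qed.

Lemma cont_expR u t : {for t, continuous u} -> {for t, continuous (fun y => expR (u y))}.
Proof. by move=> cu; apply: cont_comp => //; exact: continuous_expR. Qed.

Lemma cont_cos u t : {for t, continuous u} -> {for t, continuous (fun y => cos (u y))}.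
Proof. by move=> cu; apply: cont_comp => //; exact: continuous_cos. Qed.

Lemma cont_sin u t : {for t, continuous u} -> {for t, continuous (fun y => sin (u y))}.
Proof. by move=> cu; apply: cont_comp => //; exact: continuous_sin. Qed.

Lemma cont_norm u t : {for t, continuous u} -> {for t, continuous (fun y => `|u y|)}.
Proof. by move=> cu; apply: (@cont_comp (fun z => `|z|)) => //; exact: norm_continuous. Qed.

Lemma cont_cst (c : R) t : {for t, continuous (fun _ : T => c)}.
Proof. exact: cvg_cst. Qed.

End Calc.

Lemma cont_id (T : topologicalType) (t : T) : {for t, continuous (fun y : T => y)}.
Proof. exact: cvg_id. Qed.

Lemma cont_fst (T U V : topologicalType) (f : T -> U * V) t :
  {for t, continuous f} -> {for t, continuous (fun y => (f y).1)}.
Proof. by move=> cf; apply: (continuous_comp cf); exact: cvg_fst. Qed.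

Lemma cont_snd (T U V : topologicalType) (f : T -> U * V) t :
  {for t, continuous f} -> {for t, continuous (fun y => (f y).2)}.
Proof. by move=> cf; apply: (continuous_comp cf); exact: cvg_snd. Qed.

Ltac der_step :=
  match goal with
  | H : is_derive ?x _ ?f _ |- der1 ?x ?f _ => exact: H
  | H : forall x, is_derive x _ ?f _ |- der1 _ ?f _ => exact: H
  | |- der1 _ (fun _ => ?c) _ => exact: der_cst
  | |- der1 _ (fun y => y) _ => exact: der_id
  | |- der1 _ (fun y => @?f y - @?g y) _ => apply: (@der_sub _ f g)
  | |- der1 _ (fun y => @?f y + @?g y) _ => apply: (@der_add _ f g)
  | |- der1 _ (fun y => @?f y * @?g y) _ => apply: (@der_mul _ f g)
  | |- der1 _ (fun y => - @?f y) _ => apply: (@der_opp _ f)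
  | |- der1 _ (fun y => @?f y ^+ ?n) _ => apply: (@der_exp _ f)
  | |- der1 _ (fun y => (@?f y)^-1) _ => apply: (@der_inv _ f)
  | |- der1 _ (fun y => expR (@?f y)) _ => apply: (@der_expR _ f)
  | |- der1 _ (fun y => cos (@?f y)) _ => apply: (@der_cos _ f)
  | |- der1 _ (fun y => sin (@?f y)) _ => apply: (@der_sin _ f)
  | |- der1 _ (fun y => Num.sqrt (@?f y)) _ => apply: (@der_sqrt _ f)
  | H : forall x, is_derive x _ ?h _ |- der1 _ (fun y => ?h (@?f y)) _ => apply: (@der_comp _ h f); [exact: H|]
  end.
Ltac der := rewrite /=; repeat (der_step; rewrite /=).

Ltac cont_step :=
  match goal with
  | H : {for ?x, continuous ?f} |- continuous_at ?x ?f => exact: H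
  | H : continuous_at ?x ?f |- continuous_at ?x ?f => exact: H
  | H : continuous ?f |- continuous_at _ ?f => exact: H
  | |- continuous_at _ (fun _ => ?c) => exact: cont_cst
  | |- continuous_at _ (fun y => y) => exact: cont_id
  | |- continuous_at _ (fun y => @?f y - @?g y) => apply: (@cont_sub _ _ f g)
  | |- continuous_at _ (fun y => @?f y + @?g y) => apply: (@cont_add _ _ f g)
  | |- continuous_at _ (fun y => @?f y * @?g y) => apply: (@cont_mul _ _ f g)
  | |- continuous_at _ (fun y => - @?f y) => apply: (@cont_opp _ _ f)
  | |- continuous_at _ (fun y => @?f y ^+ ?n) => apply: (@cont_exp _ _ f)
  | |- continuous_at _ (fun y => (@?f y)^-1) => apply: (@cont_inv _ _ f)
  | |- continuous_at _ (fun y => expR (@?f y)) => apply: (@cont_expR _ _ f)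
  | |- continuous_at _ (fun y => cos (@?f y)) => apply: (@cont_cos _ _ f)
  | |- continuous_at _ (fun y => sin (@?f y)) => apply: (@cont_sin _ _ f)
  | |- continuous_at _ (fun y => Num.sqrt (@?f y)) => apply: (@cont_sqrt _ _ f)
  | |- continuous_at _ (fun y => `|@?f y|) => apply: (@cont_norm _ _ f)
  | |- continuous_at _ (fun y => (@?f y).1) => apply: (@cont_fst _ _ _ _ f)
  | |- continuous_at _ (fun y => (@?f y).2) => apply: (@cont_snd _ _ _ _ f)
  | H : continuous ?h |- continuous_at _ (fun y => ?h (@?f y)) =>
      apply: (@cont_comp _ _ h f); [exact: H|]
  end.
Ltac cont := rewrite /prop_for /=; repeat (cont_step; rewrite /prop_for /=).

(** * Substitutions and the Poisson kernel *)

(** The pushforward formula is applied to the positive and negative parts separately, so that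
    integrability does not enter. *)
Lemma integralT_preserving d (T : measurableType d) (R : realType)
    (nu : {measure set T -> \bar R}) (phi : T -> T) (mphi : measurable_fun setT phi) :
  (forall A, measurable A -> nu (phi @^-1` A) = nu A) ->
  forall f : T -> \bar R, measurable_fun setT f ->
  (\int[nu]_x f (phi x) = \int[nu]_x f x)%E.
Proof.
move=> nuphi f mf.
have ge0 (g : T -> \bar R) : measurable_fun setT g -> (forall x, 0 <= g x)%E ->
    (\int[nu]_x g (phi x) = \int[nu]_x g x)%E.
  move=> mg g0.
  have := @ge0_integral_pushforward _ _ _ _ R _ mphi nu setT g measurableT mg (fun x _ => g0 x).
  rewrite preimage_setT => <-; apply: eq_measure_integral => A mA _.
  exact: nuphi.
rewrite [LHS]integralE [RHS]integralE; congr (_ - _)%E.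
  rewrite -(ge0 (funepos f) (measurable_funepos mf) (funepos_ge0 f)).
  by apply: eq_integral => x _; rewrite (funepos_comp f phi).
rewrite -(ge0 (funeneg f) (measurable_funeneg mf) (funeneg_ge0 f)).
by apply: eq_integral => x _; rewrite (funeneg_comp f phi).
Qed.

Section Tools.
Variable R : realType.
Notation mu := (@lebesgue_measure R).

Lemma lebesgue_measureDr (c : R) (A : set R) : measurable A ->
  pushforward mu (fun x : measurableTypeR R => x + c : measurableTypeR R) A = mu A.
Proof.
have mD : measurable_fun setT (fun x : measurableTypeR R => x + c : measurableTypeR R).
  by meas.
move=> mA; apply/esym/lebesgue_measure_unique => //= _ [[a b]] _ <-.
rewrite /pushforward (_ : _ @^-1` _ = `](a - c), (b - c)]%classic); last first.
  by apply/seteqP; split=> x /=; rewrite !in_itv/=; lra.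
rewrite !lebesgue_measure_itv/= !lte_fin; congr (if _ then _ else _); first lra.
by rewrite -!EFinB; congr EFin; ring.
Qed.

Lemma integralT_addr (c : R) (f : R -> \bar R) : measurable_fun [set: R] f ->
  (\int[mu]_x f (x + c)%R = \int[mu]_x f x)%E.
Proof.
move=> mf; apply: (@integralT_preserving _ (measurableTypeR R) R mu (fun x => x + c)) => //.
  by meas.
by move=> A mA; exact: lebesgue_measureDr.
Qed.

Lemma integralT_opp (f : R -> \bar R) : measurable_fun [set: R] f ->
  (\int[mu]_x f (- x)%R = \int[mu]_x f x)%E.
Proof.
move=> mf; apply: (@integralT_preserving _ (measurableTypeR R) R mu (fun x => - x)) => //.
  by meas.
by move=> A mA; exact: lebesgue_measureN.
Qed.

Lemma ge0_integralT_mull (r : R) (f : R -> \bar R) : 0 < r ->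
  measurable_fun [set: R] f -> (forall x, 0 <= f x)%E ->
  (\int[mu]_x f x = r%:E * \int[mu]_x f (r * x)%R)%E.
Proof.
move=> r0 mf f0.
have mD : measurable_fun setT (fun x : measurableTypeR R => r * x : measurableTypeR R).
  by meas.
have r0' : 0 <= r by exact: ltW.
have := @ge0_integral_pushforward _ _ (measurableTypeR R) (measurableTypeR R) R _ mD mu setT f measurableT mf (fun x _ => f0 x).
rewrite preimage_setT => <-.
rewrite -(ge0_integral_mscale _ _ (NngNum r0'))//.
apply: eq_measure_integral => A mA _; apply: lebesgue_measure_unique => //= _ [[a b]] _ <-.
rewrite /mscale/= /pushforward.
rewrite (_ : _ @^-1` _ = `](a / r), (b / r)]%classic); last first.
  apply/seteqP; split=> x /=; rewrite !in_itv/= ltr_pdivrMr// ler_pdivlMr// mulrC//.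
rewrite !lebesgue_measure_itv/= !lte_fin ltr_pM2r ?invr_gt0//.
case: ifPn => // ab; last by rewrite mule0.
by rewrite -!EFinB -EFinM; congr EFin; field; rewrite gt_eqF.
Qed.

(** Substitution on compact intervals is extended by monotone convergence. Working on compact pieces
    inside the open half line lets [G] and [f] be singular at the ends, as the arcsine density
    is. *)
Lemma ge0_substitution0y (F f G : R -> R) :
  (forall x : R, 0 < x -> is_derive x 1 F (f x)) ->
  (forall x : R, 0 < x -> 0 < f x) ->
  (forall x : R, 0 < x -> {for x, continuous f}) ->
  (forall x : R, 0 < x -> {for F x, continuous G}) ->
  (forall x : R, 0 < x -> 0 <= G (F x)) ->
  (\int[mu]_(y in F @` `]0%R, +oo[) (G y)%:E =
   \int[mu]_(x in `]0%R, +oo[) (G (F x) * f x)%:E)%E.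
Proof.
move=> dF f0 cf cG G0.
(* The intervals [[1/(n+1), n+2]] exhaust the open half line; the shift to [n+2] keeps
   [a n <= 1 < b n] already for [n = 0]. *)
pose a (n : nat) : R := n.+1%:R^-1.
pose b (n : nat) : R := n.+2%:R.
have a0 n : 0 < a n by rewrite invr_gt0.
have a1 n : a n <= 1 by rewrite invf_le1// ler1n.
have b1 n : 1 < b n by rewrite ltr1n.
have ab n : a n < b n by apply: le_lt_trans (b1 n).
have incr x y : 0 < x -> x < y -> F x < F y.
  move=> x0 xy.
  have dF' z : z \in `]x, y[ -> is_derive z 1 F (f z).
    by rewrite in_itv/= => /andP[xz _]; apply: dF; apply: lt_trans xz.
  have cF : {within `[x, y], continuous F}.
    apply: derivable_within_continuous => z; rewrite in_itv/= => /andP[xz _].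
    by have [] := dF z (lt_le_trans x0 xz).
  have [c cxy] := MVT xy dF' cF.
  rewrite -subr_gt0 => ->; apply: mulr_gt0; last by rewrite subr_gt0.
  by apply: f0; move: cxy; rewrite in_itv/= => /andP[+ _]; exact: lt_trans.
have cF n : {within `[a n, b n], continuous F}.
  apply: derivable_within_continuous => z; rewrite in_itv/= => /andP[xz _].
  by have [] := dF z (lt_le_trans (a0 n) xz).
have U1 : `]0, +oo[%classic = \bigcup_n `[a n, b n]%classic :> set R.
  apply/seteqP; split=> x /=.
    rewrite in_itv/= andbT => x0.
    have /archi_boundP := ltW x0; set N1 := Num.bound x => N1x.
    have x0' : 0 <= x^-1 by rewrite invr_ge0 ltW.
    have /archi_boundP := x0'; set N2 := Num.bound x^-1 => N2x.
    exists (maxn N1 N2) => //=; rewrite in_itv/=; apply/andP; split.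
      rewrite /a -[leRHS]invrK lef_pV2 ?posrE ?invr_gt0//.
      apply: le_trans (ltW N2x) _; rewrite ler_nat.
      by apply: leq_trans (leq_maxr N1 N2) _.
    apply: le_trans (ltW N1x) _; rewrite ler_nat.
    by apply: leq_trans (leq_maxl N1 N2) _; rewrite ltnW.
  by move=> [n _ /=]; rewrite !in_itv/= => /andP[+ _]; rewrite andbT; exact: lt_le_trans.
have FE n : F @` `[a n, b n] = `[F (a n), F (b n)]%classic.
  apply/seteqP; split => y /=.
    move=> [x]; rewrite !in_itv/= => /andP[ax xb] <-; apply/andP; split.
      move: ax; rewrite le_eqVlt => /predU1P[->//|ax]; exact/ltW/incr.
    move: xb; rewrite le_eqVlt => /predU1P[->//|xb]; apply/ltW/incr => //.
    exact: lt_le_trans ax.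
  rewrite in_itv/= => yab.
  have FabE : F (a n) <= F (b n) by apply/ltW/incr.
  have [|c cab cy] := @IVT R F (a n) (b n) y (ltW (ab n)) (cF n).
    by rewrite min_l ?max_r.
  by exists c.
have U2 : F @` `]0, +oo[ = \bigcup_n `[F (a n), F (b n)]%classic.
  rewrite U1 image_bigcup; apply: eq_bigcupr => n _; exact: FE.
have le_a n m : (n <= m)%N -> a m <= a n.
  by move=> nm; rewrite /a lef_pV2 ?posrE// ler_nat.
have le_b n m : (n <= m)%N -> b n <= b m.
  by move=> nm; rewrite /b ler_nat.
have nd1 : {homo (fun n => `[a n, b n]%classic) : n m / (n <= m)%N >-> (n <= m)%O}.
  move=> n m nm; apply/subsetPset; apply: subset_itv; rewrite bnd_simp; [exact: le_a|exact: le_b].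
have nd2 : {homo (fun n => `[F (a n), F (b n)]%classic) : n m / (n <= m)%N >-> (n <= m)%O}.
  move=> n m nm; rewrite -!FE; apply/subsetPset/image_subset/subsetPset; exact: nd1.
have mGF : measurable_fun (`]0, +oo[%classic : set R) (fun x : R => G (F x) * f x).
  apply: open_continuous_measurable_fun => // x; rewrite inE/= in_itv/= andbT => x0.
  apply: continuousM; last exact: cf.
  apply: continuous_comp; last exact: cG.
  have [dFx _] := dF x x0.
  by apply: differentiable_continuous; exact/derivable1_diffP.
have cG' n : {within `[F (a n), F (b n)], continuous G}.
  apply: continuous_in_subspaceT => y; rewrite -FE inE/= => -[x]; rewrite in_itv/= => /andP[ax _] <-.
  by apply: cG; exact: lt_le_trans ax.
have := @ge0_nondecreasing_set_cvg_integral _ (measurableTypeR R) R _ (fun x => (G (F x) * f x)%:E) mu nd1.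
rewrite -U1 => /(_ _ _ _)/cvg_lim => <- //; last 2 first.
- by move=> n; apply/measurable_EFinP; apply: measurable_funS mGF => //; rewrite U1 => x xn; exists n.
- move=> n x /=; rewrite in_itv/= => /andP[ax _]; rewrite lee_fin mulr_ge0//.
    by apply: G0; exact: lt_le_trans ax.
  by apply/ltW/f0; exact: lt_le_trans ax.
have := @ge0_nondecreasing_set_cvg_integral _ (measurableTypeR R) R _ (fun x => (G x)%:E) mu nd2.
rewrite -U2 => /(_ _ _ _)/cvg_lim => <- //; last 2 first.
- by move=> n; apply/measurable_EFinP; apply: subspace_continuous_measurable_fun.
- move=> n y; rewrite -FE => -[x]; rewrite /= in_itv/= => /andP[ax _] <-; rewrite lee_fin.
  by apply: G0; exact: lt_le_trans ax.
congr (limn _); apply/funext => n.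
have dFE (x : R) : 0 < x -> derive1 F x = f x.
  by move=> x0; rewrite derive1E; have := dF x x0 => H; rewrite derive_val.
have near_pos (x : R) : 0 < x -> \forall y \near x, derive1 F y = f y.
  move=> x0; near=> y; apply: dFE.
  near: y; exact: lt_nbhsr.
have cF' (x : R) : 0 < x -> {for x, continuous (derive1 F)}.
  move=> x0; rewrite /prop_for /continuous_at (dFE _ x0).
  apply: cvg_trans (cf x x0); apply: near_eq_cvg.
  by near=> y; apply/esym; near: y; exact: near_pos.
rewrite integration_by_substitution_increasing//.
- apply: eq_integral => x; rewrite inE/= in_itv/= => /andP[ax _].
  by congr EFin; rewrite fctE/= dFE//; exact: lt_le_trans ax.
- exact: ltW.
- move=> x y; rewrite !in_itv/= => /andP[ax _] _ xy; apply: incr => //.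
  exact: lt_le_trans ax.
- move=> x; rewrite in_itv/= => /andP[ax _]; apply: cF'; exact: lt_trans ax.
- apply/cvg_ex; exists (derive1 F (a n)); apply: cvg_at_right_filter; exact: cF'.
- apply/cvg_ex; exists (derive1 F (b n)); apply: cvg_at_left_filter; apply: cF'.
  by apply: lt_trans (ab n).
- have cc (x : R) : 0 < x -> {for x, continuous F}.
    move=> x0; have [dFx _] := dF x x0.
    by apply: differentiable_continuous; exact/derivable1_diffP.
  split.
  + move=> x; rewrite in_itv/= => /andP[ax _].
    by have [] := dF x (lt_trans (a0 n) ax).
  + by apply: cvg_at_right_filter; exact: cc.
  + apply: cvg_at_left_filter; apply: cc; exact: lt_trans (ab n).
Unshelve. all: by end_near.
Qed.

Lemma integral_oneDsqrV_0y : (\int[mu]_(x in `]0%R, +oo[) (1 + x ^+ 2)^-1%:E = (pi / 2)%:E)%E.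
Proof.
rewrite integral_itv_obnd_cbnd; last first.
  by apply: measurable_funTS; apply/measurable_EFinP; meas.
rewrite (@ge0_continuous_FTC2y _ _ atan 0 (pi / 2))//.
- by rewrite atan0 sube0.
- by move=> x _; rewrite invr_ge0 addr_ge0// sqr_ge0.
- by apply: continuous_subspaceT => x; exact: continuous_oneDsqrV.
- exact: cvgy_atan.
- by apply: cvg_at_right_filter; exact: continuous_atan.
- by move=> x _; rewrite derive1_atan.
Qed.

Lemma integral_oneDsqrV : (\int[mu]_x (1 + x ^+ 2)^-1%:E = pi%:E)%E.
Proof.
rewrite ge0_symfun_integralT.
- rewrite -set_itvcy -integral_itv_obnd_cbnd ?integral_oneDsqrV_0y; last first.
    by apply: measurable_funTS; apply/measurable_EFinP; meas.
  by rewrite -EFinM; congr EFin; field.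
- by move=> x; rewrite invr_ge0 addr_ge0// sqr_ge0.
- exact: continuous_oneDsqrV.
- by move=> x /=; rewrite sqrrN.
Qed.

(** The Fourier transform of [exp(- d |s|)]. Its mass is [2 pi] for every [d], so it approximates
    [2 pi] times a delta function as [d] tends to 0. *)
Definition pois (d x : R) : R := 2 * d / (d ^+ 2 + x ^+ 2).

Lemma pois_ge0 d x : 0 < d -> 0 <= pois d x.
Proof. by move=> d0; rewrite /pois mulr_ge0 ?mulr_ge0 ?invr_ge0 ?addr_ge0 ?sqr_ge0// ltW. Qed.

Lemma pois_continuous d : 0 < d -> continuous (pois d).
Proof.
move=> d0 x; rewrite /pois; cont.
by rewrite gt_eqF// ltr_wpDr ?sqr_ge0// exprn_gt0.
Qed.

Lemma measurable_pois d : measurable_fun setT (pois d).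
Proof. by rewrite /pois; meas. Qed.

Lemma pois_le d x : 0 < d -> pois d x <= 2 / d.
Proof.
move=> d0; rewrite /pois ler_pdivrMr ?ltr_wpDr ?sqr_ge0 ?exprn_gt0//.
have -> : 2 / d * (d ^+ 2 + x ^+ 2) = 2 * d + 2 / d * x ^+ 2.
  by field; rewrite gt_eqF.
by rewrite lerDl mulr_ge0 ?sqr_ge0// divr_ge0// ltW.
Qed.

Lemma integral_pois d : 0 < d -> (\int[mu]_x (pois d x)%:E = (2 * pi)%:E)%E.
Proof.
move=> d0; rewrite (@ge0_integralT_mull d)//.
- rewrite (_ : (fun x => _) = (fun x => (2 / d)%:E * (1 + x ^+ 2)^-1%:E)%E); last first.
    apply/funext => x; rewrite -EFinM; congr EFin; rewrite /pois.
    have -> : d ^+ 2 + (d * x) ^+ 2 = d ^+ 2 * (1 + x ^+ 2) by ring.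
    field; rewrite (gt_eqF d0)/= gt_eqF//.
    by rewrite ltr_wpDr ?sqr_ge0.
  rewrite ge0_integralZl//.
  + rewrite integral_oneDsqrV -!EFinM; congr EFin; field; by rewrite gt_eqF.
  + by apply/measurable_EFinP; meas.
  + by move=> x _; rewrite lee_fin invr_ge0 addr_ge0// sqr_ge0.
  + by rewrite lee_fin divr_ge0// ltW.
- by apply/measurable_EFinP; exact: measurable_pois.
- by move=> x; rewrite lee_fin pois_ge0.
Qed.

Lemma image_sq_ratio (A : R) : 0 < A ->
  (fun r : R => A * (r ^+ 2 / (1 + r ^+ 2))) @` `]0, +oo[ = `]0, A[%classic.
Proof.
move=> A0; apply/seteqP; split => y /=.
  move=> [r]; rewrite !in_itv/= andbT => r0 <-.
  have r20 : 0 < r ^+ 2 by rewrite exprn_gt0.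
  apply/andP; split; first by rewrite mulr_gt0// divr_gt0// addr_gt0.
  by rewrite gtr_pMr// ltr_pdivrMr ?addr_gt0// mul1r ltrDr.
rewrite in_itv/= => /andP[y0 yA].
exists (Num.sqrt (y / (A - y))).
  by rewrite in_itv/= andbT sqrtr_gt0 divr_gt0// subr_gt0.
rewrite sqr_sqrtr; last by rewrite divr_ge0// ?subr_ge0 ltW.
have Ay : A - y != 0 by rewrite gt_eqF// subr_gt0.
field; rewrite Ay/= (_ : A - y + y = A); last by ring.
by rewrite gt_eqF.
Qed.

(* u = A r^2/(1+r^2) turns the arcsine density into 2/(1+r^2). *)
Lemma integral_arcsine (A : R) : 0 < A ->
  (\int[mu]_(u in `]0%R, A[) (Num.sqrt (u * (A - u)))^-1%:E = pi%:E)%E.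
Proof.
move=> A0; rewrite -image_sq_ratio//.
pose f (r : R) := 2 * A * r / (1 + r ^+ 2) ^+ 2.
have p1 (r : R) : 0 < 1 + r ^+ 2 by rewrite ltr_wpDr ?sqr_ge0.
have E (r : R) : 0 < r -> A * (r ^+ 2 / (1 + r ^+ 2)) * (A - A * (r ^+ 2 / (1 + r ^+ 2))) =
    (A * r / (1 + r ^+ 2)) ^+ 2.
  by move=> r0; field; rewrite gt_eqF.
have q (r : R) : 0 < r -> 0 < A * r / (1 + r ^+ 2).
  by move=> r0; rewrite divr_gt0// mulr_gt0.
have E2 (r : R) : 0 < r -> Num.sqrt ((A * r / (1 + r ^+ 2)) ^+ 2) = A * r / (1 + r ^+ 2).
  by move=> r0; rewrite sqrtr_sqr gtr0_norm// q.
apply: etrans; first apply: (@ge0_substitution0y (fun r : R => A * (r ^+ 2 / (1 + r ^+ 2))) f (fun u => (Num.sqrt (u * (A - u)))^-1)); last first.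
- rewrite (eq_integral (fun r : measurableTypeR R => 2%:E * (1 + (r : R) ^+ 2)^-1%:E)%E); last first.
    move=> r; rewrite inE/= in_itv/= andbT => r0; rewrite E// E2// -EFinM; congr EFin.
    rewrite /f; field; have := p1 r; have := A0; lra.
  rewrite ge0_integralZl//.
  + by rewrite integral_oneDsqrV_0y -EFinM; congr EFin; field.
  + by apply: measurable_funTS; apply/measurable_EFinP; meas.
  + by move=> x _; rewrite lee_fin invr_ge0 addr_ge0// sqr_ge0.
- by move=> r r0; rewrite invr_ge0 sqrtr_ge0.
- move=> r r0; cont; by rewrite E// E2// gt_eqF// q.
- move=> r r0; rewrite /f; cont; by rewrite gt_eqF// exprn_gt0.
- by move=> r r0; rewrite /f divr_gt0// ?mulr_gt0// exprn_gt0.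
- move=> r r0; rewrite /f; have p := p1 r.
  have p' : 1 + r ^+ 2 != 0 by rewrite gt_eqF.
  apply: der1_eq; first by der.
  by rewrite /=; field; lra.
Qed.

End Tools.

(** * Integrability of real-valued functions *)

Section General.
Context d (T : measurableType d) (R : realType) (nu : {measure set T -> \bar R}).

Lemma le_integrable_EFin (f g : T -> R) : measurable_fun setT f ->
  nu.-integrable setT (EFin \o g) -> (forall x, `|f x| <= g x) ->
  nu.-integrable setT (EFin \o f).
Proof.
move=> mf ig fg; apply: le_integrable ig => //.
  exact/measurable_EFinP.
move=> x _; rewrite lee_fin/=; apply: le_trans (fg x) _; exact: ler_norm.
Qed.

Lemma EFin_Rintegral (f : T -> R) : nu.-integrable setT (EFin \o f) ->
  (\int[nu]_x f x)%:E = (\int[nu]_x (f x)%:E)%E.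
Proof. by move=> fi; rewrite /Rintegral fineK//; exact: integrable_fin_num. Qed.

Lemma integrable_mul_bounded (f h : T -> R) (M : R) : nu.-integrable setT (EFin \o f) ->
  measurable_fun setT h -> (forall x, `|h x| <= M) ->
  nu.-integrable setT (EFin \o (fun x => f x * h x)).
Proof.
move=> fi mh hM.
have mf : measurable_fun setT f by apply/measurable_EFinP; exact: measurable_int fi.
apply: (@le_integrable_EFin _ (fun x => M * `|f x|)).
- exact: measurable_funM.
- have := @integrableZl _ _ _ nu _ measurableT M _ (integrable_norm fi).
  by apply: eq_integrable => //= x _; rewrite EFinM.
- by move=> x; rewrite normrM mulrC ler_wpM2r.
Qed.

Lemma ge0_integrableP (f : T -> R) : measurable_fun setT f -> (forall x, 0 <= f x) ->
  (\int[nu]_x (f x)%:E < +oo)%E -> nu.-integrable setT (EFin \o f).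
Proof.
move=> mf f0 fi; apply/integrableP; split; first exact/measurable_EFinP.
by under eq_integral do rewrite /= ger0_norm//.
Qed.

End General.

Lemma eq_integrableT d (T : measurableType d) (R : realType) (nu : {measure set T -> \bar R}) (f g : T -> R) :
  f =1 g -> nu.-integrable setT (EFin \o f) -> nu.-integrable setT (EFin \o g).
Proof. by move=> /funext ->. Qed.

Lemma EFin_RintegralZl d (T : measurableType d) (R : realType) (nu : {measure set T -> \bar R})
    (c : R) (f : T -> R) : nu.-integrable setT (EFin \o f) ->
  (\int[nu]_x (c * f x)%:E)%E = (c * \int[nu]_x f x)%:E.
Proof.
move=> fi; rewrite EFinM EFin_Rintegral// -integralZl//.
Qed.

Lemma eq_RintegralT d (T : measurableType d) (R : realType) (nu : {measure set T -> \bar R}) (f g : T -> R) :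
  f =1 g -> Rintegral nu setT f = Rintegral nu setT g.
Proof. by move=> fg; congr Rintegral; apply/funext. Qed.

(** * The Abel factor and its transform *)

Section Poisson.
Variable R : realType.
Notation mu := (@lebesgue_measure R).
Variable d : R.
Hypothesis d0 : 0 < d.

Definition expabs (s : R) : R := expR (- d * `|s|).

Lemma expabs_ge0 s : 0 <= expabs s. Proof. exact: expR_ge0. Qed.

Lemma expabs_le1 s : expabs s <= 1.
Proof. by rewrite /expabs -[leRHS]expR0 ler_expR mulNr oppr_le0 mulr_ge0// ltW. Qed.

Lemma measurable_expabs : measurable_fun setT expabs.
Proof. by rewrite /expabs; meas. Qed.

Lemma expR_cvg0 : expR (- d * s) @[s --> +oo] --> (0 : R).
Proof.
apply/cvgrPdist_le => e e0.
near=> s; rewrite sub0r normrN ger0_norm ?expR_ge0//.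
rewrite mulNr expRN -[leRHS]invrK lef_pV2 ?posrE ?expR_gt0 ?invr_gt0//.
apply: le_trans (expR_ge1Dx _).
rewrite -lerBlDl mulrC -ler_pdivrMr//.
Unshelve. all: by end_near.
Qed.

(** Adding 1 to the cosine makes the integrand nonnegative, so that the half-line fundamental
    theorem for nonnegative functions applies. The case [x = 0] then isolates the contribution of
    the 1, and subtraction gives the cosine transform. *)
Lemma integral_expabs_1Dcos x :
  (\int[mu]_s (expabs s * (1 + cos (x * s)))%:E = (2 / d + pois d x)%:E)%E.
Proof.
rewrite ge0_symfun_integralT; last 3 first.
- by move=> s; rewrite mulr_ge0 ?expabs_ge0// -lerBlDl sub0r cos_geN1.
- by move=> s; rewrite /expabs; cont.
- by move=> s /=; rewrite /expabs normrN mulrN cosN.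
have q0 : d ^+ 2 + x ^+ 2 != 0 by rewrite gt_eqF// ltr_wpDr ?sqr_ge0// exprn_gt0.
pose F s := expR (- d * s) * (- d^-1 + (x * sin (x * s) - d * cos (x * s)) / (d ^+ 2 + x ^+ 2)).
have dF (s : R) : is_derive s 1 F (expR (- d * s) * (1 + cos (x * s))).
  apply: der1_eq; first by rewrite /F; der.
  by rewrite /=; field; rewrite q0 gt_eqF.
rewrite -set_itvcy (eq_integral (fun s : measurableTypeR R => (expR (- d * s) * (1 + cos (x * s)))%:E)); last first.
  by move=> s; rewrite inE/= in_itv/= andbT => s0; rewrite /expabs ger0_norm.
rewrite (@ge0_continuous_FTC2y _ (fun s => expR (- d * s) * (1 + cos (x * s))) F 0 0).
- rewrite /F mulr0 mulr0 expR0 sin0 cos0 -EFinB -EFinM; congr EFin.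
  by rewrite /pois; field; rewrite q0 gt_eqF.
- by move=> s _; rewrite mulr_ge0 ?expR_ge0// -lerBlDl sub0r cos_geN1.
- by apply: continuous_subspaceT => s; cont.
- pose M := d^-1 + (`|x| + d) / (d ^+ 2 + x ^+ 2).
  have M0 : 0 < M.
    by rewrite ltr_pwDl ?invr_gt0// divr_ge0 ?addr_ge0 ?sqr_ge0// ltW.
  have FM (s : R) : `|F s| <= expR (- d * s) * M.
    rewrite /F normrM ger0_norm ?expR_ge0// ler_wpM2l ?expR_ge0//.
    apply: le_trans (ler_normD _ _) _; rewrite normrN ger0_norm ?invr_ge0 ?(ltW d0)//.
    rewrite /M lerD2l normrM normfV (ger0_norm (addr_ge0 (sqr_ge0 d) (sqr_ge0 x))) ler_wpM2r ?invr_ge0 ?addr_ge0 ?sqr_ge0//.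
    apply: le_trans (ler_normB _ _) _; rewrite !normrM (ger0_norm (ltW d0)).
    by rewrite lerD// ler_piMr ?(ltW d0)// ler_norml ?sin_geN1 ?sin_le1 ?cos_geN1 ?cos_le1.
  apply/cvgrPdist_le => e e0.
  have /cvgrPdist_le/(_ (e / M)) H := expR_cvg0.
  have eM : 0 < e / M by rewrite divr_gt0.
  near=> s; rewrite sub0r normrN; apply: le_trans (FM s) _.
  rewrite -ler_pdivlMr//; apply: le_trans (ler_norm _) _; rewrite -normrN -sub0r.
  by near: s; exact: H.
- by move=> s _; have [] := dF s.
- by apply: cvg_at_right_filter; exact: (der_continuous (dF 0)).
- by move=> s _; rewrite derive1E; have H := dF s; rewrite derive_val.
Unshelve. all: by end_near.
Qed.

Lemma integral_expabs : (\int[mu]_s (expabs s)%:E = (2 / d)%:E)%E.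
Proof.
have := integral_expabs_1Dcos 0.
rewrite (eq_integral (fun s : measurableTypeR R => 2%:E * (expabs s)%:E)%E); last first.
  by move=> s _; rewrite mul0r cos0 -EFinM mulrC.
rewrite ge0_integralZl//; last 2 first.
- by apply/measurable_EFinP; exact: measurable_expabs.
- by move=> s _; rewrite lee_fin expabs_ge0.
move=> H; have : (2^-1%:E * (2%:E * \int[mu]_s (expabs s)%:E) = 2^-1%:E * (2 / d + pois d 0)%:E)%E.
  by rewrite H.
rewrite muleA -EFinM mulVf// mul1e => ->; rewrite -EFinM; congr EFin.
by rewrite /pois expr0n addr0; field; rewrite gt_eqF.
Qed.

Lemma integrable_expabs : mu.-integrable setT (EFin \o expabs).
Proof.
apply: ge0_integrableP; [exact: measurable_expabs|exact: expabs_ge0|].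
by rewrite integral_expabs ltry.
Qed.

Lemma integrable_expabs_mul (h : R -> R) : measurable_fun setT h -> (forall s, `|h s| <= 1) ->
  mu.-integrable setT (EFin \o (fun s => expabs s * h s)).
Proof. by move=> mh h1; exact: (integrable_mul_bounded integrable_expabs mh h1). Qed.

Lemma Rintegral_expabs_cos x : (\int[mu]_s (expabs s * cos (x * s)))%R = pois d x.
Proof.
have i1 := integrable_expabs.
have i2 : mu.-integrable setT (EFin \o (fun s => expabs s * cos (x * s))).
  by apply: integrable_expabs_mul => [|s]; [meas|rewrite ler_norml cos_geN1 cos_le1].
have := integral_expabs_1Dcos x.
rewrite -EFin_Rintegral; last first.
  have := integrableD measurableT i1 i2; apply: eq_integrable => //= s _.
  by rewrite -EFinD mulrDr mulr1.
rewrite (@eq_RintegralT _ (measurableTypeR R) R mu _ (fun s => expabs s + expabs s * cos (x * s))); last first.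
  by move=> s; rewrite mulrDr mulr1.
rewrite RintegralD// => -[].
rewrite {1}/Rintegral integral_expabs/= => /addrI; exact.
Qed.

Lemma Rintegral_expabs_sin x : (\int[mu]_s (expabs s * sin (x * s)))%R = 0.
Proof.
set I := Rintegral _ _ _.
suff : I = - I by move=> H; lra.
have i2 : mu.-integrable setT (EFin \o (fun s => expabs s * sin (x * s))).
  by apply: integrable_expabs_mul => [|s]; [meas|rewrite ler_norml sin_geN1 sin_le1].
rewrite -mulN1r /I -RintegralZl// /Rintegral -integralT_opp; last by apply/measurable_EFinP; rewrite /expabs; meas.
by congr fine; apply: eq_integral => s _; rewrite mulrN sinN /expabs normrN mulN1r mulrN.
Qed.

(* The oscillatory part of the Abel kernel is even, so a phase shift only contributes its cosine. *)
Lemma Rintegral_expabs_phase al x :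
  (\int[mu]_s (expabs s * cos (al + x * s)))%R = cos al * pois d x.
Proof.
rewrite (@eq_RintegralT _ (measurableTypeR R) R mu _ (fun s => cos al * (expabs s * cos (x * s)) - sin al * (expabs s * sin (x * s)))); last first.
  by move=> s; rewrite cosD; ring.
have i1 : mu.-integrable setT (EFin \o (fun s => expabs s * cos (x * s))).
  by apply: integrable_expabs_mul => [|s]; [meas|rewrite ler_norml cos_geN1 cos_le1].
have i2 : mu.-integrable setT (EFin \o (fun s => expabs s * sin (x * s))).
  by apply: integrable_expabs_mul => [|s]; [meas|rewrite ler_norml sin_geN1 sin_le1].
rewrite RintegralB//.
- by rewrite !RintegralZl// Rintegral_expabs_cos Rintegral_expabs_sin mulr0 subr0.
- by have := integrableZl measurableT (cos al) i1; apply: eq_integrable => //= s _; rewrite EFinM.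
- by have := integrableZl measurableT (sin al) i2; apply: eq_integrable => //= s _; rewrite EFinM.
Qed.

End Poisson.

(** * Radial integrals in the plane *)

Section Radial.
Variable R : realType.
Notation mu := (@lebesgue_measure R).

(** Square roots of negative numbers and the inverse of 0 are both 0. Densities of the form
    [1 / sqrt] therefore vanish off their natural domain, and integrals can be written over the
    whole line. *)
Lemma sqrt_le0_inv (x : R) : x <= 0 -> (Num.sqrt x)^-1 = 0.
Proof. by move=> x0; rewrite ler0_sqrtr// invr0. Qed.

Lemma integralT_arcsine (A : R) : 0 < A ->
  (\int[mu]_u (Num.sqrt (u * (A - u)))^-1%:E = pi%:E)%E.
Proof.
move=> A0; rewrite -(integral_arcsine A0) [RHS]integral_mkcond; apply: eq_integral => u _.
rewrite patchE; case: ifPn => //; rewrite notin_setE/= in_itv/= => /negP.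
rewrite negb_and -!leNgt => H; rewrite sqrt_le0_inv//.
case/orP: H => H; first by rewrite mulr_le0_ge0// subr_ge0; apply: le_trans (ltW A0).
by rewrite mulr_ge0_le0 ?subr_le0//; apply: le_trans H; exact: ltW.
Qed.

(** Translating by the radius [sqrt s] turns [s - b^2] into [u (2 sqrt s - u)], which is the arcsine
    density; its mass does not depend on the radius. *)
Lemma integral_circle (s : R) : 0 < s ->
  (\int[mu]_b (Num.sqrt (s - b ^+ 2))^-1%:E = pi%:E)%E.
Proof.
move=> s0; have r0 : 0 < Num.sqrt s by rewrite sqrtr_gt0.
have A0 : 0 < 2 * Num.sqrt s by rewrite mulr_gt0.
rewrite -(integralT_arcsine A0).
rewrite -(integralT_addr (- Num.sqrt s)); last by apply/measurable_EFinP; meas.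
have E (u : R) : s - (u - Num.sqrt s) ^+ 2 = u * (2 * Num.sqrt s - u).
  by move: (Num.sqrt s) (sqr_sqrtr (ltW s0)) => r <-; ring.
by apply: eq_integral => u _; rewrite E.
Qed.

(** The substitution [s = a^2 + b^2] on [a > 0] has [ds = 2 a da]; the 2 is absorbed by the symmetry
    in [a]. Values [s <= b^2] contribute nothing by the convention on [sqrt] and inverse. *)
Lemma integral_halfline_sq (h : R -> R) b : continuous h -> (forall x, 0 <= h x) ->
  (\int[mu]_a (h (a ^+ 2 + b ^+ 2))%:E =
   \int[mu]_s (h s * (Num.sqrt (s - b ^+ 2))^-1)%:E)%E.
Proof.
move=> ch h0; rewrite ge0_symfun_integralT//; last 2 first.
- by move=> a; cont.
- by move=> a /=; rewrite sqrrN.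
pose X (a : R) := a ^+ 2 + b ^+ 2.
have XE : X @` `]0, +oo[ = `](b ^+ 2), +oo[%classic.
  apply/seteqP; split => s /=.
    by move=> [a]; rewrite !in_itv/= !andbT => a0 <-; rewrite /X ltrDr exprn_gt0.
  rewrite in_itv/= andbT => bs; exists (Num.sqrt (s - b ^+ 2)).
    by rewrite in_itv/= andbT sqrtr_gt0 subr_gt0.
  by rewrite /X sqr_sqrtr ?subrK// subr_ge0 ltW.
have mh : measurable_fun setT h by exact: continuous_measurable_fun.
transitivity (\int[mu]_(s in `](b ^+ 2)%R, +oo[) (h s * (Num.sqrt (s - b ^+ 2))^-1)%:E)%E; last first.
  rewrite integral_mkcond; apply: eq_integral => s _; rewrite patchE; case: ifPn => //.
  rewrite notin_setE/= in_itv/= andbT => /negP; rewrite -leNgt => bs.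
  by rewrite sqrt_le0_inv ?mulr0// subr_le0.
rewrite -XE.
have E (a : R) : 0 < a -> Num.sqrt (X a - b ^+ 2) = a.
  by move=> a0; rewrite /X addrK sqrtr_sqr gtr0_norm.
apply/esym; apply: etrans; first apply: (@ge0_substitution0y _ X (fun a => 2 * a) (fun s => h s * (Num.sqrt (s - b ^+ 2))^-1)).
- by move=> a a0; apply: der1_eq; [rewrite /X; der|rewrite /=; ring].
- by move=> a a0; rewrite mulr_gt0.
- by move=> a a0; cont.
- by move=> a a0; cont; rewrite ?E ?gt_eqF//; exact: ch.
- by move=> a a0; rewrite mulr_ge0// invr_ge0 sqrtr_ge0.
rewrite (eq_integral (fun a : measurableTypeR R => 2%:E * (h (a ^+ 2 + b ^+ 2))%:E)%E); last first.
  move=> a; rewrite inE/= in_itv/= andbT => a0; rewrite -EFinM; congr EFin.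
  by rewrite E// /X; field; rewrite gt_eqF.
rewrite -set_itvcy -integral_itv_obnd_cbnd; last first.
  by apply: measurable_funTS; apply/measurable_EFinP; meas.
rewrite ge0_integralZl//; last by move=> a _; rewrite lee_fin.
by apply: measurable_funTS; apply/measurable_EFinP; meas.
Qed.

(** Polar coordinates in the variable [s = a^2 + b^2]: after Tonelli the inner integral is the
    circle integral, equal to [pi] for [s > 0] and to 0 otherwise. The inequality comes from keeping
    the mass of [h] on [s <= 0] in the bound. *)
Lemma integral_radial (h : R -> R) : continuous h -> (forall x, 0 <= h x) ->
  (\int[mu]_b \int[mu]_a (h (a ^+ 2 + b ^+ 2))%:E <= pi%:E * \int[mu]_s (h s)%:E)%E.
Proof.
move=> ch h0; have mh : measurable_fun setT h by exact: continuous_measurable_fun.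
under eq_integral do rewrite integral_halfline_sq//.
rewrite (@fubini_tonelli _ _ _ _ R mu mu (fun z : measurableTypeR R * measurableTypeR R => (h z.2 * (Num.sqrt (z.2 - z.1 ^+ 2))^-1)%:E)); last 2 first.
- by apply/measurable_EFinP; meas.
- by move=> z; rewrite lee_fin mulr_ge0// invr_ge0 sqrtr_ge0.
rewrite -ge0_integralZl//; last 3 first.
- by apply/measurable_EFinP; meas.
- by move=> s _; rewrite lee_fin.
- by rewrite lee_fin pi_ge0.
apply: ge0_le_integral => //=.
- by move=> s _; apply: integral_ge0 => b _; rewrite lee_fin mulr_ge0// invr_ge0 sqrtr_ge0.
- apply: (@measurable_fun_fubini_tonelli_G _ _ _ _ R mu (fun z : measurableTypeR R * measurableTypeR R => (h z.2 * (Num.sqrt (z.2 - z.1 ^+ 2))^-1)%:E)).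
    by apply/measurable_EFinP; meas.
  by move=> z; rewrite lee_fin mulr_ge0// invr_ge0 sqrtr_ge0.
- by apply/measurable_EFinP; meas.
- move=> s _; under eq_integral do rewrite EFinM.
  rewrite ge0_integralZl//; last 2 first.
  + by apply/measurable_EFinP; meas.
  + by rewrite lee_fin.
  have [s0|s0] := ltP 0 s; first by rewrite integral_circle// muleC.
  rewrite integral0_eq ?mule0.
    by rewrite mule_ge0// lee_fin ?pi_ge0.
  by move=> b _; rewrite sqrt_le0_inv// subr_le0 (le_trans s0)// sqr_ge0.
Qed.

End Radial.

(** * Change of variables with a density *)

Section Density.
Variable R : realType.
Notation mu := (@lebesgue_measure R).
Variables (X k : R -> R).
Hypotheses (mX : measurable_fun setT X) (mk : measurable_fun setT k) (k0 : forall u, 0 <= k u).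

(** The region under the graph of [k]: the planar measure restricted to it projects to the measure
    [k du], which is thereby available as a pushforward. *)
Let S : set (measurableTypeR R * measurableTypeR R) := [set z | (0 <= z.2 < k z.1)%R].
Let mS : measurable S.
Proof.
rewrite (_ : S = setT `&` ((fun z => (0 <= z.2)%R && (z.2 < k z.1)%R) @^-1` [set true])).
  apply: measurable_and => //; first apply: measurable_fun_ler; meas.
  by apply: measurable_fun_ltr; meas.
by rewrite setTI; apply/seteqP; split => z /=.
Qed.

Let phi (z : measurableTypeR R * measurableTypeR R) : measurableTypeR R := X z.1.
Let mphi : measurable_fun setT phi. Proof. by rewrite /phi; meas. Qed.

Let chain (g : R -> \bar R) : measurable_fun setT g -> (forall x, (0 <= g x)%E) ->
  (\int[mrestr (leb2 R) mS]_z g (phi z) = \int[mu]_u (g (X u) * (k u)%:E))%E.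
Proof.
move=> mg g0.
have mgp : measurable_fun setT (g \o phi) by exact: measurableT_comp.
rewrite (@ge0_negligible_integral _ _ _ _ _ (~` S))//; last 2 first.
- exact: measurableC.
- by rewrite /= /mrestr setICl measure0.
rewrite setTD setCK (@eq_measure_integral _ _ _ _ (leb2 R)); last first.
  by move=> A mA AS /=; rewrite /mrestr setIidl.
rewrite integral_mkcond /leb2 fubini_tonelli1; last 2 first.
- by apply: (measurable_restrictT _ _).1 => //; apply: measurable_funTS.
- by move=> z; rewrite patchE; case: ifPn.
apply: eq_integral => u _; rewrite /fubini_F.
rewrite (eq_integral (fun s : measurableTypeR R => g (X u) * (\1_(`[0%R, k u[%classic : set (measurableTypeR R)) s)%:E)%E); last first.
  move=> s _; rewrite patchE indicE /phi/=.
  have -> : ((u, s) \in S) = (s \in (`[0%R, k u[%classic : set (measurableTypeR R))).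
    by apply/idP/idP => /set_mem H; apply/mem_set; move: H; rewrite /S/= in_itv/=.
  by case: ifPn => _; rewrite ?mule1 ?mule0//.
rewrite ge0_integralZl//; last first.
  by apply/measurable_EFinP; apply: measurable_indic; exact: measurable_itv.
rewrite integral_indic//= setIT lebesgue_measure_itv/= lte_fin.
by case: ltP => // H; rewrite ?sube0//; congr (_ * _)%E; congr EFin; apply/le_anti; rewrite k0 H.
Qed.

(** The image of [k du] under [X] has the values of Lebesgue measure on half-open intervals, hence
    equals it. [X] need only be measurable, so it may take meaningless values where [k] vanishes. *)
Lemma ge0_integral_density :
  (forall a b : R, (a < b)%R -> \int[mu]_u ((\1_(`]a, b]%classic : set R) (X u))%:E * (k u)%:E) = (b - a)%R%:E)%E ->
  forall g : R -> \bar R, measurable_fun setT g -> (forall x, (0 <= g x)%E) ->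
  (\int[mu]_x g x = \int[mu]_u (g (X u) * (k u)%:E))%E.
Proof.
move=> H g mg g0; rewrite -chain//.
have := @ge0_integral_pushforward _ _ _ _ R _ mphi (mrestr (leb2 R) mS) setT g measurableT mg (fun x _ => g0 x).
rewrite preimage_setT => <-.
apply: eq_measure_integral => A mA _; apply: lebesgue_measure_unique => //= _ [[a b]] _ <-.
have [ab|ab] := ltP a b; last first.
  by rewrite set_itv_ge ?bnd_simp -?leNgt// measure0 /pushforward preimage_set0 measure0.
rewrite lebesgue_measure_itv/= lte_fin ab -EFinB -H// -(chain (g := fun x => (\1_(`]a, b]%classic : set R) x)%:E))//.
- have := @ge0_integral_pushforward _ _ _ _ R _ mphi (mrestr (leb2 R) mS) setT (fun x => (\1_(`]a, b]%classic : set R) x)%:E) measurableT.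
  rewrite preimage_setT => <- //.
  + by rewrite integral_indic//= setIT.
  + by apply/measurable_EFinP; apply: measurable_indic; exact: measurable_itv.
- by apply/measurable_EFinP; apply: measurable_indic; exact: measurable_itv.
Qed.

End Density.

(** * Triple convolution of the cone measure *)

Section Tonelli.
Context d1 d2 (T1 : measurableType d1) (T2 : measurableType d2) (R : realType).
Variables (m1 : {sigma_finite_measure set T1 -> \bar R}) (m2 : {sigma_finite_measure set T2 -> \bar R}).

Let product_sigma_finite : sigma_finite setT (m1 \x m2)%E.
Proof.
have /sigma_finiteP[F [TF ndF Foo]] := sigma_finiteT m1.
have /sigma_finiteP[G [TG ndG Goo]] := sigma_finiteT m2.
exists (fun n => F n `*` G n); last first.
  move=> k; have [? ?] := Foo k; have [? ?] := Goo k.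
  split; first exact: measurableX.
  by rewrite product_measure1E// lte_mul_pinfty// ge0_fin_numE.
rewrite -setXTT TF TG; apply/seteqP; split => -[x y] /=; last first.
  by move=> [n _ [? ?]]; split; exists n.
move=> [[n _ Fnx] [k _ Gky]]; exists (maxn n k) => //; split.
- by move: x Fnx; exact/subsetPset/ndF/leq_maxl.
- by move: y Gky; exact/subsetPset/ndG/leq_maxr.
Qed.

(* The library only registers the sigma-finiteness of products of subprobabilities. *)
Definition sfprod : {sigma_finite_measure set (T1 * T2)%type -> \bar R} :=
  HB.pack (m1 \x m2)%E (Measure_isSigmaFinite.Build _ _ _ (m1 \x m2)%E product_sigma_finite).

Lemma measurable_integral2 (f : T1 -> T2 -> \bar R) :
  measurable_fun setT (fun z : T1 * T2 => f z.1 z.2) -> (forall x y, 0 <= f x y)%E ->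
  measurable_fun setT (fun x => \int[m2]_y f x y)%E.
Proof.
move=> mf f0.
by apply: (@measurable_fun_fubini_tonelli_F _ _ _ _ R m2 (fun z => f z.1 z.2)).
Qed.

Lemma tonelli_swap (f : T1 -> T2 -> \bar R) :
  measurable_fun setT (fun z : T1 * T2 => f z.1 z.2) -> (forall x y, 0 <= f x y)%E ->
  (\int[m1]_x \int[m2]_y f x y = \int[m2]_y \int[m1]_x f x y)%E.
Proof.
move=> mf f0.
exact: (@fubini_tonelli _ _ _ _ R m1 m2 (fun z => f z.1 z.2) mf (fun z => f0 _ _)).
Qed.

Lemma tonelli1 (f : T1 -> T2 -> \bar R) :
  measurable_fun setT (fun z : T1 * T2 => f z.1 z.2) -> (forall x y, 0 <= f x y)%E ->
  (\int[sfprod]_z f z.1 z.2 = \int[m1]_x \int[m2]_y f x y)%E.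
Proof.
move=> mf f0.
exact: (@fubini_tonelli1 _ _ _ _ R m1 m2 (fun z => f z.1 z.2) mf (fun z => f0 _ _)).
Qed.

Lemma tonelli2 (f : T1 -> T2 -> \bar R) :
  measurable_fun setT (fun z : T1 * T2 => f z.1 z.2) -> (forall x y, 0 <= f x y)%E ->
  (\int[sfprod]_z f z.1 z.2 = \int[m2]_y \int[m1]_x f x y)%E.
Proof.
move=> mf f0.
exact: (@fubini_tonelli2 _ _ _ _ R m1 m2 (fun z => f z.1 z.2) mf (fun z => f0 _ _)).
Qed.

Lemma le_integralT (f g : T1 -> \bar R) : measurable_fun setT f -> measurable_fun setT g ->
  (forall x, 0 <= f x)%E -> (forall x, f x <= g x)%E -> (\int[m1]_x f x <= \int[m1]_x g x)%E.
Proof. by move=> mf mg f0 fg; apply: ge0_le_integral. Qed.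

End Tonelli.

Lemma ge0_integralZlT d (T : measurableType d) (R : realType) (nu : {measure set T -> \bar R})
  (c : R) (f : T -> \bar R) : 0 <= c -> measurable_fun setT f -> (forall x, 0 <= f x)%E ->
  (\int[nu]_x (c%:E * f x) = c%:E * \int[nu]_x f x)%E.
Proof. by move=> c0 mf f0; rewrite ge0_integralZl// lee_fin. Qed.

Lemma ge0_integralZrT d (T : measurableType d) (R : realType) (nu : {measure set T -> \bar R})
  (c : R) (f : T -> \bar R) : 0 <= c -> measurable_fun setT f -> (forall x, 0 <= f x)%E ->
  (\int[nu]_x (f x * c%:E) = (\int[nu]_x f x) * c%:E)%E.
Proof. by move=> c0 mf f0; rewrite ge0_integralZr// lee_fin. Qed.

Lemma eq_lee (R : realType) (a b c : \bar R) : a = b -> (b <= c)%E -> (a <= c)%E.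
Proof. by move=> ->. Qed.

Tactic Notation "mintc" constr(H) := repeat (apply: measurable_integral2; last by
   (intros; repeat (apply: integral_ge0; intros); rewrite ?lee_fin; apply: H)); rewrite /=.

Ltac mint := repeat (apply: measurable_integral2; last by
   (intros; repeat (apply: integral_ge0; intros); rewrite ?lee_fin; pos)); rewrite /=.

(** * Mass of the convolution in the variables [y], then in the variables [u] *)

Section Kernel.
Variable R : realType.
Notation mu := (@lebesgue_measure R).
Variable d : R.
Hypothesis d0 : 0 < d.
Notation P := (pois d).
Let P0 x : 0 <= P x. Proof. exact: pois_ge0. Qed.
Let cP : continuous P. Proof. exact: pois_continuous. Qed.
Let mP : measurable_fun setT P. Proof. exact: measurable_pois. Qed.

Lemma integral_pois_refl z : (\int[mu]_s (P (z - s))%:E = (2 * pi)%:E)%E.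
Proof.
rewrite -(integral_pois d0) -[RHS](integralT_addr z); last exact/measurable_EFinP.
rewrite -[LHS]integralT_opp; last by apply/measurable_EFinP; meas.
by apply: eq_integral => s _; rewrite opprK addrC.
Qed.

(** A shear and two dilations make the quadratic form the sum of two squares, at the price of the
    Jacobian [sqrt (al * be)]. The radial integral then gives [pi] times the mass [2 pi] of the
    kernel. The centre [c2] may depend on [x] because [y] is integrated first. *)
Lemma integral_quadratic z (al be : R) (c1 : R) (c2 : R -> R) : 0 < al -> 0 < be ->
  measurable_fun setT c2 ->
  (\int[mu]_x \int[mu]_y (P (z - (x - c1) ^+ 2 / al - (y - c2 x) ^+ 2 / be))%:E
   <= (Num.sqrt (al * be) * (2 * pi ^+ 2))%:E)%E.
Proof.
move=> al0 be0 mc2.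
have sal : 0 < Num.sqrt al by rewrite sqrtr_gt0.
have sbe : 0 < Num.sqrt be by rewrite sqrtr_gt0.
have step x : (\int[mu]_y (P (z - (x - c1) ^+ 2 / al - (y - c2 x) ^+ 2 / be))%:E =
  (Num.sqrt be)%:E * \int[mu]_y (P (z - (x - c1) ^+ 2 / al - y ^+ 2))%:E)%E.
  rewrite -(integralT_addr (c2 x)); last by apply/measurable_EFinP; meas.
  rewrite (ge0_integralT_mull sbe)//; last 2 first.
  - by apply/measurable_EFinP; meas.
  - by move=> y; rewrite lee_fin.
  congr (_ * _)%E; apply: eq_integral => y _; rewrite addrK.
  by rewrite exprMn sqr_sqrtr ?(ltW be0)// (mulrC be) mulfK ?gt_eqF.
under eq_integral do rewrite step.
rewrite ge0_integralZlT; [|exact: ltW|by mint; meas|by move=> x; apply: integral_ge0 => y _; rewrite lee_fin].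
rewrite -(integralT_addr c1); last by mint; meas.
rewrite (ge0_integralT_mull sal); last 2 first.
- by mint; meas.
- by move=> x; apply: integral_ge0 => y _; rewrite lee_fin.
rewrite muleA -EFinM sqrtrM ?(ltW al0)// [X in (_ <= X)%E]EFinM (mulrC (Num.sqrt be)) lee_pmul2l// ?lte_fin ?mulr_gt0//.
have := @integral_radial R (fun s => P (z - s)) _ _.
rewrite integral_pois_refl -EFinM => H.
rewrite (_ : 2 * pi ^+ 2 = pi * (2 * pi)); last by ring.
apply: le_trans (H _ _); [|by move=> s; cont|by move=> s; exact: P0].
apply: eq_lee (lexx _).
apply: eq_integral => x _; apply: eq_integral => y _; congr (P _)%:E.
by rewrite addrK exprMn sqr_sqrtr ?(ltW al0)// (mulrC al) mulfK ?gt_eqF// (addrC (y ^+ 2)) opprD addrA.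
Qed.

(** With [S = y1 + y2 + y3] in place of [y3], completing squares in [y1] and [y2] leaves
    [S^2 / (u1 + u2 + u3)] plus a definite form of determinant [1 / (al * be)]. This gives [2 pi^2]
    and the square root; the remaining kernel in [S] gives [2 pi]. *)
Lemma integral_y_bound U' Z' (u1 u2 u3 : R) : 0 < u1 -> 0 < u2 -> 0 < u3 ->
  (\int[mu]_y1 \int[mu]_y2 \int[mu]_y3
     (P (U' - (y1 + y2 + y3)) * P (Z' - (y1 ^+ 2 / u1 + y2 ^+ 2 / u2 + y3 ^+ 2 / u3)))%:E
   <= (Num.sqrt (u1 * u2 * u3 / (u1 + u2 + u3)) * (4 * pi ^+ 3))%:E)%E.
Proof.
move=> u10 u20 u30.
pose q (y1 y2 S : R) := y1 ^+ 2 / u1 + y2 ^+ 2 / u2 + (S - y1 - y2) ^+ 2 / u3.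
apply: (@eq_lee _ _ (\int[mu]_y1 \int[mu]_y2 \int[mu]_S (P (U' - S) * P (Z' - q y1 y2 S))%:E)%E).
  apply: eq_integral => y1 _; apply: eq_integral => y2 _.
  rewrite -(integralT_addr (- y1 - y2)); last by meas.
  apply: eq_integral => S _; congr (P _ * P _)%:E; rewrite /q; [ring|].
  by rewrite addrA.
have PP0 x y : (0 <= (P x * P y)%:E)%E by rewrite lee_fin mulr_ge0.
rewrite (eq_integral (fun y1 : measurableTypeR R => \int[mu]_S \int[mu]_y2 (P (U' - S) * P (Z' - q y1 y2 S))%:E)%E); last first.
  by move=> y1 _; rewrite tonelli_swap// /q; meas.
rewrite tonelli_swap; last 2 first.
- by rewrite /q; mint; meas.
- by move=> x y; apply: integral_ge0.
(* The denominators found by completing the square first in [y2] and then in [y1]; their product is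
   [u1 u2 u3 / (u1 + u2 + u3)]. *)
pose al := u1 * (u2 + u3) / (u1 + u2 + u3).
pose be := u2 * u3 / (u2 + u3).
have al0 : 0 < al by rewrite /al divr_gt0 ?mulr_gt0 ?addr_gt0.
have be0 : 0 < be by rewrite /be divr_gt0 ?mulr_gt0 ?addr_gt0.
have nz : [/\ u1 != 0, u2 != 0, u3 != 0, u2 + u3 != 0 & u1 + u2 + u3 != 0].
  by rewrite !gt_eqF ?addr_gt0.
case: nz => n1 n2 n3 n4 n5.
apply: (@le_trans _ _ (\int[mu]_S ((P (U' - S))%:E * (Num.sqrt (u1 * u2 * u3 / (u1 + u2 + u3)) * (2 * pi ^+ 2))%:E))%E).
  apply: le_integralT.
  - by rewrite /q; mint; meas.
  - by meas.
  - by move=> S; apply: integral_ge0 => y1 _; apply: integral_ge0.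
  move=> S.
  rewrite (_ : u1 * u2 * u3 / (u1 + u2 + u3) = al * be); last first.
    by rewrite /al /be; field; rewrite n4 n5.
  apply: (@eq_lee _ _ ((P (U' - S))%:E * \int[mu]_y1 \int[mu]_y2 (P (Z' - q y1 y2 S))%:E)%E).
    rewrite -ge0_integralZlT; [|exact: P0|by rewrite /q; mint; meas|
      by move=> y1; apply: integral_ge0 => y2 _; rewrite lee_fin].
    apply: eq_integral => y1 _; rewrite -ge0_integralZlT; [|exact: P0|by rewrite /q; meas|
      by move=> y2; rewrite lee_fin].
    by apply: eq_integral => y2 _.
  rewrite lee_wpmul2l ?lee_fin//.
  have mc : measurable_fun setT (fun y1 : R => u2 * (S - y1) / (u2 + u3)) by meas.
  have := @integral_quadratic (Z' - S ^+ 2 / (u1 + u2 + u3)) al be (u1 * S / (u1 + u2 + u3)) _ al0 be0 mc.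
  apply: eq_lee.
  apply: eq_integral => y1 _; apply: eq_integral => y2 _; congr (P _)%:E.
  rewrite /q /al /be; move: (y1 : R) (y2 : R) => z1 z2; field.
  by rewrite n1 n2 n3 n4 n5.
rewrite ge0_integralZrT; [|by pos|by meas|by move=> S; rewrite lee_fin].
rewrite integral_pois_refl -EFinM lee_fin le_eqVlt; apply/orP; left; apply/eqP; ring.
Unshelve. all: by [].
Qed.

(** It vanishes for [u <= 0], so [isqrt u ^+ 2] is [1 / u] cut to the half line and integrals in the
    light coordinate can run over all of the line. *)
Definition isqrt (u : R) : R := (Num.sqrt u)^-1.

Lemma isqrt_ge0 u : 0 <= isqrt u. Proof. by rewrite invr_ge0 sqrtr_ge0. Qed.
Lemma isqrt0 u : u <= 0 -> isqrt u = 0. Proof. exact: sqrt_le0_inv. Qed.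
Lemma measurable_isqrt : measurable_fun setT isqrt. Proof. by rewrite /isqrt; meas. Qed.
Let misq := measurable_isqrt.
Let isq0 := isqrt_ge0.

(** The Beta integral with both parameters 1/2, which does not depend on [A]. *)
Lemma integral_isqrt_conv A : (\int[mu]_u (isqrt u * isqrt (A - u))%:E <= (if 0 < A then pi else 0)%:E)%E.
Proof.
case: ifPn => [A0|]; last first.
  rewrite -leNgt => A0; rewrite integral0_eq// => u _.
  have [u0|u0] := ltP (u : R) 0; first by rewrite isqrt0 ?mul0r// ltW.
  by rewrite mulrC isqrt0 ?mul0r// subr_le0 (le_trans A0).
rewrite -(integralT_arcsine A0); apply: le_integralT.
- by apply/measurable_EFinP; meas.
- by apply/measurable_EFinP; meas.
- by move=> u; rewrite lee_fin mulr_ge0 ?isqrt_ge0.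
move=> u; rewrite lee_fin; have [u0|u0] := leP 0 (u : R).
  by rewrite /isqrt sqrtrM// invfM.
by rewrite isqrt0 ?mul0r ?invr_ge0 ?sqrtr_ge0// ltW.
Qed.

(** With [S = u1 + u2 + u3] as a variable, the integrals in [u2] and in [u1] become two arcsine
    convolutions worth [pi] each, uniformly in [S]; the kernel in [S] contributes [2 pi]. *)
Lemma integral_u_bound U' :
  (\int[mu]_u1 \int[mu]_u2 \int[mu]_u3
    (P (U' - (u1 + u2 + u3)) * (isqrt u1 * isqrt u2 * isqrt u3 * isqrt (u1 + u2 + u3)))%:E
   <= (2 * pi ^+ 3)%:E)%E.
Proof.
pose f (u1 u2 S : R) := P (U' - S) * (isqrt u1 * isqrt u2 * isqrt (S - u1 - u2) * isqrt S).
have f0 u1 u2 S : (0 <= (f u1 u2 S)%:E)%E.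
  by rewrite /f lee_fin; pos; exact: isqrt_ge0.
apply: (@eq_lee _ _ (\int[mu]_u1 \int[mu]_u2 \int[mu]_S (f u1 u2 S)%:E)%E).
  apply: eq_integral => u1 _; apply: eq_integral => u2 _.
  rewrite -(integralT_addr (- u1 - u2)); last by apply/measurable_EFinP; meas.
  apply: eq_integral => S _; rewrite /f.
  have -> : u1 + u2 + (S + (- u1 - u2)) = S :> R by move: (u1 : R) (u2 : R) (S : R) => a b c; ring.
  by rewrite addrA.
rewrite (eq_integral (fun u1 : measurableTypeR R => \int[mu]_S \int[mu]_u2 (f u1 u2 S)%:E)%E); last first.
  by move=> u1 _; rewrite tonelli_swap// /f; meas.
rewrite tonelli_swap; last 2 first.
- by rewrite /f; mint; meas.
- by move=> x y; apply: integral_ge0.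
apply: (@le_trans _ _ (\int[mu]_S ((P (U' - S))%:E * (pi ^+ 2)%:E))%E); last first.
  rewrite ge0_integralZrT; [|by pos|by meas|by move=> S; rewrite lee_fin].
  by rewrite integral_pois_refl -EFinM lee_fin le_eqVlt; apply/orP; left; apply/eqP; ring.
apply: le_integralT.
- by rewrite /f; mint; meas.
- by meas.
- by move=> S; apply: integral_ge0 => u1 _; apply: integral_ge0.
move=> S.
apply: (@le_trans _ _ (\int[mu]_u1 ((P (U' - S) * pi * Num.sqrt S * isqrt S)%:E * (isqrt u1 * isqrt (S - u1))%:E))%E).
  apply: le_integralT.
  - by rewrite /f; mint; meas.
  - by meas.
  - by move=> u1; apply: integral_ge0.
  move=> u1.
  rewrite (eq_integral (fun u2 : measurableTypeR R => (P (U' - S) * isqrt u1 * isqrt S)%:E *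
      (isqrt u2 * isqrt (S - u1 - u2))%:E)%E); last first.
    by move=> u2 _; rewrite -EFinM /f; congr EFin; ring.
  rewrite ge0_integralZlT; [|by pos|by meas|by move=> u2; rewrite lee_fin; pos].
  apply: le_trans (lee_wpmul2l _ (integral_isqrt_conv _)) _.
    by rewrite lee_fin; pos; exact: isqrt_ge0.
  rewrite -!EFinM lee_fin; case: ifPn => [Su|_]; last first.
    by rewrite mulr0; pos.
  have [u0|u0] := leP (u1 : R) 0.
    by rewrite (isqrt0 u0) mulr0 !mul0r mulr0.
  (* The integral in [u2] has used up the dependence on [S - u1]. The factor
     [sqrt S * isqrt (S - u1)], at least 1 for [0 < u1 < S], creates a second arcsine convolution,
     and its [sqrt S] will cancel [isqrt S]. *)
  have Su' : 1 <= Num.sqrt S * isqrt (S - u1).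
    by rewrite /isqrt ler_pdivlMr ?sqrtr_gt0// mul1r ler_sqrt ?gerBl ?(ltW u0)//; lra.
  rewrite [leLHS](_ : _ = P (U' - S) * isqrt u1 * isqrt S * pi * 1); last by ring.
  rewrite [leRHS](_ : _ = P (U' - S) * isqrt u1 * isqrt S * pi * (Num.sqrt S * isqrt (S - u1))); last by ring.
  by rewrite ler_wpM2l//; pos.
rewrite ge0_integralZlT; [|by pos|by meas|by move=> u2; rewrite lee_fin; pos].
apply: le_trans (lee_wpmul2l _ (integral_isqrt_conv _)) _.
  by rewrite lee_fin; pos; exact: isqrt_ge0.
rewrite -!EFinM lee_fin; case: ifPn => [S0|_]; last first.
  by rewrite mulr0; pos.
rewrite /isqrt -(mulrA _ (Num.sqrt S)) divff ?gt_eqF ?sqrtr_gt0//.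
by rewrite le_eqVlt; apply/orP; left; apply/eqP; ring.
Qed.

End Kernel.

(** * Light coordinates on the cone *)

Section LightCone.
Variable R : realType.
Notation mu := (@lebesgue_measure R).
Notation mR := (measurableTypeR R).
Notation L2 := (sfprod mu mu).
Let misq := @measurable_isqrt R.
Let isq0 := @isqrt_ge0 R.

Definition rad (z : R * R) : R := Num.sqrt (z.1 ^+ 2 + z.2 ^+ 2).

Lemma measurable_rad : measurable_fun (setT : set (mR * mR)) rad.
Proof. by rewrite /rad; meas. Qed.

Lemma isqrt_sq (u : R) : 0 < u -> isqrt u ^+ 2 = u^-1.
Proof. by move=> u0; rewrite /isqrt exprVn sqr_sqrtr// ltW. Qed.

(** For fixed [y] other than 0, [u = |(x, y)| + x] maps the line onto the positive half line, and
    [dx / |(x, y)|] becomes [du / u]. *)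
Lemma integral_conic_coord (y : R) : y != 0 ->
  forall g : R -> \bar R, measurable_fun setT g -> (forall x, (0 <= g x)%E) ->
  (\int[mu]_x (g (rad (x, y) + x)%R * ((rad (x, y))^-1)%:E) =
   \int[mu]_u (g u * (isqrt u ^+ 2)%:E))%E.
Proof.
move=> y0 g mg g0.
have y2 : 0 < y ^+ 2 by rewrite exprn_even_gt0.
(* [X] inverts [u = |(x, y)| + x], and [k] is its derivative [(1 + y^2 / u^2) / 2] for [u > 0],
   written with [isqrt] so as to vanish for [u <= 0]. *)
pose X u := (u - y ^+ 2 / u) / 2.
pose k u := isqrt u ^+ 2 * (u + y ^+ 2 * isqrt u ^+ 2) / 2.
have k0 u : 0 <= k u.
  have [u0|u0] := leP u 0; first by rewrite /k isqrt0// expr0n/= !mul0r.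
  by rewrite /k; pos.
have mX : measurable_fun setT X by rewrite /X; meas.
have mk : measurable_fun setT k by rewrite /k; meas.
have kE u : 0 < u -> k u = (1 + y ^+ 2 / u ^+ 2) / 2.
  by move=> u0; rewrite /k isqrt_sq//; field; rewrite gt_eqF.
have rE u : 0 < u -> rad (X u, y) = (u + y ^+ 2 / u) / 2.
  move=> u0; rewrite /rad/= (_ : X u ^+ 2 + y ^+ 2 = ((u + y ^+ 2 / u) / 2) ^+ 2).
    by rewrite sqrtr_sqr ger0_norm//; pos.
  by rewrite /X; field; rewrite gt_eqF.
have mr : measurable_fun setT (fun x : mR => rad (x, y)).
  by rewrite /rad; meas.
rewrite (@ge0_integral_density R X k mX mk k0); first last.
- by move=> x; rewrite mule_ge0// lee_fin invr_ge0 sqrtr_ge0.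
- by meas.
- move=> a b ab.
  pose e c := c + Num.sqrt (c ^+ 2 + y ^+ 2).
  have ce c : `|c| < Num.sqrt (c ^+ 2 + y ^+ 2).
    by rewrite -(sqrtr_sqr c) ltr_sqrt ?ltrDl//; apply: ltr_wpDl; rewrite ?sqr_ge0.
  have e0 c : 0 < e c.
    by rewrite /e; have := ce c; rewrite ltr_norml => /andP[]; lra.
  (* The point [e c] is the positive root in [u] of [X u = c]. This factorisation, whose other
     factor is positive, shows that [X u > c] exactly when [u > e c]. *)
  have Xe c u : 0 < u -> X u - c = (u - e c) * (u - c + Num.sqrt (c ^+ 2 + y ^+ 2)) / (2 * u).
    move=> u0; rewrite /X /e.
    have := @sqr_sqrtr R (c ^+ 2 + y ^+ 2) (addr_ge0 (sqr_ge0 _) (sqr_ge0 _)).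
    set s := Num.sqrt _ => sE.
    rewrite (_ : (u - (c + s)) * (u - c + s) = (u - c) ^+ 2 - s ^+ 2); last by ring.
    by rewrite sE; field; rewrite gt_eqF.
  have pf c u : 0 < u -> 0 < (u - c + Num.sqrt (c ^+ 2 + y ^+ 2)) / (2 * u).
    move=> u0; rewrite divr_gt0 ?mulr_gt0//.
    by have := ce c; rewrite ltr_norml => /andP[]; lra.
  have ltX c u : 0 < u -> (c < X u) = (e c < u).
    by move=> u0; rewrite -subr_gt0 Xe// -mulrA pmulr_lgt0 ?pf// subr_gt0.
  have XeE c : X (e c) = c.
    by apply/eqP; rewrite -subr_eq0 Xe// subrr !mul0r.
  have eab : e a < e b by rewrite -ltX// XeE.
  transitivity (\int[mu]_(u in `](e a), (e b)]) ((1 + y ^+ 2 / u ^+ 2) / 2)%:E)%E.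
    rewrite [RHS]integral_mkcond; apply: eq_integral => u _; rewrite patchE indicE.
    have [u0|u0] := leP (u : R) 0.
      rewrite /k isqrt0// expr0n/= !mul0r mule0 memNset// /= in_itv/= => /andP[H _].
      by have := lt_trans (e0 a) H; rewrite ltNge u0.
    rewrite kE//.
    have -> : (X u \in (`]a, b]%classic : set R)) = (u \in (`](e a), (e b)]%classic : set R)).
      apply/idP/idP => /set_mem/= H; apply/mem_set; move: H; rewrite /= !in_itv/=;
      by rewrite ltX// !leNgt ltX.
    by case: ifPn => _; rewrite ?mul1e ?mul0e.
  rewrite integral_itv_obnd_cbnd; last first.
    by apply: measurable_funTS; apply/measurable_EFinP; meas.
  have dX (u : R) : 0 < u -> is_derive u 1 X ((1 + y ^+ 2 / u ^+ 2) / 2).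
    move=> u0; apply: der1_eq; first by rewrite /X; der; rewrite gt_eqF.
    by rewrite /=; field; rewrite gt_eqF.
  rewrite (@continuous_FTC2 R _ X _ _ eab); first by rewrite !XeE.
  + apply: continuous_in_subspaceT => u; rewrite inE/= in_itv/= => /andP[u0 _].
    by cont; rewrite gt_eqF// exprn_gt0// (lt_le_trans (e0 a)).
  + split.
    * move=> u; rewrite in_itv/= => /andP[u0 _].
      by have [] := dX u (lt_trans (e0 a) u0).
    * by apply: cvg_at_right_filter; exact: (der_continuous (dX _ (e0 a))).
    * by apply: cvg_at_left_filter; exact: (der_continuous (dX _ (e0 b))).
  + move=> u; rewrite in_itv/= => /andP[u0 _]; rewrite derive1E.
    by have H := dX u (lt_trans (e0 a) u0); rewrite derive_val.
apply: eq_integral => u _.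
have [u0|u0] := leP (u : R) 0; first by rewrite /k isqrt0// expr0n/= !mul0r !mule0.
rewrite -muleA -EFinM rE// kE// isqrt_sq//.
have -> : (u + y ^+ 2 / u) / 2 + X u = u.
  by rewrite /X; move: (u : R) u0 => v v0; field; rewrite gt_eqF.
congr (_ * _%:E)%E; move: (u : R) u0 => v v0; field.
by rewrite (gt_eqF v0)/= gt_eqF// addr_gt0// mulr_gt0.
Qed.

(** The one-dimensional formula holds on every horizontal line except [y = 0], where the coordinate
    degenerates; that line is removed from both sides as a null set. *)
Lemma integral_cone_coord (g : R * R -> \bar R) :
  measurable_fun (setT : set (mR * mR)) g -> (forall x, (0 <= g x)%E) ->
  (\int[L2]_z (g (rad z + z.1, z.2)%R * ((rad z)^-1)%:E) =
   \int[L2]_z (g z * (isqrt z.1 ^+ 2)%:E))%E.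
Proof.
move=> mg g0; have mr := measurable_rad.
have G1 : measurable_fun setT (fun z : mR * mR => g (rad z + z.1, z.2)%R * ((rad z)^-1)%:E)%E.
  apply: emeasurable_funM; last by meas.
  by apply: (measurableT_comp mg); meas.
have G2 : measurable_fun setT (fun z : mR * mR => g z * (isqrt z.1 ^+ 2)%:E)%E.
  by apply: emeasurable_funM => //; meas.
rewrite [LHS](@fubini_tonelli2 _ _ _ _ R mu mu _ G1); last first.
  by move=> z; rewrite mule_ge0// lee_fin invr_ge0 sqrtr_ge0.
rewrite [RHS](@fubini_tonelli2 _ _ _ _ R mu mu _ G2); last first.
  by move=> z; rewrite mule_ge0// lee_fin sqr_ge0.
rewrite -[LHS](integral_setD1 (r := 0)); last 2 first.
- exact: measurableD.
- apply: measurable_funTS; apply: measurable_fun_fubini_tonelli_G => //.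
  by move=> z; rewrite mule_ge0// lee_fin invr_ge0 sqrtr_ge0.
rewrite -[RHS](integral_setD1 (r := 0)); last 2 first.
- exact: measurableD.
- apply: measurable_funTS; apply: measurable_fun_fubini_tonelli_G => //.
  by move=> z; rewrite mule_ge0// lee_fin sqr_ge0.
apply: eq_integral => y; rewrite inE/= => -[_ /eqP y0].
rewrite /fubini_G/= (@integral_conic_coord y y0 (fun u => g (u, y)))//.
by apply: (measurableT_comp mg); meas.
Qed.

Variable d : R.
Hypothesis d0 : 0 < d.
Notation P := (pois d).
Let P0 x : 0 <= P x. Proof. exact: pois_ge0. Qed.
Let mP : measurable_fun setT P. Proof. exact: measurable_pois. Qed.

(** For fixed [u1], [u2], [u3] the integral in the [y] variables produces
    [sqrt (u1 u2 u3 / (u1 + u2 + u3))], which turns each weight [1 / u] into [isqrt u] and leaves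
    exactly the integrand of the [u] bound. The constant is [4 pi^3] times [2 pi^3]. *)
Lemma integral_light_cone_bound (U Y Z : R) :
  (\int[L2]_z1 \int[L2]_z2 \int[L2]_z3
    (P (U - (z1.1 + z2.1 + z3.1)) * P (Y - (z1.2 + z2.2 + z3.2)) *
     P (Z - (z1.2 ^+ 2 / z1.1 + z2.2 ^+ 2 / z2.1 + z3.2 ^+ 2 / z3.1)) *
     (isqrt z1.1 ^+ 2 * isqrt z2.1 ^+ 2 * isqrt z3.1 ^+ 2))%:E <= (8 * pi ^+ 6)%:E)%E.
Proof.
pose f (u1 y1 u2 y2 u3 y3 : R) := P (U - (u1 + u2 + u3)) * P (Y - (y1 + y2 + y3)) *
     P (Z - (y1 ^+ 2 / u1 + y2 ^+ 2 / u2 + y3 ^+ 2 / u3)) *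
     (isqrt u1 ^+ 2 * isqrt u2 ^+ 2 * isqrt u3 ^+ 2).
have f0 u1 y1 u2 y2 u3 y3 : 0 <= f u1 y1 u2 y2 u3 y3 by rewrite /f; pos.
have mf d' (T : measurableType d') (a1 b1 a2 b2 a3 b3 : T -> mR) :
    measurable_fun setT a1 -> measurable_fun setT b1 -> measurable_fun setT a2 -> measurable_fun setT b2 ->
    measurable_fun setT a3 -> measurable_fun setT b3 ->
    measurable_fun setT (fun t => (f (a1 t) (b1 t) (a2 t) (b2 t) (a3 t) (b3 t))%:E).
  by move=> *; rewrite /f; meas.
pose h (u1 u2 u3 : R) := P (U - (u1 + u2 + u3)) * (isqrt u1 * isqrt u2 * isqrt u3 * isqrt (u1 + u2 + u3)).
have h0 u1 u2 u3 : 0 <= h u1 u2 u3 by rewrite /h; pos.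
have mh d' (T : measurableType d') (a1 a2 a3 : T -> mR) :
    measurable_fun setT a1 -> measurable_fun setT a2 -> measurable_fun setT a3 ->
    measurable_fun setT (fun t => (h (a1 t) (a2 t) (a3 t))%:E).
  by move=> *; rewrite /h; meas.
apply: (@eq_lee _ _ (\int[mu]_u1 \int[mu]_y1 \int[mu]_u2 \int[mu]_y2 \int[mu]_u3 \int[mu]_y3
    (f u1 y1 u2 y2 u3 y3)%:E)%E).
  rewrite (@tonelli1 _ _ _ _ R mu mu (fun u1 y1 => \int[L2]_z2 \int[L2]_z3 (f u1 y1 z2.1 z2.2 z3.1 z3.2)%:E)%E); last 2 first.
  - by mintc f0; apply: mf; meas.
  - by move=> u1 y1; apply: integral_ge0 => z2 _; apply: integral_ge0 => z3 _; rewrite lee_fin.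
  apply: eq_integral => u1 _; apply: eq_integral => y1 _.
  rewrite (@tonelli1 _ _ _ _ R mu mu (fun u2 y2 => \int[L2]_z3 (f u1 y1 u2 y2 z3.1 z3.2)%:E)%E); last 2 first.
  - by mintc f0; apply: mf; meas.
  - by move=> u2 y2; apply: integral_ge0 => z3 _; rewrite lee_fin.
  apply: eq_integral => u2 _; apply: eq_integral => y2 _.
  rewrite (@tonelli1 _ _ _ _ R mu mu (fun u3 y3 => (f u1 y1 u2 y2 u3 y3)%:E)%E).
  - by [].
  - by apply: mf; meas.
  - by move=> u3 y3; rewrite lee_fin.
apply: (@eq_lee _ _ (\int[mu]_u1 \int[mu]_u2 \int[mu]_u3 \int[mu]_y1 \int[mu]_y2 \int[mu]_y3
    (f u1 y1 u2 y2 u3 y3)%:E)%E).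
  apply: eq_integral => u1 _.
  transitivity (\int[mu]_y1 \int[mu]_u2 \int[mu]_u3 \int[mu]_y2 \int[mu]_y3 (f u1 y1 u2 y2 u3 y3)%:E)%E.
    apply: eq_integral => y1 _; apply: eq_integral => u2 _.
    apply: (@tonelli_swap _ _ _ _ R mu mu (fun y2 u3 => \int[mu]_y3 (f u1 y1 u2 y2 u3 y3)%:E)%E).
    - by mintc f0; apply: mf; meas.
    - by move=> x y; apply: integral_ge0 => z3 _; rewrite lee_fin.
  apply: etrans; first apply: (@tonelli_swap _ _ _ _ R mu mu (fun y1 u2 => \int[mu]_u3 \int[mu]_y2 \int[mu]_y3 (f u1 y1 u2 y2 u3 y3)%:E)%E).
  - by mintc f0; apply: mf; meas.
  - by move=> x y; do 3!(apply: integral_ge0 => ? _); rewrite lee_fin.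
  apply: eq_integral => u2 _.
  apply: (@tonelli_swap _ _ _ _ R mu mu (fun y1 u3 => \int[mu]_y2 \int[mu]_y3 (f u1 y1 u2 y2 u3 y3)%:E)%E).
  - by mintc f0; apply: mf; meas.
  - by move=> x y; do 2!(apply: integral_ge0 => ? _); rewrite lee_fin.
pose c4 : R := 4 * pi ^+ 3.
have c40 : 0 <= c4 by rewrite /c4; pos.
have ch0 u1 u2 u3 : 0 <= c4 * h u1 u2 u3 by rewrite mulr_ge0.
have mch d' (T : measurableType d') (a1 a2 a3 : T -> mR) :
    measurable_fun setT a1 -> measurable_fun setT a2 -> measurable_fun setT a3 ->
    measurable_fun setT (fun t => (c4 * h (a1 t) (a2 t) (a3 t))%:E).
  by move=> *; rewrite /h; meas.
apply: (@le_trans _ _ (\int[mu]_u1 \int[mu]_u2 \int[mu]_u3 (c4 * h u1 u2 u3)%:E)%E); last first.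
  apply: (@eq_lee _ _ (c4%:E * \int[mu]_u1 \int[mu]_u2 \int[mu]_u3 (h u1 u2 u3)%:E)%E).
    rewrite -ge0_integralZlT; [|by []|by mintc h0; apply: mh; meas|].
      apply: eq_integral => u1 _; rewrite -ge0_integralZlT; [|by []|by mintc h0; apply: mh; meas|].
        apply: eq_integral => u2 _; rewrite -ge0_integralZlT; [by []|by []|by apply: mh; meas|].
        by move=> u3; rewrite lee_fin.
      by move=> u3; apply: integral_ge0 => ? _; rewrite lee_fin.
    by move=> u3; do 2!(apply: integral_ge0 => ? _); rewrite lee_fin.
  apply: le_trans (lee_wpmul2l _ (integral_u_bound d0 U)) _; first by rewrite lee_fin; pos.
  by rewrite -EFinM lee_fin le_eqVlt; apply/orP; left; apply/eqP; rewrite /c4; ring.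
apply: le_integralT; [by mintc f0; apply: mf; meas|by mintc ch0; apply: mch; meas|by move=> u1; do 5!(apply: integral_ge0 => ? _); rewrite lee_fin|] => u1.
apply: le_integralT; [by mintc f0; apply: mf; meas|by mintc ch0; apply: mch; meas|by move=> u2; do 4!(apply: integral_ge0 => ? _); rewrite lee_fin|] => u2.
apply: le_integralT; [by mintc f0; apply: mf; meas|by apply: mch; meas|by move=> u3; do 3!(apply: integral_ge0 => ? _); rewrite lee_fin|] => u3.
pose c : R := P (U - (u1 + u2 + u3)) * (isqrt u1 ^+ 2 * isqrt u2 ^+ 2 * isqrt u3 ^+ 2).
have c0 : 0 <= c by rewrite /c; pos.
apply: (@eq_lee _ _ (c%:E * \int[mu]_y1 \int[mu]_y2 \int[mu]_y3
     (P (Y - (y1 + y2 + y3)) * P (Z - (y1 ^+ 2 / u1 + y2 ^+ 2 / u2 + y3 ^+ 2 / u3)))%:E)%E).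
  rewrite -ge0_integralZlT; [|by []|by mint; meas|].
    apply: eq_integral => y1 _; rewrite -ge0_integralZlT; [|by []|by mint; meas|].
      apply: eq_integral => y2 _; rewrite -ge0_integralZlT; [|by []|by meas|].
        by apply: eq_integral => y3 _; rewrite -EFinM /f /c; congr EFin; ring.
      by move=> y3; rewrite lee_fin; pos.
    by move=> ?; apply: integral_ge0 => ? _; rewrite lee_fin; pos.
  by move=> ?; do 2!(apply: integral_ge0 => ? _); rewrite lee_fin; pos.
(* Nonpositive light coordinates carry weight zero, while the bound in [y] requires all three to be
   positive. *)
have [u10|u10] := leP (u1 : R) 0.
  by rewrite /c (isqrt0 u10) expr0n/= !(mul0r, mulr0) mul0e lee_fin.
have [u20|u20] := leP (u2 : R) 0.
  by rewrite /c (isqrt0 u20) expr0n/= !(mul0r, mulr0) mul0e lee_fin.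
have [u30|u30] := leP (u3 : R) 0.
  by rewrite /c (isqrt0 u30) expr0n/= !(mul0r, mulr0) mul0e lee_fin.
apply: le_trans (lee_wpmul2l _ (integral_y_bound d0 Y Z u10 u20 u30)) _; first by rewrite lee_fin.
rewrite -!EFinM lee_fin /c /c4 /h.
have s0 : 0 <= u1 + u2 + u3 by pos.
rewrite sqrtrM ?mulr_ge0 ?(ltW u10) ?(ltW u20) ?(ltW u30)// sqrtrM ?mulr_ge0 ?(ltW u10) ?(ltW u20) ?(ltW u30)//.
rewrite sqrtrM ?mulr_ge0 ?(ltW u10)// sqrtrV ?s0// -/(isqrt _).
have E (u : R) : 0 < u -> isqrt u ^+ 2 * Num.sqrt u = isqrt u.
  by move=> u0; rewrite /isqrt expr2 -mulrA mulVf ?mulr1// gt_eqF// sqrtr_gt0.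
rewrite [leLHS](_ : _ = 4 * pi ^+ 3 * (P (U - (u1 + u2 + u3)) *
   (isqrt u1 ^+ 2 * Num.sqrt u1 * (isqrt u2 ^+ 2 * Num.sqrt u2) *
    (isqrt u3 ^+ 2 * Num.sqrt u3) * isqrt (u1 + u2 + u3)))); last by ring.
by rewrite !E.
Qed.

(* Off the axis this is [rad z - z.1]. *)
Definition conc (z : R * R) : R := z.2 ^+ 2 / (rad z + z.1).

(** The light coordinates are introduced one copy at a time, from the innermost integral outwards;
    [G3] and [G2] are the partially transformed integrals, still functions of untransformed
    points. *)
Lemma integral_cone_bound (U Y Z : R) :
  (\int[L2]_z1 \int[L2]_z2 \int[L2]_z3
    (P (U - (rad z1 + z1.1 + (rad z2 + z2.1) + (rad z3 + z3.1))) * P (Y - (z1.2 + z2.2 + z3.2)) *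
     P (Z - (conc z1 + conc z2 + conc z3)) *
     ((rad z1)^-1 * (rad z2)^-1 * (rad z3)^-1))%:E <= (8 * pi ^+ 6)%:E)%E.
Proof.
apply: le_trans (integral_light_cone_bound U Y Z).
have mr := measurable_rad.
pose f (a b c : R * R) := P (U - (a.1 + b.1 + c.1)) * P (Y - (a.2 + b.2 + c.2)) *
  P (Z - (a.2 ^+ 2 / a.1 + b.2 ^+ 2 / b.1 + c.2 ^+ 2 / c.1)).
have f0 a b c : 0 <= f a b c by rewrite /f; pos.
pose T (z : R * R) := (rad z + z.1, z.2).
have mT : measurable_fun (setT : set (mR * mR)) (T : _ -> mR * mR) by rewrite /T; meas.
have radV0 z : 0 <= (rad z)^-1 by rewrite invr_ge0 sqrtr_ge0.
apply: (@eq_lee _ _ (\int[L2]_z1 \int[L2]_z2 \int[L2]_z3 ((f (T z1) (T z2) (T z3))%:E * ((rad z1)^-1 * (rad z2)^-1 * (rad z3)^-1)%:E))%E).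
  apply: eq_integral => z1 _; apply: eq_integral => z2 _; apply: eq_integral => z3 _.
  by rewrite -EFinM.
apply: (@eq_lee _ _ (\int[L2]_z1 \int[L2]_z2 \int[L2]_z3 ((f z1 z2 z3)%:E * (isqrt z1.1 ^+ 2 * isqrt z2.1 ^+ 2 * isqrt z3.1 ^+ 2)%:E))%E); last first.
  apply: eq_lee (lexx _).
  apply: eq_integral => z1 _; apply: eq_integral => z2 _; apply: eq_integral => z3 _.
  by rewrite -EFinM.
pose w (z : R * R) := isqrt z.1 ^+ 2.
have w0 z : 0 <= w z by rewrite /w sqr_ge0.
have mw : measurable_fun (setT : set (mR * mR)) w by rewrite /w; meas.
have mF d' (S : measurableType d') (a b c : S -> (mR * mR)%type) : measurable_fun setT a -> measurable_fun setT b ->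
    measurable_fun setT c -> measurable_fun setT (fun t => f (a t) (b t) (c t)).
  by move=> *; rewrite /f; meas.
have mFw d' (S : measurableType d') (a b c : S -> (mR * mR)%type) : measurable_fun setT a -> measurable_fun setT b ->
    measurable_fun setT c -> measurable_fun setT (fun t => (f (a t) (b t) (c t) * w (c t))%:E).
  by move=> *; apply/measurable_EFinP; apply: measurable_funM; [exact: mF|rewrite /w; meas].
have mf : measurable_fun setT (fun z : ((mR * mR) * (mR * mR)) * (mR * mR) => f z.1.1 z.1.2 z.2).
  by apply: mF; meas.
pose G3 a b := (\int[L2]_z3 (f a b z3 * w z3)%:E)%E.
have F0 a b c : 0 <= f a b c * w c by rewrite mulr_ge0.
have G30 a b : (0 <= G3 a b)%E by apply: integral_ge0 => ? _; rewrite lee_fin.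
have mG3 : measurable_fun setT (fun z : (mR * mR) * (mR * mR) => G3 z.1 z.2).
  by rewrite /G3; mintc F0; apply: mFw; meas.
have mG3' a : measurable_fun (setT : set (mR * mR)) (G3 a).
  by rewrite /G3; mintc F0; apply: mFw; meas.
pose G2 a := (\int[L2]_z2 (G3 a z2 * (w z2)%:E))%E.
have G20 a : (0 <= G2 a)%E by apply: integral_ge0 => ? _; rewrite mule_ge0// lee_fin.
have mG2 : measurable_fun (setT : set (mR * mR)) G2.
  rewrite /G2; apply: measurable_integral2; last by move=> x y; rewrite mule_ge0// lee_fin.
  by apply: emeasurable_funM; [exact: mG3|rewrite /w; meas].
have mTz (h : R * R -> \bar R) : measurable_fun (setT : set (mR * mR)) h ->
    measurable_fun (setT : set (mR * mR)) (fun z => h (T z)).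
  by move=> mh; exact: (measurableT_comp mh mT).
have S3 a b : (\int[L2]_z3 ((f a b (T z3))%:E * ((rad z3)^-1)%:E) = G3 a b)%E.
  rewrite (@integral_cone_coord (fun z => (f a b z)%:E)).
  - by apply: eq_integral => z _; rewrite -EFinM.
  - by apply/measurable_EFinP; apply: mF; meas.
  - by move=> z; rewrite lee_fin.
have S2 a : (\int[L2]_z2 (G3 a (T z2) * ((rad z2)^-1)%:E) = G2 a)%E.
  by rewrite (@integral_cone_coord (G3 a)).
have S1 : (\int[L2]_z1 (G2 (T z1) * ((rad z1)^-1)%:E) = \int[L2]_z1 (G2 z1 * (w z1)%:E))%E.
  by rewrite (@integral_cone_coord G2).
have mfT : measurable_fun setT (fun z : ((mR * mR) * (mR * mR)) * (mR * mR) => f z.1.1 z.1.2 (T z.2)).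
  by apply: mF; meas.
transitivity (\int[L2]_z1 (G2 (T z1) * ((rad z1)^-1)%:E))%E.
  apply: eq_integral => z1 _; rewrite -S2 -ge0_integralZrT; [|by []| |].
  - apply: eq_integral => z2 _; rewrite -S3 -ge0_integralZrT; [|by []| |].
    + rewrite -ge0_integralZrT; [|by []| |].
      * by apply: eq_integral => z3 _; rewrite -!EFinM; congr EFin; ring.
      * by rewrite /f /T; meas.
      * by move=> z; rewrite -?EFinM lee_fin; pos; apply: f0.
    + by rewrite /f /T; meas.
    + by move=> z; rewrite -?EFinM lee_fin; pos; apply: f0.
  - by apply: emeasurable_funM; [exact: (mTz (G3 (T z1)))|meas].
  - by move=> z2; rewrite mule_ge0// lee_fin.
rewrite S1; apply: eq_integral => z1 _; rewrite /G2 -ge0_integralZrT; [|by []| |].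
- apply: eq_integral => z2 _; rewrite /G3 -ge0_integralZrT; [|by []| |].
  + rewrite -ge0_integralZrT; [|by []| |].
    * by apply: eq_integral => z3 _; rewrite -!EFinM; congr EFin; rewrite /w; ring.
    * by rewrite /f /w; meas.
    * by move=> z; rewrite -?EFinM lee_fin; pos; apply: f0.
  + by rewrite /f /w; meas.
  + by move=> z; rewrite lee_fin.
- by apply: emeasurable_funM; [exact: mG3'|rewrite /w; meas].
- by move=> z2; rewrite mule_ge0// lee_fin.
Qed.

End LightCone.

(** * The T T^* argument *)

Section ProductIntegrals.
Context d1 d2 (T1 : measurableType d1) (T2 : measurableType d2) (R : realType).
Variables (m1 : {sigma_finite_measure set T1 -> \bar R}) (m2 : {sigma_finite_measure set T2 -> \bar R}).

(** The integrals of the positive and negative parts are measurable by Tonelli, and [fine] of their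
    difference stays measurable even where both are infinite. *)
Lemma measurable_Rintegral2 (f : T1 -> T2 -> R) :
  measurable_fun setT (fun z : T1 * T2 => f z.1 z.2) ->
  measurable_fun setT (fun x => \int[m2]_y f x y)%R.
Proof.
move=> mf; rewrite /Rintegral.
apply: (measurableT_comp (f := fine)); first exact: fine_measurable.
rewrite (_ : (fun x => _) = (fun x => (\int[m2]_y (maxe (f x y)%:E 0)) - (\int[m2]_y (maxe (- (f x y)%:E) 0)))%E); last first.
  apply/funext => x; rewrite integralE; congr (_ - _)%E; apply: eq_integral => y _.
    by rewrite funeposE.
  by rewrite funenegE.
apply: emeasurable_funB; apply: measurable_integral2.
- by apply: measurable_maxe => //; exact/measurable_EFinP.
- by move=> x y; rewrite le_max lexx orbT.
- by apply: measurable_maxe => //; apply: measurableT_comp => //; exact/measurable_EFinP.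
- by move=> x y; rewrite le_max lexx orbT.
Qed.

Lemma integrable_prod (f : T1 -> R) (g : T2 -> R) :
  m1.-integrable setT (EFin \o f) -> m2.-integrable setT (EFin \o g) ->
  (sfprod m1 m2).-integrable setT (EFin \o (fun z => f z.1 * g z.2)).
Proof.
move=> fi gi.
have mf : measurable_fun setT f by apply/measurable_EFinP; exact: measurable_int fi.
have mg : measurable_fun setT g by apply/measurable_EFinP; exact: measurable_int gi.
have mfg : measurable_fun setT (fun z : T1 * T2 => f z.1 * g z.2) by meas.
apply/(@integrable12ltyP _ _ _ _ R m1 m2); first exact/measurable_EFinP.
rewrite (eq_integral (fun x => (`|f x|%:E * \int[m2]_y `|g y|%:E)%E)); last first.
  move=> x _; rewrite -ge0_integralZlT//; last by apply/measurable_EFinP; meas.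
  by apply: eq_integral => y _ /=; rewrite normrM EFinM.
have := integrable_fin_num measurableT (integrable_abse gi).
move=> /fineK <-; rewrite ge0_integralZrT.
- have := integrable_fin_num measurableT (integrable_abse fi).
  by move=> /fineK <-; rewrite -EFinM ltry.
- by apply: fine_ge0; apply: integral_ge0 => y _; exact: abse_ge0.
- by meas.
- by move=> x; rewrite lee_fin.
Qed.

Lemma Rintegral_Fubini1 (f : T1 -> T2 -> R) :
  (sfprod m1 m2).-integrable setT (EFin \o (fun z => f z.1 z.2)) ->
  (forall x, m2.-integrable setT (EFin \o f x)) ->
  (\int[sfprod m1 m2]_z f z.1 z.2 = \int[m1]_x \int[m2]_y f x y)%R.
Proof.
move=> fi fxi; rewrite /Rintegral; congr fine.
rewrite -[LHS](@integral12_prod_meas1 _ _ _ _ R m1 m2 _ fi).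
by apply: eq_integral => x _; rewrite /fubini_F/= -EFin_Rintegral.
Qed.

Lemma Rintegral_Fubini2 (f : T1 -> T2 -> R) :
  (sfprod m1 m2).-integrable setT (EFin \o (fun z => f z.1 z.2)) ->
  (forall y, m1.-integrable setT (EFin \o (fun x => f x y))) ->
  (\int[sfprod m1 m2]_z f z.1 z.2 = \int[m2]_y \int[m1]_x f x y)%R.
Proof.
move=> fi fxi; rewrite /Rintegral; congr fine.
rewrite -[LHS](@integral21_prod_meas1 _ _ _ _ R m1 m2 _ fi).
by apply: eq_integral => y _; rewrite /fubini_G/= -EFin_Rintegral//; exact: fxi.
Qed.

Lemma Rintegral_prod (f : T1 -> R) (g : T2 -> R) :
  m1.-integrable setT (EFin \o f) -> m2.-integrable setT (EFin \o g) ->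
  (\int[sfprod m1 m2]_z (f z.1 * g z.2) = (\int[m1]_x f x) * (\int[m2]_y g y))%R.
Proof.
move=> fi gi.
have H x : m2.-integrable setT (EFin \o (fun y => f x * g y)).
  by have := integrableZl measurableT (f x) gi; apply: eq_integrable => //= y _; rewrite EFinM.
rewrite (@Rintegral_Fubini1 (fun x y => f x * g y)) //; last exact: integrable_prod.
rewrite -RintegralZr//; congr Rintegral; apply/funext => x.
by rewrite RintegralZl.
Qed.

End ProductIntegrals.

Section Nrm.
Variable R : realType.

Lemma cos_abs_le1 (x : R) : `|cos x| <= 1. Proof. by rewrite ler_norml cos_geN1 cos_le1. Qed.
Lemma sin_abs_le1 (x : R) : `|sin x| <= 1. Proof. by rewrite ler_norml sin_geN1 sin_le1. Qed.

Section OneSpace.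
Context d (T : measurableType d) (m : {sigma_finite_measure set T -> \bar R}).

Lemma integrable_cos (f a : T -> R) : m.-integrable setT (EFin \o f) -> measurable_fun setT a ->
  m.-integrable setT (EFin \o (fun x => f x * cos (a x))).
Proof. by move=> fi ma; apply: (integrable_mul_bounded (M := 1) fi); [meas|move=> x; exact: cos_abs_le1]. Qed.

Lemma integrable_sin (f a : T -> R) : m.-integrable setT (EFin \o f) -> measurable_fun setT a ->
  m.-integrable setT (EFin \o (fun x => f x * sin (a x))).
Proof. by move=> fi ma; apply: (integrable_mul_bounded (M := 1) fi); [meas|move=> x; exact: sin_abs_le1]. Qed.

(* |int f e^{i a} dm|^2 for real f *)
Definition sqmod (f a : T -> R) : R :=
  (\int[m]_x (f x * cos (a x))) ^+ 2 + (\int[m]_x (f x * sin (a x))) ^+ 2.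

Lemma sqmod_ge0 f a : 0 <= sqmod f a.
Proof. by rewrite addr_ge0 ?sqr_ge0. Qed.

End OneSpace.

Context d1 d2 (T1 : measurableType d1) (T2 : measurableType d2).
Variables (m1 : {sigma_finite_measure set T1 -> \bar R}) (m2 : {sigma_finite_measure set T2 -> \bar R}).

(** Phases add when exponentials are multiplied. This is how the cube of a squared modulus becomes
    one squared modulus over three copies of the frequency plane. *)
Lemma sqmod_prod (f a : T1 -> R) (g b : T2 -> R) :
  m1.-integrable setT (EFin \o f) -> m2.-integrable setT (EFin \o g) ->
  measurable_fun setT a -> measurable_fun setT b ->
  sqmod (sfprod m1 m2) (fun z => f z.1 * g z.2) (fun z => a z.1 + b z.2) =
  sqmod m1 f a * sqmod m2 g b.
Proof.
move=> fi gi ma mb.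
have fc := integrable_cos fi ma; have fs := integrable_sin fi ma.
have gc := integrable_cos gi mb; have gs := integrable_sin gi mb.
rewrite /sqmod.
rewrite (@eq_RintegralT _ _ _ (sfprod m1 m2) _ (fun z => (f z.1 * cos (a z.1)) * (g z.2 * cos (b z.2)) -
   (f z.1 * sin (a z.1)) * (g z.2 * sin (b z.2)))); last by move=> z; rewrite cosD; ring.
rewrite (@eq_RintegralT _ _ _ (sfprod m1 m2) (fun z => _ * sin _) (fun z => (f z.1 * sin (a z.1)) * (g z.2 * cos (b z.2)) +
   (f z.1 * cos (a z.1)) * (g z.2 * sin (b z.2)))); last by move=> z; rewrite sinD; ring.
rewrite RintegralB//; [|exact: (integrable_prod fc gc)|exact: (integrable_prod fs gs)].
rewrite RintegralD//; [|exact: (integrable_prod fs gc)|exact: (integrable_prod fc gs)].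
rewrite (Rintegral_prod fc gc) (Rintegral_prod fs gs) (Rintegral_prod fs gc) (Rintegral_prod fc gs).
ring.
Qed.

End Nrm.

Section TTstar.
Variable R : realType.
Notation mu := (@lebesgue_measure R).
Notation mR := (measurableTypeR R).
Context d (Y : measurableType d) (nu : {sigma_finite_measure set Y -> \bar R}).
Notation nu2 := (sfprod nu nu).

Lemma sqmod_double (H a : Y -> R) : nu.-integrable setT (EFin \o H) -> measurable_fun setT a ->
  sqmod nu H a = \int[nu2]_z (H z.1 * H z.2 * cos (a z.1 - a z.2)).
Proof.
move=> Hi ma.
have Hc := integrable_cos Hi ma; have Hs := integrable_sin Hi ma.
rewrite (@eq_RintegralT _ _ _ nu2 _ (fun z => (H z.1 * cos (a z.1)) * (H z.2 * cos (a z.2)) +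
   (H z.1 * sin (a z.1)) * (H z.2 * sin (a z.2)))); last by move=> z; rewrite cosB; ring.
rewrite RintegralD//; [|exact: (integrable_prod Hc Hc)|exact: (integrable_prod Hs Hs)].
by rewrite (Rintegral_prod Hc Hc) (Rintegral_prod Hs Hs) /sqmod !expr2.
Qed.

Variable e : R.
Hypothesis e0 : 0 < e.

Section OneVariable.
Context d' (Z : measurableType d') (m : {sigma_finite_measure set Z -> \bar R}).
Variables (K al D : Z -> R).
Hypotheses (Ki : m.-integrable setT (EFin \o K)) (mal : measurable_fun setT al) (mD : measurable_fun setT D).
Let we0 := @expabs_ge0 R e.
Let mwe := @measurable_expabs R e.

Let joint : (sfprod mu m).-integrable setT
  (EFin \o (fun z : mR * Z => expabs e z.1 * (K z.2 * cos (al z.2 + D z.2 * z.1)))).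
Proof.
have := @integrable_prod _ _ _ _ R mu m _ _ (integrable_expabs e0) Ki.
move=> /integrable_mul_bounded => /(_ (fun z : mR * Z => cos (al z.2 + D z.2 * z.1)) 1) H.
apply: eq_integrableT (H _ _); [by move=> z; rewrite mulrA|by meas|by move=> z; exact: cos_abs_le1].
Qed.

Let inner s : m.-integrable setT (EFin \o (fun z => K z * cos (al z + D z * s))).
Proof. by apply: integrable_cos => //; meas. Qed.

Lemma integrable_abel_mean :
  mu.-integrable setT (EFin \o (fun s => expabs e s * \int[m]_z (K z * cos (al z + D z * s)))).
Proof.
have := @integrable_fubini_F _ _ _ _ R mu m _ joint; apply: eq_integrable => //= s _.
by rewrite /fubini_F/= EFin_RintegralZl.
Qed.

(** By Fubini the damped average over [s] falls on the phase [al + D s] alone, and replaces its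
    oscillation by the Poisson kernel at the frequency [D]. *)
Lemma Rintegral_abel_mean :
  \int[mu]_s (expabs e s * \int[m]_z (K z * cos (al z + D z * s))) =
  \int[m]_z (K z * pois e (D z) * cos (al z)).
Proof.
rewrite (@eq_RintegralT _ mR _ mu _ (fun s => \int[m]_z (expabs e s * (K z * cos (al z + D z * s))))); last first.
  by move=> s; rewrite RintegralZl.
rewrite -(@Rintegral_Fubini1 _ _ _ _ R mu m (fun s z => expabs e s * (K z * cos (al z + D z * s)))).
- rewrite (@Rintegral_Fubini2 _ _ _ _ R mu m (fun s z => expabs e s * (K z * cos (al z + D z * s)))).
  + apply: eq_RintegralT => z.
    rewrite (@eq_RintegralT _ mR _ mu _ (fun s => K z * (expabs e s * cos (al z + D z * s)))); last first.
      by move=> s; ring.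
    rewrite RintegralZl//; last by apply: integrable_expabs_mul => //; [meas|move=> s; exact: cos_abs_le1].
    by rewrite Rintegral_expabs_phase//; ring.
  + exact: joint.
  + move=> z; apply: (@eq_integrableT _ mR _ mu (fun s => (expabs e s * cos (al z + D z * s)) * K z)).
      by move=> s; ring.
    apply: (integrable_mul_bounded (M := `|K z|)) => //.
    by apply: integrable_expabs_mul => //; [meas|move=> s; exact: cos_abs_le1].
- exact: joint.
- move=> s; apply: (@eq_integrableT _ _ _ _ (fun z => K z * cos (al z + D z * s) * expabs e s)).
    by move=> z; rewrite mulrC.
  by apply: (integrable_mul_bounded (M := `|expabs e s|)) => //.
Qed.

End OneVariable.

Let we0 := @expabs_ge0 R e.
Let P0 x : 0 <= pois e x. Proof. exact: pois_ge0. Qed.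
Let mP : measurable_fun setT (pois e). Proof. exact: measurable_pois. Qed.

Lemma integrable_mul_pois d' (Z : measurableType d') (m : {measure set Z -> \bar R}) (K D : Z -> R) :
  m.-integrable setT (EFin \o K) -> measurable_fun setT D ->
  m.-integrable setT (EFin \o (fun z => K z * pois e (D z))).
Proof.
move=> Ki mD; apply: (integrable_mul_bounded (M := 2 / e)) => //; first by meas.
by move=> z; rewrite ger0_norm// pois_le.
Qed.

(** The parameters are integrated from the innermost outwards, each trading one linear term of the
    phase for a Poisson factor. The initial [0 +] gives all stages the same shape; at the end the
    phase is 0 and its cosine 1. *)
Lemma integral_abel_mean3 d' (Z : measurableType d') (m : {sigma_finite_measure set Z -> \bar R})
    (K D1 D2 D3 : Z -> R) : m.-integrable setT (EFin \o K) ->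
    measurable_fun setT D1 -> measurable_fun setT D2 -> measurable_fun setT D3 ->
  (\int[mu]_s1 \int[mu]_s2 \int[mu]_s3 (expabs e s1 * (expabs e s2 * (expabs e s3 *
    \int[m]_z (K z * cos (0 + D1 z * s1 + D2 z * s2 + D3 z * s3)))))%:E =
  (\int[m]_z (K z * pois e (D3 z) * pois e (D2 z) * pois e (D1 z)))%:E)%E.
Proof.
move=> Ki m1 m2 m3.
have K3 := integrable_mul_pois Ki m3; have K2 := integrable_mul_pois K3 m2.
transitivity (\int[mu]_s1 \int[mu]_s2 (expabs e s1 * (expabs e s2 *
    \int[m]_z (K z * pois e (D3 z) * cos (0 + D1 z * s1 + D2 z * s2))))%:E)%E.
  apply: eq_integral => s1 _; apply: eq_integral => s2 _.
  have ma : measurable_fun setT (fun z => 0 + D1 z * s1 + D2 z * s2) by meas.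
  rewrite -(Rintegral_abel_mean Ki ma m3) !mulrA -EFin_RintegralZl; last exact: integrable_abel_mean.
  by apply: eq_integral => s3 _; congr EFin; ring.
transitivity (\int[mu]_s1 (expabs e s1 *
    \int[m]_z (K z * pois e (D3 z) * pois e (D2 z) * cos (0 + D1 z * s1)))%:E)%E.
  apply: eq_integral => s1 _.
  have ma : measurable_fun setT (fun z => 0 + D1 z * s1) by meas.
  by rewrite -(Rintegral_abel_mean K3 ma m2) -EFin_RintegralZl//; exact: integrable_abel_mean.
have ma : measurable_fun setT (fun z : Z => 0 : R) by [].
rewrite -EFin_Rintegral; last exact: integrable_abel_mean.
rewrite (Rintegral_abel_mean K2 ma m1); congr EFin; apply: eq_RintegralT => z.
by rewrite cos0 mulr1.
Qed.

Lemma poisN x : pois e (- x) = pois e x. Proof. by rewrite /pois sqrrN. Qed.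

(* Schur's test with weight W, applied to T T^*. *)
Lemma TTstar_bound (H A1 A2 A3 W : Y -> R) (C : R) : 0 <= C ->
  nu.-integrable setT (EFin \o H) ->
  measurable_fun setT A1 -> measurable_fun setT A2 -> measurable_fun setT A3 ->
  measurable_fun setT W -> (forall y, 0 <= W y) -> (forall y, H y != 0 -> 0 < W y) ->
  (forall c1 c2 c3, \int[nu]_y (pois e (c1 - A1 y) * pois e (c2 - A2 y) * pois e (c3 - A3 y) *
     (W y)^-1)%:E <= C%:E)%E ->
  (\int[mu]_s1 \int[mu]_s2 \int[mu]_s3 (expabs e s1 * (expabs e s2 * (expabs e s3 *
    sqmod nu H (fun y => 0 + A1 y * s1 + A2 y * s2 + A3 y * s3))))%:E <=
   C%:E * \int[nu]_y (H y ^+ 2 * W y)%:E)%E.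
Proof.
move=> C0 Hi mA1 mA2 mA3 mW W0 HW bound.
have mH : measurable_fun setT H by apply/measurable_EFinP; exact: measurable_int Hi.
pose D (A : Y -> R) (z : Y * Y) := A z.1 - A z.2.
pose K (z : Y * Y) := H z.1 * H z.2.
have Ki : nu2.-integrable setT (EFin \o K) by exact: integrable_prod.
have mD A : measurable_fun setT A -> measurable_fun setT (D A) by move=> mA; rewrite /D; meas.
have mD1 := mD _ mA1; have mD2 := mD _ mA2; have mD3 := mD _ mA3.
apply: (@eq_lee _ _ ((\int[nu2]_z (K z * pois e (D A3 z) * pois e (D A2 z) * pois e (D A1 z)))%:E)).
  apply: etrans (integral_abel_mean3 Ki mD1 mD2 mD3).
  apply: eq_integral => s1 _; apply: eq_integral => s2 _.
  apply: eq_integral => s3 _; congr (_ * (_ * (_ * _)))%:E.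
  rewrite sqmod_double//; last by meas.
  by apply: eq_RintegralT => z; rewrite /K /D; congr (_ * cos _); ring.
pose p z := pois e (D A3 z) * pois e (D A2 z) * pois e (D A1 z).
have p0 z : 0 <= p z by rewrite /p; pos.
have mp : measurable_fun setT p by rewrite /p; meas.
have KPi := integrable_mul_pois (integrable_mul_pois (integrable_mul_pois Ki mD3) mD2) mD1.
rewrite EFin_Rintegral//.
(* By the inequality between arithmetic and geometric means, [|H y H y'|] times the symmetric kernel
   [p] is at most half of [g y y' + g y' y]. Both halves have the same integral, and the integral in
   [y'] is the one bounded by hypothesis. *)
pose g y y' := H y ^+ 2 * W y * ((W y')^-1 * p (y, y')).
have WV0 y : 0 <= (W y)^-1 by rewrite invr_ge0.
have g0 y y' : 0 <= g y y' by rewrite /g; pos.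
have mp2 : measurable_fun setT (fun z : Y * Y => p (z.2, z.1)).
  by apply: (measurableT_comp mp); meas.
have mg : measurable_fun setT (fun z => g z.1 z.2).
  rewrite /g; apply: measurable_funM; first by meas.
  apply: measurable_funM; first by meas.
  by apply: eq_measurable_fun mp => -[].
have mg2 : measurable_fun setT (fun z => g z.2 z.1).
  by rewrite /g; apply: measurable_funM; [meas|apply: measurable_funM; [meas|exact: mp2]].
have pswap y y' : p (y', y) = p (y, y').
  by rewrite /p /D/=; congr (_ * _ * _); rewrite -poisN opprB.
apply: (@le_trans _ _ (\int[nu2]_z ((2^-1)%:E * (g z.1 z.2 + g z.2 z.1)%:E))%E).
  apply: (@le_trans _ _ (\int[nu2]_z (`|K z| * p z)%:E)%E).
    apply: le_integral => //.
    - have := integrable_mul_pois (integrable_mul_pois (integrable_mul_pois (integrable_norm Ki) mD3) mD2) mD1.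
      by apply: eq_integrableT => z /=; rewrite /p !mulrA.
    - by move=> z _; rewrite lee_fin /p !mulrA -!(mulrA (K z)) -!(mulrA `|K z|) ler_wpM2r ?ler_norm// /p; pos.
  apply: le_integralT.
  - by apply/measurable_EFinP; rewrite /K; meas.
  - by meas.
  - by move=> z; rewrite lee_fin; pos.
  - move=> [y y']; rewrite -EFinM lee_fin /K/= /g pswap.
    (* The weight is known to be positive only where [H] does not vanish; elsewhere the left side is
       zero. *)
    have [Hy|Hy] := eqVneq (H y) 0.
      by rewrite Hy mul0r normr0 mul0r; pos.
    have [Hy'|Hy'] := eqVneq (H y') 0.
      by rewrite Hy' mulr0 normr0 mul0r; pos.
    have w1 := HW _ Hy; have w2 := HW _ Hy'.
    rewrite [leRHS](_ : _ = (2^-1 * (H y ^+ 2 * W y / W y' + H y' ^+ 2 * W y' / W y)) * p (y', y)); last by ring.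
    rewrite ler_wpM2r// -(@ler_pM2r _ (2 * (W y * W y'))) ?mulr_gt0//.
    rewrite [leRHS](_ : _ = (`|H y| * W y) ^+ 2 + (`|H y'| * W y') ^+ 2); last first.
      by rewrite !exprMn !real_normK ?num_real//; field; rewrite !gt_eqF.
    rewrite normrM -subr_ge0.
    rewrite [leRHS](_ : _ = (`|H y| * W y - `|H y'| * W y') ^+ 2) ?sqr_ge0//; ring.
rewrite ge0_integralZlT; [|by rewrite invr_ge0|by meas|by move=> z; rewrite lee_fin addr_ge0].
under eq_integral do rewrite EFinD.
rewrite ge0_integralD//; [|by move=> z _; rewrite lee_fin|by meas|by move=> z _; rewrite lee_fin|by meas].
have E1 : (\int[nu2]_z (g z.1 z.2)%:E = \int[nu]_y \int[nu]_y' (g y y')%:E)%E.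
  by apply: (@tonelli1 _ _ _ _ R nu nu (fun y y' => (g y y')%:E)) => //; apply/measurable_EFinP.
have E2 : (\int[nu2]_z (g z.2 z.1)%:E = \int[nu]_y \int[nu]_y' (g y y')%:E)%E.
  have mg2' : measurable_fun setT (fun z => (g z.2 z.1)%:E) by exact/measurable_EFinP.
  exact: (@tonelli2 _ _ _ _ R nu nu (fun y y' => (g y' y)%:E) mg2' (fun y y' => g0 y' y)).
rewrite E1 E2 -mule2n -mule_natl muleA -EFinM mulVf// mul1e.
rewrite muleC -ge0_integralZrT; [|by []|by meas|by move=> y; rewrite lee_fin; pos; exact: sqr_ge0].
apply: le_integralT.
- by mintc g0; apply/measurable_EFinP.
- by meas.
- by move=> y; apply: integral_ge0 => y' _; rewrite lee_fin.
move=> y; rewrite /g; under eq_integral do rewrite EFinM.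
rewrite ge0_integralZlT; [|by rewrite mulr_ge0// sqr_ge0| |by move=> y'; rewrite lee_fin mulr_ge0].
  apply: lee_wpmul2l; first by rewrite lee_fin mulr_ge0 ?sqr_ge0.
  apply: le_trans (bound (A1 y) (A2 y) (A3 y)); rewrite le_eqVlt; apply/orP; left; apply/eqP.
  by apply: eq_integral => y' _; rewrite /p /D/=; congr EFin; ring.
by apply/measurable_EFinP; apply: measurable_funM; [meas|exact: (measurable_fun_pair2 y mp)].
Qed.

End TTstar.

Lemma measurable_sqmod d1 d2 (T1 : measurableType d1) (T2 : measurableType d2) (R : realType)
    (m2 : {sigma_finite_measure set T2 -> \bar R}) (f : T2 -> R) (a : T1 -> T2 -> R) :
  measurable_fun setT f -> measurable_fun setT (fun z : T1 * T2 => a z.1 z.2) ->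
  measurable_fun setT (fun x => sqmod m2 f (a x)).
Proof.
move=> mf ma; rewrite /sqmod; apply: measurable_funD; apply: measurable_funX;
  apply: measurable_Rintegral2; apply: measurable_funM; first 1 [by meas].
- exact: (measurableT_comp (@measurable_cos R) ma).
- by meas.
- exact: (measurableT_comp (@measurable_sin R) ma).
Qed.

(** Fatou's lemma in the form used for removing the damping and for passing from frequency
    truncations to the full wave. *)
Lemma fatou_le d (T : measurableType d) (R : realType) (m : {measure set T -> \bar R})
    (f : (T -> \bar R)^nat) (g : T -> \bar R) (C : \bar R) :
  (forall n, measurable_fun setT (f n)) -> measurable_fun setT g ->
  (forall n x, 0 <= f n x)%E -> (forall x, 0 <= g x)%E ->
  {ae m, forall x, f ^~ x @ \oo --> g x} ->
  (forall n, \int[m]_x f n x <= C)%E -> (\int[m]_x g x <= C)%E.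
Proof.
move=> mf mg f0 g0 fg fC.
have H := fatou m measurableT mf (fun n x _ => f0 n x).
have mlim : measurable_fun setT (fun x => limn_einf (f ^~ x)).
  rewrite (_ : (fun x => _) = (fun x => - limn_esup (fun n => - f n x))%E).
    by apply: measurableT_comp => //; apply: measurable_fun_limn_esup => n; apply: measurableT_comp.
  by apply/funext => x; rewrite -limn_einfN; congr limn_einf; apply/funext => n; rewrite /= oppeK.
have l0 x : (0 <= limn_einf (f ^~ x))%E.
  rewrite limn_einf_lim; apply: lime_ge; first exact: is_cvg_einfs.
  by apply: nearW => n; apply: le_ereal_inf_tmp => _ [m0 _ <-].
apply: (@eq_lee _ _ (\int[m]_x limn_einf (f ^~ x))%E).
  apply: ge0_ae_eq_integral => //; apply: filterS fg => x fgx _.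
  by rewrite (cvg_limn_einf_sup fgx).
apply: (le_trans H); rewrite limn_einf_lim; apply: lime_le; first exact: is_cvg_einfs.
by apply: nearW => n; apply: le_trans (fC n); apply: ereal_inf_lbound; exists n => /=.
Qed.

(** * The sixth power bound for one amplitude vanishing on the axis *)

Section LightConeMeasure.
Variable R : realType.
Notation mu := (@lebesgue_measure R).
Notation mR := (measurableTypeR R).
Notation L2 := (sfprod mu mu).

Lemma L2_axis_negligible : L2.-negligible [set z : mR * mR | z.2 = 0].
Proof.
exists (setT `*` [set 0]); split.
- by apply: measurableX.
- change ((mu \x mu)%E (setT `*` [set (0 : R)]) = 0%E).
  by rewrite product_measure1E//= lebesgue_measure_set1 mule0.
- by move=> z /= ->.
Qed.

Lemma eq_integral_off_axis (f g : R * R -> \bar R) : measurable_fun (setT : set (mR * mR)) f ->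
  measurable_fun (setT : set (mR * mR)) g -> (forall z, z.2 != 0 -> f z = g z) ->
  (\int[L2]_z f z = \int[L2]_z g z)%E.
Proof.
move=> mf mg fg; apply: ae_eq_integral => //.
have := L2_axis_negligible; apply: negligibleS => z /= /not_implyP[_ H].
by apply: contrapT => /eqP/fg.
Qed.

(** The rotation to light variables is composed of the translation of [t] by [x], the dilation of
    [t] by 2, which is the Jacobian, and the translation of [x] by [r]. *)
Lemma integral_light_coord (h : R -> R -> \bar R) :
  measurable_fun (setT : set (mR * mR)) (fun z => h z.1 z.2) -> (forall x y, 0 <= h x y)%E ->
  (\int[mu]_x \int[mu]_t h ((x + t) / 2)%R ((t - x) / 2)%R = 2%:E * \int[mu]_s \int[mu]_r h s r)%E.
Proof.
move=> mh h0.
have mhc d (T : measurableType d) (a b : T -> R) : measurable_fun setT a -> measurable_fun setT b ->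
    measurable_fun setT (fun x => h (a x) (b x)).
  by move=> ma mb; exact: (measurableT_comp mh (measurable_fun_pair ma mb)).
have E1 (x : R) : (\int[mu]_t h ((x + t) / 2)%R ((t - x) / 2)%R = 2%:E * \int[mu]_r h (x + r)%R r)%E.
  have m1 : measurable_fun (setT : set mR) (fun t => h ((x + t) / 2)%R ((t - x) / 2)%R).
    by apply: mhc; meas.
  rewrite -(integralT_addr x m1) (@ge0_integralT_mull _ 2)//.
  - congr (_ * _)%E; apply: eq_integral => t _; congr (h _ _); by move: (t : R) => t'; field.
  - by apply: mhc; meas.
rewrite (eq_integral (fun x : mR => 2%:E * \int[mu]_r h (x + r)%R r)%E); last by move=> x _; exact: E1.
have m2 : measurable_fun (setT : set (mR * mR)) (fun z => h (z.1 + z.2) z.2).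
  by apply: mhc; meas.
rewrite ge0_integralZlT; [|by []|exact: measurable_integral2|by move=> x; apply: integral_ge0].
congr (_ * _)%E.
apply: etrans (@tonelli_swap _ _ _ _ _ mu mu (fun x r => h (x + r)%R r) m2 _) _; first by [].
apply: etrans (esym (@tonelli_swap _ _ _ _ _ mu mu (fun x r => h x r) mh h0)).
apply: eq_integral => r _.
apply: (integralT_addr r).
by apply: mhc; meas.
Qed.

Variable F : R * R -> R.
Hypothesis Fi : L2.-integrable setT (EFin \o F).
Hypothesis F0 : forall z, z.2 = 0 -> F z = 0.
Let mF : measurable_fun (setT : set (mR * mR)) F.
Proof. by apply/measurable_EFinP; exact: measurable_int Fi. Qed.
Let mrad := @measurable_rad R.

Lemma measurable_conc : measurable_fun (setT : set (mR * mR)) (@conc R).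
Proof. by rewrite /conc; meas. Qed.
Let mconc := measurable_conc.

(** The phase [x . xi + t |xi|] written with [s1 = (x_1 + t) / 2], [s2 = x_2], [s3 = (t - x_1) / 2],
    which are dual to [|xi| + xi_1], [xi_2] and [|xi| - xi_1]. *)
Let cone_phase (s1 s2 s3 : R) (z : R * R) : R := (rad z + z.1) * s1 + z.2 * s2 + conc z * s3.
Let G s1 s2 s3 : R := sqmod L2 F (cone_phase s1 s2 s3) ^+ 3.
Let G0 s1 s2 s3 : 0 <= G s1 s2 s3. Proof. by apply: exprn_ge0; exact: sqmod_ge0. Qed.

Let mG d (T : measurableType d) (a b c : T -> R) : measurable_fun setT a -> measurable_fun setT b ->
  measurable_fun setT c -> measurable_fun setT (fun x => G (a x) (b x) (c x)).
Proof.
move=> ma mb mc; apply: measurable_funX.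
apply: (@measurable_sqmod _ _ _ (mR * mR)%type R L2 F (fun x => cone_phase (a x) (b x) (c x))) => //.
by rewrite /cone_phase; meas.
Qed.

Let E2 : \bar R := (\int[L2]_z (F z ^+ 2 * rad z)%:E)%E.

Lemma rad_ge0 (z : R * R) : 0 <= rad z. Proof. exact: sqrtr_ge0. Qed.
Lemma rad_gt0 (z : R * R) : z.2 != 0 -> 0 < rad z.
Proof. by move=> z2; rewrite sqrtr_gt0 ltr_wpDl ?sqr_ge0// exprn_even_gt0. Qed.

Lemma conc_eq (z : R * R) : z.2 != 0 -> conc z = rad z - z.1.
Proof.
move=> z2; have r2 : rad z ^+ 2 = z.1 ^+ 2 + z.2 ^+ 2 by rewrite sqr_sqrtr// addr_ge0 ?sqr_ge0.
have : (rad z + z.1) * (rad z - z.1) = z.2 ^+ 2.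
  by apply: (@etrans _ _ (rad z ^+ 2 - z.1 ^+ 2)); [ring|rewrite r2; ring].
rewrite /conc => <-; rewrite [X in X / _]mulrC mulfK//.
apply/eqP => H; move: z2; have := r2; rewrite (_ : rad z = - z.1) ?sqrrN; last by lra.
move=> h; have /eqP : z.2 ^+ 2 = 0 by lra.
by rewrite sqrf_eq0 => /eqP ->; rewrite eqxx.
Qed.

(** Schur's test on three copies of the plane, with [H] the threefold tensor power of [F] and the
    weight the product of the three radii: the weighted norm of [H] factorises into the cube of the
    energy, and the mass to be bounded is that of the triple convolution. *)
Let damped (e : R) : 0 < e ->
  (\int[mu]_s1 \int[mu]_s2 \int[mu]_s3 (expabs e s1 * (expabs e s2 * (expabs e s3 * G s1 s2 s3)))%:E
    <= (8 * pi ^+ 6)%:E * E2 ^+ 3)%E.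
Proof.
move=> e0.
pose nu := sfprod (sfprod L2 L2) L2.
pose Y := ((mR * mR) * (mR * mR) * (mR * mR))%type.
pose H (z : Y) := F z.1.1 * F z.1.2 * F z.2.
pose tot (a : R * R -> R) (z : Y) := a z.1.1 + a z.1.2 + a z.2.
pose W (z : Y) := rad z.1.1 * rad z.1.2 * rad z.2.
have FF := integrable_prod Fi Fi.
have Hi : nu.-integrable setT (EFin \o H) by exact: (integrable_prod FF Fi).
have mtot a : measurable_fun (setT : set (mR * mR)) a -> measurable_fun setT (tot a).
  by move=> ma; rewrite /tot; meas.
pose a1 (z : R * R) := rad z + z.1.
pose a2 (z : R * R) := z.2.
have ma1 : measurable_fun (setT : set (mR * mR)) a1 by rewrite /a1; meas.
have ma2 : measurable_fun (setT : set (mR * mR)) a2 by rewrite /a2; meas.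
have mW : measurable_fun setT W by rewrite /W; meas.
have W0 z : 0 <= W z by rewrite /W !mulr_ge0 ?rad_ge0.
have C0 : 0 <= 8 * pi ^+ 6 :> R by rewrite mulr_ge0// exprn_ge0// pi_ge0.
have HW z : H z != 0 -> 0 < W z.
  rewrite /H !mulf_eq0 !negb_or => /andP[/andP[h1 h2] h3].
  by rewrite /W !mulr_gt0// rad_gt0//; [move: h1|move: h2|move: h3]; apply: contraNN => /eqP/F0 ->.
have P0 x : 0 <= pois e x by exact: pois_ge0.
have mP : measurable_fun setT (pois e) by exact: measurable_pois.
have bound c1 c2 c3 : (\int[nu]_y (pois e (c1 - tot a1 y) * pois e (c2 - tot a2 y) *
     pois e (c3 - tot (@conc R) y) * (W y)^-1)%:E <= (8 * pi ^+ 6)%:E)%E.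
  apply: le_trans (integral_cone_bound e0 c1 c2 c3).
  pose k z1 z2 z3 := (pois e (c1 - (a1 z1 + a1 z2 + a1 z3)) * pois e (c2 - (a2 z1 + a2 z2 + a2 z3)) *
    pois e (c3 - (conc z1 + conc z2 + conc z3)) * (rad z1 * rad z2 * rad z3)^-1).
  have k0 z1 z2 z3 : 0 <= k z1 z2 z3 by have r0 := rad_ge0; rewrite /k; pos.
  have mk d (T : measurableType d) (f g h : T -> mR * mR) : measurable_fun setT f -> measurable_fun setT g ->
     measurable_fun setT h -> measurable_fun setT (fun x => (k (f x) (g x) (h x))%:E).
    by move=> mf mg mh; rewrite /k; meas.
  apply: (@eq_lee _ _ (\int[L2]_z1 \int[L2]_z2 \int[L2]_z3 (k z1 z2 z3)%:E)%E); last first.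
    rewrite le_eqVlt; apply/orP; left; apply/eqP.
    apply: eq_integral => z1 _; apply: eq_integral => z2 _; apply: eq_integral => z3 _.
    by rewrite /k !invfM.
  apply: etrans.
    apply: (@tonelli1 _ _ _ _ R (sfprod L2 L2) L2 (fun z z3 => (k z.1 z.2 z3)%:E)); last first.
      by move=> z z3; rewrite lee_fin.
    by apply: mk; meas.
  apply: (@tonelli1 _ _ _ _ R L2 L2 (fun z1 z2 => \int[L2]_z3 (k z1 z2 z3)%:E)%E); last first.
    by move=> z1 z2; apply: integral_ge0 => z3 _; rewrite lee_fin.
  by mintc k0; apply: mk; meas.
have T := TTstar_bound e0 C0 Hi (mtot _ ma1) (mtot _ ma2) (mtot _ mconc) mW W0 HW bound.
have HE : (\int[nu]_y (H y ^+ 2 * W y)%:E = E2 ^+ 3)%E.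
  pose f (z : R * R) := F z ^+ 2 * rad z.
  have f0 z : 0 <= f z by rewrite /f mulr_ge0 ?sqr_ge0 ?rad_ge0.
  have mf : measurable_fun (setT : set (mR * mR)) f by rewrite /f; meas.
  rewrite (eq_integral (fun y : Y => ((f y.1.1 * f y.1.2)%:E * (f y.2)%:E)%E)); last first.
    by move=> y _; rewrite -EFinM /H /W /f; congr EFin; ring.
  apply: etrans.
    apply: (@tonelli1 _ _ _ _ R (sfprod L2 L2) L2 (fun z z3 => ((f z.1 * f z.2)%:E * (f z3)%:E)%E)).
      by meas.
    by move=> z z3; rewrite -EFinM lee_fin; pos.
  rewrite (eq_integral (fun z : (mR * mR) * (mR * mR) => (f z.1 * f z.2)%:E * E2)%E); last first.
    move=> z _; apply: ge0_integralZlT; [by rewrite mulr_ge0|by meas|by move=> x; rewrite lee_fin].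
  rewrite ge0_integralZr//; last 3 first.
  - by meas.
  - by move=> z _; rewrite lee_fin mulr_ge0.
  - by apply: integral_ge0 => z _; rewrite lee_fin; exact: f0.
  rewrite !expeS expe0 mule1 muleA; congr (_ * _)%E.
  apply: etrans.
    apply: (@tonelli1 _ _ _ _ R L2 L2 (fun z z3 => (f z * f z3)%:E)%E).
      by meas.
    by move=> z z3; rewrite lee_fin; pos.
  rewrite (eq_integral (fun z : mR * mR => (f z)%:E * E2)%E); last first.
    move=> z _; rewrite (eq_integral (fun x : mR * mR => (f z)%:E * (f x)%:E)%E); last by move=> x _; rewrite EFinM.
    by apply: ge0_integralZlT; [exact: f0|meas|move=> x; rewrite lee_fin].
  rewrite ge0_integralZr//; last 3 first.
  - by meas.
  - by move=> z _; rewrite lee_fin.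
  - by apply: integral_ge0 => z _; rewrite lee_fin; exact: f0.
rewrite -HE; apply: le_trans T.
rewrite le_eqVlt; apply/orP; left; apply/eqP.
apply: eq_integral => s1 _; apply: eq_integral => s2 _; apply: eq_integral => s3 _.
congr (_ * (_ * (_ * _)))%:E.
have mc : measurable_fun (setT : set (mR * mR)) (cone_phase s1 s2 s3) by rewrite /cone_phase; meas.
have mcc : measurable_fun (setT : set ((mR * mR) * (mR * mR))) (fun z => cone_phase s1 s2 s3 z.1 + cone_phase s1 s2 s3 z.2).
  by meas.
rewrite /G 2!exprS expr1 mulrA -(sqmod_prod Fi Fi mc mc) -(sqmod_prod FF Fi mcc mc).
congr (sqmod _ _ _); apply/funext => z.
by rewrite /tot /a1 /a2 /cone_phase; ring.
Qed.

Lemma expabs_cvg1 (s : R) : expabs n.+1%:R^-1 s @[n --> \oo] --> (1 : R).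
Proof.
rewrite -[X in _ --> X]expR0; apply: (@continuous_cvg _ _ _ _ _ _ expR).
  exact: continuous_expR.
have -> : (0 : R) = - 0 * `|s| by rewrite oppr0 mul0r.
apply: cvgM; last exact: cvg_cst.
apply: cvgN.
exact: cvg_harmonic.
Qed.

Let undamped :
  (\int[mu]_s1 \int[mu]_s2 \int[mu]_s3 (G s1 s2 s3)%:E <= (8 * pi ^+ 6)%:E * E2 ^+ 3)%E.
Proof.
pose T3 := (mR * (mR * mR))%type.
have mw e : measurable_fun setT (expabs e : R -> R) by exact: measurable_expabs.
have we e x : 0 <= expabs e x :> R by exact: expabs_ge0.
pose g e s1 s2 s3 := expabs e s1 * (expabs e s2 * (expabs e s3 * G s1 s2 s3)).
have g0 e s1 s2 s3 : 0 <= g e s1 s2 s3 by rewrite /g; pos.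
have mg e d (T : measurableType d) (a b c : T -> R) : measurable_fun setT a -> measurable_fun setT b ->
  measurable_fun setT c -> measurable_fun setT (fun x => g e (a x) (b x) (c x)).
  by move=> ma mb mc; have := mG ma mb mc => mG'; have := mw e => mwe; rewrite /g; do 3 (apply: measurable_funM; [by meas|]).
have E (k : R -> R -> R -> R) : (forall d (T : measurableType d) (a b c : T -> R), measurable_fun setT a -> measurable_fun setT b ->
  measurable_fun setT c -> measurable_fun setT (fun x => k (a x) (b x) (c x))) -> (forall x y z, 0 <= k x y z) ->
  (\int[sfprod mu (sfprod mu mu)]_z (k z.1 z.2.1 z.2.2)%:E = \int[mu]_s1 \int[mu]_s2 \int[mu]_s3 (k s1 s2 s3)%:E)%E.
  move=> mk k0; apply: etrans.
    apply: (@tonelli1 _ _ _ _ R mu (sfprod mu mu) (fun s z => (k s z.1 z.2)%:E)%E).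
      by apply/measurable_EFinP; apply: mk; meas.
    by move=> x y; rewrite lee_fin.
  apply: eq_integral => s1 _; apply: (@tonelli1 _ _ _ _ R mu mu (fun s z => (k s1 s z)%:E)%E).
    by apply/measurable_EFinP; apply: mk; meas.
  by move=> x y; rewrite lee_fin.
rewrite -E//.
apply: (@fatou_le _ _ _ _ (fun n (z : T3) => (g n.+1%:R^-1 z.1 z.2.1 z.2.2)%:E)).
- by move=> n; apply/measurable_EFinP; apply: mg; meas.
- by apply/measurable_EFinP; apply: mG; meas.
- by move=> n z; rewrite lee_fin.
- by move=> z; rewrite lee_fin.
- apply: aeW => z; apply: cvg_EFin; first by apply: nearW.
  rewrite (_ : G _ _ _ = 1 * (1 * (1 * G z.1 z.2.1 z.2.2))); last by rewrite !mul1r.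
  do 3 (apply: cvgM; first exact: expabs_cvg1); exact: cvg_cst.
- move=> n; rewrite (E (g n.+1%:R^-1))//; last by move=> *; apply: mg.
  by apply: damped; rewrite invr_gt0.
Qed.

(** The constant 16 is the Jacobian 2 of the light variables times the 8 of the convolution
    bound. *)
Lemma sqmod_L6_off_axis :
  (\int[sfprod L2 mu]_z (sqmod L2 F (fun xi => (z.1.1 * xi.1 + z.1.2 * xi.2 + z.2 * rad xi)%R) ^+ 3)%:E
    <= (16 * pi ^+ 6)%:E * (\int[L2]_xi (F xi ^+ 2 * rad xi)%:E) ^+ 3)%E.
Proof.
have phase (x1 x2 t : R) : sqmod L2 F (fun xi => x1 * xi.1 + x2 * xi.2 + t * rad xi) ^+ 3 = G ((x1 + t) / 2) x2 ((t - x1) / 2).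
  rewrite /G /sqmod; congr ((_ ^+ 2 + _ ^+ 2) ^+ 3); apply: eq_RintegralT => xi.
    have [/F0 ->|x0] := eqVneq xi.2 0; first by rewrite !mul0r.
    by congr (_ * cos _); rewrite /cone_phase conc_eq//; field.
  have [/F0 ->|x0] := eqVneq xi.2 0; first by rewrite !mul0r.
  by congr (_ * sin _); rewrite /cone_phase conc_eq//; field.
pose k x1 x2 t := G ((x1 + t) / 2) x2 ((t - x1) / 2).
have mk d (T : measurableType d) (a b c : T -> R) : measurable_fun setT a -> measurable_fun setT b ->
  measurable_fun setT c -> measurable_fun setT (fun x => k (a x) (b x) (c x)).
  by move=> ma mb mc; rewrite /k; apply: mG; meas.
have k0 x1 x2 t : 0 <= k x1 x2 t by exact: G0.
rewrite (eq_integral (fun z : (mR * mR) * mR => (k z.1.1 z.1.2 z.2)%:E)); last by move=> z _; rewrite phase.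
apply: (@eq_lee _ _ (\int[mu]_x1 \int[mu]_x2 \int[mu]_t (k x1 x2 t)%:E)%E).
  apply: etrans.
    apply: (@tonelli1 _ _ _ _ R L2 mu (fun z t => (k z.1 z.2 t)%:E)).
      by apply/measurable_EFinP; apply: mk; meas.
    by move=> x y; rewrite lee_fin.
  apply: (@tonelli1 _ _ _ _ R mu mu (fun x1 x2 => \int[mu]_t (k x1 x2 t)%:E)%E).
    by mintc k0; apply/measurable_EFinP; apply: mk; meas.
  by move=> x1 x2; apply: integral_ge0 => t _; rewrite lee_fin.
apply: (@eq_lee _ _ (\int[mu]_x2 \int[mu]_x1 \int[mu]_t (k x1 x2 t)%:E)%E).
  apply: tonelli_swap.
    by mintc k0; apply/measurable_EFinP; apply: mk; meas.
  by move=> x1 x2; apply: integral_ge0 => t _; rewrite lee_fin.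
apply: (@eq_lee _ _ (2%:E * (\int[mu]_s1 \int[mu]_s2 \int[mu]_s3 (G s1 s2 s3)%:E))%E).
  have sw : (\int[mu]_s1 \int[mu]_s2 \int[mu]_s3 (G s1 s2 s3)%:E = \int[mu]_s2 \int[mu]_s1 \int[mu]_s3 (G s1 s2 s3)%:E)%E.
    apply: tonelli_swap.
      by mintc G0; apply/measurable_EFinP; apply: mG; meas.
    by move=> x y; apply: integral_ge0 => ? _; rewrite lee_fin.
  apply: esym; apply: etrans (congr1 (fun x => 2%:E * x)%E sw) _; apply: esym.
  apply: (@etrans _ _ (\int[mu]_s2 (2%:E * \int[mu]_s1 \int[mu]_s3 (G s1 s2 s3)%:E))%E).
    apply: eq_integral => x2 _.
    apply: (integral_light_coord (h := fun s r => (G s x2 r)%:E)).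
      by apply/measurable_EFinP; apply: mG; meas.
    by move=> x y; rewrite lee_fin.
  apply: ge0_integralZlT; first by [].
    by mintc G0; apply/measurable_EFinP; apply: mG; meas.
  by move=> x; apply: integral_ge0 => ? _; apply: integral_ge0 => ? _; rewrite lee_fin.
apply: le_trans (_ : 2%:E * ((8 * pi ^+ 6)%:E * E2 ^+ 3) <= _)%E; first exact: lee_wpmul2l undamped.
by rewrite muleA -EFinM mulrA -natrM.
Qed.

End LightConeMeasure.

(** * The L^6 bound for integrable amplitudes *)

(** Convexity of the cube, used twice; each use costs a factor 4. *)
Lemma sum4_cube (R : realFieldType) (a b c d : R) : 0 <= a -> 0 <= b -> 0 <= c -> 0 <= d ->
  (a + b + c + d) ^+ 3 <= 16 * (a ^+ 3 + b ^+ 3 + c ^+ 3 + d ^+ 3).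
Proof.
have two (x y : R) : 0 <= x -> 0 <= y -> (x + y) ^+ 3 <= 4 * (x ^+ 3 + y ^+ 3).
  move=> x0 y0; rewrite -subr_ge0 [leRHS](_ : _ = 3 * ((x + y) * (x - y) ^+ 2)); last by ring.
  by pos.
move=> a0 b0 c0 d0; rewrite -(addrA (a + b)); apply: le_trans (two _ _ _ _) _; rewrite ?addr_ge0//.
by have := two _ _ a0 b0; have := two _ _ c0 d0; lra.
Qed.

Lemma scaled_pair_sum (R : realType) (k : R) (x y : \bar R) : (0 <= x)%E -> (0 <= y)%E ->
  (16%:E * (k%:E * x + k%:E * x + (k%:E * y) + k%:E * y) = (32 * k)%:E * (x + y))%E.
Proof.
move=> x0 y0.
have k2 (z : \bar R) : (0 <= z -> k%:E * z + k%:E * z = (2 * k)%:E * z)%E.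
  by move=> z0; rewrite -mule2n -mule_natl muleA -EFinM.
rewrite -addeA !k2// -muleDr ?ge0_adde_def ?inE// muleA -EFinM.
by congr (_%:E * _)%E; ring.
Qed.

Lemma ge0_integral_scaled_sum4 d (T : measurableType d) (R : realType) (m : {measure set T -> \bar R})
    (k : R) (a b c e : T -> R) : 0 <= k -> measurable_fun setT a -> measurable_fun setT b ->
  measurable_fun setT c -> measurable_fun setT e -> (forall x, 0 <= a x) -> (forall x, 0 <= b x) ->
  (forall x, 0 <= c x) -> (forall x, 0 <= e x) ->
  (\int[m]_x (k * (a x + b x + c x + e x))%:E = k%:E * (\int[m]_x (a x)%:E + \int[m]_x (b x)%:E +
     \int[m]_x (c x)%:E + \int[m]_x (e x)%:E))%E.
Proof.
move=> k0 ma mb mc me a0 b0 c0 e0.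
rewrite (eq_integral (fun x => k%:E * (a x + b x + c x + e x)%:E)%E); last by move=> x _; rewrite -EFinM.
rewrite ge0_integralZlT; [|by []|by meas|by move=> z; rewrite lee_fin !addr_ge0].
congr (_ * _)%E; under eq_integral do rewrite EFinD.
rewrite ge0_integralD => //; try by move=> z _; rewrite lee_fin ?addr_ge0.
all: try by meas.
congr (_ + _)%E; under eq_integral do rewrite EFinD.
rewrite ge0_integralD => //; try by move=> z _; rewrite lee_fin ?addr_ge0.
all: try by meas.
congr (_ + _)%E; under eq_integral do rewrite EFinD.
rewrite ge0_integralD => //; try by move=> z _; rewrite lee_fin ?addr_ge0.
all: by meas.
Qed.

Section Wave.
Variable R : realType.
Notation mu := (@lebesgue_measure R).
Notation mR := (measurableTypeR R).
Notation L2 := (sfprod mu mu).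
Notation L3 := (sfprod L2 mu).
Let mrad := @measurable_rad R.

Definition dot (x xi : R * R) : R := x.1 * xi.1 + x.2 * xi.2.

Lemma integral_flip_time (g : R * R * R -> \bar R) : measurable_fun (setT : set (mR * mR * mR)) g ->
  (forall z, 0 <= g z)%E -> (\int[L3]_z g (z.1, - z.2)%R = \int[L3]_z g z)%E.
Proof.
move=> mg g0.
have mgc d (T : measurableType d) (a : T -> mR * mR) (b : T -> R) : measurable_fun setT a -> measurable_fun setT b ->
    measurable_fun setT (fun x => g (a x, b x)).
  by move=> ma mb; exact: (measurableT_comp mg (measurable_fun_pair ma mb)).
have E1 : (\int[L3]_z g (z.1, - z.2)%R = \int[L2]_x \int[mu]_t g (x, - t)%R)%E.
  apply: (@tonelli1 _ _ _ _ R L2 mu (fun x t => g (x, - t)%R)); last by [].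
  by apply: mgc; meas.
have E2 : (\int[L3]_z g z = \int[L2]_x \int[mu]_t g (x, t)%R)%E.
  rewrite -[RHS](@tonelli1 _ _ _ _ R L2 mu (fun x t => g (x, t))); [|by apply: mgc; meas|by []].
  by apply: eq_integral => -[].
rewrite E1 E2; apply: eq_integral => x _; apply: (@integralT_opp R (fun t => g (x, t))).
by apply: mgc; meas.
Qed.

Section OneAmplitude.
Variable F : R * R -> R.
Hypothesis Fi : L2.-integrable setT (EFin \o F).
Let mF : measurable_fun (setT : set (mR * mR)) F.
Proof. by apply/measurable_EFinP; exact: measurable_int Fi. Qed.

(** The squared modulus of the half wave, so that its cube is the sixth power to be integrated. The
    sign [c] is the direction of time. *)
Definition half_wave (c : R) (z : R * R * R) : R :=
  sqmod L2 F (fun xi => dot z.1 xi + c * z.2 * rad xi).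

Lemma measurable_half_wave c : measurable_fun (setT : set (mR * mR * mR)) (half_wave c).
Proof.
apply: (@measurable_sqmod _ _ (mR * mR * mR)%type (mR * mR)%type R L2 F (fun z xi => dot z.1 xi + c * z.2 * rad xi)) => //.
by rewrite /dot; meas.
Qed.

Let L6_pos : (\int[L3]_z (half_wave 1 z ^+ 3)%:E
    <= (16 * pi ^+ 6)%:E * (\int[L2]_xi (F xi ^+ 2 * rad xi)%:E) ^+ 3)%E.
Proof.
(* Cutting [F] off the null line [xi_2 = 0] changes none of the integrals and provides the vanishing
   on the axis where the light coordinates degenerate. *)
pose chi : R -> R := \1_(~` [set 0]).
have mchi : measurable_fun (setT : set R) chi by apply: measurable_indic; exact: measurableC.
have chi1 x : x != 0 -> chi x = 1 by move=> x0; rewrite /chi indicE mem_set//=; exact/eqP.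
have chi0 : chi 0 = 0 by rewrite /chi indicE memNset//=; apply/not_notP.
pose G (z : R * R) := F z * chi z.2.
have mG : measurable_fun (setT : set (mR * mR)) G by rewrite /G; meas.
have Gi : L2.-integrable setT (EFin \o G).
  apply: (integrable_mul_bounded (M := 1) Fi); first by meas.
  by move=> z; rewrite /chi indicE; case: (_ \in _); rewrite ?normr1 ?normr0.
have G0 z : z.2 = 0 -> G z = 0 by rewrite /G => ->; rewrite chi0 mulr0.
have FG z : z.2 != 0 -> F z = G z by move=> z2; rewrite /G chi1// mulr1.
have -> : (\int[L2]_xi (F xi ^+ 2 * rad xi)%:E = \int[L2]_xi (G xi ^+ 2 * rad xi)%:E)%E.
  apply: eq_integral_off_axis => [||z z2]; [by meas|by meas|by rewrite FG].
apply: eq_lee (sqmod_L6_off_axis Gi G0).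
apply: eq_integral => z _; congr (_ ^+ 3)%:E; rewrite /half_wave /sqmod.
have ma : measurable_fun (setT : set (mR * mR)) (fun xi => dot z.1 xi + 1 * z.2 * rad xi) by rewrite /dot; meas.
congr (_ ^+ 2 + _ ^+ 2); rewrite /Rintegral; congr fine; apply: eq_integral_off_axis.
- by rewrite /dot; meas.
- by rewrite /dot; meas.
- by move=> xi xi2; rewrite FG// mul1r.
- by rewrite /dot; meas.
- by rewrite /dot; meas.
- by move=> xi xi2; rewrite FG// mul1r.
Qed.

Let L6_neg : (\int[L3]_z (half_wave (-1) z ^+ 3)%:E
    <= (16 * pi ^+ 6)%:E * (\int[L2]_xi (F xi ^+ 2 * rad xi)%:E) ^+ 3)%E.
Proof.
apply: le_trans L6_pos; rewrite -(integral_flip_time (g := fun z => (half_wave 1 z ^+ 3)%:E)).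
- apply: eq_lee (lexx _); apply: eq_integral => z _; congr (_ ^+ 3)%:E.
  by rewrite /half_wave; congr sqmod; apply/funext => xi /=; rewrite mulN1r mul1r.
- by have mh := measurable_half_wave 1; meas.
- by move=> z; rewrite lee_fin exprn_ge0// sqmod_ge0.
Qed.

Lemma half_wave_L6 c : c = 1 \/ c = -1 -> (\int[L3]_z (half_wave c z ^+ 3)%:E
    <= (16 * pi ^+ 6)%:E * (\int[L2]_xi (F xi ^+ 2 * rad xi)%:E) ^+ 3)%E.
Proof. by case=> ->; [exact: L6_pos|exact: L6_neg]. Qed.

End OneAmplitude.

(** The real part of the superposition of [(p + i q) exp(i x . xi) cos(t |xi|)]. *)
Definition wave (p q : R * R -> R) (z : R * R * R) : R :=
  \int[L2]_xi (p xi * (cos (dot z.1 xi) * cos (z.2 * rad xi)) - q xi * (sin (dot z.1 xi) * cos (z.2 * rad xi))).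

Variables p q : R * R -> R.
Hypotheses (ip : L2.-integrable setT (EFin \o p)) (iq : L2.-integrable setT (EFin \o q)).
Let mp : measurable_fun (setT : set (mR * mR)) p.
Proof. by apply/measurable_EFinP; exact: measurable_int ip. Qed.
Let mq : measurable_fun (setT : set (mR * mR)) q.
Proof. by apply/measurable_EFinP; exact: measurable_int iq. Qed.

Lemma measurable_wave : measurable_fun (setT : set (mR * mR * mR)) (wave p q).
Proof.
apply: (@measurable_Rintegral2 _ _ (mR * mR * mR)%type (mR * mR)%type R L2).
by rewrite /dot; meas.
Qed.

(** Product-to-sum formulas write the wave as half a signed sum of four components of half waves;
    Cauchy-Schwarz on four terms absorbs the factor 1/2. *)
Lemma wave_sqr_le z : wave p q z ^+ 2 <= half_wave p 1 z + half_wave p (-1) z + half_wave q 1 z + half_wave q (-1) z.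
Proof.
have ma c : measurable_fun (setT : set (mR * mR)) (fun xi => dot z.1 xi + c * z.2 * rad xi).
  by rewrite /dot; meas.
have ic c := integrable_cos ip (ma c); have is_ c := integrable_sin iq (ma c).
pose A c := \int[L2]_xi (p xi * cos (dot z.1 xi + c * z.2 * rad xi)).
pose B c := \int[L2]_xi (q xi * sin (dot z.1 xi + c * z.2 * rad xi)).
have wE : wave p q z = 2^-1 * ((A 1 + A (-1)) - (B 1 + B (-1))).
  rewrite /A /B -RintegralD// -RintegralD// -RintegralB//; last 2 first.
  - by have := integrableD measurableT (ic 1) (ic (-1)); apply: eq_integrable.
  - by have := integrableD measurableT (is_ 1) (is_ (-1)); apply: eq_integrable.
  rewrite -RintegralZl//; last first.
    have i1 := integrableD measurableT (ic 1) (ic (-1)).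
    have i2 := integrableD measurableT (is_ 1) (is_ (-1)).
    by have := integrableB measurableT i1 i2; apply: eq_integrable.
  apply: eq_RintegralT => xi; rewrite !(mulN1r, mul1r) mulNr.
  by rewrite !cosD !sinD !cosN !sinN; field.
have h c : A c ^+ 2 <= half_wave p c z by rewrite /half_wave /sqmod lerDl sqr_ge0.
have h' c : B c ^+ 2 <= half_wave q c z by rewrite /half_wave /sqmod lerDr sqr_ge0.
have := h 1; have := h (-1); have := h' 1; have := h' (-1); rewrite wE.
move: (A 1) (A (-1)) (B 1) (B (-1)) => a b c d.
have : (2^-1 * (a + b - (c + d))) ^+ 2 <= a ^+ 2 + b ^+ 2 + c ^+ 2 + d ^+ 2.
  rewrite -subr_ge0 [leRHS](_ : _ = 4^-1 * ((a - b) ^+ 2 + (a + c) ^+ 2 + (a + d) ^+ 2 + (b + c) ^+ 2 + (b + d) ^+ 2 + (c - d) ^+ 2)); last by field.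
  by rewrite mulr_ge0// !addr_ge0// sqr_ge0.
by lra.
Qed.

(** The constant is 16 from cubing a sum of four terms, times 2 for the two signs of time, times the
    16 of each half wave. *)
Lemma wave_L6 : (\int[L3]_z (wave p q z ^+ 6)%:E <= (512 * pi ^+ 6)%:E *
   ((\int[L2]_xi (p xi ^+ 2 * rad xi)%:E) ^+ 3 + (\int[L2]_xi (q xi ^+ 2 * rad xi)%:E) ^+ 3))%E.
Proof.
have mw : measurable_fun (setT : set (mR * mR * mR)) (fun z => (wave p q z ^+ 6)%:E).
  by apply/measurable_EFinP; apply: measurable_funX; exact: measurable_wave.
have m1 := measurable_half_wave ip 1; have m2 := measurable_half_wave ip (-1).
have m3 := measurable_half_wave iq 1; have m4 := measurable_half_wave iq (-1).
have h0 F c z : 0 <= half_wave F c z by exact: sqmod_ge0.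
have h30 F c z : 0 <= half_wave F c z ^+ 3 by exact: exprn_ge0.
pose S z := half_wave p 1 z ^+ 3 + half_wave p (-1) z ^+ 3 + half_wave q 1 z ^+ 3 + half_wave q (-1) z ^+ 3.
apply: (@le_trans _ _ (\int[L3]_z (16 * S z)%:E)%E).
  apply: le_integralT.
  - exact: mw.
  - by apply/measurable_EFinP; rewrite /S; meas.
  - by move=> z; rewrite lee_fin exprn_even_ge0.
  - move=> z; rewrite lee_fin; apply: le_trans (sum4_cube _ _ _ _) => //.
    rewrite (exprM _ 2 3); apply: lerXn2r; last exact: wave_sqr_le.
      by rewrite nnegrE sqr_ge0.
    by rewrite nnegrE; do 3 (apply: addr_ge0; last exact: h0); exact: h0.
have mc F c : L2.-integrable setT (EFin \o F) -> measurable_fun (setT : set (mR * mR * mR)) (fun z => half_wave F c z ^+ 3).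
  by move=> Fi; apply: measurable_funX; exact: measurable_half_wave.
rewrite /S ge0_integral_scaled_sum4; [|by []|exact: mc|exact: mc|exact: mc|exact: mc|exact: h30|exact: h30|exact: h30|exact: h30].
have i0 F : (0 <= (\int[L2]_xi (F xi ^+ 2 * rad xi)%:E) ^+ 3)%E.
  by apply: expe_ge0; apply: integral_ge0 => xi _; rewrite lee_fin mulr_ge0 ?sqr_ge0// rad_ge0.
have k0 : (0 <= (16 * pi ^+ 6)%:E :> \bar R)%E by rewrite lee_fin mulr_ge0// exprn_ge0// pi_ge0.
have b1 := half_wave_L6 ip (or_introl erefl); have b2 := half_wave_L6 ip (or_intror erefl).
have b3 := half_wave_L6 iq (or_introl erefl); have b4 := half_wave_L6 iq (or_intror erefl).
apply: le_trans (lee_wpmul2l _ (leeD (leeD (leeD b1 b2) b3) b4)) _; first by [].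
move: (i0 p) (i0 q) k0; set x := (_ ^+ 3)%E; set y := (_ ^+ 3)%E => x0 y0 k0.
apply: (@eq_lee _ _ _ _ (scaled_pair_sum _ x0 y0)).
by apply: eq_lee (lexx _); congr (_%:E * _)%E; ring.
Qed.

End Wave.

(** * Test functions *)

Section Smooth1D.
Variable R : realType.
Notation mu := (@lebesgue_measure R).
Notation mR := (measurableTypeR R).
Implicit Types (f g : R -> R) (B : nat -> R -> R).

(** Repeated differentiability with the derivatives as explicit witnesses, which makes sums,
    products and affine changes of variable provable by induction. *)
Fixpoint Cn (n : nat) f : Prop :=
  if n is m.+1 then exists2 f', (forall x : R, is_derive x 1 f (f' x)) & Cn m f' else True.

Lemma Cn_S n f : Cn n.+1 f -> Cn n f.
Proof. by elim: n f => // n IH f [f' df /IH]; exists f'. Qed.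

Lemma Cn_add n f g : Cn n f -> Cn n g -> Cn n (fun x => f x + g x).
Proof.
elim: n f g => // n IH f g [f' df f'n] [g' dg g'n].
exists (fun x => f' x + g' x); last exact: IH.
by move=> x; apply: der1_eq; first by der.
Qed.

Lemma Cn_cst n (c : R) : Cn n (fun=> c).
Proof.
by elim: n c => // n IH c; exists (fun=> 0) => // x; apply: der1_eq; first by der.
Qed.

Lemma Cn_mul n f g : Cn n f -> Cn n g -> Cn n (fun x => f x * g x).
Proof.
elim: n f g => // n IH f g fn gn.
have fn' := Cn_S fn; have gn' := Cn_S gn.
move: fn gn => [f' df f'n] [g' dg g'n].
exists (fun x => f' x * g x + f x * g' x); last by apply: Cn_add; apply: IH.
by move=> x; apply: der1_eq; first by der.
Qed.

Lemma Cn_affine n f (s t : R) : Cn n f -> Cn n (fun x => f (s * x + t)).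
Proof.
elim: n f => // n IH f [f' df f'n].
exists (fun x => f' (s * x + t) * s); last by apply: Cn_mul; [exact: IH|exact: Cn_cst].
by move=> x; apply: der1_eq; [der|rewrite /=; ring].
Qed.

Lemma Cn_derive1n n f : Cn n.+1 f -> forall x : R, is_derive x 1 (iter n (fun g => derive1 g) f) (iter n.+1 (fun g => derive1 g) f x).
Proof.
elim: n f => [|n IH] f.
  by move=> [f' df _] x; rewrite /= derive1E; have H := df x; rewrite derive_val.
move=> [f' df f'n] x; have -> : iter n.+2 (fun g => derive1 g) f = iter n.+1 (fun g => derive1 g) (derive1 f) by rewrite -iterSr.
have -> : iter n.+1 (fun g => derive1 g) f = iter n (fun g => derive1 g) (derive1 f) by rewrite -iterSr.
apply: IH; rewrite (_ : derive1 f = f')//; apply/funext => y.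
by rewrite derive1E; have H := df y; rewrite derive_val.
Qed.

(** The functions [x^-k exp(- c / x)] are closed, up to linear combinations, under differentiation.
    The parameter [c] is kept because for [k = 0] they tend to the indicator of the positive half
    line as [c] tends to 0. *)
Definition flat (c : R) (k : nat) (x : R) : R := if 0 < x then x^-1 ^+ k * expR (- (c / x)) else 0.

Lemma expR_ge_pow (m : nat) (y : R) : 0 <= y -> (y / m.+1%:R) ^+ m.+1 <= expR y.
Proof.
move=> y0; have -> : expR y = expR (y / m.+1%:R) ^+ m.+1.
  by rewrite -expRM_natl; congr expR; rewrite mulrC divfK// pnatr_eq0.
rewrite lerXn2r ?nnegrE ?expR_ge0 ?divr_ge0//.
by apply: le_trans (expR_ge1Dx _); rewrite lerDr.
Qed.

Lemma flat_ge0 c k x : 0 <= flat c k x.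
Proof. by rewrite /flat; case: ifPn => // x0; rewrite mulr_ge0 ?expR_ge0 ?exprn_ge0 ?invr_ge0// ltW. Qed.

(** From [exp y >= (y / m)^m] with [y = c / x] and [m = k + 2]: two powers more than the pole leave
    the quadratic decay which makes the derivative at the origin vanish. *)
Lemma flat_le_sq (c : R) k x : 0 < c -> flat c k x <= (k.+2%:R / c) ^+ k.+2 * x ^+ 2.
Proof.
move=> c0; rewrite /flat; case: ifPn => [x0|_]; last first.
  by rewrite mulr_ge0 ?sqr_ge0 ?exprn_ge0// divr_ge0// ltW.
have y0 : 0 <= c / x by rewrite divr_ge0// ltW.
have := expR_ge_pow k.+1 y0; rewrite expRN -ler_pdivrMr ?exprn_gt0 ?divr_gt0//.
set E := expR _; have E0 : 0 < E by rewrite expR_gt0.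
have k0 : (k.+2%:R : R) != 0 by rewrite pnatr_eq0.
rewrite ler_pdivrMr ?exprn_gt0 ?divr_gt0// => H.
rewrite ler_pdivrMr//; apply: le_trans (ler_wpM2l _ H); last first.
  by rewrite mulr_ge0 ?sqr_ge0 ?exprn_ge0// divr_ge0// ltW.
rewrite [leRHS](_ : _ = x^-1 ^+ k)// mulrAC -exprMn.
have -> : k.+2%:R / c * (c / x / k.+2%:R) = x^-1 by field; rewrite ?k0 ?gt_eqF.
by rewrite -addn2 exprD -mulrA -exprMn mulVf ?gt_eqF// expr1n mulr1.
Qed.

Lemma is_derive0_of_sq_bound f (K : R) : f 0 = 0 -> (forall x, `|f x| <= K * x ^+ 2) -> is_derive (0 : R) 1 f 0.
Proof.
move=> f0 fK.
have K0 : 0 <= K by have := le_trans (normr_ge0 _) (fK 1); rewrite expr1n mulr1.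
have H : h^-1 *: ((f \o shift 0) (h *: 1) - f 0) @[h --> 0^'] --> (0 : R).
  apply/cvgrPdist_le => e e0; near=> h.
  have h0 : h != 0 by near: h; exact: nbhs_dnbhs_neq.
  rewrite /= f0 subr0 addr0 sub0r normrN normrZ normfV /GRing.scale/= mulr1.
  rewrite mulrC ler_pdivrMr ?normr_gt0//; apply: le_trans (fK h) _.
  rewrite -real_normK ?num_real// expr2 mulrA ler_wpM2r//.
  apply: (@le_trans _ _ ((K + 1) * `|h|)); first by rewrite ler_wpM2r// lerDl.
  rewrite mulrC -ler_pdivlMr ?ltr_wpDl//.
  near: h; apply: dnbhs0_le; rewrite divr_gt0// ltr_wpDl//.
by split; [apply/cvg_ex; exists 0|exact: cvg_lim H].
Unshelve. all: by end_near.
Qed.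

Lemma is_derive_flat (c : R) k (x : R) : 0 < c ->
  is_derive x 1 (flat c k) (- k%:R * flat c k.+1 x + c * flat c k.+2 x).
Proof.
move=> c0; case: (ltgtP x 0) => x0.
- have -> : - k%:R * flat c k.+1 x + c * flat c k.+2 x = 0.
    by rewrite /flat ltNge (ltW x0)/= !mulr0 addr0.
  have := der_cst 0 x; apply: near_eq_is_derive.
  near=> y; rewrite /flat ltNge (_ : y <= 0)//.
  by apply/ltW; near: y; exact: lt_nbhsl.
- have H : {near x, (fun y => y^-1 ^+ k * expR (- (c / y))) =1 flat c k}.
    by near=> y; rewrite /flat (_ : 0 < y)//; near: y; exact: lt_nbhsr.
  apply: (near_eq_is_derive H).
  have xn : x != 0 by rewrite gt_eqF.
  apply: der1_eq; first by der.
  rewrite /= /flat x0; case: k {H} => [|k] /=; rewrite ?expr0 ?exprS; field; rewrite ?xn//.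
- rewrite x0; have -> : - k%:R * flat c k.+1 0 + c * flat c k.+2 0 = 0.
    by rewrite /flat ltxx !mulr0 addr0.
  apply: (@is_derive0_of_sq_bound _ ((k.+2%:R / c) ^+ k.+2)); first by rewrite /flat ltxx.
  by move=> y; rewrite ger0_norm ?flat_ge0//; exact: flat_le_sq.
Unshelve. all: by end_near.
Qed.

Lemma Cn_flat n c k : 0 < c -> Cn n (flat c k).
Proof.
move=> c0; elim: n k => // n IH k.
exists (fun x => - k%:R * flat c k.+1 x + c * flat c k.+2 x); first by move=> x; exact: is_derive_flat.
by apply: Cn_add; (apply: Cn_mul; first exact: Cn_cst).
Qed.

(* B n is the n-th derivative of a test function on the line. *)
Definition bump_family B : Prop :=
  (forall n (x : R), is_derive x 1 (B n) (B n.+1 x)) /\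
  (exists M, forall n x, M <= `|x| -> B n x = 0).

(** Smooth, supported in the interval from [a] to [b], and convergent to its indicator as [c] tends
    to 0. The arguments are spelled as affine maps [s * x + t]. *)
Definition bump (c a b : R) (x : R) : R := flat c 0 (1 * x + - a) * flat c 0 (-1 * x + b).

Lemma flat0_le1 c x : 0 < c -> flat c 0 x <= 1.
Proof.
move=> c0; rewrite /flat; case: ifPn => // x0; rewrite expr0 mul1r -[leRHS]expR0 ler_expR.
by rewrite oppr_le0 divr_ge0// ltW.
Qed.

Lemma bump_ge0 c a b x : 0 <= bump c a b x.
Proof. by rewrite mulr_ge0// flat_ge0. Qed.

Lemma bump_le1 c a b x : 0 < c -> bump c a b x <= 1.
Proof. by move=> c0; rewrite /bump -[leRHS]mulr1 ler_pM ?flat_ge0 ?flat0_le1. Qed.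

Lemma bump_out c a b x : x <= a \/ b <= x -> bump c a b x = 0.
Proof.
rewrite /bump /flat => -[h|h].
  by rewrite [X in if X then _ else 0](_ : _ = false) ?mul0r//; apply/negbTE; rewrite -leNgt; lra.
rewrite [X in _ * (if X then _ else 0)](_ : _ = false) ?mulr0//; apply/negbTE; rewrite -leNgt; lra.
Qed.

Lemma flat0_cvg1 x : 0 < x -> flat n.+1%:R^-1 0 x @[n --> \oo] --> (1 : R).
Proof.
move=> x0; rewrite /flat x0; under eq_fun do rewrite expr0 mul1r.
suff : expR (- (n.+1%:R^-1 / x)) @[n --> \oo] --> expR (0 : R) by rewrite expR0.
apply: (@continuous_cvg _ _ _ _ _ _ expR); first exact: continuous_expR.
have -> : (0 : R) = - (0 * x^-1) by rewrite mul0r oppr0.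
by apply: cvgN; apply: cvgM; [exact: cvg_harmonic|exact: cvg_cst].
Qed.

Lemma bump_cvg a b x : bump n.+1%:R^-1 a b x @[n --> \oo] --> (\1_(`]a, b[%classic : set R) x : R).
Proof.
have [xab|xab] := boolP (x \in `]a, b[).
  rewrite indicE mem_set//; suff : bump n.+1%:R^-1 a b x @[n --> \oo] --> (1 * 1 : R) by rewrite mulr1.
  move: xab; rewrite in_itv/= => /andP[ax xb].
  by apply: cvgM; apply: flat0_cvg1; lra.
rewrite indicE memNset; last exact/negP.
rewrite (_ : (fun n => _) = (fun=> 0)); first exact: cvg_cst.
apply/funext => n; apply: bump_out; move: xab; rewrite in_itv/= negb_and -!leNgt.
by move=> /orP[]; [left|right].
Qed.

Lemma bump_familyE c a b : 0 < c -> exists2 B, bump_family B & B 0%N = bump c a b.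
Proof.
move=> c0; have Cb n : Cn n (bump c a b).
  by apply: Cn_mul; apply: Cn_affine; exact: Cn_flat.
exists (fun n => iter n (fun g => derive1 g) (bump c a b)) => //; split.
  by move=> n x; apply: Cn_derive1n.
(* The bump vanishes identically on the open set [|x| > |a| + |b|], hence so do its derivatives; the
   extra 1 turns this strict inequality into the non-strict one of [bump_family]. *)
exists (`|a| + `|b| + 1) => n.
have out : forall x, `|a| + `|b| < `|x| -> iter n (fun g => derive1 g) (bump c a b) x = 0.
  elim: n => [|n IH] x xM.
    apply: bump_out; have := ler_norm a; have := ler_norm b; have := ler_norm (- a).
    have := ler_norm (-b); rewrite !normrN; have := normr_ge0 a; have := normr_ge0 b.
    by move: xM; case: (lerP 0 x) => x0; [rewrite (ger0_norm x0); right|rewrite (ltr0_norm x0); left]; lra.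
  rewrite /= derive1E; have := @is_derive_cst R R R (0 : R) x 1.
  have near0 : {near x, (fun=> 0 : R) =1 iter n (fun g => derive1 g) (bump c a b)}.
    near=> y; rewrite IH//; near: y.
    have /cvgr_gt := @norm_continuous R R x; apply.
    exact: xM.
  by move=> /(near_eq_is_derive near0) H; rewrite derive_val.
by move=> x Mx; apply: out; lra.
Unshelve. all: by end_near.
Qed.

Section Family.
Variable B : nat -> R -> R.
Hypothesis BB : bump_family B.

Lemma bump_family_continuous n : continuous (B n).
Proof. by move=> x; apply: der_continuous (BB.1 n x). Qed.

Lemma measurable_bump_family n : measurable_fun setT (B n).
Proof. by apply: continuous_measurable_fun; exact: bump_family_continuous. Qed.

Lemma bump_family_bounded n : exists2 K, 0 <= K & forall x, `|B n x| <= K.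
Proof.
have [M BM] := BB.2.
have [||K _ H] := @EVT_max R (fun x => `|B n x|) (- (`|M| + 1)) (`|M| + 1).
- by have := normr_ge0 M; lra.
- by apply: continuous_subspaceT => x; apply: cont_norm; exact: bump_family_continuous.
exists `|B n K| => // x.
have [xM|xM] := boolP (x \in `[(- (`|M| + 1)), (`|M| + 1)]); first exact: H.
rewrite BM ?normr0//; move: xM; rewrite in_itv/= -ler_norml -ltNge.
by have := ler_norm M; lra.
Qed.

End Family.

End Smooth1D.

(** * Integration by parts for compactly supported functions *)

Section CompactSupport.
Variable R : realType.
Notation mu := (@lebesgue_measure R).
Notation mR := (measurableTypeR R).
Implicit Types (f F : R -> R) (B : nat -> R -> R).

Lemma integral_fin_support f (a b : R) : (forall x, x \notin `[a, b] -> f x = 0) ->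
  (\int[mu]_x (f x)%:E = \int[mu]_(x in `[a, b]) (f x)%:E)%E.
Proof.
move=> fab; rewrite [RHS]integral_mkcond; apply: eq_integral => x _.
rewrite patchE; case: ifPn => //; rewrite notin_setE/= => xab.
by rewrite fab//; exact/negP.
Qed.

Lemma FTC_itv F f (a b : R) : a < b -> (forall x : R, is_derive x 1 F (f x)) -> continuous f ->
  (\int[mu]_(x in `[a, b]) (f x)%:E = (F b - F a)%:E)%E.
Proof.
move=> ab dF cf.
have cF : continuous F by move=> x; exact: der_continuous (dF x).
rewrite (continuous_FTC2 (F := F))//.
- by apply: continuous_subspaceT.
- split; first by move=> x _; have [] := dF x.
  + by apply: cvg_at_right_filter; exact: cF.
  + by apply: cvg_at_left_filter; exact: cF.
- by move=> x _; rewrite derive1E; have H := dF x; rewrite derive_val.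
Qed.

Lemma Rintegral_derive0 F f M : (forall x : R, is_derive x 1 F (f x)) -> continuous f ->
  (forall x, M <= `|x| -> F x = 0) -> (forall x, M <= `|x| -> f x = 0) -> (\int[mu]_x f x)%R = 0.
Proof.
move=> dF cf F0 f0; rewrite /Rintegral (@integral_fin_support _ (- (`|M| + 1)) (`|M| + 1)).
  rewrite (FTC_itv _ dF cf); last by have := normr_ge0 M; lra.
  have M1 : M <= `|M| + 1 by have := ler_norm M; lra.
  have M0 : 0 <= `|M| + 1 by have := normr_ge0 M; lra.
  by rewrite !F0 ?subrr// ?normrN ger0_norm.
move=> x; rewrite in_itv/= -ler_norml -ltNge => xM; apply: f0.
by have := ler_norm M; lra.
Qed.

Definition future (t : R) : R := (0 < t)%R%:R.

Lemma measurable_future : measurable_fun setT future.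
Proof.
rewrite (_ : future = \1_(`]0, +oo[%classic : set R)); first exact: measurable_indic.
apply/funext => t; rewrite /future indicE; case: (boolP (0 < t)) => H.
  by rewrite mem_set//= in_itv/= H.
by rewrite memNset//= in_itv/= andbT; exact/negP.
Qed.

Lemma future_le1 t : `|future t| <= 1.
Proof. by rewrite /future; case: (0 < t); rewrite ?normr1 ?normr0. Qed.

Lemma Rintegral_future_derive F f M : (forall x : R, is_derive x 1 F (f x)) -> continuous f ->
  (forall x, M <= `|x| -> F x = 0) -> (forall x, M <= `|x| -> f x = 0) ->
  (\int[mu]_x (future x * f x))%R = - F 0.
Proof.
move=> dF cf F0 f0; rewrite /Rintegral; set N := `|M| + 1.
have M1 : M <= N by rewrite /N; have := ler_norm M; lra.
have N0 : 0 < N by rewrite /N; have := normr_ge0 M; lra.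
have -> : (\int[mu]_x (future x * f x)%:E = \int[mu]_(x in `[0%R, N]) (f x)%:E)%E.
  rewrite -integral_itv_obnd_cbnd; last first.
    by apply: measurable_funTS; apply/measurable_EFinP; exact: continuous_measurable_fun.
  rewrite [RHS]integral_mkcond; apply: eq_integral => x _.
  rewrite patchE; case: ifPn => [|]; first by rewrite inE/= in_itv/= /future => /andP[-> _]; rewrite mul1r.
  rewrite notin_setE/= in_itv/= => /negP; rewrite negb_and /future => /orP[/negbTE ->|]; first by rewrite mul0r.
  by rewrite -ltNge => Nx; rewrite f0 ?mulr0//; have := ler_norm (x : R); lra.
by rewrite (FTC_itv N0 dF cf) (F0 N) ?sub0r// ger0_norm// ltW.
Qed.

Lemma integrable_fin_support f (K M : R) : measurable_fun setT f -> (forall x, `|f x| <= K) ->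
  (forall x, M <= `|x| -> f x = 0) -> mu.-integrable setT (EFin \o f).
Proof.
move=> mf fK f0.
pose g : R -> R := fun x => `|K| * \1_(`[- M, M]%classic : set R) x.
apply: (@le_integrable_EFin _ mR _ _ f g) => //.
  have mi : measurable_fun setT (\1_(`[- M, M]%classic : set R) : R -> R) by exact: measurable_indic.
  apply: (@ge0_integrableP _ mR R mu g).
  - by rewrite /g; meas.
  - by move=> x; rewrite /g mulr_ge0.
  - rewrite (eq_integral (fun x : mR => `|K|%:E * (\1_(`[- M, M]%classic : set R) x)%:E)%E); last by move=> x _; rewrite EFinM.
    rewrite ge0_integralZlT; [|by []|by meas|by move=> x; rewrite lee_fin].
    rewrite [X in (_ * X < _)%E](_ : _ = mu `[- M, M]%classic); last by rewrite integral_indic// setIT.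
    rewrite (lebesgue_measure_itv `[- M, M])/=; case: ifP => _; last by rewrite mule0 ltry.
    by rewrite -EFinB -EFinM ltry.
move=> x; rewrite /g indicE; have [xM|xM] := boolP (x \in `[- M, M]).
  by rewrite mem_set// mulr1; apply: le_trans (fK x) (ler_norm _).
rewrite memNset ?mulr0; last exact/negP.
by rewrite f0 ?normr0//; move: xM; rewrite in_itv/= -ler_norml -ltNge => /ltW.
Qed.

Section Family.
Variable B : nat -> R -> R.
Hypothesis BB : bump_family B.
Let dB := BB.1.
Let mB := measurable_bump_family BB.

Lemma integrable_bump_family n : mu.-integrable setT (EFin \o B n).
Proof.
have [K _ BK] := @bump_family_bounded R _ BB n; have [M BM] := BB.2.
by apply: (integrable_fin_support (mB n) BK); exact: BM.
Qed.

Let dn n (x : R) : is_derive x 1 (B n) (B n.+1 x) := dB n x.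

(** Two integrations by parts at once: [B' cos(xi y) + xi B sin(xi y)] has compact support and
    derivative [B'' cos(xi y) + xi^2 B cos(xi y)]. *)
Lemma bump_cos_parts n (xi : R) :
  (\int[mu]_y (B n.+2 y * cos (xi * y)))%R = - xi ^+ 2 * \int[mu]_y (B n y * cos (xi * y)).
Proof.
have [M BM] := BB.2.
have ic k := integrable_bump_family k.
have mc : measurable_fun (setT : set mR) (fun y => xi * y) by meas.
have i1 := integrable_cos (ic n.+2) mc; have i2 := integrable_cos (ic n) mc.
have d1 := dn n; have d2 := dn n.+1.
have c0 := @bump_family_continuous R _ BB n; have c2 := @bump_family_continuous R _ BB n.+2.
have := @Rintegral_derive0 (fun y => B n.+1 y * cos (xi * y) + xi * (B n y * sin (xi * y)))
  (fun y => B n.+2 y * cos (xi * y) + xi ^+ 2 * (B n y * cos (xi * y))) M.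
have -> : (\int[mu]_y (B n.+2 y * cos (xi * y) + xi ^+ 2 * (B n y * cos (xi * y))))%R =
   \int[mu]_y (B n.+2 y * cos (xi * y)) + xi ^+ 2 * \int[mu]_y (B n y * cos (xi * y)).
  rewrite RintegralD//; first by rewrite RintegralZl.
  by have := integrableZl measurableT (xi ^+ 2) i2; apply: eq_integrable.
move=> H; have {}H := H _ _ _ _; rewrite mulNr; apply/eqP; rewrite -addr_eq0; apply/eqP; apply: H.
- by move=> x; apply: der1_eq; [der|rewrite /=; ring].
- by move=> x; cont.
- by move=> x Mx; rewrite !BM// !mul0r mulr0 addr0.
- by move=> x Mx; rewrite !BM// !mul0r mulr0 addr0.
Qed.

Lemma bump_sin_parts n (xi : R) :
  (\int[mu]_y (B n.+2 y * sin (xi * y)))%R = - xi ^+ 2 * \int[mu]_y (B n y * sin (xi * y)).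
Proof.
have [M BM] := BB.2.
have ic k := integrable_bump_family k.
have mc : measurable_fun (setT : set mR) (fun y => xi * y) by meas.
have i1 := integrable_sin (ic n.+2) mc; have i2 := integrable_sin (ic n) mc.
have d1 := dn n; have d2 := dn n.+1.
have c0 := @bump_family_continuous R _ BB n; have c2 := @bump_family_continuous R _ BB n.+2.
have := @Rintegral_derive0 (fun y => B n.+1 y * sin (xi * y) - xi * (B n y * cos (xi * y)))
  (fun y => B n.+2 y * sin (xi * y) + xi ^+ 2 * (B n y * sin (xi * y))) M.
have -> : (\int[mu]_y (B n.+2 y * sin (xi * y) + xi ^+ 2 * (B n y * sin (xi * y))))%R =
   \int[mu]_y (B n.+2 y * sin (xi * y)) + xi ^+ 2 * \int[mu]_y (B n y * sin (xi * y)).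
  rewrite RintegralD//; first by rewrite RintegralZl.
  by have := integrableZl measurableT (xi ^+ 2) i2; apply: eq_integrable.
move=> H; have {}H := H _ _ _ _; rewrite mulNr; apply/eqP; rewrite -addr_eq0; apply/eqP; apply: H.
- by move=> x; apply: der1_eq; [der|rewrite /=; ring].
- by move=> x; cont.
- by move=> x Mx; rewrite !BM// !mul0r mulr0 subr0.
- by move=> x Mx; rewrite !BM// !mul0r mulr0 addr0.
Qed.

(* d^2/dt^2 + r^2 against cos (t r) on the half line only sees the trace at 0. *)
Lemma bump_half_line_oscillator (r : R) :
  (\int[mu]_t (future t * B 2%N t * cos (t * r)) + r ^+ 2 * \int[mu]_t (future t * B 0%N t * cos (t * r)))%R = - B 1%N 0.
Proof.
have [M BM] := BB.2.
have mfu := measurable_future.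
have ic k : mu.-integrable setT (EFin \o (fun t => future t * B k t)).
  apply: (@eq_integrableT _ mR _ mu (fun t => B k t * future t)); first by move=> t; rewrite mulrC.
  by apply: (integrable_mul_bounded (M := 1) (integrable_bump_family k) mfu); exact: future_le1.
have mc : measurable_fun (setT : set mR) (fun y => y * r) by meas.
have i1 := integrable_cos (ic 2%N) mc; have i2 := integrable_cos (ic 0%N) mc.
have d1 := dn 0%N; have d2 := dn 1%N.
have c0 := @bump_family_continuous R _ BB 0; have c2 := @bump_family_continuous R _ BB 2.
have -> : - B 1%N 0 = - (B 1%N 0 * cos (0 * r) + r * (B 0%N 0 * sin (0 * r))).
  by rewrite mul0r cos0 sin0 !mulr0 mulr1 addr0.
have := @Rintegral_future_derive (fun t => B 1%N t * cos (t * r) + r * (B 0%N t * sin (t * r)))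
  (fun t => B 2%N t * cos (t * r) + r ^+ 2 * (B 0%N t * cos (t * r))) M.
move=> H; apply: etrans (H _ _ _ _).
- rewrite -RintegralZl// -RintegralD//; last by have := integrableZl measurableT (r ^+ 2) i2; apply: eq_integrable.
  by apply: eq_RintegralT => t; ring.
- by move=> x; apply: der1_eq; [der|rewrite /=; ring].
- by move=> x; cont.
- by move=> x Mx; rewrite !BM// !mul0r mulr0 addr0.
- by move=> x Mx; rewrite !BM// !mul0r mulr0 addr0.
Qed.

End Family.
End CompactSupport.

(** * Products of bumps as test functions on space-time *)

Section Tensor.
Variable R : realType.
Variables B1 B2 B3 : nat -> R -> R.
Hypotheses (BB1 : bump_family B1) (BB2 : bump_family B2) (BB3 : bump_family B3).

Definition tensor i j k (z : R * R * R) : R := B1 i z.1.1 * B2 j z.1.2 * B3 k z.2.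

Lemma is_derive_line (phi : R * R * R -> R) (z v : R * R * R) (a : R) :
  is_derive (0 : R) 1 (fun h : R => phi (h *: v + z)) a -> is_derive z v phi a.
Proof.
have E : (fun h : R => h^-1 *: ((phi \o shift z) (h *: v) - phi z)) =
         (fun h : R => h^-1 *: (((fun h : R => phi (h *: v + z)) \o shift 0) (h *: 1) - (fun h : R => phi (h *: v + z)) 0)).
  by apply/funext => h /=; rewrite addr0 scale0r add0r /GRing.scale/= mulr1.
by move=> [d1 d2]; split; [move: d1; rewrite /derivable E|move: d2; rewrite /derive E].
Qed.

Lemma is_derive_tensor i j k (z v : R * R * R) :
  is_derive z v (tensor i j k)
    (v.1.1 * tensor i.+1 j k z + v.1.2 * tensor i j.+1 k z + v.2 * tensor i j k.+1 z).
Proof.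
apply: is_derive_line; rewrite /tensor.
have d1 := BB1.1 i; have d2 := BB2.1 j; have d3 := BB3.1 k.
rewrite (_ : (fun h : R => _) = (fun h : R => B1 i (h * v.1.1 + z.1.1) * B2 j (h * v.1.2 + z.1.2) * B3 k (h * v.2 + z.2)))//.
by apply: der1_eq; [der|rewrite /= !mul0r !add0r; ring].
Qed.

Lemma continuous_tensor i j k : continuous (tensor i j k).
Proof.
have c1 := @bump_family_continuous R _ BB1 i; have c2 := @bump_family_continuous R _ BB2 j.
have c3 := @bump_family_continuous R _ BB3 k.
move=> z; rewrite /tensor.
apply: (@cont_mul R _ (fun z : R * R * R => B1 i z.1.1 * B2 j z.1.2)).
  apply: (@cont_mul R _ (fun z : R * R * R => B1 i z.1.1) (fun z : R * R * R => B2 j z.1.2)).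
    apply: (@cont_comp _ _ (B1 i) (fun z : R * R * R => z.1.1)); first exact: c1.
    apply: (@cont_fst (R * R * R)%type R R (fun z : R * R * R => z.1)).
    exact: (@cont_fst (R * R * R)%type (R * R)%type R (fun z : R * R * R => z) _ (@cont_id _ _)).
  apply: (@cont_comp _ _ (B2 j) (fun z : R * R * R => z.1.2)); first exact: c2.
  apply: (@cont_snd (R * R * R)%type R R (fun z : R * R * R => z.1)).
  exact: (@cont_fst (R * R * R)%type (R * R)%type R (fun z : R * R * R => z) _ (@cont_id _ _)).
apply: (@cont_comp _ _ (B3 k) (fun z : R * R * R => z.2)); first exact: c3.
exact: (@cont_snd (R * R * R)%type (R * R)%type R (fun z : R * R * R => z) _ (@cont_id _ _)).
Qed.

(** A directional derivative of a tensor is a combination of three tensors; linear combinations are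
    the smallest class stable under all directions, on which smoothness is proved by induction. *)
Inductive tensor_comb : (R * R * R -> R) -> Prop :=
| tensor_comb1 c i j k : tensor_comb (fun z => c * tensor i j k z)
| tensor_combD f g : tensor_comb f -> tensor_comb g -> tensor_comb (fun z => f z + g z).

Lemma tensor_comb_Ck f : tensor_comb f -> continuous f /\
  forall v, (forall z, derivable f z v) /\ tensor_comb ('D_v f).
Proof.
elim=> [c i j k|{}f g _ [cf df] _ [cg dg]].
  split; first by move=> z; apply: cont_mul; [exact: cont_cst|exact: continuous_tensor].
  move=> v; have D z : is_derive z v (fun z => c * tensor i j k z)
      ((c * v.1.1) * tensor i.+1 j k z + (c * v.1.2) * tensor i j.+1 k z + (c * v.2) * tensor i j k.+1 z).
    have := @is_deriveZ _ _ _ (tensor i j k) c z v _ (is_derive_tensor i j k z v).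
    by rewrite /GRing.scale/= !mulrDr !mulrA.
  split; first by move=> z; have [] := D z.
  rewrite (_ : 'D_v _ = (fun z => (c * v.1.1) * tensor i.+1 j k z + (c * v.1.2) * tensor i j.+1 k z + (c * v.2) * tensor i j k.+1 z)).
    by do 2 (apply: tensor_combD; last exact: tensor_comb1); exact: tensor_comb1.
  by apply/funext => z; have H := D z; rewrite derive_val.
split; first by move=> z; apply: continuousD; [exact: cf|exact: cg].
move=> v; have [df1 df2] := df v; have [dg1 dg2] := dg v; split.
  by move=> z; apply: derivableD.
rewrite (_ : 'D_v _ = (fun z => 'D_v f z + 'D_v g z)); first exact: tensor_combD.
by apply/funext => z; rewrite -deriveD.
Qed.

Lemma tensor_test_function : test_function (tensor 0%N 0%N 0%N).
Proof.
split.
  have : tensor_comb (fun z => 1 * tensor 0%N 0%N 0%N z) by exact: tensor_comb1.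
  rewrite (_ : (fun z => 1 * _) = tensor 0%N 0%N 0%N); last by apply/funext => z; rewrite mul1r.
  move: (tensor 0%N 0%N 0%N) => f Hf n; elim: n f Hf => [|n IH] f Hf; have [cf df] := tensor_comb_Ck Hf.
    by split.
  by split=> // v; have [df1 df2] := df v; split=> //; exact: IH.
have [M1 H1] := BB1.2; have [M2 H2] := BB2.2; have [M3 H3] := BB3.2.
pose K : set (R * R * R) := `[- M1, M1]%classic `*` `[- M2, M2]%classic `*` `[- M3, M3]%classic.
have cK : compact K by do 2 (apply: compact_setX; last exact: segment_compact); exact: segment_compact.
apply: (subclosed_compact _ cK); first exact: closed_closure.
have clK : closed K by apply: compact_closed => //; exact: norm_hausdorff.
have clE : closure K = K by apply/esym/closure_id.
rewrite -clE; apply: closure_subset => z /=.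
rewrite /tensor !mulf_eq0 !negb_or => /andP[/andP[h1 h2] h3].
have ab M (x : R) : ~~ (M <= `|x|) -> x \in `[- M, M] by rewrite -ltNge in_itv/= -ler_norml => /ltW.
split; [split|]; rewrite /=; apply: ab.
- by apply: contra h1 => /H1 ->.
- by apply: contra h2 => /H2 ->.
- by apply: contra h3 => /H3 ->.
Qed.

Let D v i j k : 'D_v (tensor i j k) = fun z => v.1.1 * tensor i.+1 j k z + v.1.2 * tensor i j.+1 k z + v.2 * tensor i j k.+1 z.
Proof. by apply/funext => z; have H := is_derive_tensor i j k z v; rewrite derive_val. Qed.

Lemma derive_t_tensor i j k : 'D_(dir_t R) (tensor i j k) = tensor i j k.+1.
Proof. by rewrite D; apply/funext => z /=; rewrite !mul0r !add0r mul1r. Qed.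
Lemma derive_x1_tensor i j k : 'D_(dir_x1 R) (tensor i j k) = tensor i.+1 j k.
Proof. by rewrite D; apply/funext => z /=; rewrite !mul0r !addr0 mul1r. Qed.
Lemma derive_x2_tensor i j k : 'D_(dir_x2 R) (tensor i j k) = tensor i j.+1 k.
Proof. by rewrite D; apply/funext => z /=; rewrite !mul0r addr0 add0r mul1r. Qed.

Lemma box_tensor z : box (tensor 0%N 0%N 0%N) z = tensor 0%N 0%N 2%N z - (tensor 2%N 0%N 0%N z + tensor 0%N 2%N 0%N z).
Proof.
have E1 : 'D_(dir_t R) (tensor 0%N 0%N 1%N) z = tensor 0%N 0%N 2%N z := congr1 (fun f => f z) (derive_t_tensor 0 0 1).
have E2 : 'D_(dir_x1 R) (tensor 1%N 0%N 0%N) z = tensor 2%N 0%N 0%N z := congr1 (fun f => f z) (derive_x1_tensor 1 0 0).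
have E3 : 'D_(dir_x2 R) (tensor 0%N 1%N 0%N) z = tensor 0%N 2%N 0%N z := congr1 (fun f => f z) (derive_x2_tensor 0 1 0).
rewrite -E1 -E2 -E3.
rewrite -(derive_t_tensor 0 0 0).
rewrite -(derive_x1_tensor 0 0 0).
rewrite -(derive_x2_tensor 0 0 0).
reflexivity.
Qed.

End Tensor.

(** * Functions annihilated by all bumps *)

Lemma ae_imp d (T : measurableType d) (R : realType) (m : {measure set T -> \bar R}) (P Q : T -> Prop) :
  (forall x, P x -> Q x) -> {ae m, forall x, P x} -> {ae m, forall x, Q x}.
Proof. by move=> PQ; apply: filterS. Qed.

Section ZeroOnGenerators.
Context d (Y : measurableType d) (R : realType) (m : {measure set Y -> \bar R}).
Context d' (T : measurableType d').
Variables (f : Y -> R) (X : Y -> T).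
Hypotheses (fi : m.-integrable setT (EFin \o f)) (mX : measurable_fun setT X).

Lemma integrable_restrict (S : set T) : measurable S ->
  m.-integrable setT (EFin \o (fun y => f y * \1_S (X y))).
Proof.
move=> mS; apply: (integrable_mul_bounded (M := 1) fi).
  by apply: (measurableT_comp _ mX); exact: measurable_indic.
by move=> y; rewrite indicE; case: (_ \in _); rewrite ?normr1 ?normr0.
Qed.

Lemma integral_restrict (S : set T) : measurable S ->
  (\int[m]_(y in X @^-1` S) (f y)%:E = \int[m]_y (f y * \1_S (X y))%:E)%E.
Proof.
move=> mS; rewrite integral_mkcond; apply: eq_integral => y _.
rewrite patchE indicE; have [yS|yS] := boolP (X y \in S).
  by rewrite mem_set ?mulr1//; exact/set_mem.
by rewrite memNset ?mulr0//; move: yS; rewrite notin_setE.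
Qed.

(** Dynkin's theorem for the signed measure [f dm] transported by [X]. The vanishing of the total
    integral handles complements, and integrability of [f] handles countable disjoint unions. *)
Lemma integral_zero_on_generated (G : set (set T)) :
  d'.-measurable = <<s G >> -> setI_closed G ->
  (\int[m]_y (f y)%:E = 0)%E ->
  (forall S, G S -> \int[m]_y (f y * \1_S (X y))%:E = 0)%E ->
  forall S, measurable S -> (\int[m]_y (f y * \1_S (X y))%:E = 0)%E.
Proof.
move=> mG GI fT fG S; rewrite mG.
apply: (dynkin_induction (P := fun S => (\int[m]_y (f y * \1_S (X y))%:E = 0)%E) mG GI).
- rewrite -[RHS]fT; apply: eq_integral => y _.
  by rewrite indicE mem_set// mulr1.
- by move=> A GA; exact: fG.
- move=> A mA A0; have := integralB measurableT fi (integrable_restrict mA).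
  rewrite fT; under [X in (_ = _ - X)%E]eq_integral do rewrite /=.
  rewrite A0 sube0 => <-; apply: eq_integral => y _ /=.
  by rewrite -EFinB !indicE in_setC; case: (_ \in _); rewrite ?mulr1 ?mulr0 ?subr0 ?subrr.
- move=> F mF tF F0.
  rewrite -integral_restrict; last exact: bigcup_measurable.
  rewrite preimage_bigcup integral_bigcup.
  + by apply: eseries0 => i _ _; rewrite integral_restrict.
  + apply/trivIsetP => i j _ _ ij; rewrite -preimage_setI.
    by move/trivIsetP : tF => -> //; rewrite preimage_set0.
  + by move=> k; rewrite -[X in measurable X]setTI; exact: mX.
  + by apply: integrableS fi => //; apply: bigcup_measurable => k _; rewrite -[X in measurable X]setTI; exact: mX.
Qed.

End ZeroOnGenerators.

Lemma setI_closed_rectangles d1 d2 (T1 : measurableType d1) (T2 : measurableType d2) :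
  setI_closed [set A `*` B | A in @measurable d1 T1 & B in @measurable d2 T2].
Proof.
move=> _ _ [A mA] [B mB] <- [A' mA'] [B' mB'] <-.
by exists (A `&` A'); [exact: measurableI|exists (B `&` B'); [exact: measurableI|rewrite setXI]].
Qed.

Section FundamentalLemma.
Variable R : realType.
Notation mu := (@lebesgue_measure R).
Notation mR := (measurableTypeR R).
Notation L2 := (sfprod mu mu).
Notation L3 := (sfprod L2 mu).

Definition window (N x : R) : R := (`|x| <= N)%R%:R.

Definition cube (N : R) (z : R * R * R) : R := window N z.1.1 * window N z.1.2 * window N z.2.

(** Rays form a pi-system. Since [f] vanishes where [X <= - N], the ray starting at [- N] already
    gives the total integral. *)
Lemma integral_zero_on_rays d (Y : measurableType d) (m : {measure set Y -> \bar R}) (f X : Y -> R) (N : R) :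
  m.-integrable setT (EFin \o f) -> measurable_fun setT X -> (forall y, X y <= - N -> f y = 0) ->
  (forall a, \int[m]_y (f y * \1_(`]a, +oo[%classic : set R) (X y))%:E = 0)%E ->
  forall S : set R, measurable S -> (\int[m]_y (f y * \1_S (X y))%:E = 0)%E.
Proof.
move=> fi mX fN f0.
apply: (@integral_zero_on_generated _ Y R m _ mR f X fi mX (@RGenOInfty.G R)).
- exact: RGenOInfty.measurableE.
- move=> _ _ [a ->] [b ->]; exists (Num.max a b); apply/seteqP; split=> x /=.
    by rewrite !in_itv/= !andbT gt_max => -[-> ->].
  by rewrite !in_itv/= !andbT gt_max => /andP.
- rewrite -[RHS](f0 (- N)); apply: eq_integral => y _.
  have [yN|yN] := leP (X y) (- N); first by rewrite fN// mul0r.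
  by rewrite indicE mem_set ?mulr1//= in_itv/= yN.
- by move=> _ [a ->].
Qed.

(** Rays are exchanged for Borel sets one coordinate at a time; two more monotone class arguments
    pass from rectangles to the sets of the product sigma-algebras. *)
Lemma ae0_of_rays (f : R * R * R -> R) (N : R) : L3.-integrable setT (EFin \o f) ->
  (forall z, z.1.1 <= - N \/ z.1.2 <= - N \/ z.2 <= - N -> f z = 0) ->
  (forall a1 a2 a3, \int[L3]_z (f z * (\1_(`]a1, +oo[%classic : set R) z.1.1 *
     (\1_(`]a2, +oo[%classic : set R) z.1.2 * \1_(`]a3, +oo[%classic : set R) z.2)))%:E = 0)%E ->
  {ae L3, forall z, f z = 0}.
Proof.
move=> fi fN f0.
pose Y := (mR * mR * mR)%type.
have m1 : measurable_fun (setT : set Y) (fun z : Y => z.1.1) by meas.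
have m2 : measurable_fun (setT : set Y) (fun z : Y => z.1.2) by meas.
have m3 : measurable_fun (setT : set Y) (fun z : Y => z.2) by meas.
have m12 : measurable_fun (setT : set Y) (fun z : Y => z.1) by meas.
have mray a : measurable (`]a, +oo[%classic : set R) by exact: measurable_itv.
pose r a : set R := `]a, +oo[%classic.
have i3 A3 : measurable A3 -> L3.-integrable setT (EFin \o (fun z => f z * \1_A3 z.2)).
  by move=> mA; exact: (integrable_restrict fi m3).
have i23 A2 A3 : measurable A2 -> measurable A3 ->
    L3.-integrable setT (EFin \o (fun z => f z * \1_A3 z.2 * \1_A2 z.1.2)).
  by move=> mA2 mA3; exact: (integrable_restrict (i3 _ mA3) m2).
have i13 A1 A3 : measurable A1 -> measurable A3 ->
    L3.-integrable setT (EFin \o (fun z => f z * \1_A3 z.2 * \1_A1 z.1.1)).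
  by move=> mA1 mA3; exact: (integrable_restrict (i3 _ mA3) m1).
have i12 A1 A2 : measurable A1 -> measurable A2 ->
    L3.-integrable setT (EFin \o (fun z => f z * \1_A1 z.1.1 * \1_A2 z.1.2)).
  by move=> mA1 mA2; exact: (integrable_restrict (integrable_restrict fi m1 mA1) m2).
have s1 A1 : measurable A1 -> forall a2 a3,
    (\int[L3]_z (f z * \1_(r a3) z.2 * \1_(r a2) z.1.2 * \1_A1 z.1.1)%:E = 0)%E.
  move=> mA1 a2 a3; apply: (@integral_zero_on_rays _ Y L3 (fun z => f z * \1_(r a3) z.2 * \1_(r a2) z.1.2) (fun z => z.1.1) N) => //.
  - by apply: i23; exact: mray.
  - by move=> z zN; rewrite fN ?mul0r//; left.
  - by move=> a; rewrite -[RHS](f0 a a2 a3); apply: eq_integral => z _; congr EFin; rewrite /r; ring.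
have s2 A1 A2 : measurable A1 -> measurable A2 -> forall a3,
    (\int[L3]_z (f z * \1_(r a3) z.2 * \1_A1 z.1.1 * \1_A2 z.1.2)%:E = 0)%E.
  move=> mA1 mA2 a3; apply: (@integral_zero_on_rays _ Y L3 (fun z => f z * \1_(r a3) z.2 * \1_A1 z.1.1) (fun z => z.1.2) N) => //.
  - by apply: i13 => //; exact: mray.
  - by move=> z zN; rewrite fN ?mul0r//; right; left.
  - by move=> a; rewrite -[RHS](s1 _ mA1 a a3); apply: eq_integral => z _; congr EFin; rewrite /r; ring.
have s3 A1 A2 A3 : measurable A1 -> measurable A2 -> measurable A3 ->
    (\int[L3]_z (f z * \1_A1 z.1.1 * \1_A2 z.1.2 * \1_A3 z.2)%:E = 0)%E.
  move=> mA1 mA2 mA3; apply: (@integral_zero_on_rays _ Y L3 (fun z => f z * \1_A1 z.1.1 * \1_A2 z.1.2) (fun z => z.2) N) => //.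
  - exact: i12.
  - by move=> z zN; rewrite fN ?mul0r//; right; right.
  - by move=> a; rewrite -[RHS](s2 _ _ mA1 mA2 a); apply: eq_integral => z _; congr EFin; rewrite /r; ring.
have indX d1 d2 (T1 : measurableType d1) (T2 : measurableType d2) (A : set T1) (B : set T2) (z : T1 * T2) :
    \1_(A `*` B) z = \1_A z.1 * \1_B z.2 :> R.
  by rewrite !indicE -natrM mulnb; congr (nat_of_bool _)%:R; rewrite in_setX.
have s4 (S : set (mR * mR)) A3 : measurable S -> measurable A3 ->
    (\int[L3]_z (f z * \1_A3 z.2 * \1_S z.1)%:E = 0)%E.
  move=> mS mA3; have SI := @setI_closed_rectangles _ _ mR mR; have GE := measurable_prod_measurableType mR mR.
  apply: (@integral_zero_on_generated _ Y R L3 _ (mR * mR)%type (fun z => f z * \1_A3 z.2) (fun z => z.1) (i3 _ mA3) m12 _ GE SI) => //.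
  - apply: etrans (s3 _ _ _ measurableT measurableT mA3); apply: eq_integral => z _.
    by rewrite !indicE !in_setT !mulr1.
  - move=> _ [A mA] [B mB] <-; apply: etrans (s3 _ _ _ mA mB mA3); apply: eq_integral => z _.
    by rewrite indX; congr EFin; ring.
have s5 (S : set Y) : measurable S -> (\int[L3]_z (f z * \1_S z)%:E = 0)%E.
  move=> mS; have SI := @setI_closed_rectangles _ _ (mR * mR)%type mR; have GE := measurable_prod_measurableType (mR * mR)%type mR.
  apply: (@integral_zero_on_generated _ Y R L3 _ Y f (fun z => z) fi _ _ GE SI) => //.
  - apply: etrans (s4 _ _ measurableT measurableT); apply: eq_integral => z _.
    by rewrite !indicE !in_setT !mulr1.
  - move=> _ [A mA] [B mB] <-; apply: etrans (s4 _ _ mA mB); apply: eq_integral => z _.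
    by rewrite indX; congr EFin; ring.
have := integral_ae_eq measurableT fi (measurable_cst (0%E : \bar R)).
move=> H; have {}H := H _; apply: filterS (H _) => [z /(_ I) /= []//|E _ mE].
rewrite integral0 -[RHS](s5 E mE); exact: (@integral_restrict _ Y R L3 _ Y f (fun z => z)).
Qed.

(** Bumps converge boundedly to indicators of open intervals, so [W] has zero integral over all open
    boxes, and monotone class arguments apply on each bounded cube. *)
Lemma ae0_of_bumps (W : R * R * R -> R) : measurable_fun (setT : set (mR * mR * mR)) W ->
  (forall N, L3.-integrable setT (EFin \o (fun z => W z * cube N z))) ->
  (forall B1 B2 B3 : nat -> R -> R, bump_family B1 -> bump_family B2 -> bump_family B3 ->
     (\int[L3]_z (W z * (B1 0%N z.1.1 * B2 0%N z.1.2 * B3 0%N z.2)))%R = 0) ->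
  {ae L3, forall z, W z = 0}.
Proof.
move=> mW Wi W0.
have far (a b x N : R) : `|a| + `|b| <= N -> N < `|x| -> x <= a \/ b <= x.
  have a1 := ler_norm (- a); have b1 := ler_norm b; have a0 := normr_ge0 a; have b0 := normr_ge0 b.
  rewrite normrN in a1; move: a1 b1 a0 b0; clear => a1 b1 a0 b0 abN.
  by case: (lerP 0 x) => x0; [rewrite (ger0_norm x0); right|rewrite (ltr0_norm x0); left]; lra.
pose Y := (mR * mR * mR)%type.
pose I N : set R := `](- N), N[%classic.
have mI (a b : R) : measurable (`]a, b[%classic : set R) by exact: measurable_itv.
have ind_norm (A : set R) x : `|\1_A x| <= 1 :> R.
  by rewrite indicE; case: (_ \in _); rewrite ?normr1 ?normr0.
have mind (A : set R) : measurable A -> measurable_fun (setT : set mR) (\1_A : R -> R).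
  by move=> mA; exact: measurable_indic.
have cubeI N (x : R) : \1_(I N) x = \1_(I N) x * window N x :> R.
  rewrite indicE; have [|_] := boolP (x \in I N); last by rewrite mul0r.
  by move=> /set_mem; rewrite /I/= in_itv/= -ltr_norml /window => /ltW ->; rewrite mulr1.
(* Cut off to an open cube, [W] vanishes far to the left in each coordinate, and a ray meets the
   cube in an open interval, which is where the bumps have their limit. *)
pose f N z := W z * (\1_(I N) z.1.1 * \1_(I N) z.1.2 * \1_(I N) z.2).
have fi N : L3.-integrable setT (EFin \o f N).
  have mIN := mind _ (mI (- N) N).
  apply: (@eq_integrableT _ Y R L3 (fun z => W z * cube N z * (\1_(I N) z.1.1 * \1_(I N) z.1.2 * \1_(I N) z.2))).
    by move=> z; rewrite /f /cube [in RHS](cubeI N z.1.1) [in RHS](cubeI N z.1.2) [in RHS](cubeI N z.2); ring.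
  apply: (integrable_mul_bounded (M := 1) (Wi N)); first by meas.
  move=> z; rewrite !normrM -[leRHS]mulr1 ler_pM ?mulr_ge0//.
  by rewrite -[leRHS]mulr1 ler_pM.
have box0 (a1 b1 a2 b2 a3 b3 : R) :
    (\int[L3]_z (W z * (\1_(`]a1, b1[%classic : set R) z.1.1 * \1_(`]a2, b2[%classic : set R) z.1.2 * \1_(`]a3, b3[%classic : set R) z.2))%:E = 0)%E.
  pose N := `|a1| + `|b1| + `|a2| + `|b2| + `|a3| + `|b3|.
  have c0 n : 0 < (n.+1%:R^-1 : R) by rewrite invr_gt0.
  have bump3_ge0 n (z : R * R * R) : 0 <= bump n.+1%:R^-1 a1 b1 z.1.1 * bump n.+1%:R^-1 a2 b2 z.1.2 * bump n.+1%:R^-1 a3 b3 z.2.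
    by do 2 (apply: mulr_ge0; last exact: bump_ge0); exact: bump_ge0.
  have bump3_le1 n (z : R * R * R) : bump n.+1%:R^-1 a1 b1 z.1.1 * bump n.+1%:R^-1 a2 b2 z.1.2 * bump n.+1%:R^-1 a3 b3 z.2 <= 1.
    have le1 := fun a b x => bump_le1 a b x (c0 n); have ge0 := @bump_ge0 R n.+1%:R^-1.
    apply: mulr_ile1; [by rewrite mulr_ge0|by []| |by []].
    by apply: mulr_ile1.
  have bumpw n a b x : `|a| + `|b| <= N -> bump n.+1%:R^-1 a b x = window N x * bump n.+1%:R^-1 a b x.
    move=> abN; rewrite /window; case: (lerP `|x| N) => xN; first by rewrite mul1r.
    by rewrite mul0r bump_out//; exact: far abN xN.
  have nn (x : R) : 0 <= `|x| :> R by exact: normr_ge0.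
  have bump3_cube n (z : R * R * R) : bump n.+1%:R^-1 a1 b1 z.1.1 * bump n.+1%:R^-1 a2 b2 z.1.2 * bump n.+1%:R^-1 a3 b3 z.2 =
     cube N z * (bump n.+1%:R^-1 a1 b1 z.1.1 * bump n.+1%:R^-1 a2 b2 z.1.2 * bump n.+1%:R^-1 a3 b3 z.2).
    have := nn a1; have := nn b1; have := nn a2; have := nn b2; have := nn a3; have := nn b3 => k1 k2 k3 k4 k5 k6.
    have E1 : bump n.+1%:R^-1 a1 b1 z.1.1 = window N z.1.1 * bump n.+1%:R^-1 a1 b1 z.1.1 by apply: bumpw; rewrite /N; clear - k1 k2 k3 k4 k5 k6; lra.
    have E2 : bump n.+1%:R^-1 a2 b2 z.1.2 = window N z.1.2 * bump n.+1%:R^-1 a2 b2 z.1.2 by apply: bumpw; rewrite /N; clear - k1 k2 k3 k4 k5 k6; lra.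
    have E3 : bump n.+1%:R^-1 a3 b3 z.2 = window N z.2 * bump n.+1%:R^-1 a3 b3 z.2 by apply: bumpw; rewrite /N; clear - k1 k2 k3 k4 k5 k6; lra.
    by rewrite [in LHS]E1 [in LHS]E2 [in LHS]E3 /cube; ring.
  pose g n (z : Y) := (W z * (bump n.+1%:R^-1 a1 b1 z.1.1 * bump n.+1%:R^-1 a2 b2 z.1.2 * bump n.+1%:R^-1 a3 b3 z.2))%:E.
  have mb c a b : measurable_fun (setT : set mR) (bump c a b).
    have mfl : measurable_fun (setT : set mR) (flat c 0).
      rewrite /flat; apply: measurable_fun_if => //.
      - by apply: measurable_fun_ltr.
      - by apply: measurable_funTS; rewrite /=; meas.
    by rewrite /bump; meas.
  have g0 n : (\int[L3]_z g n z = 0)%E.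
    have [B1 b1f B1E] := bump_familyE a1 b1 (c0 n).
    have [B2 b2f B2E] := bump_familyE a2 b2 (c0 n).
    have [B3 b3f B3E] := bump_familyE a3 b3 (c0 n).
    have := W0 _ _ _ b1f b2f b3f; rewrite B1E B2E B3E => H.
    rewrite /g -EFin_Rintegral; first by rewrite H.
    apply: (@eq_integrableT _ Y R L3 (fun z => W z * cube N z * (bump n.+1%:R^-1 a1 b1 z.1.1 * bump n.+1%:R^-1 a2 b2 z.1.2 * bump n.+1%:R^-1 a3 b3 z.2))); last first.
      apply: (integrable_mul_bounded (M := 1) (Wi N)).
        by have h1 := mb n.+1%:R^-1 a1 b1; have h2 := mb n.+1%:R^-1 a2 b2; have h3 := mb n.+1%:R^-1 a3 b3; meas.
      by move=> z; rewrite (ger0_norm (bump3_ge0 n z)); exact: bump3_le1.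
    by move=> z; rewrite -mulrA -bump3_cube.
  have gl z : g n z @[n --> \oo] --> (W z * (\1_(`]a1, b1[%classic : set R) z.1.1 * \1_(`]a2, b2[%classic : set R) z.1.2 * \1_(`]a3, b3[%classic : set R) z.2))%:E.
    apply: cvg_EFin; first by apply: nearW.
    apply: cvgM; first exact: cvg_cst.
    by apply: cvgM; [apply: cvgM|]; exact: bump_cvg.
  have := @dominated_convergence _ Y R L3 setT measurableT g (fun z => (W z * (\1_(`]a1, b1[%classic : set R) z.1.1 * \1_(`]a2, b2[%classic : set R) z.1.2 * \1_(`]a3, b3[%classic : set R) z.2))%:E) (fun z => (`|W z * cube N z|)%:E).
  case.
  - move=> n; rewrite /g; apply/measurable_EFinP.
    by have h1 := mb n.+1%:R^-1 a1 b1; have h2 := mb n.+1%:R^-1 a2 b2; have h3 := mb n.+1%:R^-1 a3 b3; meas.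
  - apply/measurable_EFinP; have h1 := mind _ (mI a1 b1); have h2 := mind _ (mI a2 b2); have h3 := mind _ (mI a3 b3).
    by meas.
  - by apply: aeW => z _; exact: gl.
  - exact: integrable_norm (Wi N).
  - apply: aeW => z n _; rewrite /g abse_EFin lee_fin bump3_cube mulrA normrM ler_piMr//.
    by rewrite (ger0_norm (bump3_ge0 n z)); exact: bump3_le1.
  - move=> _ _; under eq_fun do rewrite g0.
    by move=> /cvg_lim => /(_ (@ereal_hausdorff R)) <-; rewrite lim_cst//; exact: ereal_hausdorff.
have fray (N a x : R) : \1_(I N) x * \1_(`]a, +oo[%classic : set R) x = \1_(`](Num.max (- N) a), N[%classic : set R) x :> R.
  rewrite !indicE -natrM mulnb; congr (nat_of_bool _)%:R; apply/idP/idP.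
    by move=> /andP[/set_mem + /set_mem]; rewrite /I/= !in_itv/= andbT => /andP[h1 h2] h3; apply/mem_set; rewrite /= in_itv/= gt_max h1 h2 h3.
  by move=> /set_mem; rewrite /= in_itv/= gt_max => /andP[/andP[h1 h2] h3]; apply/andP; split; apply/mem_set; rewrite /I/= in_itv/= ?h1 ?h2 ?h3.
have fN0 (N x : R) : x <= - N -> \1_(I N) x = 0 :> R.
  by move=> xN; rewrite indicE memNset// /I/= in_itv/= ltNge xN.
(* Integer cubes suffice to cover space-time and involve only countably many null sets. *)
have : {ae L3, forall z, forall n : nat, f n%:R z = 0}.
  apply: ae_foralln => n; apply: (@ae0_of_rays (f n%:R) n%:R).
  - exact: fi.
  - by move=> z [|[|]] zN; rewrite /f (fN0 _ _ zN) ?(mul0r, mulr0).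
  - move=> a1 a2 a3; rewrite -[RHS](box0 (Num.max (- n%:R) a1) n%:R (Num.max (- n%:R) a2) n%:R (Num.max (- n%:R) a3) n%:R).
    by apply: eq_integral => z _; congr EFin; rewrite -!fray /f; ring.
apply: ae_imp => z zn.
pose M := `|z.1.1| + `|z.1.2| + `|z.2|.
have := archi_boundP (_ : 0 <= M); rewrite {1}/M !addr_ge0// => /(_ isT) MB.
have := zn (Num.bound M); rewrite /f.
have in1 x : `|x| <= M -> \1_(I (Num.bound M)%:R) x = 1 :> R.
  by move=> xM; rewrite indicE mem_set// /I/= in_itv/= -ltr_norml; exact: le_lt_trans MB.
rewrite !in1 ?mulr1//; have := normr_ge0 z.1.1; have := normr_ge0 z.1.2; have := normr_ge0 z.2; rewrite /M; clear; lra.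
Qed.

End FundamentalLemma.

(** * Uniqueness for the forward problem *)

Lemma is_derive_Rintegral d (Y : measurableType d) (R : realType) (m : {measure set Y -> \bar R})
    (f f' : R -> Y -> R) (a : R) (G : Y -> R) :
  (forall (s : R) y, is_derive s 1 (f^~ y) (f' s y)) ->
  (forall s, `|s - a| < 1 -> m.-integrable setT (EFin \o f s)) ->
  (forall s y, `|s - a| < 1 -> `|f' s y| <= G y) -> m.-integrable setT (EFin \o G) ->
  is_derive a 1 (fun s => \int[m]_y f s y)%R (\int[m]_y f' a y)%R.
Proof.
move=> df fi fG Gi.
have itv (s : R) : `](a - 1), (a + 1)[%classic s -> `|s - a| < 1.
  by rewrite /= in_itv/= ltr_norml => /andP[h1 h2]; apply/andP; split; lra.
have aI : `](a - 1), (a + 1)[%classic a by rewrite /= in_itv/=; apply/andP; split; lra.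
have pE s y : partial1of2 f s y = f' s y.
  by rewrite /partial1of2 derive1E; have H := df s y; rewrite derive_val.
have fi' s : `](a - 1), (a + 1)[%classic s -> m.-integrable setT (EFin \o f s) by move=> /itv; exact: fi.
have dfi s y : `](a - 1), (a + 1)[%classic s -> setT y -> derivable (f^~ y) s 1 by move=> _ _; have [] := df s y.
have G0 y : 0 <= G y by apply: le_trans (fG a y _); rewrite ?subrr ?normr0.
have Gub s y : `](a - 1), (a + 1)[%classic s -> setT y -> `|partial1of2 f s y| <= G y.
  by move=> /itv sa _; rewrite pE; exact: fG.
have := cvg_differentiation_under_integral measurableT aI fi' dfi G0 Gi Gub.
rewrite (_ : partial1of2 f a = f' a); last by apply/funext => y; exact: pE.
move=> H; have {}H : h^-1 *: (((fun s => \int[m]_y f s y)%R \o shift a) (h *: 1) - (fun s => \int[m]_y f s y)%R a) @[h --> 0^'] --> (\int[m]_y f' a y)%R.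
  by move: H; under eq_fun do rewrite -[X in X + a](mulr1); apply.
by split; [apply/cvg_ex; exists (\int[m]_y f' a y)%R|exact: cvg_lim H].
Qed.

Lemma Rintegral_eq0 d (T : measurableType d) (R : realType) (m : {measure set T -> \bar R}) (f : T -> R) :
  (forall x, f x = 0) -> Rintegral m setT f = 0.
Proof. by move=> f0; rewrite /Rintegral integral0_eq// => x _; rewrite f0. Qed.

Lemma abs_near (R : realDomainType) (x a r : R) : `|x - a| <= r -> r <= 1 -> `|x| <= `|a| + 1.
Proof.
move=> xa r1; rewrite -(subrK a x) [leRHS]addrC; apply: le_trans (ler_normD _ _) _.
by rewrite lerD2r (le_trans xa).
Qed.

Lemma line_lipschitz (R : realType) (f f' : R -> R) (K N a b : R) :
  (forall x : R, is_derive x 1 f (f' x)) -> (forall x, `|x| <= N -> `|f' x| <= K) ->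
  `|a| <= N -> `|b| <= N -> `|f a - f b| <= K * `|a - b|.
Proof.
move=> df fK; wlog ab : a b / a <= b.
  move=> H; have [ab|/ltW ba] := leP a b; first exact: H.
  by move=> aN bN; rewrite distrC (distrC a); exact: H.
move=> aN bN; have [|c cab E] := @MVT_segment R f f' a b ab (fun x _ => df x).
  by apply: continuous_subspaceT => x; exact: der_continuous (df x).
rewrite distrC E normrM (distrC a); apply: ler_wpM2r => //; apply: fK.
move: cab aN bN; rewrite in_itv/= !ler_norml => /andP[h1 h2] /andP[h3 h4] /andP[h5 h6].
by apply/andP; split; lra.
Qed.

(** * The squared positive part *)

Section Ramp.
Variable R : realType.

Definition ramp (s : R) : R := Num.max s 0.
(** Of class [C^1], which is enough for a weight that is differentiated once, with a derivative that
    is nonnegative. *)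
Definition sqramp (s : R) : R := ramp s ^+ 2.

Lemma ramp_ge0 s : 0 <= ramp s. Proof. by rewrite /ramp le_max lexx orbT. Qed.
Lemma ramp_le s : `|ramp s| <= `|s|.
Proof. by rewrite ger0_norm ?ramp_ge0// /ramp ge_max ler_norm normr_ge0. Qed.
Lemma ramp0 s : s <= 0 -> ramp s = 0. Proof. by move=> s0; rewrite /ramp max_r. Qed.
Lemma rampE s : 0 <= s -> ramp s = s. Proof. by move=> s0; rewrite /ramp max_l. Qed.

Lemma ramp_continuous : continuous ramp.
Proof.
rewrite (_ : ramp = fun s => 2^-1 * (s + `|s|)); last first.
  apply/funext => s; rewrite /ramp; case: (leP s 0) => s0; first by rewrite ler0_norm// subrr mulr0.
  by rewrite gtr0_norm//; field.
by move=> s; cont.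
Qed.

Lemma is_derive_sqramp (s : R) : is_derive s 1 sqramp (2 * ramp s).
Proof.
case: (ltgtP s 0) => s0.
- rewrite ramp0 ?mulr0; last exact: ltW.
  have := der_cst 0 s; apply: near_eq_is_derive; near=> y; rewrite /sqramp ramp0 ?expr0n//.
  by apply/ltW; near: y; exact: lt_nbhsl.
- rewrite rampE; last exact: ltW.
  have : is_derive s 1 (fun s : R => s ^+ 2) (2 * s) by apply: der1_eq; [der|rewrite /=; ring].
  apply: near_eq_is_derive; near=> y; rewrite /sqramp rampE//.
  by apply/ltW; near: y; exact: lt_nbhsr.
- rewrite s0 ramp0// mulr0; apply: (@is_derive0_of_sq_bound _ _ 1).
    by rewrite /sqramp ramp0// expr0n.
  move=> x; rewrite mul1r /sqramp normrX -[leRHS]real_normK ?num_real//.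
  by rewrite lerXn2r ?nnegrE//; exact: ramp_le.
Unshelve. all: by end_near.
Qed.

End Ramp.

Section Energy.
Variable R : realType.
Notation mu := (@lebesgue_measure R).
Notation mR := (measurableTypeR R).
Notation L2 := (sfprod mu mu).
Notation L3 := (sfprod L2 mu).
Notation R3 := (R * R * R)%type.
Notation mR3 := (mR * mR * mR)%type.

Definition in_cube (N : R) (z : R3) : Prop := [/\ `|z.1.1| <= N, `|z.1.2| <= N & `|z.2| <= N].

Lemma cube1 N z : in_cube N z -> cube N z = 1.
Proof. by case=> h1 h2 h3; rewrite /cube /window h1 h2 h3 !mulr1. Qed.

Lemma measurable_window N : measurable_fun (setT : set mR) (window N).
Proof.
rewrite (_ : window N = \1_(`[- N, N]%classic : set R)); first exact: measurable_indic.
apply/funext => x; rewrite /window indicE; case: (boolP (`|x| <= N)) => H.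
  by rewrite mem_set//= in_itv/= -ler_norml H.
by rewrite memNset//= in_itv/= -ler_norml; exact/negP.
Qed.

Lemma integrable_window N : mu.-integrable setT (EFin \o window N).
Proof.
apply: (@integrable_fin_support _ _ 1 (`|N| + 1)); first exact: measurable_window.
  by move=> x; rewrite /window; case: (`|x| <= N); rewrite ?normr1 ?normr0.
move=> x Nx; rewrite /window (_ : (`|x| <= N)%R = false)//; apply/negbTE; rewrite -ltNge.
by have := ler_norm N; lra.
Qed.

Lemma integrable_cube N : L3.-integrable setT (EFin \o cube N).
Proof. exact: (integrable_prod (integrable_prod (integrable_window N) (integrable_window N)) (integrable_window N)). Qed.

Section BoundedSupport.
Variables (D : R3 -> R) (N C : R).
Hypotheses (mD : measurable_fun (setT : set mR3) D) (DC : forall z, `|D z| <= C).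
Hypothesis D0 : forall z, ~ in_cube N z -> D z = 0.

Lemma integrable_bounded_cube : L3.-integrable setT (EFin \o D).
Proof.
have := integrable_mul_bounded (integrable_cube N) mD DC; apply: eq_integrableT => z.
have [zN|zN] := pselect (in_cube N z); first by rewrite cube1// mul1r.
by rewrite D0// mulr0.
Qed.

Let far (z : R3) x : N + 1 <= `|x| -> (x = z.1.1 \/ x = z.1.2 \/ x = z.2) -> D z = 0.
Proof.
move=> Nx [|[|]] xz; apply: D0 => -[h1 h2 h3].
- by move: h1; rewrite -xz; lra.
- by move: h2; rewrite -xz; lra.
- by move: h3; rewrite -xz; lra.
Qed.

Let mDc d (T : measurableType d) (a : T -> mR * mR) (b : T -> R) : measurable_fun setT a -> measurable_fun setT b ->
    measurable_fun setT (fun x => D (a x, b x)).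
Proof. by move=> ma mb; exact: (measurableT_comp mD (measurable_fun_pair ma mb)). Qed.

(** The use is for derivatives in [t] of compactly supported functions, whose integral along each
    vertical line is zero. The two lemmas for the space directions play the same part. *)
Lemma Rintegral_line_t : (forall x, \int[mu]_t D (x, t) = 0)%R -> (\int[L3]_z D z = 0)%R.
Proof.
move=> H; apply: (@etrans _ _ (\int[L2]_x \int[mu]_t D (x, t))%R); last exact: Rintegral_eq0.
apply: etrans (@Rintegral_Fubini1 _ _ _ _ R L2 mu (fun x t => D (x, t)) _ _).
- by apply: eq_RintegralT => -[].
- by apply: eq_integrableT integrable_bounded_cube => -[].
- move=> x; apply: (integrable_fin_support (K := C) (M := N + 1)); [by apply: mDc; meas|by []|].
  by move=> t Nt; apply: (far Nt); right; right.
Qed.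

Let slice_integrable t : L2.-integrable setT (EFin \o (fun x => D (x, t))).
Proof.
have m1 : measurable_fun (setT : set (mR * mR)) (fun x => D (x, t)) by apply: mDc; meas.
have := integrable_mul_bounded (integrable_prod (integrable_window N) (integrable_window N)) m1 (fun x => DC (x, t)).
apply: eq_integrableT => x; rewrite /window.
have [h1|h1] := leP `|x.1| N; last by rewrite !mul0r D0// => -[/= + _]; rewrite leNgt h1.
have [h2|h2] := leP `|x.2| N; last by rewrite mulr0 mul0r D0// => -[/= _]; rewrite leNgt h2.
by rewrite !mul1r.
Qed.

Lemma Rintegral_line_x1 : (forall x2 t, \int[mu]_x1 D ((x1, x2), t) = 0)%R -> (\int[L3]_z D z = 0)%R.
Proof.
move=> H; apply: (@etrans _ _ (\int[mu]_t \int[L2]_x D (x, t))%R); last first.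
  apply: Rintegral_eq0 => t.
  apply: (@etrans _ _ (\int[mu]_x2 \int[mu]_x1 D ((x1, x2), t))%R); last by apply: Rintegral_eq0 => x; exact: H.
  apply: etrans (@Rintegral_Fubini2 _ _ _ _ R mu mu (fun x1 x2 => D ((x1, x2), t)) _ _).
  - by apply: eq_RintegralT => -[].
  - by apply: eq_integrableT (slice_integrable t) => -[].
  - move=> x; apply: (integrable_fin_support (K := C) (M := N + 1)); [by apply: mDc; meas|by []|].
    by move=> s Ns; apply: (far Ns); left.
apply: etrans (@Rintegral_Fubini2 _ _ _ _ R L2 mu (fun x t => D (x, t)) _ _).
- by apply: eq_RintegralT => -[].
- by apply: eq_integrableT integrable_bounded_cube => -[].
- exact: slice_integrable.
Qed.

Lemma Rintegral_line_x2 : (forall x1 t, \int[mu]_x2 D ((x1, x2), t) = 0)%R -> (\int[L3]_z D z = 0)%R.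
Proof.
move=> H; apply: (@etrans _ _ (\int[mu]_t \int[L2]_x D (x, t))%R); last first.
  apply: Rintegral_eq0 => t.
  apply: (@etrans _ _ (\int[mu]_x1 \int[mu]_x2 D ((x1, x2), t))%R); last by apply: Rintegral_eq0 => x; exact: H.
  apply: etrans (@Rintegral_Fubini1 _ _ _ _ R mu mu (fun x1 x2 => D ((x1, x2), t)) _ _).
  - by apply: eq_RintegralT => -[].
  - by apply: eq_integrableT (slice_integrable t) => -[].
  - move=> x; apply: (integrable_fin_support (K := C) (M := N + 1)); [by apply: mDc; meas|by []|].
    by move=> s Ns; apply: (far Ns); right; left.
apply: etrans (@Rintegral_Fubini2 _ _ _ _ R L2 mu (fun x t => D (x, t)) _ _).
- by apply: eq_RintegralT => -[].
- by apply: eq_integrableT integrable_bounded_cube => -[].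
- exact: slice_integrable.
Qed.

End BoundedSupport.

Definition cube_bounded (f : R3 -> R) : Prop :=
  forall N, exists C, forall z, in_cube N z -> `|f z| <= C.

Lemma cube_boundedD f g : cube_bounded f -> cube_bounded g -> cube_bounded (fun z => f z + g z).
Proof.
move=> hf hg N; have [C1 h1] := hf N; have [C2 h2] := hg N; exists (C1 + C2) => z zN.
by apply: le_trans (ler_normD _ _) _; rewrite lerD ?h1 ?h2.
Qed.

Lemma cube_boundedM f g : cube_bounded f -> cube_bounded g -> cube_bounded (fun z => f z * g z).
Proof.
move=> hf hg N; have [C1 h1] := hf N; have [C2 h2] := hg N; exists (C1 * C2) => z zN.
by rewrite normrM ler_pM ?h1 ?h2.
Qed.

Lemma cube_bounded_cst c : cube_bounded (fun=> c).
Proof. by move=> N; exists `|c|. Qed.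

Lemma cube_boundedN f : cube_bounded f -> cube_bounded (fun z => - f z).
Proof. by move=> hf N; have [C h] := hf N; exists C => z zN; rewrite normrN h. Qed.

Lemma cube_bounded_le f g : cube_bounded f -> (forall z, `|g z| <= `|f z|) -> cube_bounded g.
Proof. by move=> hf gf N; have [C h] := hf N; exists C => z zN; apply: le_trans (gf z) (h z zN). Qed.

Lemma cube_bounded_t : cube_bounded (fun z => z.2).
Proof. by move=> N; exists N => z []. Qed.

(** Preferred to [|x|] because it is smooth at the origin and its gradient has length less than 1,
    with the explicit defect [1 - |x|^2 / jap^2 = 1 / jap^2]. *)
Definition jap (x : R * R) : R := Num.sqrt (1 + x.1 ^+ 2 + x.2 ^+ 2).

Lemma jap_gt0 x : 0 < jap x.
Proof. by rewrite sqrtr_gt0 -addrA ltr_pwDl// addr_ge0 ?sqr_ge0. Qed.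

Lemma jap_sq x : jap x ^+ 2 = 1 + x.1 ^+ 2 + x.2 ^+ 2.
Proof. by rewrite sqr_sqrtr// !addr_ge0 ?sqr_ge0. Qed.

Lemma jap_ge1 (x : R * R) : `|x.1| <= jap x.
Proof.
rewrite -[leLHS]sqrtr_sqr ler_sqrt; last by rewrite !addr_ge0 ?sqr_ge0.
by rewrite -addrA addrCA lerDl addr_ge0 ?sqr_ge0.
Qed.

Lemma jap_ge2 (x : R * R) : `|x.2| <= jap x.
Proof. by rewrite -[leLHS]sqrtr_sqr ler_sqrt ?lerDr ?addr_ge0 ?sqr_ge0// !addr_ge0 ?sqr_ge0. Qed.

Lemma jap_le (x : R * R) : jap x <= 1 + `|x.1| + `|x.2|.
Proof.
have n0 : 0 <= 1 + `|x.1| + `|x.2| by rewrite !addr_ge0.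
rewrite -[leRHS](ger0_norm n0) -sqrtr_sqr ler_sqrt ?sqr_ge0//.
rewrite -(real_normK (num_real x.1)) -(real_normK (num_real x.2)) -subr_ge0.
rewrite (_ : _ - _ = 2 * (`|x.1| + `|x.2| + `|x.1| * `|x.2|)); last by ring.
by rewrite mulr_ge0// !addr_ge0// mulr_ge0.
Qed.

Lemma bump_family_shift (B : nat -> R -> R) (s : R) : bump_family B -> bump_family (fun n x => B n (x - s)).
Proof.
move=> [dB [M BM]]; split.
  by move=> n x; have d := dB n; apply: der1_eq; [der|rewrite /=; ring].
exists (M + `|s|) => n x xM; apply: BM.
by have := lerB_dist x s; lra.
Qed.

(** * Mollifications of a weak solution supported in the future *)

Section Mollified.
Variable W : R3 -> R.
Hypothesis mW : measurable_fun (setT : set mR3) W.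
Hypothesis Wi : forall N, L3.-integrable setT (EFin \o (fun z => W z * cube N z)).
Hypothesis Wpast : forall z, z.2 <= 0 -> W z = 0.
Hypothesis Wbox : forall B1 B2 B3 : nat -> R -> R, bump_family B1 -> bump_family B2 -> bump_family B3 ->
  (\int[L3]_z (W z * (tensor B1 B2 B3 0%N 0%N 2%N z - (tensor B1 B2 B3 2%N 0%N 0%N z + tensor B1 B2 B3 0%N 2%N 0%N z))))%R = 0.

Variables B1 B2 B3 : nat -> R -> R.
Hypotheses (BB1 : bump_family B1) (BB2 : bump_family B2) (BB3 : bump_family B3).
Variable M : R.
Hypothesis M0 : 0 < M.
Hypotheses (H1 : forall n x, M <= `|x| -> B1 n x = 0) (H2 : forall n x, M <= `|x| -> B2 n x = 0)
  (H3 : forall n x, M <= `|x| -> B3 n x = 0).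

(** The indices count derivatives of the bumps. Differentiating in [z] raises an index and changes
    the sign, so the derivatives of mollifications are again mollifications. *)
Definition ker i j k (z y : R3) : R := B1 i (y.1.1 - z.1.1) * B2 j (y.1.2 - z.1.2) * B3 k (y.2 - z.2).
Definition moll i j k (z : R3) : R := (\int[L3]_y (W y * ker i j k z y))%R.

Let mB1 := measurable_bump_family BB1.
Let mB2 := measurable_bump_family BB2.
Let mB3 := measurable_bump_family BB3.

Lemma cube_ge0 N (z : R3) : 0 <= cube N z. Proof. by rewrite /cube /window -!natrM ler0n. Qed.

Lemma ker_bound i j k : exists2 C, 0 <= C & forall N z y, in_cube N z -> `|ker i j k z y| <= C * cube (N + M) y.
Proof.
have [C1 C10 h1] := @bump_family_bounded R _ BB1 i; have [C2 C20 h2] := @bump_family_bounded R _ BB2 j.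
have [C3 C30 h3] := @bump_family_bounded R _ BB3 k.
exists (C1 * C2 * C3); first by rewrite !mulr_ge0.
have far (a b N : R) : `|b| <= N -> N + M < `|a| -> M <= `|a - b|.
  by move=> bN aN; have := lerB_dist a b; lra.
move=> N z y [z1 z2 z3]; have [yN|yN] := pselect (in_cube (N + M) y).
  rewrite cube1// mulr1 /ker 2!normrM; apply: ler_pM; [by rewrite mulr_ge0|by []| |exact: h3].
  by apply: ler_pM.
apply: (@le_trans _ _ 0); last by rewrite !mulr_ge0// cube_ge0.
rewrite normr_le0; apply/eqP.
have [y1|y1] := leP `|y.1.1| (N + M); last by rewrite /ker H1 ?mul0r//; exact: (far _ _ N).
have [y2|y2] := leP `|y.1.2| (N + M); last by rewrite /ker H2 ?(mul0r, mulr0)//; exact: (far _ _ N).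
have [y3|y3] := leP `|y.2| (N + M); last by rewrite /ker H3 ?(mul0r, mulr0)//; exact: (far _ _ N).
by exfalso; apply: yN.
Qed.

Let radius (z : R3) : R := `|z.1.1| + `|z.1.2| + `|z.2|.
Let in_radius z e : 0 <= e -> in_cube (radius z + e) z.
Proof. by move=> e0; rewrite /in_cube /radius; have := normr_ge0 z.1.1; have := normr_ge0 z.1.2; have := normr_ge0 z.2; split; lra. Qed.

Let dom N C : L3.-integrable setT (EFin \o (fun y => C * `|W y * cube N y|)).
Proof.
have := integrableZl measurableT C (integrable_norm (Wi N)).
by apply: eq_integrable.
Qed.

Let wker_le i j k : exists2 C, 0 <= C & forall N z y, in_cube N z -> `|W y * ker i j k z y| <= C * `|W y * cube (N + M) y|.
Proof.
have [C C0 h] := ker_bound i j k; exists C => // N z y zN.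
rewrite (normrM (W y)) (normrM (W y)) mulrCA; apply: ler_wpM2l => //.
by rewrite (ger0_norm (cube_ge0 _ _)); exact: h.
Qed.

Let mker i j k z : measurable_fun (setT : set mR3) (fun y => W y * ker i j k z y).
Proof. by have m1 := mB1 i; have m2 := mB2 j; have m3 := mB3 k; rewrite /ker; meas. Qed.

Lemma integrable_ker i j k z : L3.-integrable setT (EFin \o (fun y => W y * ker i j k z y)).
Proof.
have [C C0 h] := wker_le i j k.
apply: (le_integrable_EFin (mker i j k z) (dom (radius z + 0 + M) C)) => y.
by apply: h; exact: in_radius.
Qed.

Lemma measurable_moll i j k : measurable_fun (setT : set mR3) (moll i j k).
Proof.
apply: (@measurable_Rintegral2 _ _ mR3 mR3 R L3 (fun z y => W y * ker i j k z y)).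
by have m1 := mB1 i; have m2 := mB2 j; have m3 := mB3 k; rewrite /ker; meas.
Qed.

Lemma moll_bounded i j k : cube_bounded (moll i j k).
Proof.
move=> N; have [C C0 h] := wker_le i j k.
exists (\int[L3]_y (C * `|W y * cube (N + M) y|))%R => z zN.
apply: le_trans (le_normr_Rintegral measurableT (integrable_ker i j k z)) _.
apply: le_Rintegral => //; [exact: integrable_norm (integrable_ker i j k z)|exact: dom|].
by move=> y _; exact: h.
Qed.

Let deriv (z : R -> R3) (a : R) (i j k i' j' k' : nat) :
  (forall (s : R) y, is_derive s 1 (fun s => ker i j k (z s) y) (- ker i' j' k' (z s) y)) ->
  (forall s, `|s - a| < 1 -> in_cube (radius (z a) + 1) (z s)) ->
  is_derive a 1 (fun s => moll i j k (z s)) (- moll i' j' k' (z a)).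
Proof.
move=> dz zs; have [C C0 h] := wker_le i' j' k'.
have := @is_derive_Rintegral _ mR3 R L3 (fun s y => W y * ker i j k (z s) y) (fun s y => - (W y * ker i' j' k' (z s) y)) a (fun y => C * `|W y * cube (radius (z a) + 1 + M) y|).
rewrite (_ : (\int[L3]_y - (W y * ker i' j' k' (z a) y))%R = - moll i' j' k' (z a)); last first.
  by rewrite /moll -mulN1r -RintegralZl//; [apply: eq_RintegralT => y; rewrite mulN1r|exact: integrable_ker].
apply.
- move=> s y; have d := dz s y; apply: der1_eq.
    by apply: (@der_mul R (fun _ => W y) (fun s => ker i j k (z s) y)); [exact: der_cst|exact: d].
  by rewrite mul0r add0r mulrN.
- by move=> s _; exact: integrable_ker.
- by move=> s y sa; rewrite normrN; apply: h; exact: zs.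
- exact: dom.
Qed.

Let near_norm (a s : R) : `|s - a| < 1 -> `|s| <= `|a| + 1.
Proof. by move=> sa; have := lerB_dist s a; lra. Qed.

Lemma is_derive_moll1 i j k x2 t (s : R) : is_derive s 1 (fun s => moll i j k ((s, x2), t)) (- moll i.+1 j k ((s, x2), t)).
Proof.
have d1 := BB1.1 i.
apply: (deriv (z := fun s => ((s, x2), t))).
  by move=> r y; rewrite /ker /=; apply: der1_eq; [der|rewrite /=; ring].
move=> r /near_norm rs; rewrite /in_cube /radius /=; have := normr_ge0 s; have := normr_ge0 x2; have := normr_ge0 t.
by split; lra.
Qed.

Lemma is_derive_moll2 i j k x1 t (s : R) : is_derive s 1 (fun s => moll i j k ((x1, s), t)) (- moll i j.+1 k ((x1, s), t)).
Proof.
have d1 := BB2.1 j.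
apply: (deriv (z := fun s => ((x1, s), t))).
  by move=> r y; rewrite /ker /=; apply: der1_eq; [der|rewrite /=; ring].
move=> r /near_norm rs; rewrite /in_cube /radius /=; have := normr_ge0 s; have := normr_ge0 x1; have := normr_ge0 t.
by split; lra.
Qed.

Lemma is_derive_moll3 i j k x (s : R) : is_derive s 1 (fun s => moll i j k (x, s)) (- moll i j k.+1 (x, s)).
Proof.
have d1 := BB3.1 k.
apply: (deriv (z := fun s => (x, s))).
  by move=> r y; rewrite /ker /=; apply: der1_eq; [der|rewrite /=; ring].
move=> r /near_norm rs; rewrite /in_cube /radius /=; have := normr_ge0 s; have := normr_ge0 x.1; have := normr_ge0 x.2.
by split; lra.
Qed.

Lemma moll_past i j k z : z.2 <= - M -> moll i j k z = 0.
Proof.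
move=> zM; apply: Rintegral_eq0 => y; have [y0|y0] := leP y.2 0; first by rewrite Wpast// mul0r.
by rewrite /ker H3 ?mulr0//; apply: le_trans (ler_norm _); lra.
Qed.

(** Translated bumps are again bumps, so the weak equation applies to the kernel centred at [z]. *)
Lemma moll_box z : moll 0%N 0%N 2%N z = moll 2%N 0%N 0%N z + moll 0%N 2%N 0%N z.
Proof.
apply/eqP; rewrite -subr_eq0; apply/eqP.
rewrite /moll -RintegralD//; [|exact: integrable_ker|exact: integrable_ker].
rewrite -RintegralB//; [|exact: integrable_ker|]; last first.
  by have := integrableD measurableT (integrable_ker 2%N 0%N 0%N z) (integrable_ker 0%N 2%N 0%N z); apply: eq_integrable.
rewrite -[RHS](Wbox (bump_family_shift z.1.1 BB1) (bump_family_shift z.1.2 BB2) (bump_family_shift z.2 BB3)).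
by apply: eq_RintegralT => y; rewrite /ker /tensor; ring.
Qed.

Lemma moll_lipschitz i j k N : exists2 K, 0 <= K & forall z z', in_cube N z -> in_cube N z' ->
  `|moll i j k z - moll i j k z'| <= K * (`|z.1.1 - z'.1.1| + `|z.1.2 - z'.1.2| + `|z.2 - z'.2|).
Proof.
have [K1 h1] := moll_bounded i.+1 j k N; have [K2 h2] := moll_bounded i j.+1 k N.
have [K3 h3] := moll_bounded i j k.+1 N.
exists (`|K1| + `|K2| + `|K3|); first by rewrite !addr_ge0.
move=> [[a1 a2] a3] [[b1 b2] b3] [/= a1N a2N a3N] [/= b1N b2N b3N].
have g1 : `|moll i j k (a1, a2, a3) - moll i j k (b1, a2, a3)| <= K1 * `|a1 - b1|.
  apply: (line_lipschitz (f := fun s => moll i j k ((s, a2), a3)) (is_derive_moll1 i j k a2 a3) _ a1N b1N).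
  by move=> x xN; rewrite normrN; exact: h1.
have g2 : `|moll i j k (b1, a2, a3) - moll i j k (b1, b2, a3)| <= K2 * `|a2 - b2|.
  apply: (line_lipschitz (f := fun s => moll i j k ((b1, s), a3)) (is_derive_moll2 i j k b1 a3) _ a2N b2N).
  by move=> x xN; rewrite normrN; exact: h2.
have g3 : `|moll i j k (b1, b2, a3) - moll i j k (b1, b2, b3)| <= K3 * `|a3 - b3|.
  apply: (line_lipschitz (f := fun s => moll i j k ((b1, b2), s)) (is_derive_moll3 i j k (b1, b2)) _ a3N b3N).
  by move=> x xN; rewrite normrN; exact: h3.
have tri : `|moll i j k (a1, a2, a3) - moll i j k (b1, b2, b3)| <= K1 * `|a1 - b1| + K2 * `|a2 - b2| + K3 * `|a3 - b3|.
  apply: le_trans (lerD (lerD g1 g2) g3).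
  rewrite (_ : _ - _ = (moll i j k (a1, a2, a3) - moll i j k (b1, a2, a3)) + (moll i j k (b1, a2, a3) - moll i j k (b1, b2, a3)) + (moll i j k (b1, b2, a3) - moll i j k (b1, b2, b3))); last by ring.
  by apply: le_trans (ler_normD _ _) _; rewrite lerD2r ler_normD.
apply: le_trans tri _.
have kk (K x y w : R) : K * `|x| <= `|K| * `|x| by move=> *; rewrite ler_wpM2r// ler_norm.
have up (K L x : R) : `|K| <= L -> K * `|x| <= L * `|x|.
  by move=> KL; rewrite ler_wpM2r//; apply: le_trans (ler_norm _) KL.
have L1 : `|K1| <= `|K1| + `|K2| + `|K3| by rewrite -addrA lerDl addr_ge0.
have L2' : `|K2| <= `|K1| + `|K2| + `|K3| by rewrite addrAC lerDr addr_ge0.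
have L3' : `|K3| <= `|K1| + `|K2| + `|K3| by rewrite lerDr addr_ge0.
by rewrite !mulrDr !lerD ?up.
Qed.

(** * The weighted energy identity *)

Section Weight.
Variable T : R.
(** Up to sign [P], [Q1], [Q2] are the derivatives of the mollification in [t], [x_1], [x_2], and
    [e] below is twice its energy density. [Dt], [D1], [D2] are the derivatives in these directions
    of [sqramp (arg z)] times [e], [2 P Q1] and [2 P Q2]. *)
Let P := moll 0%N 0%N 1%N.
Let Q1 := moll 1%N 0%N 0%N.
Let Q2 := moll 0%N 1%N 0%N.
Let arg (z : R3) : R := T - z.2 - jap z.1.
Let e z := P z * P z + Q1 z * Q1 z + Q2 z * Q2 z.
Let Dt z := - (2 * ramp (arg z)) * e z -
  sqramp (arg z) * (2 * (P z * moll 0%N 0%N 2%N z + Q1 z * moll 1%N 0%N 1%N z + Q2 z * moll 0%N 1%N 1%N z)).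
Let D1 z := - (2 * ramp (arg z)) * (z.1.1 / jap z.1) * (2 * (P z * Q1 z)) -
  sqramp (arg z) * (2 * (moll 1%N 0%N 1%N z * Q1 z + P z * moll 2%N 0%N 0%N z)).
Let D2 z := - (2 * ramp (arg z)) * (z.1.2 / jap z.1) * (2 * (P z * Q2 z)) -
  sqramp (arg z) * (2 * (moll 0%N 1%N 1%N z * Q2 z + P z * moll 0%N 2%N 0%N z)).

(* The energy flux through the level sets of the weight, which is coercive
   because these are spacelike. *)
Definition flux z := 2 * ramp (arg z) * (e z - 2 * (P z * (z.1.1 / jap z.1 * Q1 z + z.1.2 / jap z.1 * Q2 z))).

(** The mixed second derivatives cancel and the pure ones cancel by the wave equation; only the
    terms in which the weight is differentiated remain. *)
Lemma flux_div z : flux z = D1 z + D2 z - Dt z.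
Proof. by rewrite /flux /D1 /D2 /Dt /e moll_box; ring. Qed.

(** Completing the squares in [q1] and [q2] leaves [p^2 (1 - |x|^2 / jap^2)], which is
    [p^2 / jap^2]. *)
Lemma flux_ge z : 2 * ramp (arg z) * (P z ^+ 2 / jap z.1 ^+ 2) <= flux z.
Proof.
rewrite /flux; apply: ler_wpM2l; first by rewrite mulr_ge0// ramp_ge0.
have j0 := jap_gt0 z.1; have j2 := jap_sq z.1.
rewrite -subr_ge0 /e; move: (P z) (Q1 z) (Q2 z) => p q1 q2.
have -> : p * p + q1 * q1 + q2 * q2 - 2 * (p * (z.1.1 / jap z.1 * q1 + z.1.2 / jap z.1 * q2)) - p ^+ 2 / jap z.1 ^+ 2
   = (p * (z.1.1 / jap z.1) - q1) ^+ 2 + (p * (z.1.2 / jap z.1) - q2) ^+ 2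
     + p ^+ 2 * (jap z.1 ^+ 2 - (1 + z.1.1 ^+ 2 + z.1.2 ^+ 2)) / jap z.1 ^+ 2.
  by field; rewrite gt_eqF.
by rewrite j2 subrr mulr0 mul0r addr0 addr_ge0 ?sqr_ge0.
Qed.

Let N : R := `|T| + M + 1.

(** Where [t > - M] and the weight is positive, [jap x < T + M] and [- M < t < T]; this is the
    compact region left by the support in the future and by the weight. *)
Let outside z : ~ in_cube N z -> z.2 <= - M \/ arg z <= 0.
Proof.
move=> zN; have [zM|zM] := leP z.2 (- M); [by left|right].
have [//|a0] := leP (arg z) 0; exfalso; apply: zN.
have j1 := jap_ge1 z.1; have j2 := jap_ge2 z.1; have j0 := jap_gt0 z.1; have T0 := ler_norm T; have M0' := M0.
have T1 : 0 <= `|T| by exact: normr_ge0.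
have z2 : `|z.2| <= N by rewrite ler_norml /N; move: a0; rewrite /arg => a0; apply/andP; split; lra.
by split=> //; move: a0; rewrite /arg /N; lra.
Qed.

Let moll0 i j k z : z.2 <= - M -> moll i j k z = 0. Proof. exact: moll_past. Qed.

Let Dt0 z : ~ in_cube N z -> Dt z = 0.
Proof.
move=> /outside[zM|a0]; rewrite /Dt /e /P /Q1 /Q2; last by rewrite /sqramp ramp0// expr2 !(mulr0, mul0r, oppr0, addr0).
by rewrite !(moll0 _ _ _ zM) !(mulr0, mul0r, oppr0, addr0).
Qed.
Let D10 z : ~ in_cube N z -> D1 z = 0.
Proof.
move=> /outside[zM|a0]; rewrite /D1 /P /Q1; last by rewrite /sqramp ramp0// expr2 !(mulr0, mul0r, oppr0, addr0).
by rewrite !(moll0 _ _ _ zM) !(mulr0, mul0r, oppr0, addr0).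
Qed.
Let D20 z : ~ in_cube N z -> D2 z = 0.
Proof.
move=> /outside[zM|a0]; rewrite /D2 /P /Q2; last by rewrite /sqramp ramp0// expr2 !(mulr0, mul0r, oppr0, addr0).
by rewrite !(moll0 _ _ _ zM) !(mulr0, mul0r, oppr0, addr0).
Qed.

Let F0 (c : R3 -> R) z : (z.2 <= - M -> c z = 0) -> ~ in_cube N z -> sqramp (arg z) * c z = 0.
Proof. by move=> c0 /outside[/c0 ->|a0]; rewrite ?mulr0// /sqramp ramp0// expr2 !mul0r. Qed.

Let arg_bounded : cube_bounded arg.
Proof.
apply: cube_boundedD.
  by apply: cube_boundedD; [exact: cube_bounded_cst|apply: cube_boundedN; exact: cube_bounded_t].
apply: cube_boundedN => K; exists (1 + K + K) => z [z1 z2 _].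
by rewrite ger0_norm ?sqrtr_ge0//; apply: le_trans (jap_le z.1) _; lra.
Qed.

Let ramp_bounded : cube_bounded (fun z => ramp (arg z)).
Proof. by apply: cube_bounded_le arg_bounded _ => z; exact: ramp_le. Qed.

Let sqramp_bounded : cube_bounded (fun z => sqramp (arg z)).
Proof. by rewrite /sqramp; under eq_fun do rewrite expr2; apply: cube_boundedM. Qed.

Let slope1_bounded : cube_bounded (fun z => z.1.1 / jap z.1).
Proof.
apply: cube_bounded_le (cube_bounded_cst 1) _ => z; have j0 := jap_gt0 z.1.
by rewrite normrM normfV (gtr0_norm j0) normr1 ler_pdivrMr// mul1r jap_ge1.
Qed.

Let slope2_bounded : cube_bounded (fun z => z.1.2 / jap z.1).
Proof.
apply: cube_bounded_le (cube_bounded_cst 1) _ => z; have j0 := jap_gt0 z.1.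
by rewrite normrM normfV (gtr0_norm j0) normr1 ler_pdivrMr// mul1r jap_ge2.
Qed.

Ltac cb := repeat first [exact: moll_bounded | exact: ramp_bounded | exact: sqramp_bounded
  | exact: slope1_bounded | exact: slope2_bounded | exact: cube_bounded_cst
  | apply: cube_boundedM | apply: cube_boundedD | apply: cube_boundedN].

Let global (D : R3 -> R) : cube_bounded D -> (forall z, ~ in_cube N z -> D z = 0) -> exists C, forall z, `|D z| <= C.
Proof.
move=> Db D0; have [C h] := Db N; exists `|C| => z.
have [zN|zN] := pselect (in_cube N z); first by apply: le_trans (h z zN) (ler_norm _).
by rewrite D0// normr0.
Qed.

Let mramp : measurable_fun setT (@ramp R).
Proof. by apply: continuous_measurable_fun; exact: ramp_continuous. Qed.
Let msqramp : measurable_fun setT (@sqramp R).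
Proof. by rewrite /sqramp; meas. Qed.
Let mjap : measurable_fun (setT : set (mR * mR)) jap.
Proof. by rewrite /jap; meas. Qed.

Let mDt : measurable_fun (setT : set mR3) Dt.
Proof.
have m1 := measurable_moll 0%N 0%N 1%N; have m2 := measurable_moll 1%N 0%N 0%N; have m3 := measurable_moll 0%N 1%N 0%N.
have m4 := measurable_moll 0%N 0%N 2%N; have m5 := measurable_moll 1%N 0%N 1%N; have m6 := measurable_moll 0%N 1%N 1%N.
by rewrite /Dt /e /P /Q1 /Q2 /arg; meas.
Qed.
Let mD1 : measurable_fun (setT : set mR3) D1.
Proof.
have m1 := measurable_moll 0%N 0%N 1%N; have m2 := measurable_moll 1%N 0%N 0%N.
have m4 := measurable_moll 2%N 0%N 0%N; have m5 := measurable_moll 1%N 0%N 1%N.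
by rewrite /D1 /e /P /Q1 /Q2 /arg; meas.
Qed.
Let mD2 : measurable_fun (setT : set mR3) D2.
Proof.
have m1 := measurable_moll 0%N 0%N 1%N; have m2 := measurable_moll 0%N 1%N 0%N.
have m4 := measurable_moll 0%N 2%N 0%N; have m5 := measurable_moll 0%N 1%N 1%N.
by rewrite /D2 /e /P /Q1 /Q2 /arg; meas.
Qed.

Let bDt : cube_bounded Dt. Proof. by rewrite /Dt /e /P /Q1 /Q2; cb. Qed.
Let bD1 : cube_bounded D1. Proof. by rewrite /D1 /P /Q1; cb. Qed.
Let bD2 : cube_bounded D2. Proof. by rewrite /D2 /P /Q2; cb. Qed.

Let dsq := @is_derive_sqramp R.
Let cramp := @ramp_continuous R.
Let csqramp : continuous (@sqramp R).
Proof. by move=> s; exact: der_continuous (dsq s). Qed.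

Lemma integral_Dt : (\int[L3]_z Dt z)%R = 0.
Proof.
have [C DC] := global bDt Dt0.
apply: (Rintegral_line_t mDt DC Dt0) => x.
have d1 := is_derive_moll3 0%N 0%N 1%N x; have d2 := is_derive_moll3 1%N 0%N 0%N x; have d3 := is_derive_moll3 0%N 1%N 0%N x.
have c i j k : continuous (fun t => moll i j k (x, t)) by move=> t; exact: der_continuous (is_derive_moll3 i j k x t).
have c1 := c 0%N 0%N 1%N; have c2 := c 1%N 0%N 0%N; have c3 := c 0%N 1%N 0%N.
have c4 := c 0%N 0%N 2%N; have c5 := c 1%N 0%N 1%N; have c6 := c 0%N 1%N 1%N.
apply: (@Rintegral_derive0 R (fun t => sqramp (arg (x, t)) * e (x, t)) _ (N + 1)).
- move=> t; rewrite /e /P /Q1 /Q2 /arg /Dt /=; apply: der1_eq; [by der|rewrite /Dt /e /P /Q1 /Q2 /arg /=; ring].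
- by move=> t; rewrite /Dt /e /P /Q1 /Q2 /arg /=; cont.
- move=> t tN; apply: F0; last by case=> _ _ /=; lra.
  by move=> /moll0 h; rewrite /e /P /Q1 /Q2 !h !mul0r !addr0.
- by move=> t tN; apply: Dt0; case=> _ _ /=; lra.
Qed.

Let jap_line (s b : R) : 0 < 1 + s ^+ 2 + b ^+ 2.
Proof. by rewrite -addrA ltr_pwDl// addr_ge0 ?sqr_ge0. Qed.

Lemma integral_D1 : (\int[L3]_z D1 z)%R = 0.
Proof.
have [C DC] := global bD1 D10.
apply: (Rintegral_line_x1 mD1 DC D10) => x2 t.
have d1 := is_derive_moll1 0%N 0%N 1%N x2 t; have d2 := is_derive_moll1 1%N 0%N 0%N x2 t.
have c i j k : continuous (fun s => moll i j k ((s, x2), t)) by move=> s; exact: der_continuous (is_derive_moll1 i j k x2 t s).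
have c1 := c 0%N 0%N 1%N; have c2 := c 1%N 0%N 0%N; have c4 := c 2%N 0%N 0%N; have c5 := c 1%N 0%N 1%N.
apply: (@Rintegral_derive0 R (fun s => sqramp (arg ((s, x2), t)) * (2 * (P ((s, x2), t) * Q1 ((s, x2), t)))) _ (N + 1)).
- move=> s; have js : Num.sqrt (1 + s ^+ 2 + x2 ^+ 2) != 0 by rewrite gt_eqF// sqrtr_gt0.
  by rewrite /P /Q1 /arg /D1 /jap /=; apply: der1_eq; [der; exact: jap_line|rewrite /D1 /P /Q1 /arg /jap /=; field].
- move=> s; rewrite /D1 /P /Q1 /arg /jap /=; cont.
  by rewrite gt_eqF// sqrtr_gt0.
- move=> s sN; apply: (F0 (c := fun z => 2 * (P z * Q1 z))); last by case=> /=; lra.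
  by move=> /moll0 h; rewrite /P /Q1 !h !mulr0.
- by move=> s sN; apply: D10; case=> /=; lra.
Qed.

Lemma integral_D2 : (\int[L3]_z D2 z)%R = 0.
Proof.
have [C DC] := global bD2 D20.
apply: (Rintegral_line_x2 mD2 DC D20) => x1 t.
have d1 := is_derive_moll2 0%N 0%N 1%N x1 t; have d2 := is_derive_moll2 0%N 1%N 0%N x1 t.
have c i j k : continuous (fun s => moll i j k ((x1, s), t)) by move=> s; exact: der_continuous (is_derive_moll2 i j k x1 t s).
have c1 := c 0%N 0%N 1%N; have c2 := c 0%N 1%N 0%N; have c4 := c 0%N 2%N 0%N; have c5 := c 0%N 1%N 1%N.
apply: (@Rintegral_derive0 R (fun s => sqramp (arg ((x1, s), t)) * (2 * (P ((x1, s), t) * Q2 ((x1, s), t)))) _ (N + 1)).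
- move=> s; have js : Num.sqrt (1 + x1 ^+ 2 + s ^+ 2) != 0 by rewrite gt_eqF// sqrtr_gt0.
  by rewrite /P /Q2 /arg /D2 /jap /=; apply: der1_eq; [der; exact: jap_line|rewrite /D2 /P /Q2 /arg /jap /=; field].
- move=> s; rewrite /D2 /P /Q2 /arg /jap /=; cont.
  by rewrite gt_eqF// sqrtr_gt0.
- move=> s sN; apply: (F0 (c := fun z => 2 * (P z * Q2 z))); last by case=> /=; lra.
  by move=> /moll0 h; rewrite /P /Q2 !h !mulr0.
- by move=> s sN; apply: D20; case=> /=; lra.
Qed.

Lemma measurable_flux : measurable_fun (setT : set mR3) flux.
Proof.
have m1 := measurable_moll 0%N 0%N 1%N; have m2 := measurable_moll 1%N 0%N 0%N; have m3 := measurable_moll 0%N 1%N 0%N.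
by rewrite /flux /e /P /Q1 /Q2 /arg; meas.
Qed.

Lemma integral_flux : (\int[L3]_z (flux z)%:E = 0)%E.
Proof.
have [C1 DC1] := global bD1 D10; have [C2 DC2] := global bD2 D20; have [Ct DCt] := global bDt Dt0.
have i1 := integrable_bounded_cube mD1 DC1 D10; have i2 := integrable_bounded_cube mD2 DC2 D20.
have it := integrable_bounded_cube mDt DCt Dt0.
have i12 : L3.-integrable setT (EFin \o (fun z => D1 z + D2 z)).
  by have := integrableD measurableT i1 i2; apply: eq_integrable.
have i : L3.-integrable setT (EFin \o flux).
  apply: (@eq_integrableT _ mR3 R L3 (fun z => D1 z + D2 z - Dt z)); first by move=> z; rewrite flux_div.
  by have := integrableB measurableT i12 it; apply: eq_integrable.
rewrite -EFin_Rintegral//; congr EFin.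
rewrite (@eq_RintegralT _ mR3 R L3 flux (fun z => D1 z + D2 z - Dt z)); last by move=> z; exact: flux_div.
by rewrite RintegralB// RintegralD// integral_D1 integral_D2 integral_Dt addr0 subr0.
Qed.

End Weight.

(** The flux is nonnegative with zero integral. A nonzero time derivative at [z0] would persist on a
    cube by the Lipschitz bound and, for [T] large, force a positive integral there. *)
Lemma moll_t_eq0 z0 : moll 0%N 0%N 1%N z0 = 0.
Proof.
apply: contrapT => /eqP P0; set a := `|moll 0%N 0%N 1%N z0|.
have a0 : 0 < a by rewrite normr_gt0.
have [K K0 lip] := moll_lipschitz 0 0 1 (radius z0 + 1).
(* Small enough for [r <= 1] and [3 K r <= a / 2], so that the time derivative keeps at least half
   of its size on the cube of half side [r]. *)
pose r := a / (6 * K + 6 + a).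
have den : 0 < 6 * K + 6 + a by have := K0; lra.
have r0 : 0 < r by rewrite divr_gt0.
have r1 : r <= 1 by rewrite /r ler_pdivrMr// mul1r; have := K0; lra.
have rK : K * (3 * r) <= a / 2.
  rewrite /r (_ : K * (3 * _) = (3 * K * a) / (6 * K + 6 + a)); last by ring.
  rewrite ler_pdivrMr// mulrDr mulrDr -subr_ge0 (_ : _ - _ = 3 * a + a / 2 * a); last by field.
  by rewrite addr_ge0 ?mulr_ge0 ?divr_ge0// ltW.
(* A bound for [jap] within distance 1 of [z0] in each coordinate. With [T] below, the argument of
   the weight is at least 1 there. *)
pose rho := 3 + `|z0.1.1| + `|z0.1.2|.
have rho0 : 0 < rho by rewrite /rho -addrA ltr_pwDl// addr_ge0.
pose T := z0.2 + rho + 2.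
pose delta := 2 * ((a / 2) ^+ 2 / rho ^+ 2).
have delta0 : 0 < delta by rewrite mulr_gt0// divr_gt0// exprn_gt0// divr_gt0.
pose I (c : R) : set R := `](c - r), (c + r)[%classic.
pose A : set R3 := I z0.1.1 `*` I z0.1.2 `*` I z0.2.
have mI c : measurable (I c) by exact: measurable_itv.
have mA : measurable (A : set mR3) by apply: measurableX; [apply: measurableX; exact: mI|exact: mI].
have IE (c x : R) : I c x -> `|x - c| <= r.
  by rewrite /I/= in_itv/= => /andP[h1 h2]; rewrite ler_norml; apply/andP; split; lra.
have lower z : A z -> delta <= flux T z.
  move=> [[/= /IE h1 /IE h2] /IE h3]; apply: le_trans (flux_ge T z).
  have n1 := normr_ge0 z0.1.1; have n2 := normr_ge0 z0.1.2; have n3 := normr_ge0 z0.2.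
  have c0 : in_cube (radius z0 + 1) z0 by exact: in_radius.
  have t1 := lerB_dist z.1.1 z0.1.1; have t2 := lerB_dist z.1.2 z0.1.2; have t3 := lerB_dist z.2 z0.2.
  have cz : in_cube (radius z0 + 1) z.
    split; [apply: le_trans (abs_near h1 r1) _|apply: le_trans (abs_near h2 r1) _|apply: le_trans (abs_near h3 r1) _];
      rewrite lerD2r /radius.
    - by rewrite -addrA lerDl addr_ge0.
    - by rewrite addrAC lerDr addr_ge0.
    - by rewrite lerDr addr_ge0.
  have Pz : a / 2 <= `|moll 0%N 0%N 1%N z|.
    have := lip _ _ c0 cz; have := lerB_dist (moll 0%N 0%N 1%N z0) (moll 0%N 0%N 1%N z); rewrite -/a.
    have : K * (`|z0.1.1 - z.1.1| + `|z0.1.2 - z.1.2| + `|z0.2 - z.2|) <= K * (3 * r).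
      by apply: ler_wpM2l => //; rewrite distrC (distrC z0.1.2) (distrC z0.2); lra.
    by lra.
  have jr : jap z.1 <= rho by apply: le_trans (jap_le z.1) _; rewrite /rho; lra.
  have j0 := jap_gt0 z.1.
  have ar : 1 <= T - z.2 - jap z.1 by have := ler_norm (z.2 - z0.2); rewrite /T; lra.
  have ar1 : 1 <= ramp (T - z.2 - jap z.1) by rewrite rampE//; lra.
  have d0 : 0 <= (a / 2) ^+ 2 / rho ^+ 2 by rewrite divr_ge0 ?sqr_ge0.
  have dd : (a / 2) ^+ 2 / rho ^+ 2 <= moll 0%N 0%N 1%N z ^+ 2 / jap z.1 ^+ 2.
    apply: ler_pM; [by rewrite sqr_ge0|by rewrite invr_ge0 sqr_ge0| |].
      rewrite -(real_normK (num_real (moll _ _ _ z))); apply: lerXn2r => //; rewrite nnegrE//.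
      by rewrite divr_ge0// ltW.
    rewrite lef_pV2 ?posrE ?exprn_gt0//; apply: lerXn2r => //; by rewrite nnegrE ltW.
  rewrite /delta; apply: ler_pM => //; by rewrite ?mulr_ge0//; lra.
have flux0 z : 0 <= flux T z.
  apply: le_trans (flux_ge T z); apply: mulr_ge0; first by rewrite mulr_ge0// ramp_ge0.
  by rewrite divr_ge0 ?sqr_ge0.
have : ((delta * (2 * r * (2 * r) * (2 * r)))%:E <= 0 :> \bar R)%E.
  rewrite -(integral_flux T).
  apply: (@le_trans _ _ (\int[L3]_(z in A) delta%:E)%E).
    rewrite integral_cst//.
    have LA : (L3 A = (2 * r * (2 * r) * (2 * r))%:E)%E.
      have muI c : (mu (I c) = (2 * r)%:E)%E.
        rewrite /I (lebesgue_measure_itv `](c - r), (c + r)[)/= lte_fin ifT; last by lra.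
        by rewrite -EFinB; congr EFin; ring.
      apply: (@etrans _ _ ((mu \x mu)%E (I z0.1.1 `*` I z0.1.2) * mu (I z0.2))%E).
        by apply: product_measure1E; [apply: measurableX; exact: mI|exact: mI].
      have E2 : ((mu \x mu)%E (I z0.1.1 `*` I z0.1.2) = mu (I z0.1.1) * mu (I z0.1.2))%E.
        by apply: product_measure1E; exact: mI.
      by rewrite E2 !muI -!EFinM.
    by rewrite [X in (_ <= _ * X)%E]LA -EFinM.
  rewrite integral_mkcond; apply: ge0_le_integral => //.
  - by move=> z _; rewrite patchE; case: ifP => // _; rewrite lee_fin ltW.
  - by apply/(measurable_restrictT (fun _ : mR3 => delta%:E) mA); exact: measurable_cst.
  - by apply/measurable_EFinP; exact: measurable_flux.
  - move=> z _; rewrite patchE; case: ifPn => [/set_mem zA|_]; rewrite lee_fin//; exact: lower.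
rewrite lee_fin leNgt => /negP; apply; apply: mulr_gt0 => //.
by do 2 (apply: mulr_gt0; last by rewrite mulr_gt0); rewrite mulr_gt0.
Qed.

(** Constant in time, and zero before the time [- M]. *)
Lemma moll_eq0 z : moll 0%N 0%N 0%N z = 0.
Proof.
case: z => x t; have [tM|tM] := leP t (- M); first exact: moll_past.
have := line_lipschitz (K := 0) (N := `|t| + M) (a := t) (b := - M) (is_derive_moll3 0%N 0%N 0%N x).
rewrite (_ : moll 0 0 0 (x, - M) = 0); last exact: moll_past.
rewrite subr0 mul0r normr_le0 => H; apply/eqP; apply: H.
- by move=> s _; rewrite moll_t_eq0 oppr0 normr0.
- by rewrite lerDl ltW.
- by rewrite normrN gtr0_norm// lerDr.
Qed.

End Mollified.

Theorem forward_wave_uniqueness (W : R3 -> R) : measurable_fun (setT : set mR3) W ->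
  (forall N, L3.-integrable setT (EFin \o (fun z => W z * cube N z))) ->
  (forall z, z.2 <= 0 -> W z = 0) ->
  (forall B1 B2 B3 : nat -> R -> R, bump_family B1 -> bump_family B2 -> bump_family B3 ->
    (\int[L3]_z (W z * (tensor B1 B2 B3 0%N 0%N 2%N z - (tensor B1 B2 B3 2%N 0%N 0%N z + tensor B1 B2 B3 0%N 2%N 0%N z))))%R = 0) ->
  {ae L3, forall z, W z = 0}.
Proof.
move=> mW Wi Wpast Wbox; apply: ae0_of_bumps => // B1 B2 B3 b1 b2 b3.
have [M1 h1] := b1.2; have [M2 h2] := b2.2; have [M3 h3] := b3.2.
pose M := `|M1| + `|M2| + `|M3| + 1.
have n1 := ler_norm M1; have n2 := ler_norm M2; have n3 := ler_norm M3.
have p1 := normr_ge0 M1; have p2 := normr_ge0 M2; have p3 := normr_ge0 M3.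
have M0 : 0 < M by rewrite /M; lra.
have H1 n x : M <= `|x| -> B1 n x = 0 by move=> Mx; apply: h1; move: Mx; rewrite /M; lra.
have H2 n x : M <= `|x| -> B2 n x = 0 by move=> Mx; apply: h2; move: Mx; rewrite /M; lra.
have H3 n x : M <= `|x| -> B3 n x = 0 by move=> Mx; apply: h3; move: Mx; rewrite /M; lra.
(* The pairing with a product of bumps is the value at the origin of the corresponding
   mollification. *)
rewrite -[RHS](moll_eq0 mW Wi Wpast Wbox b1 b2 b3 M0 H1 H2 H3 ((0, 0), 0)).
by apply: eq_RintegralT => z; rewrite /ker /= !subr0.
Qed.

End Energy.

(** * Fourier inversion against bumps *)

Section Inversion.
Variable R : realType.
Notation mu := (@lebesgue_measure R).
Notation mR := (measurableTypeR R).
Notation L2 := (sfprod mu mu).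

Lemma Rintegral_opp (f : R -> R) : measurable_fun setT f -> (\int[mu]_x f (- x) = \int[mu]_x f x)%R.
Proof. by move=> mf; rewrite /Rintegral (integralT_opp (f := fun x => (f x)%:E))//; exact/measurable_EFinP. Qed.

Lemma Rintegral_addr (c : R) (f : R -> R) : measurable_fun setT f -> (\int[mu]_x f (x + c) = \int[mu]_x f x)%R.
Proof. by move=> mf; rewrite /Rintegral (integralT_addr c (f := fun x => (f x)%:E))//; exact/measurable_EFinP. Qed.

(** After rescaling, the kernel is the fixed [pois 1] and the width appears only in the argument of
    [a], so dominated convergence applies. *)
Lemma pois_approx (a : R -> R) (K : R) (x : R) : continuous a -> (forall y, `|a y| <= K) ->
  (\int[mu]_y (a y * pois n.+1%:R^-1 (y - x)))%R @[n --> \oo] --> (2 * pi * a x : R).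
Proof.
move=> ca aK.
have ma : measurable_fun setT a by exact: continuous_measurable_fun.
have c0 n : 0 < (n.+1%:R^-1 : R) by rewrite invr_gt0.
have Pi (c : R) : 0 < c -> mu.-integrable setT (EFin \o pois c).
  move=> c0'; apply: ge0_integrableP; [exact: measurable_pois|by move=> y; exact: pois_ge0|].
  by rewrite integral_pois// ltry.
have P1 : (\int[mu]_y pois 1 y)%R = 2 * pi by rewrite /Rintegral integral_pois.
have Pc n : (\int[mu]_y pois n.+1%:R^-1 y)%R = 2 * pi by rewrite /Rintegral integral_pois.
have mp (c : R) : measurable_fun setT (pois c) by exact: measurable_pois.
have bi (g : R -> R) c : 0 < c -> measurable_fun setT g -> (forall y, `|g y| <= K) ->
    mu.-integrable setT (EFin \o (fun y => g y * pois c y)).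
  move=> c0' mg gK; apply: (@eq_integrableT _ mR R mu (fun y => pois c y * g y)); first by move=> y; rewrite mulrC.
  exact: (integrable_mul_bounded (Pi c c0') mg gK).
have scale n : (\int[mu]_y (a y * pois n.+1%:R^-1 (y - x)))%R = (\int[mu]_y (a (x + n.+1%:R^-1 * y) * pois 1 y))%R.
  set d := n.+1%:R^-1; have dp : 0 < d by exact: c0.
  have m1 : measurable_fun (setT : set mR) (fun y => a (x + y)) by meas.
  have m2 : measurable_fun (setT : set mR) (fun y => a (x + d * y)) by meas.
  have mpd := mp d; have mp1 := mp 1.
  rewrite -(@Rintegral_addr x (fun y => a y * pois d (y - x))); last by meas.
  (* [K + a] is nonnegative, as the dilation formula requires; the subtracted constant has the same
     mass at every scale. *)
  rewrite (@eq_RintegralT _ mR R mu _ (fun y => (K + a (x + y)) * pois d y - K * pois d y)); last first.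
    by move=> y; rewrite addrK (addrC y x); ring.
  rewrite (@eq_RintegralT _ mR R mu (fun y => a (x + d * y) * pois 1 y) (fun y => (K + a (x + d * y)) * pois 1 y - K * pois 1 y)); last first.
    by move=> y; ring.
  have i1 (g : R -> R) c : 0 < c -> measurable_fun setT g -> (forall y, `|g y| <= K) ->
      mu.-integrable setT (EFin \o (fun y => (K + g y) * pois c y)).
    move=> c0' mg gK; have := integrableD measurableT (integrableZl measurableT K (Pi c c0')) (bi g c c0' mg gK).
    by apply: eq_integrable => //= y _; rewrite -EFinM -EFinD mulrDl.
  have i2 c : 0 < c -> mu.-integrable setT (EFin \o (fun y => K * pois c y)).
    by move=> c0'; have := integrableZl measurableT K (Pi c c0'); apply: eq_integrable.
  rewrite RintegralB//; [|by apply: i1; rewrite /d|by apply: i2; rewrite /d].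
  rewrite [RHS]RintegralB//; [|exact: i1|exact: i2].
  rewrite RintegralZl ?Pi ?c0// [in RHS]RintegralZl ?Pi//.
  rewrite Pc P1; congr (_ - _); rewrite /Rintegral; congr fine.
  rewrite (ge0_integralT_mull (c0 n)); last 2 first.
  - by apply/measurable_EFinP; meas.
  - move=> y; rewrite lee_fin mulr_ge0 ?pois_ge0//.
    by have := aK (x + y); rewrite ler_norml => /andP[h _]; rewrite -lerBlDl sub0r.
  rewrite -ge0_integralZlT; last 3 first.
  - exact: ltW.
  - by apply/measurable_EFinP; rewrite -/d; meas.
  - move=> y; rewrite lee_fin mulr_ge0 ?pois_ge0//.
    by have := aK (x + n.+1%:R^-1 * y); rewrite ler_norml => /andP[h _]; rewrite -lerBlDl sub0r.
  apply: eq_integral => y _; rewrite -EFinM; congr EFin.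
  rewrite mulrCA; congr (_ * _); rewrite /pois -/d; move: (y : R) => s.
  have d0 : d != 0 by rewrite /d gt_eqF.
  have s1 : 1 + s ^+ 2 != 0 by rewrite gt_eqF// ltr_wpDr ?sqr_ge0.
  rewrite expr1n (_ : d ^+ 2 + (d * s) ^+ 2 = d ^+ 2 * (1 + s ^+ 2)); last by ring.
  by field; rewrite d0 s1.
under eq_fun do rewrite scale.
have m2 n : measurable_fun (setT : set mR) (fun y => a (x + n.+1%:R^-1 * y)) by meas.
have := @dominated_convergence _ mR R mu setT measurableT (fun n y => (a (x + n.+1%:R^-1 * y) * pois 1 y)%:E)
  (fun y => (a x * pois 1 y)%:E) (fun y => (K * pois 1 y)%:E).
case.
- by move=> n; apply/measurable_EFinP; have := m2 n; have := mp 1 => h1 h2; meas.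
- by apply/measurable_EFinP; have := mp 1 => h1; meas.
- apply: aeW => y _; apply: cvg_EFin; first by apply: nearW.
  apply: cvgM; last exact: cvg_cst.
  apply: (@continuous_cvg _ _ _ _ _ _ a); first exact: ca.
  rewrite -[X in _ --> X]addr0; apply: cvgD; first exact: cvg_cst.
  have -> : (0 : R) = 0 * y by rewrite mul0r.
  by apply: cvgM; [exact: cvg_harmonic|exact: cvg_cst].
- by have := integrableZl measurableT K (Pi 1 ltr01); apply: eq_integrable.
- apply: aeW => y n _; rewrite lee_fin normrM (ger0_norm (pois_ge0 _ _))// ler_wpM2r ?pois_ge0//.
have -> : 2 * pi * a x = (\int[mu]_y (a x * pois 1 y))%R by rewrite RintegralZl ?Pi// P1 mulrC.
move=> ax _; rewrite -EFin_Rintegral; last by have := integrableZl measurableT (a x) (Pi 1 ltr01); apply: eq_integrable.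
by move=> /fine_cvg.
Qed.

(** * Fourier inversion for bumps on the line *)

Section OneD.
Variable B : nat -> R -> R.
Hypothesis BB : bump_family B.
Let dB := BB.1.
Let mB := measurable_bump_family BB.
Let iB := integrable_bump_family BB.

Definition bcos n (xi : R) : R := (\int[mu]_y (B n y * cos (xi * y)))%R.
Definition bsin n (xi : R) : R := (\int[mu]_y (B n y * sin (xi * y)))%R.

Lemma measurable_bcos n : measurable_fun setT (bcos n).
Proof.
by have m := mB n; apply: (@measurable_Rintegral2 _ _ mR mR R mu (fun xi y => B n y * cos (xi * y))); meas.
Qed.

Lemma measurable_bsin n : measurable_fun setT (bsin n).
Proof.
by have m := mB n; apply: (@measurable_Rintegral2 _ _ mR mR R mu (fun xi y => B n y * sin (xi * y))); meas.
Qed.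

Let osc_bound (o : R -> R) n : measurable_fun setT o -> (forall s, `|o s| <= 1) ->
  `|\int[mu]_y (B n y * o y)|%R <= \int[mu]_y `|B n y|%R.
Proof.
move=> mo o1; have i := integrable_mul_bounded (iB n) mo o1.
apply: le_trans (le_normr_Rintegral measurableT i) _.
apply: le_Rintegral => //; [exact: integrable_norm i|exact: integrable_norm (iB n)|].
by move=> y _; rewrite normrM ler_piMr.
Qed.

(** Two integrations by parts bound [1 + xi^2] times the transform by the [L^1] norms of [B] and its
    second derivative; [pois 1] is [2 / (1 + xi^2)] and serves as an integrable majorant. *)
Lemma bcos_bsin_decay : exists2 K, 0 <= K & forall xi, `|bcos 0%N xi| <= K * pois 1 xi /\ `|bsin 0%N xi| <= K * pois 1 xi.
Proof.
pose K := (\int[mu]_y `|B 0%N y| + \int[mu]_y `|B 2%N y|)%R.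
have K0 : 0 <= K by rewrite addr_ge0// Rintegral_ge0.
exists K => // xi.
have p (x y : R) : y = - xi ^+ 2 * x -> `|x| <= \int[mu]_y `|B 0%N y|%R -> `|y| <= \int[mu]_y `|B 2%N y|%R -> `|x| <= K * pois 1 xi.
  move=> yE xb yb; have q : 0 < 1 + xi ^+ 2 by rewrite ltr_wpDr ?sqr_ge0.
  rewrite /pois expr1n mulr1 mulrA ler_pdivlMr//.
  have yn : `|y| = xi ^+ 2 * `|x| by rewrite yE normrM normrN (ger0_norm (sqr_ge0 _)).
  rewrite mulrDr mulr1 (mulrC `|x|) -yn /K.
  move: xb yb (normr_ge0 x) (normr_ge0 y); clear; move: (\int[mu]_y `|B 0%N y|)%R (\int[mu]_y `|B 2%N y|)%R => I0 I2; lra.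
have mc : measurable_fun (setT : set mR) (fun y => cos (xi * y)) by meas.
have ms : measurable_fun (setT : set mR) (fun y => sin (xi * y)) by meas.
have c1 s : `|cos (xi * s)| <= 1 by exact: cos_abs_le1.
have s1 s : `|sin (xi * s)| <= 1 by exact: sin_abs_le1.
split.
  exact: (p _ _ (bump_cos_parts BB 0%N xi) (osc_bound 0%N mc c1) (osc_bound 2%N mc c1)).
exact: (p _ _ (bump_sin_parts BB 0%N xi) (osc_bound 0%N ms s1) (osc_bound 2%N ms s1)).
Qed.

Let integrable_pois1 K : mu.-integrable setT (EFin \o (fun xi => K * pois 1 xi)).
Proof.
have : mu.-integrable setT (EFin \o pois (1 : R)).
  apply: ge0_integrableP; [exact: measurable_pois|by move=> y; exact: pois_ge0|].
  by rewrite integral_pois// ltry.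
by move=> /(integrableZl measurableT K); apply: eq_integrable.
Qed.

Lemma integrable_bcos : mu.-integrable setT (EFin \o bcos 0%N).
Proof.
have [K K0 h] := bcos_bsin_decay; apply: (@le_integrable_EFin _ mR R mu (bcos 0%N) (fun xi => K * pois 1 xi) (measurable_bcos 0%N) (integrable_pois1 K)).
by move=> xi; have [] := h xi.
Qed.

Lemma integrable_bsin : mu.-integrable setT (EFin \o bsin 0%N).
Proof.
have [K K0 h] := bcos_bsin_decay; apply: (@le_integrable_EFin _ mR R mu (bsin 0%N) (fun xi => K * pois 1 xi) (measurable_bsin 0%N) (integrable_pois1 K)).
by move=> xi; have [] := h xi.
Qed.

Lemma bcos_bsin_bounded : exists2 K, 0 <= K & forall xi, `|bcos 0%N xi| <= K /\ `|bsin 0%N xi| <= K.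
Proof.
have [K K0 h] := bcos_bsin_decay; exists (K * 2); first by rewrite mulr_ge0.
move=> xi; have [h1 h2] := h xi; have p1 : pois 1 xi <= 2 by have := @pois_le R 1 xi ltr01; rewrite divr1.
by split; [apply: le_trans h1 _|apply: le_trans h2 _]; rewrite ler_wpM2l.
Qed.

(* e^{- i y xi} times the transform of [B 0]: real and imaginary parts. *)
Definition re_mod y xi := cos (y * xi) * bcos 0%N xi + sin (y * xi) * bsin 0%N xi.
Definition im_mod y xi := cos (y * xi) * bsin 0%N xi - sin (y * xi) * bcos 0%N xi.

Let ic := integrable_bcos.
Let is_ := integrable_bsin.

Let iosc (f : R -> R) y : mu.-integrable setT (EFin \o f) -> 
  mu.-integrable setT (EFin \o (fun xi => cos (y * xi) * f xi)) /\ mu.-integrable setT (EFin \o (fun xi => sin (y * xi) * f xi)).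
Proof.
move=> fi; split.
  apply: (@eq_integrableT _ mR R mu (fun xi => f xi * cos (y * xi))); first by move=> xi; rewrite mulrC.
  by apply: integrable_cos => //; meas.
apply: (@eq_integrableT _ mR R mu (fun xi => f xi * sin (y * xi))); first by move=> xi; rewrite mulrC.
by apply: integrable_sin => //; meas.
Qed.

Lemma integrable_re_mod y : mu.-integrable setT (EFin \o re_mod y).
Proof. by have := integrableD measurableT (iosc y ic).1 (iosc y is_).2; apply: eq_integrable. Qed.

Lemma integrable_im_mod y : mu.-integrable setT (EFin \o im_mod y).
Proof. by have := integrableB measurableT (iosc y is_).1 (iosc y ic).2; apply: eq_integrable. Qed.

Let re_modE y xi : re_mod y xi = (\int[mu]_x (B 0%N x * cos (0 + (x - y) * xi)))%R.
Proof.
have mc : measurable_fun (setT : set mR) (fun x => xi * x) by meas.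
have i1 := integrable_cos (iB 0%N) mc; have i2 := integrable_sin (iB 0%N) mc.
rewrite /re_mod /bcos /bsin -!RintegralZl// -RintegralD//; last 2 first.
- by have := integrableZl measurableT (cos (y * xi)) i1; apply: eq_integrable.
- by have := integrableZl measurableT (sin (y * xi)) i2; apply: eq_integrable.
apply: eq_RintegralT => x.
rewrite (_ : 0 + (x - y) * xi = xi * x - y * xi); last by ring.
by rewrite cosB; ring.
Qed.

(** Abel summation: the damped inversion integral equals the pairing of [B] with a Poisson kernel
    centred at [y]. It tends to the undamped integral by dominated convergence and to [2 pi B y] by
    approximation of the identity. *)
Lemma Rintegral_re_mod y : (\int[mu]_xi re_mod y xi)%R = 2 * pi * B 0%N y.
Proof.
have c0 n : 0 < (n.+1%:R^-1 : R) by rewrite invr_gt0.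
have m1 : measurable_fun setT (re_mod y) by apply/measurable_EFinP; exact: measurable_int (integrable_re_mod y).
have Abel n : (\int[mu]_xi (expabs n.+1%:R^-1 xi * re_mod y xi))%R = (\int[mu]_x (B 0%N x * pois n.+1%:R^-1 (x - y)))%R.
  rewrite (@eq_RintegralT _ mR R mu _ (fun xi => expabs n.+1%:R^-1 xi * \int[mu]_x (B 0%N x * cos (0 + (x - y) * xi)))); last first.
    by move=> xi; rewrite re_modE.
  rewrite (Rintegral_abel_mean (c0 n) (iB 0%N)); last 2 first.
  - exact: measurable_cst.
  - by meas.
  by apply: eq_RintegralT => x; rewrite cos0 mulr1.
have [K K0 BK] := @bump_family_bounded R _ BB 0%N.
have lim1 := @pois_approx (B 0%N) K y (@bump_family_continuous R _ BB 0%N) BK.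
have lim2 : (\int[mu]_xi (expabs n.+1%:R^-1 xi * re_mod y xi))%R @[n --> \oo] --> (\int[mu]_xi re_mod y xi)%R.
  have := @dominated_convergence _ mR R mu setT measurableT (fun n xi => (expabs n.+1%:R^-1 xi * re_mod y xi)%:E)
    (fun xi => (re_mod y xi)%:E) (fun xi => (`|re_mod y xi|)%:E).
  case.
  - by move=> n; apply/measurable_EFinP; have := measurable_expabs (R := R) n.+1%:R^-1 => h; meas.
  - exact/measurable_EFinP.
  - apply: aeW => xi _; apply: cvg_EFin; first by apply: nearW.
    rewrite -[X in _ --> X]mul1r; apply: cvgM; [exact: expabs_cvg1|exact: cvg_cst].
  - exact: integrable_norm (integrable_re_mod y).
  - apply: aeW => xi n _; rewrite lee_fin normrM ler_piMl// ger0_norm ?expabs_ge0//.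
    by apply: expabs_le1.
  move=> _ _; rewrite -EFin_Rintegral; last exact: integrable_re_mod.
  by move=> /fine_cvg.
move: lim2; under eq_fun do rewrite Abel; move=> lim2.
exact: (cvg_unique _ lim2 lim1).
Qed.

Lemma Rintegral_im_mod y : (\int[mu]_xi im_mod y xi)%R = 0.
Proof.
have m1 : measurable_fun setT (im_mod y) by apply/measurable_EFinP; exact: measurable_int (integrable_im_mod y).
have odd xi : im_mod y (- xi) = - im_mod y xi.
  have bc : bcos 0%N (- xi) = bcos 0%N xi.
    by apply: eq_RintegralT => x; rewrite mulNr cosN.
  have bs : bsin 0%N (- xi) = - bsin 0%N xi.
    have mc : measurable_fun (setT : set mR) (fun x => xi * x) by meas.
    rewrite /bsin -[RHS]mulN1r -RintegralZl//; last exact: (integrable_sin (iB 0%N) mc).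
    by apply: eq_RintegralT => x; rewrite mulNr sinN; ring.
  by rewrite /im_mod bc bs (mulrN y) cosN sinN; ring.
have := Rintegral_opp m1; rewrite (@eq_RintegralT _ mR R mu _ (fun xi => -1 * im_mod y xi)); last first.
  by move=> xi; rewrite odd mulN1r.
rewrite RintegralZl//; last exact: integrable_im_mod.
by move: (Rintegral _ _ _) => I; lra.
Qed.

End OneD.

(** * Inversion in the plane and the pairing of transforms *)

Section TwoD.
Variables B1 B2 : nat -> R -> R.
Hypotheses (BB1 : bump_family B1) (BB2 : bump_family B2).

(** With [tsin], the cosine and sine transforms at [xi] of the product of the two bumps, expanded by
    the addition formulas. *)
Definition tcos (xi : R * R) : R := bcos B1 0%N xi.1 * bcos B2 0%N xi.2 - bsin B1 0%N xi.1 * bsin B2 0%N xi.2.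
Definition tsin (xi : R * R) : R := bsin B1 0%N xi.1 * bcos B2 0%N xi.2 + bcos B1 0%N xi.1 * bsin B2 0%N xi.2.

Let ic1 := integrable_bcos BB1.
Let is1 := integrable_bsin BB1.
Let ic2 := integrable_bcos BB2.
Let is2 := integrable_bsin BB2.

Lemma integrable_tcos : L2.-integrable setT (EFin \o tcos).
Proof. by have := integrableB measurableT (integrable_prod ic1 ic2) (integrable_prod is1 is2); apply: eq_integrable. Qed.

Lemma integrable_tsin : L2.-integrable setT (EFin \o tsin).
Proof. by have := integrableD measurableT (integrable_prod is1 ic2) (integrable_prod ic1 is2); apply: eq_integrable. Qed.

Lemma tcos_tsin_bounded : exists2 K, 0 <= K & forall xi, `|tcos xi| <= K /\ `|tsin xi| <= K.
Proof.
have [K1 K10 h1] := bcos_bsin_bounded BB1; have [K2 K20 h2] := bcos_bsin_bounded BB2.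
exists (K1 * K2 + K1 * K2); first by rewrite addr_ge0// mulr_ge0.
move=> xi; have [c1 s1] := h1 xi.1; have [c2 s2] := h2 xi.2; split.
  by apply: le_trans (ler_normB _ _) _; rewrite !normrM lerD// ler_pM.
by apply: le_trans (ler_normD _ _) _; rewrite !normrM lerD// ler_pM.
Qed.

Let iosc (f : R * R -> R) y : L2.-integrable setT (EFin \o f) ->
  L2.-integrable setT (EFin \o (fun xi => cos (dot y xi) * f xi)) /\ L2.-integrable setT (EFin \o (fun xi => sin (dot y xi) * f xi)).
Proof.
move=> fi; have md : measurable_fun (setT : set (mR * mR)) (dot y) by rewrite /dot; meas.
split.
  apply: (@eq_integrableT _ _ R L2 (fun xi => f xi * cos (dot y xi))); first by move=> xi; rewrite mulrC.
  exact: integrable_cos.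
apply: (@eq_integrableT _ _ R L2 (fun xi => f xi * sin (dot y xi))); first by move=> xi; rewrite mulrC.
exact: integrable_sin.
Qed.

Let ire1 y := integrable_re_mod BB1 y.
Let iim1 y := integrable_im_mod BB1 y.
Let ire2 y := integrable_re_mod BB2 y.
Let iim2 y := integrable_im_mod BB2 y.

Lemma Rintegral_re_mod2 (y : R * R) :
  (\int[L2]_xi (cos (dot y xi) * tcos xi + sin (dot y xi) * tsin xi))%R = (2 * pi) ^+ 2 * (B1 0%N y.1 * B2 0%N y.2).
Proof.
rewrite (@eq_RintegralT _ _ R L2 _ (fun xi => re_mod B1 y.1 xi.1 * re_mod B2 y.2 xi.2 - im_mod B1 y.1 xi.1 * im_mod B2 y.2 xi.2)).
  rewrite RintegralB//; [|exact: (integrable_prod (ire1 y.1) (ire2 y.2))|exact: (integrable_prod (iim1 y.1) (iim2 y.2))].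
  rewrite (Rintegral_prod (ire1 y.1) (ire2 y.2)) (Rintegral_prod (iim1 y.1) (iim2 y.2)).
  rewrite (Rintegral_re_mod BB1) (Rintegral_re_mod BB2) (Rintegral_im_mod BB1) mul0r subr0; ring.
by move=> xi; rewrite /re_mod /im_mod /tcos /tsin /dot cosD sinD; ring.
Qed.

Lemma Rintegral_im_mod2 (y : R * R) :
  (\int[L2]_xi (sin (dot y xi) * tcos xi - cos (dot y xi) * tsin xi))%R = 0.
Proof.
rewrite (@eq_RintegralT _ _ R L2 _ (fun xi => - 1 * (re_mod B1 y.1 xi.1 * im_mod B2 y.2 xi.2 + im_mod B1 y.1 xi.1 * re_mod B2 y.2 xi.2))).
  have i1 := integrable_prod (ire1 y.1) (iim2 y.2); have i2 := integrable_prod (iim1 y.1) (ire2 y.2).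
  rewrite RintegralZl//; last by have := integrableD measurableT i1 i2; apply: eq_integrable.
  rewrite RintegralD// (Rintegral_prod (ire1 y.1) (iim2 y.2)) (Rintegral_prod (iim1 y.1) (ire2 y.2)).
  by rewrite (Rintegral_im_mod BB1) (Rintegral_im_mod BB2) mul0r mulr0 addr0 mulr0.
by move=> xi; rewrite /re_mod /im_mod /tcos /tsin /dot cosD sinD; ring.
Qed.

Section IntegrablePairing.
Variables hr hi : R * R -> R.
Hypotheses (ihr : L2.-integrable setT (EFin \o hr)) (ihi : L2.-integrable setT (EFin \o hi)).

(** With [ft_im], the real and imaginary parts of the Fourier integral of [hr + i hi]. *)
Definition ft_re (xi : R * R) : R := (\int[L2]_y (cos (dot y xi) * hr y + sin (dot y xi) * hi y))%R.
Definition ft_im (xi : R * R) : R := (\int[L2]_y (cos (dot y xi) * hi y - sin (dot y xi) * hr y))%R.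

Let mhr : measurable_fun (setT : set (mR * mR)) hr.
Proof. by apply/measurable_EFinP; exact: measurable_int ihr. Qed.
Let mhi : measurable_fun (setT : set (mR * mR)) hi.
Proof. by apply/measurable_EFinP; exact: measurable_int ihi. Qed.

Let mdot d (T : measurableType d) (a b : T -> mR * mR) : measurable_fun setT a -> measurable_fun setT b ->
  measurable_fun setT (fun x => dot (a x) (b x)).
Proof. by move=> ma mb; rewrite /dot; meas. Qed.

Let ioscy (f : R * R -> R) xi : L2.-integrable setT (EFin \o f) ->
  L2.-integrable setT (EFin \o (fun y => cos (dot y xi) * f y)) /\ L2.-integrable setT (EFin \o (fun y => sin (dot y xi) * f y)).
Proof.
move=> fi; have md : measurable_fun (setT : set (mR * mR)) (fun y => dot y xi) by apply: mdot; meas.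
split.
  apply: (@eq_integrableT _ _ R L2 (fun y => f y * cos (dot y xi))); first by move=> y; rewrite mulrC.
  exact: integrable_cos.
apply: (@eq_integrableT _ _ R L2 (fun y => f y * sin (dot y xi))); first by move=> y; rewrite mulrC.
exact: integrable_sin.
Qed.

Lemma measurable_ft_re : measurable_fun (setT : set (mR * mR)) ft_re.
Proof.
apply: (@measurable_Rintegral2 _ _ (mR * mR)%type (mR * mR)%type R L2 (fun xi y => cos (dot y xi) * hr y + sin (dot y xi) * hi y)).
by have h : measurable_fun (setT : set ((mR * mR) * (mR * mR))) (fun z => dot z.2 z.1); [apply: mdot; meas|meas].
Qed.

Lemma measurable_ft_im : measurable_fun (setT : set (mR * mR)) ft_im.
Proof.
apply: (@measurable_Rintegral2 _ _ (mR * mR)%type (mR * mR)%type R L2 (fun xi y => cos (dot y xi) * hi y - sin (dot y xi) * hr y)).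
by have h : measurable_fun (setT : set ((mR * mR) * (mR * mR))) (fun z => dot z.2 z.1); [apply: mdot; meas|meas].
Qed.

Lemma ft_bounded : exists K, forall xi, `|ft_re xi| <= K /\ `|ft_im xi| <= K.
Proof.
have inh : L2.-integrable setT (EFin \o (fun y => `|hr y| + `|hi y|)).
  by have := integrableD measurableT (integrable_norm ihr) (integrable_norm ihi); apply: eq_integrable.
exists (\int[L2]_y (`|hr y| + `|hi y|))%R => xi.
have i1 : L2.-integrable setT (EFin \o (fun y => cos (dot y xi) * hr y + sin (dot y xi) * hi y)).
  by have := integrableD measurableT (ioscy xi ihr).1 (ioscy xi ihi).2; apply: eq_integrable.
have i2 : L2.-integrable setT (EFin \o (fun y => cos (dot y xi) * hi y - sin (dot y xi) * hr y)).
  by have := integrableB measurableT (ioscy xi ihi).1 (ioscy xi ihr).2; apply: eq_integrable.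
split.
  apply: le_trans (le_normr_Rintegral measurableT i1) _; apply: le_Rintegral => //; first exact: integrable_norm i1.
  move=> y _; apply: le_trans (ler_normD _ _) _; rewrite !normrM lerD// ler_piMl// ?cos_abs_le1 ?sin_abs_le1//.
apply: le_trans (le_normr_Rintegral measurableT i2) _; apply: le_Rintegral => //; first exact: integrable_norm i2.
move=> y _; apply: le_trans (ler_normB _ _) _; rewrite addrC !normrM lerD// ler_piMl// ?cos_abs_le1 ?sin_abs_le1//.
Qed.

(** Fubini moves the transform from the integrable function to the bump, where the inversion formula
    evaluates it: its real part gives back the product of bumps and its imaginary part vanishes. *)
Lemma Rintegral_ft_pairing :
  (\int[L2]_xi (ft_re xi * tcos xi - ft_im xi * tsin xi))%R =
  (2 * pi) ^+ 2 * (\int[L2]_y (hr y * (B1 0%N y.1 * B2 0%N y.2)))%R.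
Proof.
pose G (xi y : R * R) := hr y * (cos (dot y xi) * tcos xi + sin (dot y xi) * tsin xi) +
  hi y * (sin (dot y xi) * tcos xi - cos (dot y xi) * tsin xi).
have mosc : measurable_fun (setT : set ((mR * mR) * (mR * mR))) (fun z => dot z.2 z.1) by apply: mdot; meas.
have ip (c h : R * R -> R) : L2.-integrable setT (EFin \o c) -> L2.-integrable setT (EFin \o h) ->
  (sfprod L2 L2).-integrable setT (EFin \o (fun z => c z.1 * h z.2 * cos (dot z.2 z.1))) /\
  (sfprod L2 L2).-integrable setT (EFin \o (fun z => c z.1 * h z.2 * sin (dot z.2 z.1))).
  by move=> ci hi'; split; [apply: integrable_cos|apply: integrable_sin] => //; exact: integrable_prod.
have iG : (sfprod L2 L2).-integrable setT (EFin \o (fun z => G z.1 z.2)).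
  have := integrableD measurableT (integrableD measurableT (ip _ _ integrable_tcos ihr).1 (ip _ _ integrable_tsin ihr).2)
    (integrableB measurableT (ip _ _ integrable_tcos ihi).2 (ip _ _ integrable_tsin ihi).1).
  by apply: eq_integrable => //= z _; rewrite -!EFinD; congr EFin; rewrite /G; ring.
have iGy xi : L2.-integrable setT (EFin \o G xi).
  have a1 := integrableZl measurableT (tcos xi) (ioscy xi ihr).1; have a2 := integrableZl measurableT (tsin xi) (ioscy xi ihr).2.
  have a3 := integrableZl measurableT (tcos xi) (ioscy xi ihi).2; have a4 := integrableZl measurableT (tsin xi) (ioscy xi ihi).1.
  have := integrableD measurableT (integrableD measurableT a1 a2) (integrableB measurableT a3 a4).
  by apply: eq_integrable => //= z _; rewrite -!EFinM -!EFinD; congr EFin; rewrite /G; ring.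
have b1 y : L2.-integrable setT (EFin \o (fun xi => cos (dot y xi) * tcos xi + sin (dot y xi) * tsin xi)).
  by have := integrableD measurableT (iosc y integrable_tcos).1 (iosc y integrable_tsin).2; apply: eq_integrable.
have b2 y : L2.-integrable setT (EFin \o (fun xi => sin (dot y xi) * tcos xi - cos (dot y xi) * tsin xi)).
  by have := integrableB measurableT (iosc y integrable_tcos).2 (iosc y integrable_tsin).1; apply: eq_integrable.
have b1' y : L2.-integrable setT (EFin \o (fun xi => hr y * (cos (dot y xi) * tcos xi + sin (dot y xi) * tsin xi))).
  by have := integrableZl measurableT (hr y) (b1 y); apply: eq_integrable.
have b2' y : L2.-integrable setT (EFin \o (fun xi => hi y * (sin (dot y xi) * tcos xi - cos (dot y xi) * tsin xi))).
  by have := integrableZl measurableT (hi y) (b2 y); apply: eq_integrable.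
have iGxi y : L2.-integrable setT (EFin \o (fun xi => G xi y)).
  by have := integrableD measurableT (b1' y) (b2' y); apply: eq_integrable.
apply: (@etrans _ _ (\int[L2]_xi \int[L2]_y G xi y)%R).
  apply: eq_RintegralT => xi; rewrite /ft_re /ft_im.
  rewrite RintegralD//; [|exact: (ioscy xi ihr).1|exact: (ioscy xi ihi).2].
  rewrite RintegralB//; [|exact: (ioscy xi ihi).1|exact: (ioscy xi ihr).2].
  have c1 := (ioscy xi ihr).1; have c2 := (ioscy xi ihr).2; have c3 := (ioscy xi ihi).1; have c4 := (ioscy xi ihi).2.
  have z (c : R) f : L2.-integrable setT (EFin \o f) -> L2.-integrable setT (EFin \o (fun y => c * f y)).
    by move=> /(integrableZl measurableT c); apply: eq_integrable.
  rewrite (@eq_RintegralT _ _ R L2 (G xi) (fun y => (tcos xi * (cos (dot y xi) * hr y) + tcos xi * (sin (dot y xi) * hi y))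
     - (tsin xi * (cos (dot y xi) * hi y) - tsin xi * (sin (dot y xi) * hr y)))); last by move=> y; rewrite /G; ring.
  have d1 : L2.-integrable setT (EFin \o (fun y => tcos xi * (cos (dot y xi) * hr y) + tcos xi * (sin (dot y xi) * hi y))).
    by have := integrableD measurableT (z (tcos xi) _ c1) (z (tcos xi) _ c4); apply: eq_integrable.
  have d2 : L2.-integrable setT (EFin \o (fun y => tsin xi * (cos (dot y xi) * hi y) - tsin xi * (sin (dot y xi) * hr y))).
    by have := integrableB measurableT (z (tsin xi) _ c3) (z (tsin xi) _ c2); apply: eq_integrable.
  rewrite RintegralB// RintegralD//; [|exact: z|exact: z].
  rewrite RintegralB//; [|exact: z|exact: z].
  by rewrite !RintegralZl//; ring.
apply: (etrans (esym (@Rintegral_Fubini1 _ _ _ _ R L2 L2 G iG iGy))).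
apply: (etrans (@Rintegral_Fubini2 _ _ _ _ R L2 L2 G iG iGxi)).
have [K1 K10 h1] := @bump_family_bounded R _ BB1 0%N; have [K2 K20 h2] := @bump_family_bounded R _ BB2 0%N.
have ib : L2.-integrable setT (EFin \o (fun y => hr y * (B1 0%N y.1 * B2 0%N y.2))).
  apply: (@integrable_mul_bounded _ _ R L2 hr (fun y => B1 0%N y.1 * B2 0%N y.2) (K1 * K2) ihr).
    by have m1 := measurable_bump_family BB1 0%N; have m2 := measurable_bump_family BB2 0%N; meas.
  by move=> y; rewrite normrM ler_pM.
rewrite -[RHS]RintegralZl//.
apply: eq_RintegralT => y; rewrite /G RintegralD//; [|exact: b1'|exact: b2'].
rewrite RintegralZl//; last exact: b1.
rewrite RintegralZl//; last exact: b2.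
by rewrite Rintegral_re_mod2 Rintegral_im_mod2 mulr0 addr0; ring.
Qed.

End IntegrablePairing.
End TwoD.
End Inversion.

(** * Even Lebesgue norms and pairings of square integrable functions *)

Section SquareIntegrable.
Context d (T : measurableType d) (R : realType) (m : {measure set T -> \bar R}).

(** For an even exponent the power of the modulus is polynomial in the real and imaginary parts. *)
Lemma cLnorm_even (k : nat) (D : set T) (F : T -> R[i]) : (0 < k)%N ->
  cLnorm m ((2 * k)%:R)%:E D F =
  ((\int[m]_x ((complex.Re (F x) ^+ 2 + complex.Im (F x) ^+ 2) ^+ k * \1_D x)%:E) `^ ((2 * k)%:R^-1))%E.
Proof.
move=> k0; rewrite /cLnorm Lnorm.unlock; congr (_ `^ _)%E.
apply: eq_integral => x _; rewrite /= patchE indicE.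
have [xD|xD] := boolP (x \in D); last first.
  (* Restriction to [D] takes the default value outside [D], and this value is 0 in [R]. *)
  have -> : (point : R) = 0 by [].
  by rewrite normr0 powR0 ?mulr0// pnatr_eq0 -lt0n muln_gt0 k0.
rewrite mulr1; congr EFin.
rewrite powR_mulrn ?normr_ge0// exprM; congr (_ ^+ _).
by rewrite real_normK ?num_real//; case: (F x) => a b /=; rewrite sqr_sqrtr// addr_ge0 ?sqr_ge0.
Qed.

(** A form of Cauchy-Schwarz without square roots, from [|a b| <= t a^2 + b^2 / t]; the free
    parameter [t] is chosen according to the size of [A]. *)
Lemma sq_integrable_pair (phi psi : T -> R) (A Q : R) : measurable_fun setT phi -> measurable_fun setT psi ->
  (\int[m]_x (phi x ^+ 2)%:E <= A%:E)%E -> (\int[m]_x (psi x ^+ 2)%:E <= Q%:E)%E ->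
  m.-integrable setT (EFin \o (fun x => phi x * psi x)) /\
  forall t, 0 < t -> `|\int[m]_x (phi x * psi x)|%R <= t * A + t^-1 * Q.
Proof.
move=> mphi mpsi hA hQ.
have bound t : 0 < t -> (\int[m]_x (`|phi x * psi x|)%:E <= (t * A + t^-1 * Q)%:E)%E.
  move=> t0; have tV0 : 0 <= t^-1 by rewrite invr_ge0 ltW.
  apply: (@le_trans _ _ (\int[m]_x (t%:E * (phi x ^+ 2)%:E + t^-1%:E * (psi x ^+ 2)%:E))%E).
    apply: ge0_le_integral => //.
    - by apply/measurable_EFinP; meas.
    - rewrite (_ : (fun x => _) = (fun x => (t * phi x ^+ 2 + t^-1 * psi x ^+ 2)%:E)).
        by apply/measurable_EFinP; meas.
      by apply/funext => x; rewrite EFinD !EFinM.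
    - move=> x _; rewrite -!EFinM -EFinD lee_fin normrM.
      rewrite -(real_normK (num_real (phi x))) -(real_normK (num_real (psi x))).
      move: `|phi x| `|psi x| (normr_ge0 (phi x)) (normr_ge0 (psi x)) => a b a0 b0.
      have h : 0 <= t^-1 * (t * a - b) ^+ 2 by rewrite mulr_ge0// sqr_ge0.
      have e : t^-1 * (t * a - b) ^+ 2 = t * a ^+ 2 + t^-1 * b ^+ 2 - 2 * (a * b).
        by field; rewrite gt_eqF.
      by have := mulr_ge0 a0 b0; move: h; rewrite e; lra.
  rewrite ge0_integralD//; last 4 first.
  - by move=> x _; rewrite -EFinM lee_fin mulr_ge0 ?sqr_ge0// ltW.
  - by under eq_fun do rewrite -EFinM; apply/measurable_EFinP; meas.
  - by move=> x _; rewrite -EFinM lee_fin mulr_ge0 ?sqr_ge0.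
  - by under eq_fun do rewrite -EFinM; apply/measurable_EFinP; meas.
  rewrite ge0_integralZlT; [|exact: ltW|by apply/measurable_EFinP; meas|by move=> x; rewrite lee_fin sqr_ge0].
  rewrite ge0_integralZlT; [|by []|by apply/measurable_EFinP; meas|by move=> x; rewrite lee_fin sqr_ge0].
  by rewrite EFinD !EFinM leeD// lee_wpmul2l// lee_fin// ltW.
have mpp : measurable_fun setT (fun x => phi x * psi x) by meas.
have i : m.-integrable setT (EFin \o (fun x => phi x * psi x)).
  apply/integrableP; split; first exact/measurable_EFinP.
  by apply: le_lt_trans (bound 1 ltr01) _; rewrite ltry.
split=> // t t0; apply: le_trans (le_normr_Rintegral measurableT i) _.
by rewrite -lee_fin EFin_Rintegral; [exact: bound|exact: integrable_norm i].
Qed.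

End SquareIntegrable.

(** * The pairing formula for the square integrable Fourier transform *)

Section FourierPairing.
Variable R : realType.
Notation mu := (@lebesgue_measure R).
Notation mR := (measurableTypeR R).
Notation L2 := (sfprod mu mu).
Notation mR2 := (mR * mR)%type.

Lemma eq0_of_le_div (x K : R) : (forall t, 0 < t -> `|x| <= K / t) -> x = 0.
Proof.
move=> h; apply: contrapT => /eqP x0; have n0 : 0 < `|x| by rewrite normr_gt0.
have K0 : 0 <= K by have := h 1 ltr01; rewrite divr1; have := normr_ge0 x; lra.
have t0 : 0 < (K + 1) / `|x| by rewrite divr_gt0// ltr_wpDl.
have := h _ t0; rewrite invf_div mulrA ler_pdivlMr ?ltr_wpDl//.
by rewrite mulrC ler_pM2r//; lra.
Qed.

Variables B1 B2 : nat -> R -> R.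
Hypotheses (BB1 : bump_family B1) (BB2 : bump_family B2).
Let b (y : R * R) := B1 0%N y.1 * B2 0%N y.2.

Lemma sq_integrable_of_bounded (f : R * R -> R) (K : R) : L2.-integrable setT (EFin \o f) ->
  (forall x, `|f x| <= K) -> exists Q : R, (\int[L2]_x (f x ^+ 2)%:E <= Q%:E)%E.
Proof.
move=> fi fK; have mf : measurable_fun (setT : set mR2) f by apply/measurable_EFinP; exact: measurable_int fi.
have i := integrable_mul_bounded fi mf fK.
by exists (\int[L2]_x (f x * f x))%R; rewrite EFin_Rintegral.
Qed.

Lemma bump2_bounded : exists K : R, forall y, `|b y| <= K.
Proof.
have [K1 K10 h1] := @bump_family_bounded R _ BB1 0%N; have [K2 K20 h2] := @bump_family_bounded R _ BB2 0%N.
by exists (K1 * K2) => y; rewrite /b normrM ler_pM.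
Qed.

Lemma integrable_bump2 : L2.-integrable setT (EFin \o b).
Proof. exact: (integrable_prod (integrable_bump_family BB1 0%N) (integrable_bump_family BB2 0%N)). Qed.

Lemma measurable_bump2 : measurable_fun (setT : set mR2) b.
Proof. by apply/measurable_EFinP; exact: measurable_int integrable_bump2. Qed.

Let kappa : R := ((2 * pi) ^+ 2)^-1.

(** The identity holds for the integrable approximants, and both sides are continuous in [L^2]
    because the bump and its transform are square integrable. *)
Lemma L2_pairing (fr gr gi : R * R -> R) (hr hi : nat -> R * R -> R) :
  measurable_fun (setT : set mR2) fr -> measurable_fun (setT : set mR2) gr -> measurable_fun (setT : set mR2) gi ->
  (exists Q : R, \int[L2]_x (fr x ^+ 2)%:E <= Q%:E)%E ->
  (exists Q : R, \int[L2]_x (gr x ^+ 2)%:E <= Q%:E)%E ->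
  (exists Q : R, \int[L2]_x (gi x ^+ 2)%:E <= Q%:E)%E ->
  (forall n, L2.-integrable setT (EFin \o hr n)) -> (forall n, L2.-integrable setT (EFin \o hi n)) ->
  (forall e : R, 0 < e -> exists n, [/\ (\int[L2]_x ((fr x - hr n x) ^+ 2)%:E <= e%:E)%E,
     (\int[L2]_x ((gr x - ft_re (hr n) (hi n) x) ^+ 2)%:E <= e%:E)%E &
     (\int[L2]_x ((gi x - ft_im (hr n) (hi n) x) ^+ 2)%:E <= e%:E)%E]) ->
  (\int[L2]_x (fr x * b x) = kappa * \int[L2]_xi (gr xi * tcos B1 B2 xi - gi xi * tsin B1 B2 xi))%R.
Proof.
move=> mfr mgr mgi [Qf hf] [Qr hgr] [Qi hgi] ihr ihi approx.
have ic := integrable_tcos BB1 BB2; have is_ := integrable_tsin BB1 BB2.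
have [K K0 hK] := tcos_tsin_bounded BB1 BB2.
have [Qc hc] := sq_integrable_of_bounded ic (fun x => (hK x).1).
have [Qs hs] := sq_integrable_of_bounded is_ (fun x => (hK x).2).
have [Kb hb] := bump2_bounded; have [Qb hQb] := sq_integrable_of_bounded integrable_bump2 hb.
have mb := measurable_bump2.
have mc : measurable_fun (setT : set mR2) (tcos B1 B2) by apply/measurable_EFinP; exact: measurable_int ic.
have ms : measurable_fun (setT : set mR2) (tsin B1 B2) by apply/measurable_EFinP; exact: measurable_int is_.
have [ifb _] := sq_integrable_pair mfr mb hf hQb.
have [igc _] := sq_integrable_pair mgr mc hgr hc.
have [igs _] := sq_integrable_pair mgi ms hgi hs.
have k0 : 0 <= kappa by rewrite invr_ge0 sqr_ge0.
apply/eqP; rewrite -subr_eq0; apply/eqP.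
apply: (@eq0_of_le_div _ (1 + Qb + kappa * (2 + Qc + Qs))) => t t0.
(* With squared errors of size [t^-2], the pairing bound with parameter [t] makes every error a
   multiple of [1 / t]. *)
have e0 : 0 < (t ^+ 2)^-1 by rewrite invr_gt0 exprn_gt0.
have [n [a1 a2 a3]] := approx _ e0.
have mhr : measurable_fun (setT : set mR2) (hr n) by apply/measurable_EFinP; exact: measurable_int (ihr n).
have mfre := measurable_ft_re (ihr n) (ihi n); have mfim := measurable_ft_im (ihr n) (ihi n).
have [i1 b1] := sq_integrable_pair (measurable_funB mfr mhr) mb a1 hQb.
have [i2 b2] := sq_integrable_pair (measurable_funB mgr mfre) mc a2 hc.
have [i3 b3] := sq_integrable_pair (measurable_funB mgi mfim) ms a3 hs.
have ihb : L2.-integrable setT (EFin \o (fun x => hr n x * b x)) by exact: integrable_mul_bounded (ihr n) mb hb.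
have [Kf hKf] := ft_bounded (ihr n) (ihi n).
have ifc : L2.-integrable setT (EFin \o (fun x => ft_re (hr n) (hi n) x * tcos B1 B2 x)).
  apply: (@eq_integrableT _ mR2 R L2 (fun x => tcos B1 B2 x * ft_re (hr n) (hi n) x)); first by move=> x; rewrite mulrC.
  by apply: (integrable_mul_bounded ic mfre) => x; exact: (hKf x).1.
have ifs : L2.-integrable setT (EFin \o (fun x => ft_im (hr n) (hi n) x * tsin B1 B2 x)).
  apply: (@eq_integrableT _ mR2 R L2 (fun x => tsin B1 B2 x * ft_im (hr n) (hi n) x)); first by move=> x; rewrite mulrC.
  by apply: (integrable_mul_bounded is_ mfim) => x; exact: (hKf x).2.
have E1 : (\int[L2]_x ((fr x - hr n x) * b x) = \int[L2]_x (fr x * b x) - \int[L2]_x (hr n x * b x))%R.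
  by rewrite -RintegralB//; apply: eq_RintegralT => x; rewrite mulrBl.
have E2 : (\int[L2]_x ((gr x - ft_re (hr n) (hi n) x) * tcos B1 B2 x) = \int[L2]_x (gr x * tcos B1 B2 x) - \int[L2]_x (ft_re (hr n) (hi n) x * tcos B1 B2 x))%R.
  by rewrite -RintegralB//; apply: eq_RintegralT => x; rewrite mulrBl.
have E3 : (\int[L2]_x ((gi x - ft_im (hr n) (hi n) x) * tsin B1 B2 x) = \int[L2]_x (gi x * tsin B1 B2 x) - \int[L2]_x (ft_im (hr n) (hi n) x * tsin B1 B2 x))%R.
  by rewrite -RintegralB//; apply: eq_RintegralT => x; rewrite mulrBl.
have P := Rintegral_ft_pairing BB1 BB2 (ihr n) (ihi n).
have pi0 : (2 * pi) ^+ 2 != 0 :> R by rewrite expf_neq0// mulf_neq0// gt_eqF// pi_gt0.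
have {}P : (\int[L2]_x (hr n x * b x))%R = kappa * (\int[L2]_x (ft_re (hr n) (hi n) x * tcos B1 B2 x) - \int[L2]_x (ft_im (hr n) (hi n) x * tsin B1 B2 x))%R.
  by rewrite -RintegralB// P /kappa mulrA mulVf// mul1r.
rewrite RintegralB//.
have {}b1 := b1 t t0; have {}b2 := b2 t t0; have {}b3 := b3 t t0.
rewrite E1 P in b1; rewrite E2 in b2; rewrite E3 in b3.
have tt : t * (t ^+ 2)^-1 = t^-1 by field; rewrite gt_eqF.
rewrite tt in b1; rewrite tt in b2; rewrite tt in b3.
move: b1 b2 b3; set X := Rintegral _ _ _; set Y := Rintegral _ _ _; set Z := Rintegral _ _ _.
set U := Rintegral _ _ _; set V := Rintegral _ _ _ => b1 b2 b3.
rewrite (_ : X - _ = (X - kappa * (Y - Z)) - kappa * ((U - Y) - (V - Z))); last by ring.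
apply: le_trans (ler_normB _ _) _.
rewrite mulrDl; apply: lerD; first by apply: le_trans b1 _; rewrite mulrDl mul1r (mulrC Qb).
rewrite normrM (ger0_norm k0) -mulrA; apply: ler_wpM2l => //.
by apply: le_trans (ler_normB _ _) _; apply: le_trans (lerD b2 b3) _; rewrite le_eqVlt; apply/orP; left; apply/eqP; ring.
Qed.

End FourierPairing.

Section FourierTransform.
Variable R : realType.
Notation mu := (@lebesgue_measure R).
Notation mR := (measurableTypeR R).
Notation L2 := (sfprod mu mu).
Notation mR2 := (mR * mR)%type.
Implicit Types F : R * R -> R[i].

Definition sqnorm F : \bar R := (\int[L2]_x (complex.Re (F x) ^+ 2 + complex.Im (F x) ^+ 2)%:E)%E.

Lemma sqnorm_ge0 F : (0 <= sqnorm F)%E.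
Proof. by apply: integral_ge0 => x _; rewrite lee_fin addr_ge0 ?sqr_ge0. Qed.

Lemma cLnorm2E F : cLnorm (leb2 R) 2%:E setT F = (sqnorm F `^ (2^-1))%E.
Proof.
have := @cLnorm_even _ _ R (leb2 R) 1 setT F isT; rewrite muln1 => ->; congr (_ `^ _)%E.
by apply: eq_integral => x _; rewrite expr1 indicE in_setT mulr1.
Qed.

Lemma cLnorm2_sq F : sqnorm F = (cLnorm (leb2 R) 2%:E setT F * cLnorm (leb2 R) 2%:E setT F)%E.
Proof. by rewrite cLnorm2E poweR12_sqrt ?sqnorm_ge0// -expe2 sqr_sqrte// sqnorm_ge0. Qed.

Lemma cvg_sqnorm (F : nat -> R * R -> R[i]) : cLnorm (leb2 R) 2%:E setT (F n) @[n --> \oo] --> 0%E ->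
  forall e : R, 0 < e -> \forall n \near \oo, (sqnorm (F n) <= e%:E)%E.
Proof.
move=> F0 e e0; have : (cLnorm (leb2 R) 2%:E setT (F n) * cLnorm (leb2 R) 2%:E setT (F n))%E @[n --> \oo] --> (0 * 0)%E.
  by apply: cvgeM.
rewrite mule0 => /fine_cvgP[fin /cvgrPdist_le /(_ e e0) H].
near=> n; rewrite cLnorm2_sq.
have fn : ((cLnorm (leb2 R) 2%:E setT (F n) * cLnorm (leb2 R) 2%:E setT (F n))%E \is a fin_num) by near: n.
rewrite -(fineK fn) lee_fin.
have : `|0 - fine (cLnorm (leb2 R) 2%:E setT (F n) * cLnorm (leb2 R) 2%:E setT (F n))%E| <= e by near: n.
by rewrite sub0r normrN; apply: le_trans; exact: ler_norm.
Unshelve. all: by end_near.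
Qed.

Lemma in_L2P F : in_Lp (leb2 R) 2%:E F ->
  [/\ measurable_fun (setT : set mR2) (fun x => complex.Re (F x)),
      measurable_fun (setT : set mR2) (fun x => complex.Im (F x)) & (sqnorm F < +oo)%E].
Proof.
move=> [[m1 m2] fin]; split=> //; rewrite cLnorm2_sq.
by rewrite lte_mul_pinfty//; [rewrite cLnorm2E poweR_ge0|rewrite ge0_fin_numE// cLnorm2E poweR_ge0].
Qed.

Lemma sqnorm_Re F : measurable_fun (setT : set mR2) (fun x => complex.Re (F x)) ->
  measurable_fun (setT : set mR2) (fun x => complex.Im (F x)) ->
  (\int[L2]_x (complex.Re (F x) ^+ 2)%:E <= sqnorm F)%E.
Proof.
move=> m1 m2; apply: ge0_le_integral => //.
- by move=> x _; rewrite lee_fin sqr_ge0.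
- by apply/measurable_EFinP; meas.
- by apply/measurable_EFinP; meas.
- by move=> x _; rewrite lee_fin lerDl sqr_ge0.
Qed.

Lemma sqnorm_Im F : measurable_fun (setT : set mR2) (fun x => complex.Re (F x)) ->
  measurable_fun (setT : set mR2) (fun x => complex.Im (F x)) ->
  (\int[L2]_x (complex.Im (F x) ^+ 2)%:E <= sqnorm F)%E.
Proof.
move=> m1 m2; apply: ge0_le_integral => //.
- by move=> x _; rewrite lee_fin sqr_ge0.
- by apply/measurable_EFinP; meas.
- by apply/measurable_EFinP; meas.
- by move=> x _; rewrite lee_fin lerDr sqr_ge0.
Qed.

Lemma in_L1P F : in_Lp (leb2 R) 1%:E F ->
  L2.-integrable setT (EFin \o (fun x => complex.Re (F x))) /\ L2.-integrable setT (EFin \o (fun x => complex.Im (F x))).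
Proof.
move=> [[m1 m2]]; rewrite /cLnorm Lnorm1 => fin.
have b (g : R * R -> R) : measurable_fun (setT : set mR2) g -> (forall x, `|g x| <= Normc.normc (F x)) ->
    L2.-integrable setT (EFin \o g).
  move=> mg gF; apply/integrableP; split; first exact/measurable_EFinP.
  apply: le_lt_trans fin; apply: ge0_le_integral => //.
  - by apply/measurable_EFinP; meas.
  - apply/measurable_EFinP; apply: (@eq_measurable_fun _ _ _ _ _ (fun x => Num.sqrt (complex.Re (F x) ^+ 2 + complex.Im (F x) ^+ 2))).
      by move=> x _; rewrite /= patchE in_setT ger0_norm; case: (F x) => //= *; rewrite sqrtr_ge0.
    by meas.
  - move=> x _; rewrite /= patchE in_setT lee_fin; apply: le_trans (gF x) _; exact: ler_norm.
split; apply: b => // x; case: (F x) => u v /=; rewrite -[leLHS]sqrtr_sqr ler_sqrt ?addr_ge0 ?sqr_ge0//.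
  by rewrite lerDl sqr_ge0.
by rewrite lerDr sqr_ge0.
Qed.

Lemma fourier_integralE F xi :
  L2.-integrable setT (EFin \o (fun x => complex.Re (F x))) -> L2.-integrable setT (EFin \o (fun x => complex.Im (F x))) ->
  fourier_integral F xi = Complex (ft_re (fun x => complex.Re (F x)) (fun x => complex.Im (F x)) xi)
    (ft_im (fun x => complex.Re (F x)) (fun x => complex.Im (F x)) xi).
Proof.
move=> _ _; rewrite /fourier_integral /cintegral /ft_re /ft_im; congr Complex.
  by apply: eq_RintegralT => x /=; rewrite /dot; case: (F x) => u v /=; rewrite mulNr opprK.
by apply: eq_RintegralT => x /=; rewrite /dot; case: (F x) => u v /=; rewrite mulNr.
Qed.

Variables B1 B2 : nat -> R -> R.
Hypotheses (BB1 : bump_family B1) (BB2 : bump_family B2).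

(** The second identity is the first one for [- i f], whose real part is the imaginary part of [f]
    and whose transform is [- i g]; this is the source of the double sign. *)
Theorem fourier_pairing (f g : R * R -> R[i]) : is_fourier f g ->
  (\int[L2]_x (complex.Re (f x) * (B1 0%N x.1 * B2 0%N x.2)) = ((2 * pi) ^+ 2)^-1 *
     \int[L2]_xi (complex.Re (g xi) * tcos B1 B2 xi - complex.Im (g xi) * tsin B1 B2 xi))%R /\
  (\int[L2]_x (complex.Im (f x) * (B1 0%N x.1 * B2 0%N x.2)) = ((2 * pi) ^+ 2)^-1 *
     \int[L2]_xi (complex.Im (g xi) * tcos B1 B2 xi - - complex.Re (g xi) * tsin B1 B2 xi))%R.
Proof.
move=> [/in_L2P[mfr mfi nf] /in_L2P[mgr mgi ng] [h [hL hf hg]]].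
have fin G : (sqnorm G < +oo)%E -> exists Q : R, (sqnorm G <= Q%:E)%E.
  by move=> Gf; exists (fine (sqnorm G)); rewrite fineK// ge0_fin_numE// sqnorm_ge0.
have [Qf hQf] := fin _ nf; have [Qg hQg] := fin _ ng.
have hi n := in_L1P (hL n).1; have mh n := in_L2P (hL n).2.
pose hr n x := complex.Re (h n x); pose him n x := complex.Im (h n x).
have ih1 n : L2.-integrable setT (EFin \o hr n) by exact: (hi n).1.
have ih2 n : L2.-integrable setT (EFin \o him n) by exact: (hi n).2.
have mf1 n := measurable_ft_re (ih1 n) (ih2 n); have mf2 n := measurable_ft_im (ih1 n) (ih2 n).
have ReB (x y : R[i]) : complex.Re (x - y) = complex.Re x - complex.Re y by case: x y => ? ? [].
have ImB (x y : R[i]) : complex.Im (x - y) = complex.Im x - complex.Im y by case: x y => ? ? [].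
have mReB (u v : R * R -> R[i]) : measurable_fun (setT : set mR2) (fun x => complex.Re (u x)) ->
    measurable_fun (setT : set mR2) (fun x => complex.Re (v x)) -> measurable_fun (setT : set mR2) (fun x => complex.Re (u x - v x)).
  by move=> mu' mv'; apply: eq_measurable_fun (measurable_funB mu' mv') => x _; rewrite ReB.
have mImB (u v : R * R -> R[i]) : measurable_fun (setT : set mR2) (fun x => complex.Im (u x)) ->
    measurable_fun (setT : set mR2) (fun x => complex.Im (v x)) -> measurable_fun (setT : set mR2) (fun x => complex.Im (u x - v x)).
  by move=> mu' mv'; apply: eq_measurable_fun (measurable_funB mu' mv') => x _; rewrite ImB.
have approx (e : R) : 0 < e -> exists n,
   [/\ (\int[L2]_x ((complex.Re (f x) - hr n x) ^+ 2)%:E <= e%:E)%E, (\int[L2]_x ((complex.Im (f x) - him n x) ^+ 2)%:E <= e%:E)%E,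
     (\int[L2]_x ((complex.Re (g x) - ft_re (hr n) (him n) x) ^+ 2)%:E <= e%:E)%E &
     (\int[L2]_x ((complex.Im (g x) - ft_im (hr n) (him n) x) ^+ 2)%:E <= e%:E)%E].
  move=> e0; have H1 := cvg_sqnorm hf e0; have H2 := cvg_sqnorm hg e0.
  have [n [n1 n2]] : exists n, (sqnorm (fun x => h n x - f x)%R <= e%:E)%E /\ (sqnorm (fun xi => fourier_integral (h n) xi - g xi)%R <= e%:E)%E.
    have [n _ Hn] := filterI H1 H2; exists n; exact: (Hn n (leqnn n)).
  have [m1 m2 _] := mh n; have m3 := mf1 n; have m4 := mf2 n.
  have FE xi := fourier_integralE xi (ih1 n) (ih2 n).
  have m5 : measurable_fun (setT : set mR2) (fun x => complex.Re (fourier_integral (h n) x)).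
    by apply: eq_measurable_fun m3 => x _; rewrite FE.
  have m6 : measurable_fun (setT : set mR2) (fun x => complex.Im (fourier_integral (h n) x)).
    by apply: eq_measurable_fun m4 => x _; rewrite FE.
  exists n; split.
  - apply: le_trans n1; apply: le_trans (sqnorm_Re _ _).
    + by apply: eq_lee (lexx _); apply: eq_integral => x _; rewrite ReB -sqrrN opprB.
    + exact: mReB.
    + exact: mImB.
  - apply: le_trans n1; apply: le_trans (sqnorm_Im _ _).
    + by apply: eq_lee (lexx _); apply: eq_integral => x _; rewrite ImB -sqrrN opprB.
    + exact: mReB.
    + exact: mImB.
  - apply: le_trans n2; apply: le_trans (sqnorm_Re _ _).
    + by apply: eq_lee (lexx _); apply: eq_integral => x _; rewrite ReB FE -sqrrN opprB.
    + exact: mReB m5 mgr.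
    + exact: mImB m6 mgi.
  - apply: le_trans n2; apply: le_trans (sqnorm_Im _ _).
    + by apply: eq_lee (lexx _); apply: eq_integral => x _; rewrite ImB FE -sqrrN opprB.
    + exact: mReB m5 mgr.
    + exact: mImB m6 mgi.
have q1 : exists Q : R, (\int[L2]_x (complex.Re (f x) ^+ 2)%:E <= Q%:E)%E by exists Qf; apply: le_trans hQf; exact: sqnorm_Re.
have q2 : exists Q : R, (\int[L2]_x (complex.Im (f x) ^+ 2)%:E <= Q%:E)%E by exists Qf; apply: le_trans hQf; exact: sqnorm_Im.
have q3 : exists Q : R, (\int[L2]_x (complex.Re (g x) ^+ 2)%:E <= Q%:E)%E by exists Qg; apply: le_trans hQg; exact: sqnorm_Re.
have q4 : exists Q : R, (\int[L2]_x (complex.Im (g x) ^+ 2)%:E <= Q%:E)%E by exists Qg; apply: le_trans hQg; exact: sqnorm_Im.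
split.
  apply: (L2_pairing BB1 BB2 mfr mgr mgi q1 q3 q4 ih1 ih2) => e e0.
  by have [n [a1 a2 a3 a4]] := approx e e0; exists n; split; [exact: a1|exact: a3|exact: a4].
have mgr' : measurable_fun (setT : set mR2) (fun x => - complex.Re (g x)) by meas.
have q3' : exists Q : R, (\int[L2]_x ((- complex.Re (g x)) ^+ 2)%:E <= Q%:E)%E.
  by have [Q hQ] := q3; exists Q; under eq_integral do rewrite sqrrN.
have ih1' n : L2.-integrable setT (EFin \o (fun x => - hr n x)).
  by have := integrableN (ih1 n); apply: eq_integrable.
apply: (L2_pairing BB1 BB2 mfi mgi mgr' q2 q4 q3' ih2 ih1') => e e0.
have [n [a1 a2 a3 a4]] := approx e e0; exists n; split; [exact: a2| |].
- apply: eq_lee a4; apply: eq_integral => x _; congr ((_ - _) ^+ 2)%:E.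
  by apply: eq_RintegralT => y; ring.
- apply: eq_lee a3; apply: eq_integral => x _.
  rewrite (_ : ft_im (him n) (fun y => - hr n y) x = - ft_re (hr n) (him n) x).
    by congr (_ %:E); ring.
  have md : measurable_fun (setT : set mR2) (fun y => dot y x) by rewrite /dot; meas.
  have i : L2.-integrable setT (EFin \o (fun y => cos (dot y x) * hr n y + sin (dot y x) * him n y)).
    have := integrableD measurableT (integrable_cos (ih1 n) md) (integrable_sin (ih2 n) md).
    by apply: eq_integrable => //= y _; rewrite -EFinD mulrC (mulrC (him n y)).
  rewrite /ft_re -[RHS]mulN1r -RintegralZl//.
  by apply: eq_RintegralT => y; ring.
Qed.

End FourierTransform.

(** * Waves as weak solutions *)

Section WaveWeak.
Variable R : realType.
Notation mu := (@lebesgue_measure R).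
Notation mR := (measurableTypeR R).
Notation L2 := (sfprod mu mu).
Notation L3 := (sfprod L2 mu).
Notation mR2 := (mR * mR)%type.
Notation mR3 := (mR * mR * mR)%type.
Notation R3 := (R * R * R)%type.

Variables B1 B2 B3 : nat -> R -> R.
Hypotheses (BB1 : bump_family B1) (BB2 : bump_family B2) (BB3 : bump_family B3).

Let i1 := integrable_bump_family BB1.
Let i2 := integrable_bump_family BB2.
Let i3 := integrable_bump_family BB3.
Let mfuture := @measurable_future R.

Let fB3 k (t : R) := future t * B3 k t.
Let if3 k : mu.-integrable setT (EFin \o fB3 k).
Proof.
apply: (@eq_integrableT _ mR R mu (fun t => B3 k t * future t)); first by move=> t; rewrite mulrC.
by apply: (integrable_mul_bounded (M := 1) (i3 k) mfuture); exact: future_le1.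
Qed.

Definition ftensor i j k (z : R3) : R := B1 i z.1.1 * B2 j z.1.2 * fB3 k z.2.

Lemma integrable_ftensor i j k : L3.-integrable setT (EFin \o ftensor i j k).
Proof. exact: (integrable_prod (integrable_prod (i1 i) (i2 j)) (if3 k)). Qed.

(** The wave operator is applied to the product of bumps before the cut to [t > 0], so the
    derivatives do not fall on the jump. *)
Definition future_box (z : R3) : R :=
  ftensor 0%N 0%N 2%N z - (ftensor 2%N 0%N 0%N z + ftensor 0%N 2%N 0%N z).

Lemma future_boxE z : future_box z = future z.2 *
  (tensor B1 B2 B3 0%N 0%N 2%N z - (tensor B1 B2 B3 2%N 0%N 0%N z + tensor B1 B2 B3 0%N 2%N 0%N z)).
Proof. by rewrite /future_box /ftensor /fB3 /tensor; ring. Qed.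

Lemma integrable_future_box : L3.-integrable setT (EFin \o future_box).
Proof.
have := integrableB measurableT (integrable_ftensor 0 0 2) (integrableD measurableT (integrable_ftensor 2 0 0) (integrable_ftensor 0 2 0)).
by apply: eq_integrable.
Qed.

Let osc k (r : R) : R := (\int[mu]_t (fB3 k t * cos (t * r)))%R.

Let plane i j (xi : R * R) :
  (\int[L2]_x (B1 i x.1 * B2 j x.2 * cos (dot x xi)) = bcos B1 i xi.1 * bcos B2 j xi.2 - bsin B1 i xi.1 * bsin B2 j xi.2)%R /\
  (\int[L2]_x (B1 i x.1 * B2 j x.2 * sin (dot x xi)) = bsin B1 i xi.1 * bcos B2 j xi.2 + bcos B1 i xi.1 * bsin B2 j xi.2)%R.
Proof.
have ml (c : R) : measurable_fun (setT : set mR) (fun y => c * y) by meas.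
have c1 := integrable_cos (i1 i) (ml xi.1); have s1 := integrable_sin (i1 i) (ml xi.1).
have c2 := integrable_cos (i2 j) (ml xi.2); have s2 := integrable_sin (i2 j) (ml xi.2).
rewrite /bcos /bsin; split.
  rewrite (@eq_RintegralT _ mR2 R L2 _ (fun x => (B1 i x.1 * cos (xi.1 * x.1)) * (B2 j x.2 * cos (xi.2 * x.2)) - (B1 i x.1 * sin (xi.1 * x.1)) * (B2 j x.2 * sin (xi.2 * x.2)))); last first.
    by move=> x; rewrite /dot cosD (mulrC x.1) (mulrC x.2); ring.
  rewrite RintegralB//; [|exact: (integrable_prod c1 c2)|exact: (integrable_prod s1 s2)].
  by rewrite (Rintegral_prod c1 c2) (Rintegral_prod s1 s2).
rewrite (@eq_RintegralT _ mR2 R L2 _ (fun x => (B1 i x.1 * sin (xi.1 * x.1)) * (B2 j x.2 * cos (xi.2 * x.2)) + (B1 i x.1 * cos (xi.1 * x.1)) * (B2 j x.2 * sin (xi.2 * x.2)))); last first.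
  by move=> x; rewrite /dot sinD (mulrC x.1) (mulrC x.2); ring.
rewrite RintegralD//; [|exact: (integrable_prod s1 c2)|exact: (integrable_prod c1 s2)].
by rewrite (Rintegral_prod s1 c2) (Rintegral_prod c1 s2).
Qed.

Let mdot (xi : R * R) : measurable_fun (setT : set mR2) (fun x => dot x xi).
Proof. by rewrite /dot; meas. Qed.
Let mtr (r : R) : measurable_fun (setT : set mR) (fun t => t * r).
Proof. by meas. Qed.

Let ftens_int i j k (xi : R * R) (r : R) :
  L3.-integrable setT (EFin \o (fun z => ftensor i j k z * (cos (dot z.1 xi) * cos (z.2 * r)))) /\
  L3.-integrable setT (EFin \o (fun z => ftensor i j k z * (sin (dot z.1 xi) * cos (z.2 * r)))).
Proof.
have ic := integrable_cos (if3 k) (mtr r).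
have iab := integrable_prod (i1 i) (i2 j).
split.
  have := integrable_prod (integrable_cos iab (mdot xi)) ic.
  by apply: eq_integrableT => z; rewrite /ftensor; ring.
have := integrable_prod (integrable_sin iab (mdot xi)) ic.
by apply: eq_integrableT => z; rewrite /ftensor; ring.
Qed.

Let ftens_val i j k (xi : R * R) (r : R) :
  (\int[L3]_z (ftensor i j k z * (cos (dot z.1 xi) * cos (z.2 * r))) =
    (bcos B1 i xi.1 * bcos B2 j xi.2 - bsin B1 i xi.1 * bsin B2 j xi.2) * osc k r)%R /\
  (\int[L3]_z (ftensor i j k z * (sin (dot z.1 xi) * cos (z.2 * r))) =
    (bsin B1 i xi.1 * bcos B2 j xi.2 + bcos B1 i xi.1 * bsin B2 j xi.2) * osc k r)%R.
Proof.
have ic := integrable_cos (if3 k) (mtr r).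
have iab := integrable_prod (i1 i) (i2 j).
have [<- <-] := plane i j xi; split.
  rewrite /osc -(Rintegral_prod (integrable_cos iab (mdot xi)) ic).
  by apply: eq_RintegralT => z; rewrite /ftensor; ring.
rewrite /osc -(Rintegral_prod (integrable_sin iab (mdot xi)) ic).
by apply: eq_RintegralT => z; rewrite /ftensor; ring.
Qed.

(** Integration by parts in space gives [|xi|^2], while in time the half-line oscillator of
    frequency [|xi|] gives the opposite multiple plus its trace at [t = 0]. Only the trace
    survives. *)
Lemma Rintegral_future_box_plane_wave (xi : R * R) :
  (\int[L3]_z (future_box z * (cos (dot z.1 xi) * cos (z.2 * rad xi))) = - B3 1%N 0 * tcos B1 B2 xi)%R /\
  (\int[L3]_z (future_box z * (sin (dot z.1 xi) * cos (z.2 * rad xi))) = - B3 1%N 0 * tsin B1 B2 xi)%R.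
Proof.
have H := bump_half_line_oscillator BB3 (rad xi).
have r2 : rad xi ^+ 2 = xi.1 ^+ 2 + xi.2 ^+ 2 by rewrite sqr_sqrtr// addr_ge0 ?sqr_ge0.
have parts := (bump_cos_parts BB1 0%N xi.1, bump_sin_parts BB1 0%N xi.1, bump_cos_parts BB2 0%N xi.2, bump_sin_parts BB2 0%N xi.2).
pose F i j k := ftens_int i j k xi (rad xi).
have lin (o : R3 -> R) :
  (forall i j k, L3.-integrable setT (EFin \o (fun z => ftensor i j k z * o z))) ->
  (\int[L3]_z (future_box z * o z) = \int[L3]_z (ftensor 0%N 0%N 2%N z * o z) -
    (\int[L3]_z (ftensor 2%N 0%N 0%N z * o z) + \int[L3]_z (ftensor 0%N 2%N 0%N z * o z)))%R.
  move=> io; have io2 : L3.-integrable setT (EFin \o (fun z => ftensor 2%N 0%N 0%N z * o z + ftensor 0%N 2%N 0%N z * o z)).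
    by have := integrableD measurableT (io 2%N 0%N 0%N) (io 0%N 2%N 0%N); apply: eq_integrable.
  rewrite -RintegralD// -RintegralB//.
  by apply: eq_RintegralT => z; rewrite /future_box; ring.
split.
  rewrite (lin (fun z => cos (dot z.1 xi) * cos (z.2 * rad xi))); last by move=> i j k; exact: (F i j k).1.
  rewrite (ftens_val 0 0 2 xi (rad xi)).1 (ftens_val 2 0 0 xi (rad xi)).1 (ftens_val 0 2 0 xi (rad xi)).1.
  rewrite -H r2 /tcos /bcos /bsin !parts /osc /fB3; ring.
rewrite (lin (fun z => sin (dot z.1 xi) * cos (z.2 * rad xi))); last by move=> i j k; exact: (F i j k).2.
rewrite (ftens_val 0 0 2 xi (rad xi)).2 (ftens_val 2 0 0 xi (rad xi)).2 (ftens_val 0 2 0 xi (rad xi)).2.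
by rewrite -H r2 /tsin /bcos /bsin !parts /osc /fB3; ring.
Qed.

Variables p q : R * R -> R.
Hypotheses (ip : L2.-integrable setT (EFin \o p)) (iq : L2.-integrable setT (EFin \o q)).

Let mrad := @measurable_rad R.

Lemma wave_box_pairing :
  (\int[L3]_z (wave p q z * future_box z))%R = - B3 1%N 0 * (\int[L2]_xi (p xi * tcos B1 B2 xi - q xi * tsin B1 B2 xi))%R.
Proof.
pose oc (z : R3) (xi : R * R) := cos (dot z.1 xi) * cos (z.2 * rad xi).
pose os (z : R3) (xi : R * R) := sin (dot z.1 xi) * cos (z.2 * rad xi).
have moc d (T : measurableType d) (a : T -> mR3) (b : T -> mR2) : measurable_fun setT a -> measurable_fun setT b ->
    measurable_fun setT (fun x => oc (a x) (b x)) by move=> ma mb; rewrite /oc /dot; meas.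
have mos d (T : measurableType d) (a : T -> mR3) (b : T -> mR2) : measurable_fun setT a -> measurable_fun setT b ->
    measurable_fun setT (fun x => os (a x) (b x)) by move=> ma mb; rewrite /os /dot; meas.
have bc z xi : `|oc z xi| <= 1 by rewrite normrM mulr_ile1 ?cos_abs_le1.
have bs z xi : `|os z xi| <= 1 by rewrite normrM mulr_ile1 ?cos_abs_le1 ?sin_abs_le1.
pose G z xi := future_box z * p xi * oc z xi - future_box z * q xi * os z xi.
have ib := integrable_future_box.
have iG : (sfprod L3 L2).-integrable setT (EFin \o (fun w => G w.1 w.2)).
  have := integrableB measurableT
    (integrable_mul_bounded (integrable_prod ib ip) (moc _ _ _ _ measurable_fst measurable_snd) (fun w => bc w.1 w.2))
    (integrable_mul_bounded (integrable_prod ib iq) (mos _ _ _ _ measurable_fst measurable_snd) (fun w => bs w.1 w.2)).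
  by apply: eq_integrable.
have ipz z : L2.-integrable setT (EFin \o (fun xi => p xi * oc z xi)).
  by apply: integrable_mul_bounded ip _ (bc z); apply: moc; meas.
have iqz z : L2.-integrable setT (EFin \o (fun xi => q xi * os z xi)).
  by apply: integrable_mul_bounded iq _ (bs z); apply: mos; meas.
have ipq z : L2.-integrable setT (EFin \o (fun xi => p xi * oc z xi - q xi * os z xi)).
  by have := integrableB measurableT (ipz z) (iqz z); apply: eq_integrable.
have iGz z : L2.-integrable setT (EFin \o G z).
  by have := integrableZl measurableT (future_box z) (ipq z); apply: eq_integrable => //= xi _; rewrite -EFinM; congr EFin; rewrite /G; ring.
have ibc xi : L3.-integrable setT (EFin \o (fun z => future_box z * oc z xi)).
  by apply: integrable_mul_bounded ib _ (fun z => bc z xi); apply: moc; meas.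
have ibs xi : L3.-integrable setT (EFin \o (fun z => future_box z * os z xi)).
  by apply: integrable_mul_bounded ib _ (fun z => bs z xi); apply: mos; meas.
have ibcp xi : L3.-integrable setT (EFin \o (fun z => p xi * (future_box z * oc z xi))).
  by have := integrableZl measurableT (p xi) (ibc xi); apply: eq_integrable.
have ibsq xi : L3.-integrable setT (EFin \o (fun z => q xi * (future_box z * os z xi))).
  by have := integrableZl measurableT (q xi) (ibs xi); apply: eq_integrable.
have iGxi xi : L3.-integrable setT (EFin \o (fun z => G z xi)).
  by have := integrableB measurableT (ibcp xi) (ibsq xi); apply: eq_integrable => //= z _; rewrite -EFinD; congr EFin; rewrite /G; ring.
apply: (@etrans _ _ (\int[L3]_z \int[L2]_xi G z xi)%R).
  apply: eq_RintegralT => z; rewrite /wave mulrC -RintegralZl//; last exact: ipq.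
  by apply: eq_RintegralT => xi; rewrite /G /oc /os; ring.
apply: (etrans (esym (@Rintegral_Fubini1 _ _ _ _ R L3 L2 G iG iGz))).
apply: (etrans (@Rintegral_Fubini2 _ _ _ _ R L3 L2 G iG iGxi)).
have [K K0 hK] := tcos_tsin_bounded BB1 BB2.
have mtc : measurable_fun (setT : set mR2) (tcos B1 B2) by apply/measurable_EFinP; exact: measurable_int (integrable_tcos BB1 BB2).
have mts : measurable_fun (setT : set mR2) (tsin B1 B2) by apply/measurable_EFinP; exact: measurable_int (integrable_tsin BB1 BB2).
have ipt := integrable_mul_bounded ip mtc (fun x => (hK x).1); have iqt := integrable_mul_bounded iq mts (fun x => (hK x).2).
have it : L2.-integrable setT (EFin \o (fun xi => p xi * tcos B1 B2 xi - q xi * tsin B1 B2 xi)).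
  by have := integrableB measurableT ipt iqt; apply: eq_integrable.
rewrite -[RHS]RintegralZl//.
apply: eq_RintegralT => xi.
have [E1 E2] := Rintegral_future_box_plane_wave xi.
rewrite (@eq_RintegralT _ mR3 R L3 _ (fun z => p xi * (future_box z * oc z xi) - q xi * (future_box z * os z xi))); last first.
  by move=> z; rewrite /G; ring.
have jbc := ibc xi; have jbs := ibs xi; have jp := ibcp xi; have jq := ibsq xi.
rewrite RintegralB// RintegralZl// RintegralZl//.
by rewrite /oc /os E1 E2; ring.
Qed.

End WaveWeak.

(** * Dyadic decomposition of the amplitude *)

Section Core.
Variable R : realType.
Notation mu := (@lebesgue_measure R).
Notation mR := (measurableTypeR R).
Notation L2 := (sfprod mu mu).
Notation L3 := (sfprod L2 mu).
Notation mR2 := (mR * mR)%type.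
Notation mR3 := (mR * mR * mR)%type.
Notation R3 := (R * R * R)%type.

Section Additivity.
Variables p q p' q' : R * R -> R.
Hypotheses (ip : L2.-integrable setT (EFin \o p)) (iq : L2.-integrable setT (EFin \o q)).
Hypotheses (ip' : L2.-integrable setT (EFin \o p')) (iq' : L2.-integrable setT (EFin \o q')).
Let mrad := @measurable_rad R.

Let iwave (a b : R * R -> R) (z : R3) : L2.-integrable setT (EFin \o a) -> L2.-integrable setT (EFin \o b) ->
  L2.-integrable setT (EFin \o (fun xi => a xi * (cos (dot z.1 xi) * cos (z.2 * rad xi)) - b xi * (sin (dot z.1 xi) * cos (z.2 * rad xi)))).
Proof.
move=> ia ib.
have mc : measurable_fun (setT : set mR2) (fun xi => cos (dot z.1 xi) * cos (z.2 * rad xi)) by rewrite /dot; meas.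
have ms : measurable_fun (setT : set mR2) (fun xi => sin (dot z.1 xi) * cos (z.2 * rad xi)) by rewrite /dot; meas.
have bc xi : `|cos (dot z.1 xi) * cos (z.2 * rad xi)| <= 1 by rewrite normrM mulr_ile1 ?cos_abs_le1.
have bs xi : `|sin (dot z.1 xi) * cos (z.2 * rad xi)| <= 1 by rewrite normrM mulr_ile1 ?cos_abs_le1 ?sin_abs_le1.
have := integrableB measurableT (integrable_mul_bounded ia mc bc) (integrable_mul_bounded ib ms bs).
by apply: eq_integrable.
Qed.

Lemma waveD z : wave (fun xi => p xi + p' xi) (fun xi => q xi + q' xi) z = wave p q z + wave p' q' z.
Proof.
have i1 := iwave z ip iq; have i2 := iwave z ip' iq'.
by rewrite /wave -RintegralD//; apply: eq_RintegralT => xi; ring.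
Qed.

End Additivity.

Definition wt (xi : R * R) : R := 1 + xi.1 ^+ 2 + xi.2 ^+ 2.

Lemma wt_ge1 xi : 1 <= wt xi.
Proof. by rewrite /wt -addrA lerDl addr_ge0 ?sqr_ge0. Qed.

(** Dyadic in [1 + |xi|^2] rather than in [|xi|]: the bottom value is then 1, so the shells with
    [k >= 0] cover the whole plane and the truncation at level 0 is empty. *)
Definition shell (k : nat) (xi : R * R) : R := ((2 ^+ k <= wt xi) && (wt xi < 2 ^+ k.+1))%R%:R.
Definition lowfreq (n : nat) (xi : R * R) : R := (wt xi < 2 ^+ n)%R%:R.

Lemma lowfreq0 xi : lowfreq 0 xi = 0.
Proof. by rewrite /lowfreq expr0 ltNge wt_ge1. Qed.

Lemma lowfreqS n xi : lowfreq n.+1 xi = lowfreq n xi + shell n xi.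
Proof.
rewrite /lowfreq /shell; have [h|h] /= := ltP (wt xi) (2 ^+ n); last by rewrite add0r.
by rewrite addr0 (lt_trans h)// exprS ltr_pMl ?exprn_gt0// ltr1n.
Qed.

Let mwt : measurable_fun (setT : set mR2) wt.
Proof. by rewrite /wt; meas. Qed.

Let mlt (c : R) : measurable_fun (setT : set mR) (fun x => (x < c)%R%:R : R).
Proof.
rewrite (_ : (fun x => _) = \1_(`]-oo, c[%classic : set R)); first exact: measurable_indic.
apply/funext => x; rewrite indicE; case: (boolP (x < c)) => h.
  by rewrite mem_set//= in_itv/= h.
by rewrite memNset//= in_itv/=; exact/negP.
Qed.

Lemma measurable_lowfreq n : measurable_fun (setT : set mR2) (lowfreq n).
Proof. by have m := mlt (2 ^+ n); apply: (measurableT_comp m mwt). Qed.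

Lemma measurable_shell n : measurable_fun (setT : set mR2) (shell n).
Proof.
have m1 := measurable_lowfreq n; have m2 := measurable_lowfreq n.+1.
rewrite (_ : shell n = fun xi => lowfreq n.+1 xi - lowfreq n xi); first by meas.
by apply/funext => xi; rewrite lowfreqS addrC addKr.
Qed.

Lemma shell01 k xi : 0 <= shell k xi <= 1. Proof. by rewrite /shell; case: ((2 ^+ k <= wt xi) && _); rewrite ?lexx ?ler01. Qed.
Lemma lowfreq01 k xi : 0 <= lowfreq k xi <= 1. Proof. by rewrite /lowfreq; case: (wt xi < _); rewrite ?lexx ?ler01. Qed.

Lemma shell_le_lowfreq k xi : shell k xi <= lowfreq k.+1 xi.
Proof. by rewrite lowfreqS lerDr; case/andP: (lowfreq01 k xi). Qed.

Lemma integrable_lowfreq n : L2.-integrable setT (EFin \o lowfreq n).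
Proof.
have m := measurable_lowfreq n.
have := integrable_mul_bounded (integrable_prod (integrable_window (2 ^+ n : R)) (integrable_window (2 ^+ n : R))) m.
move=> /(_ 1) H; have {}H := H _; apply: eq_integrableT (H _) => xi; last first.
  by case/andP: (lowfreq01 n xi) => h0 h1; rewrite ger0_norm.
rewrite /lowfreq /window; case: (boolP (wt xi < 2 ^+ n)) => h; last by rewrite mulr0.
have sq (x : R) : `|x| <= 1 + x ^+ 2.
  by rewrite -(real_normK (num_real x)); have := sqr_ge0 (`|x| - 1); have := normr_ge0 x; nra.
have h1 : `|xi.1| <= 2 ^+ n.
  by apply: le_trans (sq _) _; move: h; rewrite /wt; have := sqr_ge0 xi.2; lra.
have h2 : `|xi.2| <= 2 ^+ n.
  by apply: le_trans (sq _) _; move: h; rewrite /wt; have := sqr_ge0 xi.1; lra.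
by rewrite h1 h2 !mulr1.
Qed.

Variable eps : R.
Hypothesis eps0 : 0 < eps.
(** The square of the Sobolev multiplier of order [1/2 + eps]. *)
Definition sobw (xi : R * R) : R := wt xi `^ (1 / 2 + eps).
Let a : R := 2 `^ eps.
Let rho : R := a^-1.
(** Equal to [2^(- eps / 2)]. The energy of the k-th shell gains [rho^k = r^(2k)], and the sixth
    power integral, cubic in the energy, gains [r^(6k)]. *)
Definition ratio : R := Num.sqrt rho.
Notation r := ratio.

Let a1 : 1 < a.
Proof. by rewrite /a -[ltLHS](congr1 (fun f => f eps) (@powR1 R)); apply: gt0_ltr_powR; rewrite ?nnegrE// ltr1n. Qed.

Let a0 : 0 < a. Proof. exact: lt_trans a1. Qed.
Let rho0 : 0 < rho. Proof. by rewrite invr_gt0. Qed.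
Let rho1 : rho < 1. Proof. by rewrite /rho invf_lt1. Qed.
Lemma ratio_gt0 : 0 < r. Proof. by rewrite sqrtr_gt0. Qed.
Lemma ratio_sq : r ^+ 2 = rho. Proof. by rewrite sqr_sqrtr// ltW. Qed.
Lemma ratio_lt1 : r < 1.
Proof. by rewrite /r -[ltRHS]sqrtr1 ltr_sqrt. Qed.

Let rad_sqrt xi : rad xi <= Num.sqrt (wt xi).
Proof.
rewrite /rad ler_sqrt; first by rewrite /wt -addrA lerDr.
by apply: le_trans (wt_ge1 xi).
Qed.

Let sobwE xi : sobw xi = Num.sqrt (wt xi) * wt xi `^ eps.
Proof.
have w0 : 0 < wt xi by apply: lt_le_trans (wt_ge1 xi).
rewrite /sobw powRD ?(gt_eqF w0) ?implybT// -powR12_sqrt ?ltW//.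
by rewrite div1r.
Qed.

Lemma rad_le_sobw xi : rad xi <= sobw xi.
Proof.
rewrite sobwE; apply: le_trans (rad_sqrt xi) _; rewrite ler_peMr ?sqrtr_ge0//.
by rewrite -(powRr0 (wt xi)); apply: ler_powR; [exact: wt_ge1|exact: ltW].
Qed.

Lemma sobw_ge1 xi : 1 <= sobw xi.
Proof.
rewrite -(powRr0 (wt xi)); apply: ler_powR; first exact: wt_ge1.
by have := eps0; lra.
Qed.

(** On the shell [wt xi >= 2^k], so [|xi|] is at most [wt^(1/2)], that is [sobw] times [wt^(- eps)],
    and the last factor is at most [2^(- k eps)]. *)
Lemma shell_rad k xi : shell k xi * rad xi <= rho ^+ k * sobw xi.
Proof.
have s1 := sobw_ge1 xi.
have z0 : 0 <= rho ^+ k * sobw xi by rewrite mulr_ge0 ?exprn_ge0 ?(ltW rho0)// (le_trans ler01 s1).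
rewrite /shell; have [h|h] /= := leP (2 ^+ k) (wt xi); last by rewrite mul0r.
case: (wt xi < 2 ^+ k.+1); last by rewrite mul0r.
rewrite mul1r sobwE mulrCA; apply: le_trans (rad_sqrt xi) _; rewrite ler_peMr ?sqrtr_ge0//.
rewrite /rho exprVn mulrC ler_pdivlMr ?exprn_gt0// mul1r.
rewrite /a -powR_mulrn ?powR_ge0// powRAC powR_mulrn//.
by apply: ge0_ler_powR; rewrite ?nnegrE ?exprn_ge0// ?ltW//; apply: lt_le_trans (wt_ge1 xi).
Qed.

Lemma measurable_sobw : measurable_fun (setT : set mR2) sobw.
Proof. by rewrite /sobw; meas. Qed.

Let msob := measurable_sobw.

Section Amplitude.
Variables (p : R * R -> R) (B : R).
Hypotheses (mp : measurable_fun (setT : set mR2) p) (hp : (\int[L2]_xi (p xi ^+ 2 * sobw xi)%:E <= B%:E)%E).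

Let sq_sob xi : 0 <= p xi ^+ 2 * sobw xi.
Proof. by rewrite mulr_ge0 ?sqr_ge0// (le_trans ler01 (sobw_ge1 xi)). Qed.

Lemma amp_B_ge0 : 0 <= B.
Proof. by rewrite -lee_fin; apply: le_trans hp; apply: integral_ge0 => xi _; rewrite lee_fin. Qed.

Lemma amp_sq : (\int[L2]_xi (p xi ^+ 2)%:E <= B%:E)%E.
Proof.
apply: le_trans hp; apply: ge0_le_integral => //.
- by move=> x _; rewrite lee_fin sqr_ge0.
- by apply/measurable_EFinP; meas.
- by apply/measurable_EFinP; meas.
- by move=> x _; rewrite lee_fin ler_peMr ?sqr_ge0// sobw_ge1.
Qed.

(** Square integrability gives integrability on the bounded set of low frequencies, through
    [|p| <= p^2 + 1]. *)
Lemma integrable_amp (chi : R * R -> R) n : measurable_fun (setT : set mR2) chi ->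
  (forall xi, 0 <= chi xi <= lowfreq n xi) -> L2.-integrable setT (EFin \o (fun xi => p xi * chi xi)).
Proof.
move=> mchi chi1.
have i1 : L2.-integrable setT (EFin \o (fun xi => p xi ^+ 2 * sobw xi)).
  apply: ge0_integrableP; [by meas|exact: sq_sob|].
  by apply: le_lt_trans hp _; rewrite ltry.
have i2 : L2.-integrable setT (EFin \o (fun xi => p xi ^+ 2 * sobw xi + lowfreq n xi)).
  by have := integrableD measurableT i1 (integrable_lowfreq n); apply: eq_integrable.
apply: (@le_integrable_EFin _ mR2 R L2 _ (fun xi => p xi ^+ 2 * sobw xi + lowfreq n xi)) => //; first by meas.
move=> xi; have /andP[c0 c1] := chi1 xi; have /andP[l0 l1] := lowfreq01 n xi.
rewrite normrM (ger0_norm c0).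
have s1 := sobw_ge1 xi.
have h1 : p xi ^+ 2 <= p xi ^+ 2 * sobw xi by rewrite ler_peMr ?sqr_ge0.
have c2 : chi xi <= 1 by exact: le_trans l1.
have h2 : `|p xi| * chi xi <= p xi ^+ 2 * chi xi + chi xi.
  rewrite [leRHS](_ : _ = (p xi ^+ 2 + 1) * chi xi); last by ring.
  rewrite ler_wpM2r// -(real_normK (num_real (p xi))).
  by have := sqr_ge0 (`|p xi| - 1); have := normr_ge0 (p xi); nra.
have h3 : p xi ^+ 2 * chi xi <= p xi ^+ 2 by rewrite ler_piMr ?sqr_ge0.
by lra.
Qed.

Lemma amp_energy (chi : R * R -> R) (K : R) : measurable_fun (setT : set mR2) chi ->
  (forall xi, 0 <= chi xi <= 1) -> (forall xi, chi xi * rad xi <= K * sobw xi) -> 0 <= K ->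
  (\int[L2]_xi ((p xi * chi xi) ^+ 2 * rad xi)%:E <= (K * B)%:E)%E.
Proof.
move=> mchi chi01 chiK K0; have mrad := @measurable_rad R.
apply: (@le_trans _ _ (\int[L2]_xi (K%:E * (p xi ^+ 2 * sobw xi)%:E))%E).
  apply: ge0_le_integral => //.
  - by move=> x _; rewrite lee_fin mulr_ge0 ?sqr_ge0// rad_ge0.
  - by apply/measurable_EFinP; meas.
  - by under eq_fun do rewrite -EFinM; apply/measurable_EFinP; meas.
  - move=> xi _; rewrite -EFinM lee_fin.
    rewrite [leLHS](_ : _ = p xi ^+ 2 * (chi xi ^+ 2 * rad xi)); last by ring.
    rewrite [leRHS](_ : _ = p xi ^+ 2 * (K * sobw xi)); last by ring.
    apply: ler_wpM2l; first exact: sqr_ge0.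
    have /andP[c0 c1] := chi01 xi.
    apply: le_trans (chiK xi); by rewrite ler_wpM2r ?rad_ge0// expr2 ler_piMr.
rewrite ge0_integralZlT//; last by apply/measurable_EFinP; meas.
by rewrite EFinM lee_wpmul2l.
Qed.

End Amplitude.

Lemma future_box_supported (B1 B2 B3 : nat -> R -> R) : bump_family B1 -> bump_family B2 -> bump_family B3 ->
  exists K N, 0 <= K /\ forall z, `|future_box B1 B2 B3 z| <= K * cube N z.
Proof.
move=> BB1 BB2 BB3; have [M1 h1] := BB1.2; have [M2 h2] := BB2.2; have [M3 h3] := BB3.2.
pose N := `|M1| + `|M2| + `|M3|.
have n1 := ler_norm M1; have n2 := ler_norm M2; have n3 := ler_norm M3.
have p1 := normr_ge0 M1; have p2 := normr_ge0 M2; have p3 := normr_ge0 M3.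
have ten i j k : exists2 K, 0 <= K & forall z, `|ftensor B1 B2 B3 i j k z| <= K * cube N z.
  have [K1 K10 k1] := @bump_family_bounded R _ BB1 i; have [K2 K20 k2] := @bump_family_bounded R _ BB2 j.
  have [K3 K30 k3] := @bump_family_bounded R _ BB3 k.
  exists (K1 * K2 * K3); first by rewrite !mulr_ge0.
  move=> z; rewrite /ftensor; have [zN|zN] := pselect (in_cube N z).
    rewrite cube1// mulr1 2!normrM; apply: ler_pM; [by rewrite mulr_ge0|by []|by apply: ler_pM|].
    by rewrite normrM -[leRHS]mul1r; apply: ler_pM => //; exact: future_le1.
  rewrite (_ : B1 i z.1.1 * _ * _ = 0) ?normr0 ?mulr_ge0 ?cube_ge0//.
  have [y1|y1] := leP `|z.1.1| N; last by rewrite h1 ?mul0r//; move: y1; rewrite /N; lra.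
  have [y2|y2] := leP `|z.1.2| N; last by rewrite h2 ?(mul0r, mulr0)//; move: y2; rewrite /N; lra.
  have [y3|y3] := leP `|z.2| N; last by rewrite h3 ?(mul0r, mulr0)//; move: y3; rewrite /N; lra.
  by exfalso; apply: zN.
have [K1 K10 k1] := ten 0%N 0%N 2%N; have [K2 K20 k2] := ten 2%N 0%N 0%N; have [K3 K30 k3] := ten 0%N 2%N 0%N.
exists (K1 + (K2 + K3)), N; split; first by rewrite !addr_ge0.
move=> z; rewrite /future_box; apply: le_trans (ler_normB _ _) _; rewrite mulrDl lerD//.
by apply: le_trans (ler_normD _ _) _; rewrite mulrDl lerD.
Qed.

(** This is [y <= 1 + y^6] at [y = |x| / c]. It trades a sixth power bound for a pointwise one, with
    the scale [c] at choice. *)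
Lemma le_scaled_sixth (x c : R) : 0 < c -> `|x| <= c + (c^-1) ^+ 5 * x ^+ 6.
Proof.
move=> c0; pose y := `|x| / c; have y0 : 0 <= y by rewrite divr_ge0// ltW.
have -> : `|x| = c * y by rewrite /y mulrC divfK// gt_eqF.
have -> : (c^-1) ^+ 5 * x ^+ 6 = c * y ^+ 6.
  have -> : x ^+ 6 = `|x| ^+ 6 by rewrite -normrX ger0_norm// exprn_even_ge0.
  by rewrite /y; field; rewrite gt_eqF.
rewrite -{2}(mulr1 c) -mulrDr ler_wpM2l//; first exact: ltW.
have [h|h] := leP y 1; first by apply: le_trans h _; rewrite lerDl exprn_ge0.
by apply: (@le_trans _ _ (y ^+ 6)); [rewrite -{1}(expr1 y) ler_eXn2l|rewrite lerDr].
Qed.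

End Core.

Lemma ae_imp2 d (T : measurableType d) (R : realType) (m : {measure set T -> \bar R}) (P Q S : T -> Prop) :
  (forall x, P x -> Q x -> S x) ->
  {ae m, forall x, P x} -> {ae m, forall x, Q x} -> {ae m, forall x, S x}.
Proof. by move=> PQS; apply: filterS2. Qed.

Lemma Rintegral_dominated d (T : measurableType d) (R : realType) (m : {measure set T -> \bar R})
    (F : nat -> T -> R) (f : T -> R) (g : T -> \bar R) :
  (forall n, measurable_fun setT (F n)) -> measurable_fun setT f -> m.-integrable setT g ->
  {ae m, forall x, F ^~ x @ \oo --> f x} -> (forall n x, (`|F n x|%:E <= g x)%E) ->
  m.-integrable setT (EFin \o f) /\ (\int[m]_x F n x)%R @[n --> \oo] --> (\int[m]_x f x)%R.
Proof.
move=> mF mf ig Ff Fg.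
have iF n : m.-integrable setT (EFin \o F n).
  apply: le_integrable ig => //; first by apply/measurable_EFinP; exact: mF.
  by move=> x _ /=; rewrite (le_trans (Fg n x))// lee_abs.
have mF' n : measurable_fun setT (EFin \o F n) by apply/measurable_EFinP; exact: mF.
have mf' : measurable_fun setT (EFin \o f) by apply/measurable_EFinP.
have cv : {ae m, forall x, setT x -> (fun n => (EFin \o F n) x) @ \oo --> (EFin \o f) x}.
  by apply: ae_imp Ff => x Fx _; apply: cvg_EFin => //; exact: nearW.
have dom : {ae m, forall x, forall n, setT x -> (`|(EFin \o F n) x| <= g x)%E}.
  by apply: aeW => x n _; exact: Fg.
have [if_ _ c] := dominated_convergence measurableT mF' mf' cv ig dom.
split=> //; apply: fine_cvg; rewrite EFin_Rintegral//.
Qed.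

(** * The wave with a given amplitude and its comparison with a weak solution *)

Section Strichartz.
Variable R : realType.
Notation mu := (@lebesgue_measure R).
Notation mR := (measurableTypeR R).
Notation L2 := (sfprod mu mu).
Notation L3 := (sfprod L2 mu).
Notation mR2 := (mR * mR)%type.
Notation mR3 := (mR * mR * mR)%type.
Notation R3 := (R * R * R)%type.
Variable eps : R.
Hypothesis eps0 : 0 < eps.
Notation r := (ratio eps).
Variables (p q : R * R -> R) (B : R).
Hypotheses (mp : measurable_fun (setT : set mR2) p) (mq : measurable_fun (setT : set mR2) q).
Hypotheses (hp : (\int[L2]_xi (p xi ^+ 2 * sobw eps xi)%:E <= B%:E)%E)
  (hq : (\int[L2]_xi (q xi ^+ 2 * sobw eps xi)%:E <= B%:E)%E).

Let r0 : 0 < r. Proof. exact: ratio_gt0. Qed.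
Let r1 : r < 1. Proof. exact: ratio_lt1. Qed.
Let B0 : 0 <= B. Proof. exact: amp_B_ge0 hp. Qed.

Definition piece k (z : R3) : R := wave (fun xi => p xi * shell k xi) (fun xi => q xi * shell k xi) z.
Definition partial n (z : R3) : R := wave (fun xi => p xi * lowfreq n xi) (fun xi => q xi * lowfreq n xi) z.

Let lowle n (xi : R * R) : 0 <= lowfreq n xi <= lowfreq n xi.
Proof. by case/andP: (lowfreq01 n xi) => ->; rewrite lexx. Qed.
Let shle k (xi : R * R) : 0 <= shell k xi <= lowfreq k.+1 xi.
Proof. by case/andP: (shell01 k xi) => ->; rewrite shell_le_lowfreq. Qed.

Let ilow (f : R * R -> R) n : measurable_fun (setT : set mR2) f -> (\int[L2]_xi (f xi ^+ 2 * sobw eps xi)%:E <= B%:E)%E ->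
  L2.-integrable setT (EFin \o (fun xi => f xi * lowfreq n xi)).
Proof. by move=> mf hf; apply: (integrable_amp eps0 mf hf (measurable_lowfreq n) (lowle n)). Qed.
Let ish (f : R * R -> R) k : measurable_fun (setT : set mR2) f -> (\int[L2]_xi (f xi ^+ 2 * sobw eps xi)%:E <= B%:E)%E ->
  L2.-integrable setT (EFin \o (fun xi => f xi * shell k xi)).
Proof. by move=> mf hf; apply: (integrable_amp eps0 mf hf (measurable_shell k) (shle k)). Qed.

Lemma partialS n z : partial n.+1 z = partial n z + piece n z.
Proof.
rewrite /partial /piece -(waveD (ilow n mp hp) (ilow n mq hq) (ish n mp hp) (ish n mq hq)).
by congr (wave _ _ z); apply/funext => xi; rewrite lowfreqS mulrDr.
Qed.

Lemma partial0 z : partial 0 z = 0.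
Proof. by apply: Rintegral_eq0 => xi; rewrite !lowfreq0 !mulr0 !mul0r subrr. Qed.

Lemma partial_sum n z : partial n z = \sum_(k < n) piece k z.
Proof. by elim: n => [|n IH]; rewrite ?big_ord0 ?partial0// partialS IH big_ord_recr. Qed.

Lemma measurable_piece k : measurable_fun (setT : set mR3) (piece k).
Proof. exact: measurable_wave (ish k mp hp) (ish k mq hq). Qed.

Lemma measurable_partial n : measurable_fun (setT : set mR3) (partial n).
Proof. exact: measurable_wave (ilow n mp hp) (ilow n mq hq). Qed.

(** The bound for a wave when both amplitudes have energy at most [B]. *)
Definition C6 : R := 512 * pi ^+ 6 * (B ^+ 3 + B ^+ 3).

Lemma C6_ge0 : 0 <= C6.
Proof.
apply: mulr_ge0; last by apply: addr_ge0; apply: exprn_ge0.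
by apply: mulr_ge0; [exact: ler0n|apply: exprn_ge0; exact: pi_ge0].
Qed.

Let expe3_le (x : \bar R) (c : R) : (0 <= x)%E -> (x <= c%:E)%E -> (x ^+ 3 <= (c ^+ 3)%:E)%E.
Proof.
case: x => [x| |]//; rewrite !lee_fin => x0 xc.
rewrite [leLHS](_ : _ = x ^+ 3); last by ring.
by apply: lerXn2r; rewrite ?nnegrE//; exact: le_trans xc.
Qed.

Let e_ge0 (f : R * R -> R) : (0 <= \int[L2]_xi (f xi ^+ 2 * rad xi)%:E)%E.
Proof. by apply: integral_ge0 => xi _; rewrite lee_fin mulr_ge0 ?sqr_ge0 ?rad_ge0. Qed.

Let L6_from_energy (f g : R * R -> R) (K : R) : 0 <= K -> L2.-integrable setT (EFin \o f) -> L2.-integrable setT (EFin \o g) ->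
  (\int[L2]_xi (f xi ^+ 2 * rad xi)%:E <= (K * B)%:E)%E -> (\int[L2]_xi (g xi ^+ 2 * rad xi)%:E <= (K * B)%:E)%E ->
  (\int[L3]_z (wave f g z ^+ 6)%:E <= (C6 * K ^+ 3)%:E)%E.
Proof.
move=> K0 fi gi hf hg; apply: le_trans (wave_L6 fi gi) _.
have E : ((C6 * K ^+ 3)%:E = (512 * pi ^+ 6)%:E * (((K * B) ^+ 3)%:E + ((K * B) ^+ 3)%:E))%E.
  by rewrite -EFinD -EFinM /C6; congr EFin; rewrite exprMn; ring.
rewrite E; apply: lee_wpmul2l.
  by rewrite lee_fin; apply: mulr_ge0; [exact: ler0n|apply: exprn_ge0; exact: pi_ge0].
by apply: leeD; apply: expe3_le => //; exact: e_ge0.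
Qed.

Lemma partial_L6 n : (\int[L3]_z (partial n z ^+ 6)%:E <= C6%:E)%E.
Proof.
have E (f : R * R -> R) : measurable_fun (setT : set mR2) f -> (\int[L2]_xi (f xi ^+ 2 * sobw eps xi)%:E <= B%:E)%E ->
  (\int[L2]_xi ((f xi * lowfreq n xi) ^+ 2 * rad xi)%:E <= (1 * B)%:E)%E.
  move=> mf hf; apply: (amp_energy eps0 mf hf (measurable_lowfreq n) (lowfreq01 n)) => // xi.
  rewrite mul1r; apply: le_trans (rad_le_sobw eps0 xi); rewrite ler_piMl ?rad_ge0//.
  by case/andP: (lowfreq01 n xi).
have := L6_from_energy ler01 (ilow n mp hp) (ilow n mq hq) (E p mp hp) (E q mq hq).
by rewrite expr1n mulr1.
Qed.

Lemma piece_L6 k : (\int[L3]_z (piece k z ^+ 6)%:E <= (C6 * (r ^+ k) ^+ 6)%:E)%E.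
Proof.
have k0 : 0 <= (r ^+ 2) ^+ k by rewrite !exprn_ge0// ltW.
have E (f : R * R -> R) : measurable_fun (setT : set mR2) f -> (\int[L2]_xi (f xi ^+ 2 * sobw eps xi)%:E <= B%:E)%E ->
  (\int[L2]_xi ((f xi * shell k xi) ^+ 2 * rad xi)%:E <= ((r ^+ 2) ^+ k * B)%:E)%E.
  move=> mf hf; apply: (amp_energy eps0 mf hf (measurable_shell k) (shell01 k)) => // xi.
  by rewrite (ratio_sq eps0); exact: (shell_rad eps0).
have := L6_from_energy k0 (ish k mp hp) (ish k mq hq) (E p mp hp) (E q mq hq).
have -> // : ((r ^+ 2) ^+ k) ^+ 3 = (r ^+ k) ^+ 6.
by rewrite -!exprM; congr (_ ^+ _); rewrite mulnCA.
Qed.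

(** With the scale [r^k] the integral of the second summand is at most [C6 r^k], of the same order
    as the first on a cube, so both parts are summable. *)
Definition term k (z : R3) : R := r ^+ k + ((r ^+ k)^-1) ^+ 5 * piece k z ^+ 6.

Lemma term_ge0 k z : 0 <= term k z.
Proof.
have rk : 0 <= r ^+ k by rewrite exprn_ge0 ?ltW.
apply: addr_ge0; first by [].
by apply: mulr_ge0; [apply: exprn_ge0; rewrite invr_ge0|rewrite exprn_even_ge0].
Qed.

Lemma piece_le_term k z : `|piece k z| <= term k z.
Proof. by apply: le_scaled_sixth; rewrite exprn_gt0. Qed.

Definition dominator N (z : R3) : \bar R := (\sum_(0 <= k <oo) (term k z * cube N z)%:E)%E.

Let tc_ge0 N k z : (0 <= (term k z * cube N z)%:E :> \bar R)%E.
Proof. by rewrite lee_fin mulr_ge0 ?term_ge0 ?cube_ge0. Qed.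

Let mcube N : measurable_fun (setT : set mR3) (cube N).
Proof. by apply/measurable_EFinP; exact: measurable_int (integrable_cube N). Qed.

Let mterm k : measurable_fun (setT : set mR3) (term k).
Proof. by have m := measurable_piece k; rewrite /term; meas. Qed.

Let mtc N k : measurable_fun (setT : set mR3) (fun z => (term k z * cube N z)%:E).
Proof. by have m1 := mcube N; have m2 := mterm k; apply/measurable_EFinP; meas. Qed.

Lemma dominator_ge0 N z : (0 <= dominator N z)%E.
Proof. by apply: nneseries_ge0 => k _ _; exact: tc_ge0. Qed.

Lemma measurable_dominator N : measurable_fun (setT : set mR3) (dominator N).
Proof. by apply: ge0_emeasurable_sum => //= k z _ _; exact: tc_ge0. Qed.

(** Each term has integral at most [r^k (vol + C6)], and the geometric series sums to at most
    [(vol + C6) / (1 - r)]. *)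
Lemma integrable_dominator N : L3.-integrable setT (dominator N).
Proof.
pose vol := (\int[L3]_z cube N z)%R.
have volE : (\int[L3]_z (cube N z)%:E = vol%:E)%E by rewrite EFin_Rintegral//; exact: integrable_cube.
have vol0 : 0 <= vol by apply: Rintegral_ge0 => z _; exact: cube_ge0.
have rk k : 0 < r ^+ k by rewrite exprn_gt0.
have t0 k z : 0 <= (r ^+ k)^-1 ^+ 5 * piece k z ^+ 6.
  by apply: mulr_ge0; [apply: exprn_ge0; rewrite invr_ge0 ltW|rewrite exprn_even_ge0].
have tint k : (\int[L3]_z (term k z * cube N z)%:E <= (r ^+ k * (vol + C6))%:E)%E.
  have mc := mcube N; have mpi := measurable_piece k.
  apply: (@le_trans _ _ (\int[L3]_z ((r ^+ k)%:E * (cube N z)%:E + (((r ^+ k)^-1) ^+ 5)%:E * (piece k z ^+ 6)%:E))%E).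
    apply: ge0_le_integral => //.
    - rewrite (_ : (fun z => _) = (fun z => (r ^+ k * cube N z + (r ^+ k)^-1 ^+ 5 * piece k z ^+ 6)%:E)).
        by apply/measurable_EFinP; meas.
      by apply/funext => z; rewrite EFinD !EFinM.
    - move=> z _; rewrite -!EFinM -EFinD lee_fin /term mulrDl lerD2l; apply: ler_piMr; first exact: t0.
      by rewrite /cube /window; case: (_ <= N)%R; case: (_ <= N)%R; case: (_ <= N)%R; rewrite ?(mulr0, mul0r, mulr1) ?lexx ?ler01.
  rewrite ge0_integralD//; last 4 first.
  - by move=> z _; rewrite -EFinM lee_fin mulr_ge0 ?cube_ge0// ltW.
  - by under eq_fun do rewrite -EFinM; apply/measurable_EFinP; meas.
  - by move=> z _; rewrite -EFinM lee_fin; exact: t0.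
  - by under eq_fun do rewrite -EFinM; apply/measurable_EFinP; meas.
  rewrite ge0_integralZlT; [|exact: ltW|by apply/measurable_EFinP|by move=> z; rewrite lee_fin cube_ge0].
  rewrite ge0_integralZlT; [|by apply: exprn_ge0; rewrite invr_ge0 ltW|by apply/measurable_EFinP; meas|by move=> z; rewrite lee_fin exprn_even_ge0].
  rewrite volE mulrDr EFinD EFinM; apply: leeD => //.
  have c0 : (0 <= ((r ^+ k)^-1 ^+ 5)%:E :> \bar R)%E by rewrite lee_fin; apply: exprn_ge0; rewrite invr_ge0 ltW.
  apply: le_trans (lee_wpmul2l c0 (piece_L6 k)) _.
  rewrite -EFinM lee_fin le_eqVlt; apply/orP; left; apply/eqP; field.
  by rewrite gt_eqF.
apply/integrableP; split; first exact: measurable_dominator.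
under eq_integral do rewrite gee0_abs ?dominator_ge0//.
rewrite integral_nneseries; [|exact: measurableT|by move=> k; exact: mtc|by move=> k z _; exact: tc_ge0].
apply: (@le_lt_trans _ _ ((vol + C6) / (1 - r))%:E); last by rewrite ltry.
apply: lime_le.
  by apply: is_cvg_nneseries => k _ _; apply: integral_ge0 => z _; exact: tc_ge0.
apply: nearW => n; apply: (@le_trans _ _ (\sum_(0 <= k < n) (r ^+ k * (vol + C6))%:E)%E).
  by apply: lee_sum => k _; exact: tint.
rewrite sumEFin lee_fin -mulr_suml mulrC; apply: ler_wpM2l; first by rewrite addr_ge0 ?C6_ge0.
rewrite -[leRHS]mul1r ler_pdivlMr ?subr_gt0//.
have -> : (\sum_(0 <= k < n) r ^+ k) * (1 - r) = 1 - r ^+ n.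
  rewrite big_mkord; have := subrX1 r n; move=> H.
  by rewrite -[RHS]opprB H -mulNr opprB mulrC.
by rewrite lerBlDr lerDl exprn_ge0// ltW.
Qed.

Let mul_cube_le n z N : ((`|partial n z| * cube N z)%:E <= dominator N z)%E.
Proof.
apply: le_trans (nneseries_lim_ge n _); last by move=> k _ _; exact: tc_ge0.
rewrite sumEFin lee_fin -mulr_suml big_mkord ler_wpM2r ?cube_ge0// partial_sum.
by apply: le_trans (ler_norm_sum _ _ _) _; apply: ler_sum => k _; exact: piece_le_term.
Qed.

(** The upper limit is measurable and defined everywhere; it is the limit of the truncations
    wherever these converge. *)
Definition full_wave (z : R3) : R := fine (limn_esup (fun n => (partial n z)%:E)).

Lemma measurable_full_wave : measurable_fun (setT : set mR3) full_wave.
Proof.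
apply: measurableT_comp; first exact: fine_measurable.
by apply: measurable_fun_limn_esup => n; apply/measurable_EFinP; exact: measurable_partial.
Qed.

Let in_big_cube (z : R3) : exists N : nat, in_cube N%:R z.
Proof.
pose M := `|z.1.1| + `|z.1.2| + `|z.2|; exists (Num.bound M).
have MB : M < (Num.bound M)%:R by apply: archi_boundP; rewrite /M !addr_ge0.
have := normr_ge0 z.1.1; have := normr_ge0 z.1.2; have := normr_ge0 z.2.
by move: MB; rewrite /M => *; split; lra.
Qed.

(** Outside a null set the dominating series is finite on all integer cubes, and there the series of
    pieces converges absolutely. *)
Lemma partial_cvg : {ae L3, forall z, partial ^~ z @ \oo --> full_wave z}.
Proof.
have fin : {ae L3, forall z, forall N : nat, dominator N%:R z \is a fin_num}.
  apply: ae_foralln => N; have := integrable_ae measurableT (integrable_dominator N%:R).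
  by apply: ae_imp => z; apply.
apply: ae_imp fin => z fz; have [N zN] := in_big_cube z.
have c1 := cube1 zN; have fN := fz N.
have ps : partial ^~ z = series (piece ^~ z) by apply/funext => n; rewrite partial_sum /series /= big_mkord.
have : cvgn (series (piece ^~ z)).
  apply: normed_cvg; apply: nondecreasing_is_cvgn.
    by apply: nondecreasing_series => k _ _; exact: normr_ge0.
  exists (fine (dominator N%:R z)) => _ [n _ <-].
  rewrite -lee_fin fineK//; apply: le_trans (nneseries_lim_ge n _); last by move=> k _ _; exact: tc_ge0.
  rewrite sumEFin lee_fin /series /=; apply: ler_sum => k _; rewrite c1 mulr1; exact: piece_le_term.
rewrite -ps => cv; rewrite /full_wave.
have cv' : (partial n z)%:E @[n --> \oo] --> (limn (partial ^~ z))%:E by apply: cvg_EFin => //; exact: nearW.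
by rewrite (cvg_limn_einf_sup cv').2.
Qed.

Lemma integrable_full_wave_cube N : L3.-integrable setT (EFin \o (fun z => full_wave z * cube N z)).
Proof.
have mc := mcube N; have mf := measurable_full_wave.
apply: (proj1 (@Rintegral_dominated _ _ R L3 (fun n z => partial n z * cube N z) (fun z => full_wave z * cube N z) (dominator N) _ _ _ _ _)).
- by move=> n; have m := measurable_partial n; meas.
- by meas.
- exact: integrable_dominator.
- by apply: ae_imp partial_cvg => z cz; apply: cvgMl.
- by move=> n z; rewrite normrM (ger0_norm (cube_ge0 N z)); exact: mul_cube_le.
Qed.

Section Pairing.
Variables B1 B2 B3 : nat -> R -> R.
Hypotheses (BB1 : bump_family B1) (BB2 : bump_family B2) (BB3 : bump_family B3).

Lemma integrable_amp_pair (f h : R * R -> R) (K : R) : measurable_fun (setT : set mR2) f ->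
  (\int[L2]_xi (f xi ^+ 2 * sobw eps xi)%:E <= B%:E)%E ->
  L2.-integrable setT (EFin \o h) -> (forall xi, `|h xi| <= K) ->
  L2.-integrable setT (EFin \o (fun xi => f xi * h xi)).
Proof.
move=> mf hf ih hK; have [Q hQ] := sq_integrable_of_bounded ih hK.
have mh : measurable_fun (setT : set mR2) h by apply/measurable_EFinP; exact: measurable_int ih.
exact: (sq_integrable_pair mf mh (amp_sq eps0 mf hf) hQ).1.
Qed.

Let lowfreq_cvg (xi : R * R) : (fun n => lowfreq n xi) @ \oo --> (1 : R).
Proof.
have [N hN] : exists N : nat, wt xi < 2 ^+ N.
  exists (Num.bound (wt xi)); apply: lt_le_trans (archi_boundP _) _; first by apply: le_trans (wt_ge1 xi).
  by rewrite -natrX ler_nat ltnW// ltn_expl.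
apply: cvg_near_cst; exists N => // n /= Nn; rewrite /lowfreq.
by rewrite (lt_le_trans hN)// ler_eXn2l// ltr1n.
Qed.

(** The pairing formula for truncations passes to the limit on both sides by dominated convergence:
    in space-time under the dominator of a cube containing the support, in frequency under the
    square integrable pairing with the transform of the bumps. *)
Lemma full_wave_box_pairing :
  (\int[L3]_z (full_wave z * future_box B1 B2 B3 z))%R
  = - B3 1%N 0 * (\int[L2]_xi (p xi * tcos B1 B2 xi - q xi * tsin B1 B2 xi))%R.
Proof.
have [K [N [K0 hK]]] := future_box_supported BB1 BB2 BB3.
have mc := mcube N; have mf := measurable_full_wave.
have mb : measurable_fun (setT : set mR3) (future_box B1 B2 B3).
  by apply/measurable_EFinP; exact: measurable_int (integrable_future_box BB1 BB2 BB3).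
have lhs : (\int[L3]_z (partial n z * future_box B1 B2 B3 z))%R @[n --> \oo] -->
    (\int[L3]_z (full_wave z * future_box B1 B2 B3 z))%R.
  apply: (proj2 (@Rintegral_dominated _ _ R L3 (fun n z => partial n z * future_box B1 B2 B3 z)
    (fun z => full_wave z * future_box B1 B2 B3 z) (fun z => K%:E * dominator N z)%E _ _ _ _ _)).
  - by move=> n; have m := measurable_partial n; meas.
  - by meas.
  - by apply: integrableZl => //; exact: integrable_dominator.
  - by apply: ae_imp partial_cvg => z cz; apply: cvgMl.
  - move=> n z; apply: (@le_trans _ _ (K%:E * (`|partial n z| * cube N z)%:E)%E).
      rewrite -EFinM lee_fin normrM mulrCA; apply: ler_wpM2l => //; exact: hK.
    by apply: lee_wpmul2l; [rewrite lee_fin|exact: mul_cube_le].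
have itc := integrable_tcos BB1 BB2; have its := integrable_tsin BB1 BB2.
have [Kt Kt0 hKt] := tcos_tsin_bounded BB1 BB2.
have ipc := integrable_amp_pair mp hp itc (fun xi => (hKt xi).1).
have iqs := integrable_amp_pair mq hq its (fun xi => (hKt xi).2).
have mtc' : measurable_fun (setT : set mR2) (tcos B1 B2) by apply/measurable_EFinP; exact: measurable_int itc.
have mts : measurable_fun (setT : set mR2) (tsin B1 B2) by apply/measurable_EFinP; exact: measurable_int its.
pose gd xi := `|p xi * tcos B1 B2 xi| + `|q xi * tsin B1 B2 xi|.
have igd : L2.-integrable setT (EFin \o gd).
  have := integrableD measurableT (integrable_abse ipc) (integrable_abse iqs).
  by apply: eq_integrable.
have rhs : (\int[L2]_xi (p xi * lowfreq n xi * tcos B1 B2 xi - q xi * lowfreq n xi * tsin B1 B2 xi))%R @[n --> \oo] -->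
    (\int[L2]_xi (p xi * tcos B1 B2 xi - q xi * tsin B1 B2 xi))%R.
  apply: (proj2 (@Rintegral_dominated _ _ R L2
    (fun n xi => p xi * lowfreq n xi * tcos B1 B2 xi - q xi * lowfreq n xi * tsin B1 B2 xi)
    (fun xi => p xi * tcos B1 B2 xi - q xi * tsin B1 B2 xi) (EFin \o gd) _ _ igd _ _)).
  - by move=> n; have m := @measurable_lowfreq R n; meas.
  - by meas.
  - apply: aeW => xi.
    rewrite (_ : (fun n => _) = (fun n => lowfreq n xi * (p xi * tcos B1 B2 xi - q xi * tsin B1 B2 xi))); last first.
      by apply/funext => n; ring.
    by rewrite -[X in _ --> X]mul1r; apply: cvgMl; exact: lowfreq_cvg.
  - move=> n xi; rewrite lee_fin /gd.
    have /andP[l0 l1] := lowfreq01 n xi.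
    apply: le_trans (ler_normB _ _) _; rewrite !(mulrAC _ (lowfreq n xi)).
    rewrite (normrM (p xi * tcos B1 B2 xi)) (normrM (q xi * tsin B1 B2 xi)) (ger0_norm l0).
    by apply: lerD; apply: ler_piMr.
have eqn : (fun n => \int[L3]_z (partial n z * future_box B1 B2 B3 z))%R =
    (fun n => - B3 1%N 0 * (\int[L2]_xi (p xi * lowfreq n xi * tcos B1 B2 xi - q xi * lowfreq n xi * tsin B1 B2 xi))%R).
  by apply/funext => n; exact: (wave_box_pairing BB1 BB2 BB3 (ilow n mp hp) (ilow n mq hq)).
move: lhs; rewrite eqn => lhs.
by apply: (cvg_unique _ lhs); [exact: norm_hausdorff|apply: cvgMr].
Qed.

End Pairing.

Theorem forward_wave_L6 (U : R3 -> R) : measurable_fun (setT : set mR3) U ->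
  (forall N, L3.-integrable setT (EFin \o (fun z => U z * cube N z))) ->
  (forall B1 B2 B3 : nat -> R -> R, bump_family B1 -> bump_family B2 -> bump_family B3 ->
    (\int[L3]_z (U z * future_box B1 B2 B3 z))%R
    = - B3 1%N 0 * (\int[L2]_xi (p xi * tcos B1 B2 xi - q xi * tsin B1 B2 xi))%R) ->
  (\int[L3]_z (U z ^+ 6 * (1 <= z.2 <= 2)%R%:R)%:E <= C6%:E)%E.
Proof.
move=> mU iU pU; have mV := measurable_full_wave; have mfut := @measurable_future R.
have W0 : {ae L3, forall z, future z.2 * (U z - full_wave z) = 0}.
  apply: forward_wave_uniqueness.
  - by meas.
  - move=> N; have mc := mcube N.
    have iD : L3.-integrable setT (EFin \o (fun z => U z * cube N z - full_wave z * cube N z)).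
      have := integrableB measurableT (iU N) (integrable_full_wave_cube N); by apply: eq_integrable.
    have mft : measurable_fun (setT : set mR3) (fun z => future z.2) by meas.
    have := integrable_mul_bounded iD mft (fun z => future_le1 z.2).
    by apply: eq_integrableT => z; ring.
  - by move=> z z0; rewrite /future ltNge z0 mul0r.
  - move=> B1 B2 B3 BB1 BB2 BB3.
    have [K [N [K0 hK]]] := future_box_supported BB1 BB2 BB3.
    have mb : measurable_fun (setT : set mR3) (future_box B1 B2 B3).
      by apply/measurable_EFinP; exact: measurable_int (integrable_future_box BB1 BB2 BB3).
    have pair_int (G : R3 -> R) : measurable_fun (setT : set mR3) G -> L3.-integrable setT (EFin \o (fun z => G z * cube N z)) ->
        L3.-integrable setT (EFin \o (fun z => G z * future_box B1 B2 B3 z)).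
      move=> mG iG; have i : L3.-integrable setT (EFin \o (fun z => K * `|G z * cube N z|)).
        by have := integrableZl measurableT K (integrable_abse iG); apply: eq_integrable.
      apply: (le_integrable_EFin _ i) => [|z]; first by meas.
      by rewrite normrM (normrM (G z)) (ger0_norm (cube_ge0 N z)) mulrCA; apply: ler_wpM2l => //; exact: hK.
    apply: (@etrans _ _ (\int[L3]_z (U z * future_box B1 B2 B3 z - full_wave z * future_box B1 B2 B3 z))%R).
      by apply: eq_RintegralT => z; rewrite future_boxE; ring.
    rewrite RintegralB//; [|by apply: pair_int|by apply: pair_int => //; exact: integrable_full_wave_cube].
    by rewrite pU// full_wave_box_pairing// subrr.
have ind : measurable_fun (setT : set mR) (fun t => (1 <= t <= 2)%R%:R : R).
  rewrite (_ : (fun t => _) = \1_(`[1, 2]%classic : set R)); first exact: measurable_indic.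
  apply/funext => t; rewrite indicE; case: (boolP (1 <= t <= 2)) => h.
    by rewrite mem_set//= in_itv/= h.
  by rewrite memNset//= in_itv/=; exact/negP.
have ind3 : measurable_fun (setT : set mR3) (fun z => (1 <= z.2 <= 2)%R%:R : R).
  by apply: (measurableT_comp ind); meas.
apply: (@fatou_le _ _ R L3 (fun n z => (partial n z ^+ 6 * (1 <= z.2 <= 2)%R%:R)%:E)).
- by move=> n; have m := measurable_partial n; apply/measurable_EFinP; meas.
- by apply/measurable_EFinP; meas.
- by move=> n z; rewrite lee_fin mulr_ge0// exprn_even_ge0.
- by move=> z; rewrite lee_fin mulr_ge0// exprn_even_ge0.
- apply: ae_imp2 W0 partial_cvg => z Wz cz; apply: cvg_EFin; first exact: nearW.
  case: (boolP (1 <= z.2 <= 2)) => h; last by under eq_fun do rewrite mulr0; rewrite mulr0; exact: cvg_cst.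
  have f1 : future z.2 = 1 by rewrite /future (lt_le_trans ltr01)//; case/andP: h.
  move: Wz; rewrite f1 mul1r => /eqP; rewrite subr_eq0 => /eqP ->.
  by apply: cvgMl; exact: (cvgM cz (cvgM cz (cvgM cz (cvgM cz (cvgM cz cz))))).
- move=> n; apply: le_trans (partial_L6 n); apply: ge0_le_integral => //.
  + by move=> z _; rewrite lee_fin mulr_ge0// exprn_even_ge0.
  + by have m := measurable_partial n; apply/measurable_EFinP; meas.
  + by have m := measurable_partial n; apply/measurable_EFinP; meas.
  + by move=> z _; rewrite lee_fin ler_piMr ?exprn_even_ge0//; case: (1 <= z.2 <= 2)%R; rewrite ?lexx ?ler01.
Qed.

End Strichartz.

(** * Solutions with given Cauchy data *)

Section Assembly.
Variable R : realType.
Notation mu := (@lebesgue_measure R).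
Notation mR := (measurableTypeR R).
Notation L2 := (sfprod mu mu).
Notation L3 := (sfprod L2 mu).
Notation mR2 := (mR * mR)%type.
Notation mR3 := (mR * mR * mR)%type.
Notation R3 := (R * R * R)%type.

Let box_set (N : R) : set R3 := (`[- N, N] `*` `[- N, N]) `*` `[- N, N].

Let compact_box_set N : compact (box_set N).
Proof. by apply: compact_setX; [apply: compact_setX|]; exact: segment_compact. Qed.

Let measurable_box_set N : measurable (box_set N : set mR3).
Proof. by apply: measurableX; [apply: measurableX|]; exact: measurable_itv. Qed.

Let cube_patch (h : R3 -> R) N : (fun z => h z * cube N z) = h \_ (box_set N).
Proof.
have in1 (x : R) : (x \in ([set` `[- N, N]] : set R)) = (`|x| <= N).
  by rewrite ler_norml; apply/idP/idP; rewrite inE /= in_itv.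
apply/funext => -[[x y] t]; rewrite /cube /window /patch /box_set /= !in_setX /= !in1.
by case: (`|x| <= N); case: (`|y| <= N); case: (`|t| <= N); rewrite ?(mulr0, mul0r, mulr1).
Qed.

(** Integrability on cubes is the hypothesis on compact boxes. Global measurability follows because
    the cut-offs to integer cubes are eventually constant at each point. *)
Lemma integrable_compact_cube (h : R3 -> R) :
  (forall K : set R3, compact K -> (leb3 R).-integrable K (fun z => (h z)%:E)) ->
  measurable_fun (setT : set mR3) h /\ forall N, L3.-integrable setT (EFin \o (fun z => h z * cube N z)).
Proof.
move=> hK.
have iN N : L3.-integrable setT (EFin \o (fun z => h z * cube N z)).
  rewrite cube_patch.
  have := (integrable_mkcond (mu := L3) (fun z => (h z)%:E) (measurable_box_set N)).1 (hK _ (@compact_box_set N)).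
  apply: eq_integrable => // z _; rewrite /= /patch; by case: ifP.
split=> //; apply: (@measurable_fun_cvg _ _ _ _ (fun n z => h z * cube n%:R z)) => [n|z _].
  by apply/measurable_EFinP; exact: measurable_int (iN n%:R).
pose M := `|z.1.1| + `|z.1.2| + `|z.2|.
have MB : M < (Num.bound M)%:R by apply: archi_boundP; rewrite /M !addr_ge0.
apply: cvg_near_cst; exists (Num.bound M) => // n /= Mn.
have Mn' : M <= n%:R by apply: le_trans (ltW MB) _; rewrite ler_nat.
have := normr_ge0 z.1.1; have := normr_ge0 z.1.2; have := normr_ge0 z.2.
by move: Mn'; rewrite /M => *; rewrite cube1 ?mulr1//; split; lra.
Qed.

Let Re_scale (w : R[i]) (c : R) : complex.Re (w * c%:C%C) = complex.Re w * c.
Proof. by case: w => a b /=; rewrite mulr0 subr0. Qed.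
Let Im_scale (w : R[i]) (c : R) : complex.Im (w * c%:C%C) = complex.Im w * c.
Proof. by case: w => a b /=; rewrite mulr0 add0r. Qed.

Lemma cauchy_data_pairing (u : R3 -> R[i]) (f : R * R -> R[i]) (B1 B2 B3 : nat -> R -> R) :
  bump_family B1 -> bump_family B2 -> bump_family B3 -> has_cauchy_data u f ->
  (\int[L3]_z (complex.Re (u z) * future_box B1 B2 B3 z) =
    - \int[L2]_x (complex.Re (f x) * (B1 0%N x.1 * B2 0%N x.2) * B3 1%N 0))%R /\
  (\int[L3]_z (complex.Im (u z) * future_box B1 B2 B3 z) =
    - \int[L2]_x (complex.Im (f x) * (B1 0%N x.1 * B2 0%N x.2) * B3 1%N 0))%R.
Proof.
move=> BB1 BB2 BB3 /(_ _ (tensor_test_function BB1 BB2 BB3)) H.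
have side z : ((fun z => box (tensor B1 B2 B3 0%N 0%N 0%N) z) \_ [set z : R3 | 0 < z.2]) z = future_box B1 B2 B3 z.
  rewrite future_boxE /patch; case: (boolP (0 < z.2)) => z2.
    by rewrite mem_set// box_tensor// /future z2 mul1r.
  by rewrite memNset ?/future ?(negbTE z2) ?mul0r//=; exact/negP.
have dt x : 'D_(dir_t R) (tensor B1 B2 B3 0%N 0%N 0%N) (x, 0) = B1 0%N x.1 * B2 0%N x.2 * B3 1%N 0.
  exact: (congr1 (fun h : R3 -> R => h (x, 0)) (derive_t_tensor BB1 BB2 BB3 0%N 0%N 0%N)).
split.
- have := congr1 (@complex.Re R) H; rewrite /cintegral /= Rintegral_mkcond => E.
  apply: etrans; last (apply: etrans; first exact: E).
    apply: eq_RintegralT => z; rewrite -side /patch; case: ifP => _; last by rewrite mulr0.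
    by rewrite Re_scale.
  by congr (- _)%R; apply: eq_RintegralT => x; rewrite Re_scale dt mulrA.
- have := congr1 (@complex.Im R) H; rewrite /cintegral /= Rintegral_mkcond => E.
  apply: etrans; last (apply: etrans; first exact: E).
    apply: eq_RintegralT => z; rewrite -side /patch; case: ifP => _; last by rewrite mulr0.
    by rewrite Im_scale.
  by congr (- _)%R; apply: eq_RintegralT => x; rewrite Im_scale dt mulrA.
Qed.

Section FixedTransform.
Variables (eps : R) (f g : R * R -> R[i]) (u : R3 -> R[i]) (B : R).
Hypotheses (eps0 : 0 < eps) (fg : is_fourier f g) (ul : loc_integrable u) (uf : has_cauchy_data u f).
Hypothesis gB : (\int[L2]_xi ((complex.Re (g xi) ^+ 2 + complex.Im (g xi) ^+ 2) * sobw eps xi)%:E <= B%:E)%E.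

Let mRe : measurable_fun (setT : set mR2) (fun xi => complex.Re (g xi)).
Proof. by case: fg => _ /in_L2P[]. Qed.
Let mIm : measurable_fun (setT : set mR2) (fun xi => complex.Im (g xi)).
Proof. by case: fg => _ /in_L2P[]. Qed.

(** The constant of Fourier inversion in the plane. It is at most 1, so it is discarded from the
    energy bounds. *)
Let kap : R := (2 * pi) ^- 2.

Let kap01 : 0 <= kap <= 1.
Proof.
have p2 := pi_ge2 R.
by rewrite /kap invr_ge0 sqr_ge0 invf_le1 ?exprn_gt0 ?expr_ge1//; lra.
Qed.

Let scaled_energy (a : R * R -> R) : measurable_fun (setT : set mR2) a ->
  (forall xi, a xi ^+ 2 <= complex.Re (g xi) ^+ 2 + complex.Im (g xi) ^+ 2) ->
  (\int[L2]_xi (a xi ^+ 2 * sobw eps xi)%:E <= B%:E)%E /\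
  (\int[L2]_xi ((kap * a xi) ^+ 2 * sobw eps xi)%:E <= B%:E)%E.
Proof.
move=> ma ha; have ms := measurable_sobw eps.
have s0 xi : 0 <= sobw eps xi by apply: le_trans (sobw_ge1 eps0 xi).
have E : (\int[L2]_xi (a xi ^+ 2 * sobw eps xi)%:E <= B%:E)%E.
  apply: le_trans gB; apply: ge0_le_integral => //.
  - by move=> xi _; rewrite lee_fin mulr_ge0 ?sqr_ge0.
  - by apply/measurable_EFinP; meas.
  - by apply/measurable_EFinP; meas.
  - by move=> xi _; rewrite lee_fin ler_wpM2r.
split=> //; apply: le_trans E; apply: ge0_le_integral => //.
- by move=> xi _; rewrite lee_fin mulr_ge0 ?sqr_ge0.
- by apply/measurable_EFinP; meas.
- by apply/measurable_EFinP; meas.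
- move=> xi _; rewrite lee_fin ler_wpM2r// exprMn ler_piMl ?sqr_ge0//.
  by have /andP[k0 k1] := kap01; rewrite expr_le1.
Qed.

(** Used for the real part of [u] with amplitudes [Re g], [Im g], and for the imaginary part with
    [Im g], [- Re g]. *)
Let component_L6 (U : R3 -> R) (b : R * R -> R) (a c : R * R -> R) :
  measurable_fun (setT : set mR2) a -> measurable_fun (setT : set mR2) c ->
  (forall xi, a xi ^+ 2 <= complex.Re (g xi) ^+ 2 + complex.Im (g xi) ^+ 2) ->
  (forall xi, c xi ^+ 2 <= complex.Re (g xi) ^+ 2 + complex.Im (g xi) ^+ 2) ->
  (forall K : set R3, compact K -> (leb3 R).-integrable K (fun z => (U z)%:E)) ->
  (forall B1 B2 B3 : nat -> R -> R, bump_family B1 -> bump_family B2 -> bump_family B3 ->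
    (\int[L3]_z (U z * future_box B1 B2 B3 z) =
      - \int[L2]_x (b x * (B1 0%N x.1 * B2 0%N x.2) * B3 1%N 0))%R) ->
  (forall B1 B2 : nat -> R -> R, bump_family B1 -> bump_family B2 ->
    (\int[L2]_x (b x * (B1 0%N x.1 * B2 0%N x.2)))%R =
    kap * (\int[L2]_xi (a xi * tcos B1 B2 xi - c xi * tsin B1 B2 xi))%R /\
    L2.-integrable setT (EFin \o (fun x => b x * (B1 0%N x.1 * B2 0%N x.2)))) ->
  (\int[L3]_z (U z ^+ 6 * (1 <= z.2 <= 2)%R%:R)%:E <= (C6 B)%:E)%E.
Proof.
move=> ma mc ha hc UK Ubox bft; have [mU iU] := integrable_compact_cube UK.
have [ea eka] := scaled_energy ma ha; have [ec ekc] := scaled_energy mc hc.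
have mka : measurable_fun (setT : set mR2) (fun xi => kap * a xi) by meas.
have mkc : measurable_fun (setT : set mR2) (fun xi => kap * c xi) by meas.
apply: (forward_wave_L6 eps0 mka mkc eka ekc mU iU) => B1 B2 B3 BB1 BB2 BB3.
have [bE ib] := bft _ _ BB1 BB2.
rewrite Ubox// RintegralZr// bE.
have [K K0 hK] := tcos_tsin_bounded BB1 BB2.
have i1 := integrable_amp_pair eps0 ma ea (integrable_tcos BB1 BB2) (fun xi => (hK xi).1).
have i2 := integrable_amp_pair eps0 mc ec (integrable_tsin BB1 BB2) (fun xi => (hK xi).2).
have i : L2.-integrable setT (EFin \o (fun xi => a xi * tcos B1 B2 xi - c xi * tsin B1 B2 xi)).
  by have := integrableB measurableT i1 i2; apply: eq_integrable.
rewrite mulrC -mulNr -RintegralZl//; congr (_ * _).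
by apply: eq_RintegralT => xi; ring.
Qed.

Let bump_L2 (b : R * R -> R) (A : \bar R) (B1 B2 : nat -> R -> R) : measurable_fun (setT : set mR2) b ->
  (\int[L2]_x (b x ^+ 2)%:E <= A)%E -> (A < +oo)%E -> bump_family B1 -> bump_family B2 ->
  L2.-integrable setT (EFin \o (fun x => b x * (B1 0%N x.1 * B2 0%N x.2))).
Proof.
move=> mb hb Aoo BB1 BB2.
have A0 : (0 <= A)%E by apply: le_trans hb; apply: integral_ge0 => x _; rewrite lee_fin sqr_ge0.
have [A' AE] : exists A' : R, A = A'%:E by exists (fine A); rewrite fineK// ge0_fin_numE.
have it := integrable_prod (integrable_bump_family BB1 0%N) (integrable_bump_family BB2 0%N).
have [K1 K10 k1] := @bump_family_bounded R _ BB1 0%N; have [K2 K20 k2] := @bump_family_bounded R _ BB2 0%N.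
have hK x : `|B1 0%N x.1 * B2 0%N x.2| <= K1 * K2 by rewrite normrM ler_pM.
have [Q hQ] := sq_integrable_of_bounded it hK.
have mt : measurable_fun (setT : set mR2) (fun x => B1 0%N x.1 * B2 0%N x.2).
  by apply/measurable_EFinP; exact: measurable_int it.
by rewrite AE in hb; exact: (sq_integrable_pair mb mt hb hQ).1.
Qed.

Lemma component_L6_Re : (\int[L3]_z (complex.Re (u z) ^+ 6 * (1 <= z.2 <= 2)%R%:R)%:E <= (C6 B)%:E)%E.
Proof.
have [mfr mfi ffin] : [/\ _, _ & _] := in_L2P (let: And3 h _ _ := fg in h).
apply: (@component_L6 _ (fun x => complex.Re (f x)) (fun xi => complex.Re (g xi)) (fun xi => complex.Im (g xi))) => //.
- by move=> xi; rewrite lerDl sqr_ge0.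
- by move=> xi; rewrite lerDr sqr_ge0.
- by move=> K cK; exact: (ul cK).1.
- by move=> B1 B2 B3 BB1 BB2 BB3; exact: (cauchy_data_pairing BB1 BB2 BB3 uf).1.
- move=> B1 B2 BB1 BB2; split; first exact: (fourier_pairing BB1 BB2 fg).1.
  exact: (bump_L2 mfr (sqnorm_Re mfr mfi) ffin BB1 BB2).
Qed.

Lemma component_L6_Im : (\int[L3]_z (complex.Im (u z) ^+ 6 * (1 <= z.2 <= 2)%R%:R)%:E <= (C6 B)%:E)%E.
Proof.
have [mfr mfi ffin] : [/\ _, _ & _] := in_L2P (let: And3 h _ _ := fg in h).
have mN : measurable_fun (setT : set mR2) (fun xi => - complex.Re (g xi)) by meas.
apply: (@component_L6 _ (fun x => complex.Im (f x)) (fun xi => complex.Im (g xi)) (fun xi => - complex.Re (g xi))) => //.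
- by move=> xi; rewrite lerDr sqr_ge0.
- by move=> xi; rewrite sqrrN lerDl sqr_ge0.
- by move=> K cK; exact: (ul cK).2.
- by move=> B1 B2 B3 BB1 BB2 BB3; exact: (cauchy_data_pairing BB1 BB2 BB3 uf).2.
- move=> B1 B2 BB1 BB2; split; first exact: (fourier_pairing BB1 BB2 fg).2.
  exact: (bump_L2 mfi (sqnorm_Im mfr mfi) ffin BB1 BB2).
Qed.

(** The two real components are recombined by [(a^2 + b^2)^3 <= 4 (a^6 + b^6)]. *)
Lemma wave_L6_of_transform :
  (\int[L3]_z ((complex.Re (u z) ^+ 2 + complex.Im (u z) ^+ 2) ^+ 3 * \1_[set z : R3 | (1 <= z.2 <= 2)%R] z)%:E
    <= (4 * (C6 B + C6 B))%:E)%E.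
Proof.
have [mr ir] := integrable_compact_cube (fun K cK => (ul cK).1).
have [mi ii] := integrable_compact_cube (fun K cK => (ul cK).2).
have mS : measurable ([set z : R3 | (1 <= z.2 <= 2)%R] : set mR3).
  have := @measurable_snd _ _ mR2 mR measurableT `[1, 2]%classic (measurable_itv _).
  rewrite setTI; congr (measurable _); apply/seteqP; split => z /=; by rewrite in_itv.
have mI : measurable_fun (setT : set mR3) (fun z => \1_[set z : R3 | (1 <= z.2 <= 2)%R] z : R).
  exact: measurable_indic.
have I01 z : 0 <= \1_[set z : R3 | (1 <= z.2 <= 2)%R] z :> R by rewrite indicE; case: (_ \in _).
have IE z : (1 <= z.2 <= 2)%R%:R = \1_[set z : R3 | (1 <= z.2 <= 2)%R] z :> R.
  rewrite indicE; case: (boolP (1 <= z.2 <= 2)) => h; first by rewrite mem_set.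
  by rewrite memNset//; exact/negP.
pose S := [set z : R3 | (1 <= z.2 <= 2)%R].
have hr : (\int[L3]_z (complex.Re (u z) ^+ 6 * \1_S z)%:E <= (C6 B)%:E)%E.
  have E : (\int[L3]_z (complex.Re (u z) ^+ 6 * \1_S z)%:E = \int[L3]_z (complex.Re (u z) ^+ 6 * (1 <= z.2 <= 2)%R%:R)%:E)%E.
    by apply: eq_integral => z _; rewrite IE.
  by rewrite E; exact: component_L6_Re.
have hi : (\int[L3]_z (complex.Im (u z) ^+ 6 * \1_S z)%:E <= (C6 B)%:E)%E.
  have E : (\int[L3]_z (complex.Im (u z) ^+ 6 * \1_S z)%:E = \int[L3]_z (complex.Im (u z) ^+ 6 * (1 <= z.2 <= 2)%R%:R)%:E)%E.
    by apply: eq_integral => z _; rewrite IE.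
  by rewrite E; exact: component_L6_Im.
have r0 z : (0 <= (complex.Re (u z) ^+ 6 * \1_S z)%:E :> \bar R)%E by rewrite lee_fin mulr_ge0// exprn_even_ge0.
have i0 z : (0 <= (complex.Im (u z) ^+ 6 * \1_S z)%:E :> \bar R)%E by rewrite lee_fin mulr_ge0// exprn_even_ge0.
have m1 : measurable_fun (setT : set mR3) (fun z => (complex.Re (u z) ^+ 6 * \1_S z)%:E).
  by apply/measurable_EFinP; meas.
have m2 : measurable_fun (setT : set mR3) (fun z => (complex.Im (u z) ^+ 6 * \1_S z)%:E).
  by apply/measurable_EFinP; meas.
apply: (@le_trans _ _ (\int[L3]_z (4%:E * ((complex.Re (u z) ^+ 6 * \1_S z) + (complex.Im (u z) ^+ 6 * \1_S z))%:E))%E).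
  apply: ge0_le_integral => //.
  - by move=> z _; rewrite lee_fin mulr_ge0// exprn_ge0// addr_ge0 ?sqr_ge0.
  - by apply/measurable_EFinP; meas.
  - by under eq_fun do rewrite -EFinM; apply/measurable_EFinP; meas.
  - move=> z _; rewrite -EFinM lee_fin -mulrDl mulrA; apply: ler_wpM2r => //.
    move: (complex.Re _) (complex.Im _) => a b.
    have := sqr_ge0 (a ^+ 2 - b ^+ 2); have := sqr_ge0 a; have := sqr_ge0 b; nra.
rewrite ge0_integralZlT//; last 2 first.
- by apply/measurable_EFinP; meas.
- by move=> z; rewrite EFinD adde_ge0.
rewrite EFinM; apply: lee_wpmul2l => //.
under eq_integral do rewrite EFinD.
by rewrite ge0_integralD// EFinD; apply: leeD.
Qed.

End FixedTransform.

Lemma weighted_sqnorm (eps : R) (g : R * R -> R[i]) :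
  sqnorm (fun xi => ((1 + xi.1 ^+ 2 + xi.2 ^+ 2) `^ ((1 / 2 + eps) / 2))%:C%C * g xi)
  = (\int[L2]_xi ((complex.Re (g xi) ^+ 2 + complex.Im (g xi) ^+ 2) * sobw eps xi)%:E)%E.
Proof.
rewrite /sqnorm; apply: eq_integral => xi _; congr EFin.
rewrite mulrC Re_scale Im_scale !exprMn -mulrDl; congr (_ * _).
by rewrite -[LHS](powR_mulrn 2 (powR_ge0 _ _)) -powRrM /sobw /wt; congr (_ `^ _); field.
Qed.

Lemma sixth_root_cube (K B : R) : 0 <= K -> 0 <= B ->
  (((K * B ^+ 3)%:E) `^ 6^-1 = (K `^ 6^-1)%:E * (B%:E `^ 2^-1))%E.
Proof.
move=> K0 B0; rewrite !poweR_EFin -EFinM; congr EFin.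
rewrite powRM ?exprn_ge0// -powR_mulrn// -powRrM; congr (_ * _ `^ _).
by field.
Qed.

End Assembly.

Theorem mainTheorem4 (R : realType) (eps : R) (eps_gt0 : 0 < eps) :
  exists C : R, forall (f : R * R -> R[i]) (u : R * R * R -> R[i]),
    in_sobolev (1 / 2 + eps) f ->
    wave_solution u f ->
    (cLnorm (leb3 R) 6%:E [set z : R * R * R | (1 <= z.2 <= 2)%R] u
       <= C%:E * sobolev_norm (1 / 2 + eps) f)%E.
Proof.
(* The product of 512 from the wave bound, 2 for its two amplitudes, 2 for the two components of [u]
   and 4 for recombining them. *)
pose K : R := 8192 * pi ^+ 6.
have K0 : 0 < K by rewrite mulr_gt0 ?ltr0n// exprn_gt0// pi_gt0.
have C0 : 0 < K `^ 6^-1 by exact: powR_gt0.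
exists (K `^ 6^-1) => f u _ [ul _ uf].
(* A positive constant passes inside the infimum, so the bound is proved for each transform [g] of
   [f] separately. *)
rewrite /sobolev_norm -(ereal_inf_pZl _ C0); apply: le_ereal_inf_tmp => _ [_ [g fg <-] <-].
rewrite cLnorm2E weighted_sqnorm.
set I := (\int[_]_xi _)%E.
have I0 : (0 <= I)%E.
  apply: integral_ge0 => xi _; rewrite lee_fin mulr_ge0 ?addr_ge0 ?sqr_ge0//.
  exact: le_trans (sobw_ge1 eps_gt0 xi).
(* For a transform of infinite weighted norm the right side is infinite, since the constant is
   positive. *)
case EI : I I0 => [B| |]// B0; last first.
  by rewrite poweRyr ?invr_eq0 ?pnatr_eq0// gt0_muley ?lte_fin// leey.
have gB : (I <= B%:E)%E by rewrite EI.
have H := wave_L6_of_transform eps_gt0 fg ul uf gB.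
rewrite lee_fin in B0; rewrite -(sixth_root_cube (ltW K0) B0).
rewrite (@cLnorm_even _ _ R (leb3 R) 3)//.
apply: gt0_ler_poweR; rewrite ?invr_ge0 ?ler0n// ?in_itv/= ?leey ?andbT.
- by apply: integral_ge0 => z _; rewrite lee_fin mulr_ge0// exprn_ge0// addr_ge0 ?sqr_ge0.
- by rewrite lee_fin mulr_ge0 ?exprn_ge0// ltW.
apply: le_trans H _; rewrite lee_fin le_eqVlt; apply/orP; left; apply/eqP.
by rewrite /C6 /K; ring.
Qed.
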